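(* Let $k\ge2$ be an integer. Let $\vec\psi$ be a solution in $\mathcal H_0$ of the $k$-equivariant wave maps equation $$\psi_{tt}-\psi_{rr}-\tfrac1r\psi_r+k^2\frac{\sin 2\psi}{2r^2}=0$$ with $\mathcal E(\vec\psi)=2\mathcal E(\vec Q)=8\pi k$ which is a two-bubble in the forward time direction (so that $T_+=+\infty$), with scales $\lambda(t),\mu(t)$ satisfying $\mu(t)\to\mu_0\in(0,+\infty)$ and $\lambda(t)\to0$ as $t\to+\infty$. (i) If $k\ge3$, there exists a constant $C_k>0$ such that for all $t$ large enough $$\frac1{C_k}\,\mu_0\,t^{-\frac2{k-2}}\le\lambda(t)\le C_k\,\mu_0\,t^{-\frac2{k-2}} .$$ (ii) If $k=2$, there exists a constant $C>0$ such that for all $t$ large enough $$\exp(-Ct)\le\lambda(t)\le\exp(-t/C).$$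
   Context: Energy: for $\vec\psi=(\psi_0,\psi_1)$, radial functions of $r\in(0,\infty)$, $\mathcal E(\vec\psi)=\pi\int_0^\infty\big(\psi_1^2+(\partial_r\psi_0)^2+k^2\frac{\sin^2\psi_0}{r^2}\big)\,r\,dr$, conserved by the flow, with $\vec\psi(t)=(\psi(t),\psi_t(t))$. $\mathcal H_0=\{(\psi_0,\psi_1):\mathcal E(\psi_0,\psi_1)<\infty,\ \lim_{r\to0}\psi_0(r)=\lim_{r\to\infty}\psi_0(r)=0\}$, with norm $\|(\psi_0,\psi_1)\|_{\mathcal H_0}^2=\int_0^\infty\big((\partial_r\psi_0)^2+k^2\frac{\psi_0^2}{r^2}\big)r\,dr+\int_0^\infty\psi_1^2\,r\,dr$. Solutions: for data in $\mathcal H_0$, ''solution'' means the unique maximal energy-class solution $\vec\psi\in C^0((T_-,T_+);\mathcal H_0)$ such that $\psi/r$, viewed as a radial function on $\mathbb R^4$, lies in $L^3_t(J;L^6_x(\mathbb R^4))$ for every compact $J\subset(T_-,T_+)$. Harmonic map: $Q(r)=2\arctan(r^k)$, $\vec Q=(Q,0)$, $\mathcal E(\vec Q)=4\pi k$, $Q_\lambda(r)=Q(r/\lambda)$. Two-bubble in the forward time direction: there exist $\iota\in\{1,-1\}$ and continuous functions $\lambda(t),\mu(t)>0$ (the scales) with $\lim_{t\to T_+}\|(\psi(t)-\iota(Q_{\lambda(t)}-Q_{\mu(t)}),\psi_t(t))\|_{\mathcal H_0}=0$ and $\lambda(t)/\mu(t)\to0$ as $t\to T_+$. It is known that every such solution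 at this energy has $T_+=+\infty$, $\mu(t)\to\mu_0\in(0,+\infty)$ and $\lambda(t)\to0$. *)

(* Defs.v *)
From HB Require Import structures.
From mathcomp Require Import all_boot all_order all_algebra.
From mathcomp Require Import all_classical all_reals all_analysis.

Set Implicit Arguments.
Unset Strict Implicit.
Unset Printing Implicit Defensive.

Import Order.TTheory GRing.Theory Num.Theory.
Import numFieldNormedType.Exports.

Local Open Scope ring_scope.
Local Open Scope classical_set_scope.

(* Functions of the radius r in (0, +oo) are functions R -> R of which only the
   values on (0, +oo) matter. *)
Definition state (R : realType) : Type := ((R -> R) * (R -> R))%type.

Definition halfline (R : realType) : set R := `]0, +oo[.
Arguments halfline R : clear implicits.

Definition sub_state (R : realType) (u v : state R) : state R :=
  (fun r => u.1 r - v.1 r, fun r => u.2 r - v.2 r).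

(* Existence of a locally integrable weak derivative on (0, +oo), for the
   continuous representative of f: f is the indefinite integral of its almost
   everywhere derivative. As derive1 f takes a default value only on a null set,
   it can be used for the weak derivative in the integrals below. *)
Definition weakly_differentiable (R : realType) (f : R -> R) : Prop :=
  locally_integrable (halfline R) (derive1 f) /\
  forall a b : R, 0 < a -> a <= b ->
    f b - f a = \int[lebesgue_measure]_(r in `[a, b]) (derive1 f r).

Definition energy (R : realType) (k : nat) (u : state R) : \bar R :=
  (pi%:E * \int[lebesgue_measure]_(r in halfline R)
     (((u.2 r) ^+ 2 + (derive1 u.1 r) ^+ 2 + k%:R ^+ 2 * (sin (u.1 r) ^+ 2 / r ^+ 2))
        * r)%:E)%E.

Definition in_H0 (R : realType) (k : nat) (u : state R) : Prop :=
  [/\ weakly_differentiable u.1,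
      measurable_fun (halfline R) u.2,
      (energy k u < +oo)%E,
      u.1 r @[r --> 0^'+] --> (0 : R)
    & u.1 r @[r --> +oo] --> (0 : R)].

Definition H0_norm (R : realType) (k : nat) (u : state R) : \bar R :=
  sqrte (\int[lebesgue_measure]_(r in halfline R)
           (((derive1 u.1 r) ^+ 2 + k%:R ^+ 2 * ((u.1 r) ^+ 2 / r ^+ 2)) * r)%:E
       + \int[lebesgue_measure]_(r in halfline R) ((u.2 r) ^+ 2 * r)%:E)%E.

Definition time_interval (R : realType) (Tm Tp : \bar R) : set R :=
  [set t : R | (Tm < t%:E)%E /\ (t%:E < Tp)%E].

(* The filter t -> Tp, t < Tp, for a finite or infinite Tp. *)
Definition toward (R : realType) (Tp : \bar R) : set_system R :=
  filter_from [set a : R | (a%:E < Tp)%E]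
              (fun a => [set t : R | a < t /\ (t%:E < Tp)%E]).

Definition test_function (R : realType) (b : R -> R) : Prop :=
  (forall (n : nat) (r : R), derivable (derive1n n b) r 1) /\
  (exists r1 r2 : R, [/\ 0 < r1, r1 < r2
     & forall r : R, ~ (r1 <= r <= r2) -> b r = 0]).

(* The equation
     psi_tt - psi_rr - psi_r / r + k^2 sin (2 psi) / (2 r^2) = 0
   as the first-order system for (psi, psi_t), in the sense of distributions in
   r with respect to the measure r dr:
     d/dt <psi, b>   = <psi_t, b>,
     d/dt <psi_t, b> = - <psi_r, b_r> - <k^2 sin (2 psi) / (2 r^2), b>. *)
Definition wave_map_equation (R : realType) (k : nat) (Tm Tp : \bar R)
    (psi : R -> state R) : Prop :=
  forall (b : R -> R) (t : R), test_function b -> time_interval Tm Tp t ->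
    is_derive t (1 : R)
      (fun s : R => \int[lebesgue_measure]_(r in halfline R)
                      ((psi s).1 r * b r * r) : R)
      (\int[lebesgue_measure]_(r in halfline R) ((psi t).2 r * b r * r)) /\
    is_derive t (1 : R)
      (fun s : R => \int[lebesgue_measure]_(r in halfline R)
                      ((psi s).2 r * b r * r) : R)
      (- \int[lebesgue_measure]_(r in halfline R)
           ((derive1 (psi t).1 r * derive1 b r
             + k%:R ^+ 2 * (sin (2 * (psi t).1 r) / (2 * r ^+ 2)) * b r) * r)).

Definition continuous_in_H0 (R : realType) (k : nat) (Tm Tp : \bar R)
    (psi : R -> state R) : Prop :=
  forall t0 : R, time_interval Tm Tp t0 ->
    H0_norm k (sub_state (psi t) (psi t0)) @[t --> t0] --> (0 : \bar R)%E.

(* The L^6(R^4) norm of x |-> f |x| in polar coordinates; 2 pi^2 is the area of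
   the unit sphere of R^4. *)
Definition radial_L6_R4 (R : realType) (f : R -> R) : \bar R :=
  (((2 * pi ^+ 2)%:E *
     \int[lebesgue_measure]_(r in halfline R) (`|f r| ^+ 6 * r ^+ 3)%:E)
   `^ (6%:R^-1)%R)%E.

Definition locally_L3L6 (R : realType) (Tm Tp : \bar R)
    (psi : R -> state R) : Prop :=
  forall J : set R, compact J -> J `<=` time_interval Tm Tp ->
    (\int[lebesgue_measure]_(t in J)
       (radial_L6_R4 (fun r : R => ((psi t).1 r / r)%R)) ^+ 3 < +oo)%E.

Definition energy_class_solution (R : realType) (k : nat) (Tm Tp : \bar R)
    (psi : R -> state R) : Prop :=
  [/\ (exists t : R, time_interval Tm Tp t),
      (forall t : R, time_interval Tm Tp t -> in_H0 k (psi t)),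
      continuous_in_H0 k Tm Tp psi,
      wave_map_equation k Tm Tp psi
    & locally_L3L6 Tm Tp psi].

(* A solution that admits no extension to a larger open time interval. Elements
   of H_0 are identified when their distance vanishes. *)
Definition maximal_solution (R : realType) (k : nat) (Tm Tp : \bar R)
    (psi : R -> state R) : Prop :=
  energy_class_solution k Tm Tp psi /\
  forall (Tm' Tp' : \bar R) (phi : R -> state R),
    (Tm' <= Tm)%E -> (Tp <= Tp')%E ->
    energy_class_solution k Tm' Tp' phi ->
    (forall t : R, time_interval Tm Tp t ->
       H0_norm k (sub_state (phi t) (psi t)) = 0%E) ->
    Tm' = Tm /\ Tp' = Tp.

Definition Q (R : realType) (k : nat) (r : R) : R := 2 * atan (r ^+ k).

Definition vecQ (R : realType) (k : nat) : state R := (@Q R k, fun=> 0).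

Definition two_bubble_state (R : realType) (k : nat) (iota l m : R) : state R :=
  (fun r => iota * (Q k (r / l) - Q k (r / m)), fun=> 0).

Definition forward_two_bubble (R : realType) (k : nat) (Tm Tp : \bar R)
    (psi : R -> state R) (lambda mu : R -> R) : Prop :=
  [/\ (forall t : R, time_interval Tm Tp t -> 0 < lambda t /\ 0 < mu t),
      {in time_interval Tm Tp, continuous lambda},
      {in time_interval Tm Tp, continuous mu},
      (exists iota : R, (iota = 1 \/ iota = -1) /\
         H0_norm k (sub_state (psi t) (two_bubble_state k iota (lambda t) (mu t)))
           @[t --> toward Tp] --> (0 : \bar R)%E)
    & lambda t / mu t @[t --> toward Tp] --> (0 : R)].

(* Main.v *)
Require Import Defs.
From HB Require Import structures.
From mathcomp Require Import all_boot all_order all_algebra.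
From mathcomp Require Import all_classical all_reals all_analysis.
From mathcomp Require Import measurable_realfun.
From mathcomp Require Import ring lra zify.

Import Order.TTheory GRing.Theory Num.Theory.
Import numFieldNormedType.Exports.

Local Open Scope ring_scope.
Local Open Scope classical_set_scope.

Set Implicit Arguments.
Unset Strict Implicit.
Unset Printing Implicit Defensive.

(* Write u = iota psi and lambda = m^6, so that every scale used below is a power
   of m, and M = m^k.

   Completing squares in the energy (Bogomolny) at a radius rho where u is close
   to pi bounds the kinetic energy, the defect r u_r - k sin u on (0, rho) and the
   defect r u_r + k sin u beyond rho by 4 k (1 + cos (u rho)). In terms of
   tan (u / 2) both defects give first order equations, which for rho = m^3 yield
   pi - u(rho) of order M^3. The three bounded quantities are therefore at most
   C M^6, while r^k (pi - u) is almost constant, of order M^6, between the two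
   bubbles.

   The functional V = <u_t, phi r u_r> + c(u) <u_t, omega r^(-k)>, with phi a slowly
   varying cutoff of the region of the inner bubble and c(u) the value of
   k r^k (pi - u) between the bubbles, satisfies |V| <= K M^3 m^6 and
   dV/dt <= - gamma M^6: the second term turns the interaction of the inner
   bubble with the tail of the outer one into a term with a sign. As solutions
   are only of finite energy, the derivative of the first term is computed from
   the transport equations of u_t + u_r and u_t - u_r.

   Since the kinetic energy is at most C M^6, lambda changes at most by a factor 2
   during a time c m^6 / M^3. Over consecutive intervals of that length V drops by
   a multiple of a = M^3 m^6 while |V| <= K a. Hence V stays nonnegative and
   decays geometrically, so a does too, and comparing with the lengths of the
   intervals gives t m^(3 (k - 2)) of order 1 if k >= 3, and exponential decay if
   k = 2. *)

(** * Integration on the half-line *)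

(** The virial identity alone only brings in the kinetic energy, which may vanish, so it cannot
    force a definite drift. The missing sign comes from the outer bubble: near [r = m ^+ 2], [sin u]
    is at least a multiple of [r ^+ k], and the tail of the inner bubble, of strength [M ^+ 6],
    meets it there. The obstacle is the inner cut at [m ^+ 4]: there [sin u] is of order [M ^+ 2]
    and the Bogomolny defect of order [M ^+ 3], so the virial term alone leaves a cross term of
    order [M ^+ 5]. The second functional is cut off by the same function, and its coefficient is
    fitted so that [sin u] is replaced by a remainder of order [M ^+ 3]. The boundary terms are then
    of the critical order [M ^+ 6], and cutoffs that are slow on the logarithmic scale make their
    constants small. The scale is only known to be continuous and no modulation equation is derived.
    It is frozen during each step, and functionals with different frozen scales are compared through
    one integral over a window that lies in the plateau of both cutoffs. *)

Section Integrability.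
Context (R : realType).
Local Notation mu := (@lebesgue_measure R).
Implicit Types (D : set R) (f g h : R -> R) (a b c r : R).

Definition summable_on D f := mu.-integrable D (EFin \o f).

Definition bounded_on D f :=
  measurable_fun (D : set (measurableTypeR R)) f /\ exists M, forall x, D x -> `|f x| <= M.

Definition square_summable_on D f :=
  measurable_fun (D : set (measurableTypeR R)) f /\ summable_on D (fun x => f x ^+ 2).

Lemma summable_measurable D f : summable_on D f -> measurable_fun D f.
Proof. by move=> /integrableP[/measurable_EFinP]. Qed.

Section Domain.
Variable D : set R.
Hypothesis mD : measurable (D : set (measurableTypeR R)).

Lemma summable_eq f g : {in D, f =1 g} -> summable_on D f -> summable_on D g.
Proof.
by move=> fg; apply: eq_integrable => // x xD; rewrite /= fg.
Qed.

Lemma summableD f g : summable_on D f -> summable_on D g ->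
  summable_on D (fun x => f x + g x).
Proof. by move=> If Ig; have := integrableD mD If Ig. Qed.

Lemma summableN f : summable_on D f -> summable_on D (fun x => - f x).
Proof. by move=> If; have := integrableN If. Qed.

Lemma summableB f g : summable_on D f -> summable_on D g ->
  summable_on D (fun x => f x - g x).
Proof. by move=> If Ig; apply: summableD => //; apply: summableN. Qed.

Lemma summableZ c f : summable_on D f -> summable_on D (fun x => c * f x).
Proof. by move=> If; have := integrableZl mD c If. Qed.

Lemma summable_norm f : summable_on D f -> summable_on D (fun x => `|f x|).
Proof. by move=> If; have := integrable_norm If. Qed.

Lemma le_summable f g : measurable_fun D f -> (forall x, D x -> `|f x| <= g x) ->
  summable_on D g -> summable_on D f.
Proof.
move=> mf fg Ig; apply: (le_integrable mD _ _ Ig); first exact/measurable_EFinP.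
move=> x Dx /=; rewrite lee_fin (le_trans (fg _ Dx))//.
exact: ler_norm.
Qed.

Lemma summableMr h g : bounded_on D h -> summable_on D g ->
  summable_on D (fun x => h x * g x).
Proof.
move=> [mh [M hM]] Ig; apply: (@le_summable _ (fun x => M * `|g x|)).
- by apply: measurable_funM => //; exact: summable_measurable.
- by move=> x Dx; rewrite normrM ler_wpM2r// hM.
- by apply: summableZ; apply: summable_norm.
Qed.

Lemma summableMl h g : bounded_on D h -> summable_on D g ->
  summable_on D (fun x => g x * h x).
Proof.
move=> bh Ig; apply: summable_eq (summableMr bh Ig) => x _; exact: mulrC.
Qed.

Lemma square_summableM f g : square_summable_on D f -> square_summable_on D g ->
  summable_on D (fun x => f x * g x).
Proof.
move=> [mf If] [mg Ig].
apply: (@le_summable _ (fun x => f x ^+ 2 + g x ^+ 2)).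
- exact: measurable_funM.
- move=> x _; rewrite normrM -(real_normK (num_real (f x))).
  rewrite -(real_normK (num_real (g x))).
  have := sqr_ge0 (`|f x| - `|g x|); have := normr_ge0 (f x).
  have := normr_ge0 (g x); nra.
- exact: summableD.
Qed.

Lemma square_summableD f g : square_summable_on D f -> square_summable_on D g ->
  square_summable_on D (fun x => f x + g x).
Proof.
move=> sf sg; have Ifg := square_summableM sf sg.
case: sf sg => [mf If] [mg Ig]; split; first exact: measurable_funD.
apply: (@summable_eq (fun x => f x ^+ 2 + g x ^+ 2 + 2 * (f x * g x))).
  by move=> x _; ring.
by apply: summableD; [exact: summableD|exact: summableZ].
Qed.

Lemma square_summableZ c f : square_summable_on D f ->
  square_summable_on D (fun x => c * f x).
Proof.
move=> [mf If]; split; first exact: measurable_funM.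
apply: (@summable_eq (fun x => c ^+ 2 * f x ^+ 2)).
  by move=> x _; rewrite exprMn.
exact: summableZ.
Qed.

Lemma square_summableN f : square_summable_on D f ->
  square_summable_on D (fun x => - f x).
Proof.
by move=> sf; have := square_summableZ (-1) sf; under eq_fun do rewrite mulN1r.
Qed.

Lemma square_summableB f g : square_summable_on D f -> square_summable_on D g ->
  square_summable_on D (fun x => f x - g x).
Proof. by move=> sf sg; apply: square_summableD => //; exact: square_summableN. Qed.

Lemma square_summableMr h g : bounded_on D h -> square_summable_on D g ->
  square_summable_on D (fun x => h x * g x).
Proof.
move=> [mh [M hM]] [mg Ig]; split; first exact: measurable_funM.
apply: (@le_summable _ (fun x => M ^+ 2 * g x ^+ 2)).
- by apply/measurable_funX/measurable_funM.
- move=> x Dx; rewrite ger0_norm ?sqr_ge0// exprMn ler_wpM2r ?sqr_ge0//.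
  by rewrite -(real_normK (num_real (h x))) lerXn2r ?nnegrE// ?hM// (le_trans _ (hM _ Dx)).
- exact: summableZ.
Qed.

Lemma square_summable_eq f g : {in D, f =1 g} ->
  square_summable_on D f -> square_summable_on D g.
Proof.
move=> fg [mf If]; split; first exact: eq_measurable_fun mf.
by apply: summable_eq If => x xD; rewrite fg.
Qed.

Lemma bounded_square_summable h : (mu D < +oo)%E -> bounded_on D h ->
  square_summable_on D h.
Proof.
move=> Doo bh; have : square_summable_on D (fun=> 1).
  split; first exact: measurable_cst.
  apply: measurable_bounded_integrable => //.
  exists 1; split => // M M1 x _ /=; rewrite expr1n normr1; exact: ltW.
by move/(square_summableMr bh); apply: square_summable_eq => x _; rewrite mulr1.
Qed.

Lemma bounded_summable h : (mu D < +oo)%E -> bounded_on D h -> summable_on D h.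
Proof.
move=> Doo bh; have : summable_on D (fun=> 1).
  apply: measurable_bounded_integrable => //.
  exists 1; split => // M M1 x _ /=; rewrite normr1; exact: ltW.
by move/(summableMr bh); apply: summable_eq => x _; rewrite mulr1.
Qed.

Lemma le_square_summable f g : measurable_fun D f ->
  (forall x, D x -> f x ^+ 2 <= g x) -> summable_on D g -> square_summable_on D f.
Proof.
move=> mf fg Ig; split => //; apply: le_summable Ig; first exact: measurable_funX.
by move=> x Dx; rewrite ger0_norm ?sqr_ge0// fg.
Qed.

Lemma RintegralN f : summable_on D f ->
  \int[mu]_(x in D) (- f x) = - \int[mu]_(x in D) f x.
Proof.
move=> If; rewrite -[RHS]mulN1r -RintegralZl//.
by apply: eq_Rintegral => x _; rewrite mulN1r.
Qed.

(** The integral of [(s * f + t * g) ^+ 2] is a nonnegative quadratic form in [s] and [t]; at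
    [s = - B], [t = A] it equals [A * (A * C - B ^+ 2)]. *)
Lemma Cauchy_Schwarz f g : square_summable_on D f -> square_summable_on D g ->
  (\int[mu]_(x in D) (f x * g x)) ^+ 2 <=
  (\int[mu]_(x in D) (f x ^+ 2)) * (\int[mu]_(x in D) (g x ^+ 2)).
Proof.
move=> sf sg.
have Ifg := square_summableM sf sg.
have H s t : 0 <= s ^+ 2 * (\int[mu]_(x in D) (f x ^+ 2)) +
   (2 * s * t) * (\int[mu]_(x in D) (f x * g x)) +
   t ^+ 2 * (\int[mu]_(x in D) (g x ^+ 2)).
  rewrite -!RintegralZl//; try by case: sf. 2: by case: sg.
  rewrite -!RintegralD//.
  - by apply: Rintegral_ge0 => x _; have := sqr_ge0 (s * f x + t * g x); lra.
  - by apply: summableD; apply: summableZ => //; case: sf.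
  - by apply: summableZ; case: sg.
  - by apply: summableZ; case: sf.
  - exact: summableZ.
set A := \int[mu]_(x in D) (f x ^+ 2) in H *.
set B := \int[mu]_(x in D) (f x * g x) in H *.
set C := \int[mu]_(x in D) (g x ^+ 2) in H *.
have A0 : 0 <= A by apply: Rintegral_ge0 => x _; exact: sqr_ge0.
have C0 : 0 <= C by apply: Rintegral_ge0 => x _; exact: sqr_ge0.
have [A1|A1|A1] := ltgtP A 0; first by lra.
- have := H (- B) A.
  have -> : (- B) ^+ 2 * A + 2 * - B * A * B + A ^+ 2 * C = A * (A * C - B ^+ 2) by ring.
  by rewrite pmulr_rge0// subr_ge0.
- rewrite A1 mul0r.
  have [->|B0] := eqVneq B 0; first by rewrite expr0n.
  (* When [A = 0] the form is affine in [s], and this choice makes it equal to -1. *)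
  have := H (- (C + 1) / (2 * B)) 1; rewrite A1.
  have -> : (- (C + 1) / (2 * B)) ^+ 2 * 0 + 2 * (- (C + 1) / (2 * B)) * 1 * B
    + 1 ^+ 2 * C = - 1 by field.
  by lra.
Qed.

Lemma Cauchy_Schwarz_le f g A B : square_summable_on D f -> square_summable_on D g ->
  0 <= A -> 0 <= B ->
  \int[mu]_(x in D) (f x ^+ 2) <= A ^+ 2 -> \int[mu]_(x in D) (g x ^+ 2) <= B ^+ 2 ->
  `|\int[mu]_(x in D) (f x * g x)| <= A * B.
Proof.
move=> sf sg A0 B0 fA gB.
rewrite -(@ler_pXn2r _ 2)// ?nnegrE ?mulr_ge0//.
rewrite real_normK ?num_real// (le_trans (Cauchy_Schwarz sf sg))//.
rewrite exprMn ler_pM//; apply: Rintegral_ge0 => x _; exact: sqr_ge0.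
Qed.

End Domain.

Lemma summableS D E f : measurable (E : set (measurableTypeR R)) -> measurable (D : set (measurableTypeR R)) -> D `<=` E ->
  summable_on E f -> summable_on D f.
Proof. by move=> mE mD DE; apply: integrableS. Qed.

Lemma square_summableS D E f : measurable (E : set (measurableTypeR R)) -> measurable (D : set (measurableTypeR R)) -> D `<=` E ->
  square_summable_on E f -> square_summable_on D f.
Proof.
move=> mE mD DE [mf If]; split; first exact: measurable_funS mf.
exact: summableS If.
Qed.

Lemma ge0_subset_Rintegral D E f : measurable (E : set (measurableTypeR R)) -> measurable (D : set (measurableTypeR R)) -> D `<=` E ->
  summable_on E f -> (forall x, E x -> 0 <= f x) ->
  \int[mu]_(x in D) f x <= \int[mu]_(x in E) f x.
Proof.
move=> mE mD DE If f0; rewrite /Rintegral fine_le//.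
- by apply: integrable_fin_num => //; exact: summableS If.
- exact: integrable_fin_num.
- by apply: ge0_subset_integral => //; have /integrableP[] := If.
Qed.

Lemma Rintegral_itv_split a b c f : a <= b -> b <= c -> summable_on `[a, c] f ->
  \int[mu]_(x in `[a, c]) f x = \int[mu]_(x in `[a, b]) f x + \int[mu]_(x in `[b, c]) f x.
Proof.
move=> ab bc If.
have I' : mu.-integrable [set` Interval (BLeft a) (BRight c)] (EFin \o f) by [].
have := @Rintegral_itvB R f (BLeft a) (BRight c) b I'.
rewrite !bnd_simp => /(_ ab bc) H.
rewrite -[X in _ + X]Rintegral_itv_obnd_cbnd ?(@Rintegral_itv_bndo_bndc _ _ c)//.
  by rewrite -H addrC subrK.
apply: summableS If => //.
by move=> x /=; rewrite !in_itv/= => /andP[bx ->]; rewrite (le_trans ab)// ltW.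
Qed.

(** After extension by zero both sides integrate the same function over the line, so this holds for
    any [f], integrable or not. *)
Lemma Rintegral_zero D E f : measurable (D : set (measurableTypeR R)) -> measurable (E : set (measurableTypeR R)) -> D `<=` E ->
  (forall x, E x -> ~ D x -> f x = 0) ->
  \int[mu]_(x in E) f x = \int[mu]_(x in D) f x.
Proof.
move=> mD mE DE f0; rewrite [LHS]Rintegral_mkcond [RHS]Rintegral_mkcond.
apply: eq_Rintegral => x _; rewrite !patchE.
case: ifPn => [/set_mem xE|xE]; case: ifPn => [/set_mem xD|xD] //.
- by rewrite f0// => Dx; move/negP: xD; apply; apply/mem_set.
- by move/negP: xE; case; apply/mem_set/DE.
Qed.

Definition translation (h : R) : measurableTypeR R -> measurableTypeR R :=
  fun x => x + h.

Lemma measurable_translation (h : R) : measurable_fun setT (translation h).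
Proof. exact: measurable_funD. Qed.

HB.instance Definition _ (h : R) :=
  isMeasurableFun.Build _ _ _ _ (translation h) (measurable_translation h).

(** Lebesgue measure is determined by its values on the intervals []a, b]], whose lengths are
    preserved. *)
Lemma lebesgue_measure_translation (h : R) (A : set (measurableTypeR R)) :
  measurable A -> pushforward mu (translation h) A = mu A.
Proof.
move=> mA; apply/esym.
apply: (@lebesgue_measure_unique R (pushforward mu (translation h))) => //.
move=> _ [[a b]] _ <-; rewrite /= /pushforward.
have -> : translation h @^-1` `]a, b]%classic = `]a - h, b - h]%classic.
  by apply/seteqP; split => x /=; rewrite !in_itv/= ltrBlDr lerBrDr.
rewrite /= !lebesgue_measure_itv/= !lte_fin ltrD2r -!EFinB.
by congr (if _ then _%:E else _); ring.
Qed.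

Lemma summable_shift (h : R) f : summable_on setT f ->
  summable_on setT (fun x => f (x + h)).
Proof.
move=> If; have mf := summable_measurable If.
apply/integrableP; split.
  apply/measurable_EFinP.
  exact: (measurableT_comp mf (measurable_translation h)).
have /integrableP[_] := If.
rewrite (@eq_measure_integral _ _ R setT (pushforward mu (translation h)) mu); last first.
  by move=> A mA _; apply/esym; exact: lebesgue_measure_translation.
rewrite (ge0_integral_pushforward (measurable_translation h)) ?preimage_setT//.
by apply/measurableT_comp => //; exact/measurable_EFinP.
Qed.

Lemma Rintegral_shift (h : R) f : summable_on setT f ->
  \int[mu]_x f (x + h) = \int[mu]_x f x.
Proof.
move=> If; have mf := summable_measurable If.
rewrite /Rintegral; congr fine.
rewrite [RHS](@eq_measure_integral _ _ R setT (pushforward mu (translation h)) mu); last first.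
  by move=> A mA _; apply/esym; exact: lebesgue_measure_translation.
rewrite (integral_pushforward (measurable_translation h)) ?preimage_setT//.
  exact/measurable_EFinP.
exact: summable_shift.
Qed.

End Integrability.

(** Turns every integral into a variable, so that linear and nonlinear arithmetic never have to
    compare integrands. *)
Ltac gen_int :=
  repeat match goal with
  | H : is_true (@Order.le _ _ _ _) |- _ => revert H
  | H : is_true (@Order.lt _ _ _ _) |- _ => revert H
  | H : is_true (andb _ _) |- _ => revert H
  | H : @eq (Real.sort _) _ _ |- _ => revert H
  end;
  repeat match goal with
  | H : ?T |- _ => match type of T with Prop => clear H end
  end;
  repeat match goal with
  | |- context [@Rintegral ?a ?b ?c ?m ?D ?f] =>
    let I := fresh "I" in
    pose (I := @Rintegral a b c m D f);
    repeat match goal with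
    | |- context [@Rintegral ?a1 ?b1 ?c1 ?m1 ?D1 ?f1] =>
      unify D1 D; unify f1 f; change (@Rintegral a1 b1 c1 m1 D1 f1) with I
    end;
    clearbody I
  end; intros.
Ltac ilra := gen_int; lra.
Ltac inra := gen_int; nra.

(** * Locally absolutely continuous functions on the half-line *)

Section Primitives.
Context (R : realType).
Local Notation mu := (@lebesgue_measure R).
Implicit Types (f g h m : R -> R) (a b c d e r x y z : R).

Definition continuous_pos f := forall x, 0 < x -> {for x, continuous f}.

Definition locally_summable f := forall a b, 0 < a -> summable_on `[a, b] f.

Definition locally_square_summable f :=
  forall a b, 0 < a -> square_summable_on `[a, b] f.

Lemma measurable_segment a b : measurable (`[a, b]%classic : set (measurableTypeR R)).
Proof. exact: measurable_itv. Qed.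

Lemma segment_lty a b : (mu `[a, b] < +oo)%E.
Proof. by rewrite lebesgue_measure_itv/=; case: ifP => // _; rewrite -EFinB ltry. Qed.

Hint Resolve measurable_segment segment_lty : core.

Lemma continuous_pos_cst c : continuous_pos (fun=> c).
Proof. by move=> x _; exact: cvg_cst. Qed.

Lemma continuous_pos_id : continuous_pos id.
Proof. by move=> x _; exact: cvg_id. Qed.

Lemma continuous_posD f g : continuous_pos f -> continuous_pos g ->
  continuous_pos (fun x => f x + g x).
Proof. by move=> cf cg x x0; apply: cvgD; [exact: cf|exact: cg]. Qed.

Lemma continuous_posN f : continuous_pos f -> continuous_pos (fun x => - f x).
Proof. by move=> cf x x0; apply: cvgN; exact: cf. Qed.

Lemma continuous_posB f g : continuous_pos f -> continuous_pos g ->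
  continuous_pos (fun x => f x - g x).
Proof. by move=> cf cg x x0; apply: cvgB; [exact: cf|exact: cg]. Qed.

Lemma continuous_posM f g : continuous_pos f -> continuous_pos g ->
  continuous_pos (fun x => f x * g x).
Proof. by move=> cf cg x x0; apply: cvgM; [exact: cf|exact: cg]. Qed.

Lemma continuous_posX f n : continuous_pos f -> continuous_pos (fun x => f x ^+ n).
Proof.
move=> cf; elim: n => [|n IH].
  by under eq_fun do rewrite expr0; exact: continuous_pos_cst.
by under eq_fun do rewrite exprS; exact: continuous_posM.
Qed.

Lemma continuous_posV f : continuous_pos f -> (forall x, 0 < x -> f x != 0) ->
  continuous_pos (fun x => (f x)^-1).
Proof. by move=> cf f0 x x0; apply: cvgV; [exact: f0|exact: cf]. Qed.

Lemma continuous_pos_comp h f : continuous h -> continuous_pos f ->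
  continuous_pos (fun x => h (f x)).
Proof. by move=> ch cf x x0; apply: continuous_comp; [exact: cf|exact: ch]. Qed.

Lemma continuous_continuous_pos f : continuous f -> continuous_pos f.
Proof. by move=> cf x _; exact: cf. Qed.

Lemma continuous_pos_sin f : continuous_pos f -> continuous_pos (fun x => sin (f x)).
Proof. by apply: continuous_pos_comp; exact: continuous_sin. Qed.

Lemma continuous_pos_cos f : continuous_pos f -> continuous_pos (fun x => cos (f x)).
Proof. by apply: continuous_pos_comp; exact: continuous_cos. Qed.

Lemma continuous_pos_inv n : continuous_pos (fun x => x ^- n).
Proof.
apply: continuous_posV; first exact/continuous_posX/continuous_pos_id.
by move=> x x0; rewrite expf_neq0// gt_eqF.
Qed.

Lemma continuous_pos_inv1 : continuous_pos (fun x => x^-1).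
Proof. by have := @continuous_pos_inv 1; under eq_fun do rewrite expr1. Qed.

Lemma continuous_pos_within f a b : 0 < a -> continuous_pos f ->
  {within `[a, b], continuous f}.
Proof.
move=> a0 cf; apply: continuous_in_subspaceT => x /set_mem /=.
by rewrite in_itv/= => /andP[ax _]; apply: cf; exact: lt_le_trans ax.
Qed.

Lemma measurable_continuous_pos f : continuous_pos f ->
  measurable_fun (`]0, +oo[%classic : set (measurableTypeR R)) f.
Proof.
move=> cf; apply: open_continuous_measurable_fun; first exact: interval_open.
by move=> x /set_mem /=; rewrite in_itv/= andbT => x0; exact: cf.
Qed.

Lemma segment_sub_pos a b : 0 < a -> `[a, b] `<=` `]0, +oo[%classic.
Proof. by move=> a0 x /=; rewrite !in_itv/= andbT => /andP[ax _]; exact: lt_le_trans ax. Qed.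

Lemma continuous_pos_bounded f a b : 0 < a -> continuous_pos f -> bounded_on `[a, b] f.
Proof.
move=> a0 cf; split.
  apply: measurable_funS (measurable_continuous_pos cf) => //.
  exact: segment_sub_pos.
have /compact_bounded[M [_ HM]] : compact (f @` `[a, b]).
  by apply: continuous_compact; [exact: continuous_pos_within|exact: segment_compact].
exists (M + 1) => x xab; apply: (HM (M + 1)); first by rewrite ltrDl.
by exists x.
Qed.

Lemma continuous_pos_square_summable f : continuous_pos f -> locally_square_summable f.
Proof.
move=> cf a b a0; apply: bounded_square_summable => //.
exact: continuous_pos_bounded.
Qed.

Lemma continuous_pos_summable f : continuous_pos f -> locally_summable f.
Proof.
move=> cf a b a0; apply: bounded_summable => //.
exact: continuous_pos_bounded.
Qed.

Lemma locally_summableD f g : locally_summable f -> locally_summable g ->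
  locally_summable (fun x => f x + g x).
Proof. by move=> If Ig a b a0; apply: summableD => //; [exact: If|exact: Ig]. Qed.

Lemma locally_summableN f : locally_summable f -> locally_summable (fun x => - f x).
Proof. by move=> If a b a0; apply: summableN => //; exact: If. Qed.

Lemma locally_summableB f g : locally_summable f -> locally_summable g ->
  locally_summable (fun x => f x - g x).
Proof. by move=> If Ig; apply: locally_summableD => //; exact: locally_summableN. Qed.

Lemma locally_summableMr h g : continuous_pos h -> locally_summable g ->
  locally_summable (fun x => h x * g x).
Proof.
move=> ch Ig a b a0; apply: summableMr => //; last exact: Ig.
exact: continuous_pos_bounded.
Qed.

Lemma locally_summableMl h g : continuous_pos h -> locally_summable g ->
  locally_summable (fun x => g x * h x).
Proof.
move=> ch Ig a b a0; apply: summableMl => //; last exact: Ig.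
exact: continuous_pos_bounded.
Qed.

Lemma locally_summable_norm f : locally_summable f ->
  locally_summable (fun x => `|f x|).
Proof. by move=> If a b a0; apply: summable_norm; exact: If. Qed.

Lemma locally_summable_squareM f g : locally_square_summable f ->
  locally_square_summable g -> locally_summable (fun x => f x * g x).
Proof. by move=> sf sg a b a0; apply: square_summableM; [|exact: sf|exact: sg]. Qed.

Lemma locally_summable_sqr f : locally_square_summable f ->
  locally_summable (fun x => f x ^+ 2).
Proof. by move=> sf a b a0; have [] := sf a b a0. Qed.

Lemma locally_square_summableD f g : locally_square_summable f ->
  locally_square_summable g -> locally_square_summable (fun x => f x + g x).
Proof. by move=> sf sg a b a0; apply: square_summableD; [|exact: sf|exact: sg]. Qed.

Lemma locally_square_summableB f g : locally_square_summable f ->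
  locally_square_summable g -> locally_square_summable (fun x => f x - g x).
Proof. by move=> sf sg a b a0; apply: square_summableB; [|exact: sf|exact: sg]. Qed.

Lemma locally_square_summableN f : locally_square_summable f ->
  locally_square_summable (fun x => - f x).
Proof. by move=> sf a b a0; apply: square_summableN => //; exact: sf. Qed.

Lemma locally_square_summableMr h f : continuous_pos h ->
  locally_square_summable f -> locally_square_summable (fun x => h x * f x).
Proof.
move=> ch sf a b a0; apply: square_summableMr => //; last exact: sf.
exact: continuous_pos_bounded.
Qed.

Lemma locally_square_summable_summable f : locally_square_summable f ->
  locally_summable f.
Proof.
move=> sf a b a0.
apply: (@summable_eq _ _ _ (fun x => f x * 1)) => //; first by move=> x _; rewrite mulr1.
apply: square_summableM => //; first exact: sf.
by apply: continuous_pos_square_summable => //; exact: continuous_pos_cst.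
Qed.

(** Local absolute continuity on (0, +oo), with [f'] one version of the derivative. Profiles of
    finite energy enter the proof in this form, and the calculus rules below avoid pointwise
    derivatives of them. *)
Definition primitive f f' := locally_summable f' /\
  forall a b, 0 < a -> a <= b -> f b - f a = \int[mu]_(x in `[a, b]) f' x.

Lemma sub_segment a b c d : c <= a -> b <= d -> `[a, b] `<=` `[c, d]%classic.
Proof.
move=> ca bd x /=; rewrite !in_itv/= => /andP[ax xb].
by rewrite (le_trans ca ax) (le_trans xb bd).
Qed.

Lemma Rintegral_ge0_segment f a b : (forall x, a <= x <= b -> 0 <= f x) ->
  0 <= \int[mu]_(x in `[a, b]) f x.
Proof. by move=> f0; apply: Rintegral_ge0 => x /=; rewrite in_itv/=; exact: f0. Qed.

Lemma le_Rintegral_segment f g a b : summable_on `[a, b] f -> summable_on `[a, b] g ->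
  (forall x, a <= x <= b -> f x <= g x) ->
  \int[mu]_(x in `[a, b]) f x <= \int[mu]_(x in `[a, b]) g x.
Proof.
by move=> If Ig fg; apply: le_Rintegral => // x /=; rewrite in_itv/=; exact: fg.
Qed.

Lemma eq_Rintegral_segment f g a b : (forall x, a <= x <= b -> f x = g x) ->
  \int[mu]_(x in `[a, b]) f x = \int[mu]_(x in `[a, b]) g x.
Proof.
by move=> fg; apply: eq_Rintegral => x /set_mem/=; rewrite in_itv/=; exact: fg.
Qed.

Lemma primitive_cont f f' : primitive f f' -> continuous_pos f.
Proof.
move=> [If' ff'] x x0.
have h0 : 0 < x / 2 by rewrite divr_gt0.
have xx : x / 2 < x + 1 by lra.
have := parameterized_integral_continuous (ltW xx) (If' _ _ h0).
move=> /(continuous_within_itvP _ xx)[/(_ x) H _ _].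
have {H}cx : {for x, continuous (fun y => parameterized_integral mu (x / 2) y f')}.
  by apply: H; rewrite in_itv/=; lra.
have : (fun y => f (x / 2) + parameterized_integral mu (x / 2) y f') y @[y --> x]
    --> f (x / 2) + parameterized_integral mu (x / 2) x f'.
  by apply: cvgD; [exact: cvg_cst|exact: cx].
have E y : x / 2 <= y -> f (x / 2) + parameterized_integral mu (x / 2) y f' = f y.
  by move=> xy; rewrite /parameterized_integral -ff'// addrC subrK.
rewrite E; last by lra.
apply: cvg_trans; apply: near_eq_cvg; near=> y; rewrite E//.
near: y; exists (x / 2) => //= y; rewrite /ball/= => /ltr_normlW; lra.
Unshelve. all: by end_near. Qed.

(** Uniform continuity from the covering form of compactness. Only [x] is confined to the segment;
    [y] may leave it. *)
Lemma continuous_pos_unif f a b e : 0 < a -> continuous_pos f -> 0 < e ->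
  exists2 d : R, 0 < d &
    forall x y, a <= x <= b -> `|y - x| <= d -> `|f y - f x| <= e.
Proof.
move=> a0 cf e0.
have := @segment_compact R a b; rewrite compact_near_coveringP => cK.
have H : forall x : R, `[a, b]%classic x -> \forall x' \near x & d \near (0 : R)^'+,
    forall y : R, `|y - x'| <= d -> `|f y - f x'| <= e.
  move=> x /=; rewrite in_itv/= => /andP[ax xb].
  have x0 : 0 < x by exact: lt_le_trans ax.
  have e2 : 0 < e / 2 by rewrite divr_gt0.
  have /cvgrPdist_le/(_ _ e2)/nbhs_ballP[d /= d0 Hd] := cf x x0.
  exists (ball x (d / 2), [set t : R | 0 < t < d / 2]) => /=; first split.
  - by apply: nbhsx_ballx; rewrite divr_gt0.
  - near=> t; rewrite /=; apply/andP; split => //.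
    by near: t; apply: nbhs_right_lt; rewrite divr_gt0.
  - move=> [x' d'] /= [].
    rewrite /ball/= => xx' /andP[d'0 d'd] y yx'.
    have H1 : `|f x - f x'| <= e / 2 by apply: Hd; rewrite /ball/=; lra.
    have H2 : `|f x - f y| <= e / 2.
      apply: Hd; rewrite /ball/= (_ : x - y = (x - x') - (y - x')); last by ring.
      by rewrite (le_lt_trans (ler_normB _ _))//; lra.
    rewrite (_ : f y - f x' = (f x - f x') - (f x - f y)); last by ring.
    by rewrite (le_trans (ler_normB _ _))//; lra.
have {H}H := cK R ((0 : R)^'+) (fun d x => forall y : R, `|y - x| <= d -> `|f y - f x| <= e) _ H.
have [d [d0 Hd]] : exists d : R, 0 < d /\
    forall x, a <= x <= b -> forall y, `|y - x| <= d -> `|f y - f x| <= e.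
  have : \forall d \near (0 : R)^'+, 0 < d /\
      forall x, a <= x <= b -> forall y, `|y - x| <= d -> `|f y - f x| <= e.
    near=> d; split => // x xab.
    have Hd : `[a, b] `<=` (fun x => forall y : R, `|y - x| <= d -> `|f y - f x| <= e).
      by near: d; exact: H.
    by apply: Hd; rewrite /= in_itv.
  by move=> /filter_ex[d Hd]; exists d.
by exists d => // x y xab; exact: Hd.
Unshelve. all: by end_near. Qed.

(* The increments of F match those of the integral of f up to a fraction e of
   those of the integral of m, on all short intervals, hence on [a, b]. *)
Lemma increment_criterion F f m a b : 0 < a -> a <= b ->
  locally_summable f -> locally_summable m -> (forall x, 0 <= m x) ->
  (forall e, 0 < e -> exists2 d : R, 0 < d & forall x y, a <= x -> x <= y -> y <= b ->
     y - x <= d -> `|F y - F x - \int[mu]_(z in `[x, y]) f z|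
       <= e * \int[mu]_(z in `[x, y]) m z) ->
  F b - F a = \int[mu]_(z in `[a, b]) f z.
Proof.
move=> a0 ab If Im m0 H.
apply/eqP; rewrite -subr_eq0 -normr_le0.
suff G e : 0 < e -> `|F b - F a - \int[mu]_(z in `[a, b]) f z|
    <= e * \int[mu]_(z in `[a, b]) m z.
  set M := \int[mu]_(z in `[a, b]) m z in G.
  have M0 : 0 <= M by apply: Rintegral_ge0.
  apply/ler_addgt0Pl => e e0; rewrite addr0.
  have := G (e / (M + 1)) (divr_gt0 e0 (ltr_wpDl M0 ltr01)).
  move/le_trans; apply; rewrite mulrAC ler_pdivrMr ?ltr_wpDl//.
  by rewrite ler_pM2l// lerDl.
move=> e0; have [d d0 Hd] := H e e0.
have [n nd] : exists n : nat, (b - a) / d < n.+1%:R.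
  exists (Num.truncn ((b - a) / d)); apply: truncnS_gt.
pose h := (b - a) / n.+1%:R.
have h0 : 0 <= h by rewrite divr_ge0// subr_ge0.
have hd : h <= d by rewrite ler_pdivrMr// mulrC -ler_pdivrMr// ltW.
have hb (i : nat) : (i <= n.+1)%N -> a + i%:R * h <= b.
  move=> ni; rewrite -lerBrDl /h mulrA ler_pdivrMr// mulrC ler_wpM2l ?subr_ge0//.
  by rewrite ler_nat.
have I (i : nat) : (i <= n.+1)%N ->
    `|F (a + i%:R * h) - F a - \int[mu]_(z in `[a, a + i%:R * h]) f z|
    <= e * \int[mu]_(z in `[a, a + i%:R * h]) m z.
  elim: i => [_|i IH ni].
    by rewrite mul0r addr0 set_itv1 !Rintegral_set1 subrr subr0 normr0 mulr0.
  have ai : a <= a + i%:R * h by rewrite lerDl mulr_ge0.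
  have ii : a + i%:R * h <= a + i.+1%:R * h.
    by rewrite lerD2l ler_wpM2r// ler_nat.
  rewrite (@Rintegral_itv_split _ a (a + i%:R * h) _ f)//; last exact: If.
  rewrite (@Rintegral_itv_split _ a (a + i%:R * h) _ m)//; last exact: Im.
  rewrite mulrDr.
  have S (A B C D E : R) : A - B - (C + D) = (E - B - C) + (A - E - D) by ring.
  rewrite [X in `|X|](S _ _ _ _ (F (a + i%:R * h))).
  rewrite (le_trans (ler_normD _ _))// lerD//; last first.
    apply: Hd => //; first exact: hb.
    by rewrite [leLHS](_ : _ = h)// -natr1; ring.
  by apply: IH; exact: ltnW.
have := I n.+1 (leqnn _).
have -> // : a + n.+1%:R * h = b.
by rewrite /h mulrC divfK ?pnatr_eq0// addrC subrK.
Qed.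

Lemma Rintegral_cst_segment a b c : a <= b -> \int[mu]_(x in `[a, b]) c = c * (b - a).
Proof.
move=> ab; rewrite Rintegral_cst//= lebesgue_measure_itv/=; congr (_ * _).
case: ifPn => [_//|]; rewrite lte_fin -leNgt => ba.
by have -> : b = a; [apply/eqP; rewrite eq_le ba|rewrite subrr].
Qed.

(** On a short interval each continuous factor is frozen at an endpoint. Its oscillation times the
    integral of [|f'| + |g'|] bounds the error, which is what [increment_criterion] asks for. *)
Lemma primitiveM f f' g g' : primitive f f' -> primitive g g' ->
  primitive (fun x => f x * g x) (fun x => f' x * g x + f x * g' x).
Proof.
move=> pf pg; have cf := primitive_cont pf; have cg := primitive_cont pg.
have [If' ff'] := pf; have [Ig' gg'] := pg.
have I1 : locally_summable (fun x => f' x * g x) by exact: locally_summableMl.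
have I2 : locally_summable (fun x => f x * g' x) by exact: locally_summableMr.
split; first exact: locally_summableD.
move=> a b a0 ab.
apply: (@increment_criterion (fun x => f x * g x) _ (fun x => `|f' x| + `|g' x|)) => //.
- exact: locally_summableD.
- by apply: locally_summableD; exact: locally_summable_norm.
move=> e e0.
have [d1 d10 H1] := continuous_pos_unif b a0 cf e0.
have [d2 d20 H2] := continuous_pos_unif b a0 cg e0.
exists (Num.min d1 d2); first by rewrite lt_min d10.
move=> x y ax xy yb; rewrite le_min => /andP[yx1 yx2].
have x0 : 0 < x by exact: lt_le_trans ax.
have -> : f y * g y - f x * g x = (f y - f x) * g y + f x * (g y - g x) by ring.
rewrite ff'// gg'// -RintegralZr//; last exact: If'.
rewrite -RintegralZl//; last exact: Ig'.
have J1 : summable_on `[x, y] (fun z => f' z * g y).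
  apply: (@summable_eq _ _ _ (fun z => g y * f' z)) => //.
    by move=> z _; rewrite mulrC.
  by apply: summableZ => //; exact: If'.
have J2 : summable_on `[x, y] (fun z => f x * g' z) by apply: summableZ => //; exact: Ig'.
rewrite -RintegralD//.
have J3 : summable_on `[x, y] (fun z => f' z * g z + f z * g' z).
  by apply: summableD => //; [exact: I1|exact: I2].
rewrite -RintegralB//; last exact: summableD.
have J4 : summable_on `[x, y] (fun z => `|f' z| + `|g' z|).
  by apply: summableD => //; apply: summable_norm => //; [exact: If'|exact: Ig'].
rewrite -RintegralZl//.
apply: (le_trans (le_normr_Rintegral _ _)) => //.
  by apply: summableB => //; exact: summableD.
apply: le_Rintegral_segment.
- by apply: summable_norm => //; apply: summableB => //; exact: summableD.
- exact: summableZ.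
move=> z /andP[xz zy].
have -> : f' z * g y + f x * g' z - (f' z * g z + f z * g' z) =
  f' z * (g y - g z) + g' z * (f x - f z) by ring.
rewrite (le_trans (ler_normD _ _))// !normrM [leRHS]mulrDr !(mulrC e).
have az : a <= z <= b by rewrite (le_trans ax)//= (le_trans zy).
by rewrite lerD// ler_wpM2l//; [apply: H2 => //|apply: H1 => //];
  rewrite ler_norml; lra.
Qed.

Lemma primitive_comp f f' (G G' : R -> R) : primitive f f' ->
  (forall x, 0 < x -> is_derive (f x) 1 G (G' (f x))) ->
  continuous_pos (fun x => G' (f x)) ->
  primitive (fun x => G (f x)) (fun x => G' (f x) * f' x).
Proof.
move=> pf dG cG'; have cf := primitive_cont pf; have [If' ff'] := pf.
have I1 : locally_summable (fun x => G' (f x) * f' x) by exact: locally_summableMr.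
split => // a b a0 ab.
apply: (@increment_criterion (fun x => G (f x)) _ (fun x => `|f' x|)) => //.
  exact: locally_summable_norm.
move=> e e0.
have [d d0 H] := continuous_pos_unif b a0 cG' e0.
exists d => // x y ax xy yb yxd.
have x0 : 0 < x by exact: lt_le_trans ax.
(* The mean value theorem for [G] yields a value between [f x] and [f y]; the intermediate value
   theorem writes it as [f c]. So [G] has to be differentiable only at values taken by [f]. *)
have [c xcy Hc] : exists2 c : R, x <= c <= y & G (f y) - G (f x) = G' (f c) * (f y - f x).
  have ivt v : Num.min (f x) (f y) <= v <= Num.max (f x) (f y) ->
      exists2 c : R, x <= c <= y & f c = v.
    move=> vv; have [c] := IVT xy (continuous_pos_within x0 cf) vv.
    by rewrite in_itv/= => ? ?; exists c.
  have [fxy|fxy|fxy] := ltgtP (f x) (f y).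
  - have [||w vxy ->] := @MVT _ G G' _ _ fxy.
    + move=> v; rewrite in_itv/= => /andP[v1 v2]; have [|c /andP[xc cy] <-] := ivt v.
        by rewrite ge_min le_max (ltW v1) (ltW v2) ?orbT.
      by apply: dG; exact: lt_le_trans xc.
    + apply: continuous_in_subspaceT => v /set_mem/=; rewrite in_itv/= => /andP[v1 v2].
      have [|c /andP[xc cy] <-] := ivt v; first by rewrite ge_min le_max v1 v2 ?orbT.
      apply: differentiable_continuous; apply/derivable1_diffP.
      by have [] := dG c (lt_le_trans x0 xc).
    + move: vxy; rewrite in_itv/= => /andP[v1 v2]; have [|c xcy <-] := ivt w.
        by rewrite ge_min le_max (ltW v1) (ltW v2) ?orbT.
      by exists c.
  - have [||w vxy E] := @MVT _ G G' _ _ fxy.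
    + move=> v; rewrite in_itv/= => /andP[v1 v2]; have [|c /andP[xc cy] <-] := ivt v.
        by rewrite ge_min le_max (ltW v1) (ltW v2) ?orbT.
      by apply: dG; exact: lt_le_trans xc.
    + apply: continuous_in_subspaceT => v /set_mem/=; rewrite in_itv/= => /andP[v1 v2].
      have [|c /andP[xc cy] <-] := ivt v; first by rewrite ge_min le_max v1 v2 ?orbT.
      apply: differentiable_continuous; apply/derivable1_diffP.
      by have [] := dG c (lt_le_trans x0 xc).
    + move: vxy E; rewrite in_itv/= => /andP[v1 v2]; have [|c xcy <-] := ivt w.
        by rewrite ge_min le_max (ltW v1) (ltW v2) ?orbT.
      by move=> E; exists c => //; lra.
  - by exists x; rewrite ?lexx// fxy !subrr mulr0.
have J1 : summable_on `[x, y] (fun z => G' (f c) * f' z).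
  by apply: summableZ => //; exact: If'.
rewrite Hc ff'// -RintegralZl//; last exact: If'.
have J2 : summable_on `[x, y] (fun z => G' (f z) * f' z) by exact: I1.
rewrite -RintegralB//.
have J3 : summable_on `[x, y] (fun z => `|f' z|) by apply: summable_norm => //; exact: If'.
rewrite -RintegralZl//.
apply: (le_trans (le_normr_Rintegral _ _)) => //; first exact: summableB.
apply: le_Rintegral_segment.
- by apply: summable_norm => //; exact: summableB.
- exact: summableZ.
move=> z /andP[xz zy]; rewrite -mulrBl normrM ler_wpM2r//.
apply: H; first by rewrite (le_trans ax)//= (le_trans zy).
move/andP: xcy => [xc cy]; rewrite ler_norml; lra.
Qed.

Lemma primitiveD f f' g g' : primitive f f' -> primitive g g' ->
  primitive (fun x => f x + g x) (fun x => f' x + g' x).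
Proof.
move=> [If' ff'] [Ig' gg']; split; first exact: locally_summableD.
move=> a b a0 ab; rewrite RintegralD//; [|exact: If'|exact: Ig'].
by rewrite -ff'// -gg'//; ring.
Qed.

Lemma primitiveZ c f f' : primitive f f' ->
  primitive (fun x => c * f x) (fun x => c * f' x).
Proof.
move=> [If' ff']; split.
  by apply: locally_summableMr => //; exact: continuous_pos_cst.
by move=> a b a0 ab; rewrite RintegralZl//; [rewrite -ff'// mulrBr|exact: If'].
Qed.

Lemma primitive_eq f f' g g' : (forall x, 0 < x -> f x = g x) ->
  (forall x, 0 < x -> f' x = g' x) -> primitive f f' -> primitive g g'.
Proof.
move=> fg fg' [If' ff']; split.
  move=> a b a0; apply: summable_eq (If' a b a0) => // x /set_mem/=.
  by rewrite in_itv/= => /andP[ax _]; apply: fg'; exact: lt_le_trans ax.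
move=> a b a0 ab; rewrite -!fg//; last exact: lt_le_trans ab.
rewrite ff'//; apply: eq_Rintegral_segment => x /andP[ax _].
by apply: fg'; exact: lt_le_trans ax.
Qed.

(** The chain rule along the identity. *)
Lemma primitive_derive f f' : (forall x, 0 < x -> is_derive x 1 f (f' x)) ->
  continuous_pos f' -> primitive f f'.
Proof.
move=> df cf'.
have pid : primitive id (fun=> 1).
  split; first exact/continuous_pos_summable/continuous_pos_cst.
  by move=> a b a0 ab; rewrite Rintegral_cst_segment// mul1r.
by apply: primitive_eq (primitive_comp pid df cf') => // x _; rewrite mulr1.
Qed.

Lemma primitive_cst c : primitive (fun=> c) (fun=> 0).
Proof.
apply: primitive_derive; last exact: continuous_pos_cst.
Qed.

End Primitives.

#[global] Hint Resolve measurable_segment segment_lty : core.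

(** * Smooth functions and density *)

Section Smooth.
Context (R : realType).
Local Notation mu := (@lebesgue_measure R).
Implicit Types (f g h : R -> R) (a b c d e r x y z : R).

Lemma derive_mul f g x a b : is_derive x 1 f a -> is_derive x 1 g b ->
  is_derive x 1 (fun y => f y * g y) (a * g x + f x * b).
Proof.
move=> df dg; apply: (is_derive_eq (is_deriveM df dg)).
by rewrite /GRing.scale/=; ring.
Qed.

Lemma is_deriveP f x a : is_derive x 1 f a <->
  forall e : R, 0 < e -> exists2 d : R, 0 < d &
    forall h : R, `|h| < d -> `|f (x + h) - f x - a * h| <= e * `|h|.
Proof.
have E (h : R) : h != 0 -> `|a - h^-1 * (f (x + h) - f x)| = `|f (x + h) - f x - a * h| / `|h|.
  move=> h0; rewrite -normfV -normrM -normrN; congr (`|_|); field.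
  by rewrite h0.
split.
  move=> [df Df] e e0.
  have : h^-1 *: ((f \o shift x) (h *: 1) - f x) @[h --> (0:R)^'] --> a.
    by rewrite -Df; exact: df.
  move=> /cvgrPdist_le/(_ _ e0)/nbhs_ballP[d /= d0 H].
  exists d => // h hd; have [->|h0] := eqVneq h 0.
    by rewrite addr0 subrr mulr0 subr0 normr0 mulr0.
  have := H h; rewrite /ball/= sub0r normrN => /(_ hd h0).
  rewrite /GRing.scale/= mulr1 (addrC h) E// ler_pdivrMr ?normr_gt0//.
move=> H.
have C : h^-1 *: ((f \o shift x) (h *: 1) - f x) @[h --> (0:R)^'] --> a.
  apply/cvgrPdist_le => e e0; have [d d0 Hd] := H e e0.
  apply/nbhs_ballP; exists d => //= h; rewrite /ball/= sub0r normrN => hd h0.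
  by rewrite /GRing.scale/= mulr1 (addrC h) E// ler_pdivrMr ?normr_gt0// Hd.
apply: DeriveDef; first by apply/cvg_ex; exists a.
by apply/cvg_lim.
Qed.

Lemma derive_add f g x a b : is_derive x 1 f a -> is_derive x 1 g b ->
  is_derive x 1 (fun y => f y + g y) (a + b).
Proof. by move=> df dg; exact: is_deriveD. Qed.

Lemma derive_sub f g x a b : is_derive x 1 f a -> is_derive x 1 g b ->
  is_derive x 1 (fun y => f y - g y) (a - b).
Proof. by move=> df dg; exact: is_deriveB. Qed.

Lemma derive_opp f x a : is_derive x 1 f a -> is_derive x 1 (fun y => - f y) (- a).
Proof. by move=> df; exact: is_deriveN. Qed.

Lemma derive_cmul f c x a : is_derive x 1 f a -> is_derive x 1 (fun y => c * f y) (c * a).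
Proof. by move=> df; exact: is_deriveZ. Qed.

Lemma derive_near f g x a : (\forall y \near x, f y = g y) ->
  is_derive x 1 f a -> is_derive x 1 g a.
Proof. exact: near_eq_is_derive. Qed.

Lemma derive_cst c x : is_derive x 1 (fun=> c) (0 : R).
Proof. exact: is_derive_cst. Qed.

Lemma derive_pow n x : is_derive x 1 (fun y => y ^+ n) (n%:R * x ^+ n.-1).
Proof.
elim: n => [|n IH]; first by under eq_fun do rewrite expr0; rewrite mul0r; exact: derive_cst.
under eq_fun do rewrite exprS.
apply: (is_derive_eq (derive_mul (is_derive_id x 1) IH)).
rewrite mul1r -natr1 mulrDl mul1r addrC; congr (_ + _).
by case: n {IH} => [|n]; rewrite ?mul0r ?mulr0// mulrCA -exprS.
Qed.

Lemma derive_expV n x : x != 0 -> is_derive x 1 (fun y => y ^- n) (- n%:R * x ^- n.+1).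
Proof.
move=> x0; have := @is_deriveV R (fun y => y ^+ n) x _ 1 (expf_neq0 n x0) (derive_pow n x).
move=> H; apply: (is_derive_eq H).
rewrite /GRing.scale/=; case: n {H} => [|n]; first by rewrite !mul0r mulr0 mulNr mul0r oppr0.
rewrite /= !mulNr; congr (- _).
rewrite mulrCA; congr (_ * _).
have := expf_neq0 n x0; rewrite !exprS expr0 mulr1; move: (x ^+ n) => t t0.
by field; rewrite ?x0 ?t0.
Qed.

Record smooth f : Prop := Smooth {
  smooth_derivable : forall n x, derivable (derive1n n f) x 1 }.

(** Coinduction for smoothness: a class of functions closed under differentiation consists of smooth
    functions. The smoothness proofs below each exhibit such a class. *)
Lemma smooth_class (C : (R -> R) -> Prop) :
  (forall f, C f -> exists2 f', C f' & forall x, is_derive x 1 f (f' x)) ->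
  forall f, C f -> smooth f.
Proof.
move=> H f Cf; split => n x.
have : C (derive1n n f).
  elim: n => [|n IH]; first by rewrite derive1n0.
  have [f' Cf' df'] := H _ IH; rewrite derive1nS.
  suff -> : derive1 (derive1n n f) = f' by [].
  by apply/funext => y; rewrite derive1E; exact: derive_val.
by move=> /H[f' _ df']; have [] := df' x.
Qed.

Lemma smooth_derive f x : smooth f -> is_derive x 1 f (derive1 f x).
Proof.
move=> sf; rewrite derive1E; apply: derivableP.
by have := @smooth_derivable f sf 0 x; rewrite derive1n0.
Qed.

Lemma smooth_derive1 f : smooth f -> smooth (derive1 f).
Proof. by move=> sf; split=> n x; have := @smooth_derivable f sf n.+1 x; rewrite derive1Sn. Qed.

Lemma is_derive1E f x d : is_derive x 1 f d -> derive1 f x = d.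
Proof. by move=> df; rewrite derive1E; exact: derive_val. Qed.

Lemma smooth_cont f : smooth f -> continuous f.
Proof.
move=> sf x; apply: differentiable_continuous; apply/derivable1_diffP.
by have [] := smooth_derive x sf.
Qed.

Lemma smooth_cst c : smooth (fun=> c).
Proof.
apply: (@smooth_class (fun f => exists c, f = fun=> c)); last by exists c.
move=> f [d ->]; exists (fun=> 0); first by exists 0.
by move=> x; exact: is_derive_cst.
Qed.

Lemma smooth_id : smooth id.
Proof.
apply: (@smooth_class (fun f => f = id \/ exists c, f = fun=> c)); last by left.
move=> f [->|[c ->]].
  by exists (fun=> 1); [right; exists 1|move=> x; exact: is_derive_id].
by exists (fun=> 0); [right; exists 0|move=> x; exact: is_derive_cst].
Qed.

(** By the Leibniz rule sums of products are closed under differentiation, which single products are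
    not. *)
Inductive sum_of_products : (R -> R) -> Prop :=
| sum_of_products1 f g : smooth f -> smooth g -> sum_of_products (fun x => f x * g x)
| sum_of_productsD f g : sum_of_products f -> sum_of_products g ->
    sum_of_products (fun x => f x + g x).

Lemma smooth_sum_of_products f : sum_of_products f -> smooth f.
Proof.
apply: smooth_class => {}f; elim=> [g h sg sh|g h _ [g' Cg' dg] _ [h' Ch' dh]].
  exists (fun x => derive1 g x * h x + g x * derive1 h x).
    apply: sum_of_productsD; apply: sum_of_products1 => //; exact: smooth_derive1.
  move=> x; have dg := smooth_derive x sg; have dh := smooth_derive x sh.
  exact: derive_mul.
exists (fun x => g' x + h' x); first exact: sum_of_productsD.
by move=> x; exact: derive_add.
Qed.

Lemma smoothM f g : smooth f -> smooth g -> smooth (fun x => f x * g x).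
Proof. by move=> sf sg; apply: smooth_sum_of_products; exact: sum_of_products1. Qed.

Lemma smoothZ c f : smooth f -> smooth (fun x => c * f x).
Proof. by move=> sf; apply: smoothM => //; exact: smooth_cst. Qed.

Lemma smoothD f g : smooth f -> smooth g -> smooth (fun x => f x + g x).
Proof.
move=> sf sg; have H h : smooth h -> sum_of_products h.
  move=> sh; rewrite (_ : h = fun x => 1 * h x); last by apply/funext => x; rewrite mul1r.
  by apply: sum_of_products1 => //; exact: smooth_cst.
by apply: smooth_sum_of_products; apply: sum_of_productsD; exact: H.
Qed.

Lemma smoothN f : smooth f -> smooth (fun x => - f x).
Proof.
by move=> sf; have := @smoothZ (-1) f sf; under eq_fun do rewrite mulN1r.
Qed.

Lemma smoothB f g : smooth f -> smooth g -> smooth (fun x => f x - g x).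
Proof. by move=> sf sg; apply: smoothD => //; exact: smoothN. Qed.

Lemma smoothX n : smooth (fun x => x ^+ n).
Proof.
elim: n => [|n IH]; first by under eq_fun do rewrite expr0; exact: smooth_cst.
by under eq_fun do rewrite exprS; apply: smoothM => //; exact: smooth_id.
Qed.

Lemma is_derive_affine f a b x d : is_derive (a * x + b) 1 f d ->
  is_derive x 1 (fun y => f (a * y + b)) (a * d).
Proof.
move=> df.
have d1 : is_derive x 1 (fun y => a * y + b) a.
  apply: (is_derive_eq (derive_add (derive_cmul a (is_derive_id x 1)) (derive_cst b x))).
  by rewrite mulr1 addr0.
have := @is_derive1_comp R f (fun y => a * y + b) x d a df d1.
by rewrite mulrC.
Qed.

Lemma smooth_affine f a b : smooth f -> smooth (fun x => f (a * x + b)).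
Proof.
move=> sf; apply: (@smooth_class (fun g => exists c h, smooth h /\
  g = fun x => c * h (a * x + b))); last first.
  by exists 1, f; split => //; apply/funext => x; rewrite mul1r.
move=> _ [c [h [sh ->]]]; exists (fun x => c * a * derive1 h (a * x + b)).
  by exists (c * a), (derive1 h); split => //; exact: smooth_derive1.
move=> x; have := is_derive_affine (smooth_derive (a * x + b) sh).
move=> /(derive_cmul c).
by rewrite mulrA.
Qed.

Lemma smooth_scale f a : smooth f -> smooth (fun x => f (a * x)).
Proof. by move=> /(@smooth_affine f a 0); under eq_fun do rewrite addr0. Qed.

Lemma smooth_shift f a : smooth f -> smooth (fun x => f (x + a)).
Proof. by move=> /(@smooth_affine f 1 a); under eq_fun do rewrite mul1r. Qed.

Lemma derive1_scale f a x : smooth f -> derive1 (fun x => f (a * x)) x = a * derive1 f (a * x).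
Proof.
move=> sf; apply: is_derive1E.
have := @is_derive_affine f a 0 x (derive1 f (a * x)).
under eq_fun do rewrite addr0.
by rewrite addr0; apply; exact: smooth_derive.
Qed.

Lemma derive1_shift f a x : smooth f -> derive1 (fun x => f (x + a)) x = derive1 f (x + a).
Proof.
move=> sf; apply: is_derive1E.
have := @is_derive_affine f 1 a x (derive1 f (x + a)).
under eq_fun do rewrite mul1r.
by rewrite !mul1r; apply; exact: smooth_derive.
Qed.

Lemma derive1_lt0 f a x : (forall y, y < a -> f y = 0) -> x < a -> derive1 f x = 0.
Proof.
move=> f0 xa; apply: is_derive1E.
apply: (@derive_near (fun=> 0)).
by near=> y; rewrite f0//; near: y; exact: lt_nbhsl.
Unshelve. all: by end_near. Qed.

Lemma derive1_gt0 f a x : (forall y, a < y -> f y = 0) -> a < x -> derive1 f x = 0.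
Proof.
move=> f0 xa; apply: is_derive1E.
apply: (@derive_near (fun=> 0)).
by near=> y; rewrite f0//; near: y; exact: lt_nbhsr.
Unshelve. all: by end_near. Qed.

(** Up to linear combinations these are the derivatives of [exp (- 1 / x)], extended by zero to the
    left half-line. *)
Definition flat n x : R := if 0 < x then x ^- n * expR (- x^-1) else 0.

Lemma expR_ge_pow n x : 0 <= x -> (x / n.+1%:R) ^+ n.+1 <= expR x.
Proof.
move=> x0; have -> : expR x = expR (x / n.+1%:R) ^+ n.+1.
  by rewrite -expRM_natl mulrC divfK// pnatr_eq0.
rewrite lerXn2r ?nnegrE ?divr_ge0 ?expR_ge0//.
by rewrite (le_trans _ (expR_ge1Dx _))// lerDr.
Qed.

(** The exponential of [x^-1] dominates its power [n.+2]. The resulting quadratic bound gives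
    differentiability at 0, with derivative 0. *)
Lemma flat_le n x : 0 < x -> flat n x <= n.+2%:R ^+ n.+2 * x ^+ 2.
Proof.
move=> x0; rewrite /flat x0 expRN.
have xi : 0 < x^-1 by rewrite invr_gt0.
have := @expR_ge_pow n.+1 x^-1 (ltW xi).
rewrite expr_div_n ler_pdivrMr ?exprn_gt0 ?ltr0n// => H.
rewrite ler_pdivrMr ?expR_gt0//.
have -> : x ^- n = x ^+ 2 * x^-1 ^+ n.+2.
  rewrite exprVn !exprS expr0 mulr1; have x1 : x != 0 by rewrite gt_eqF.
  have := expf_neq0 n x1; move: (x ^+ n) => t t0; field; by rewrite ?x1 ?t0.
by rewrite [leRHS]mulrAC mulrC ler_pM2r ?exprn_gt0// mulrC.
Qed.

Lemma flat_ge0 n x : 0 <= flat n x.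
Proof.
rewrite /flat; case: ifP => // x0.
by rewrite mulr_ge0 ?expR_ge0// invr_ge0 exprn_ge0// ltW.
Qed.

Lemma derive_flat n x :
  is_derive x 1 (flat n) (flat n.+2 x - n%:R * flat n.+1 x).
Proof.
have [x0|x0|x0] := ltgtP x 0.
- have E y : y < 0 -> flat n y = 0 by move=> y0; rewrite /flat ltNge ltW.
  rewrite /flat ltNge (ltW x0)/= mulr0 subrr.
  apply: (@derive_near (fun=> 0)).
  by near=> y; rewrite -/(flat n y) E//; near: y; exact: lt_nbhsl.
- apply: (@derive_near (fun y => y ^- n * expR (- y^-1))).
    by near=> y; rewrite /flat ifT//; near: y; exact: lt_nbhsr.
  have x1 : x != 0 by rewrite gt_eqF.
  have d1 := derive_expV n x1.
  have d2 := derive_expV 1 x1.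
  have d3 := derive_opp d2.
  have d4 := @is_derive1_comp R expR (fun y => - y ^- 1) x _ _ (is_derive_expR _) d3.
  have := derive_mul d1 d4.
  rewrite /comp/=; move=> H; apply: (is_derive_eq H).
  rewrite /flat x0.
  rewrite !expr1 mulN1r opprK.
  rewrite !exprS expr0 mulr1; have := expf_neq0 n x1; move: (x ^+ n) => t t0.
  by field; rewrite ?x1 ?t0.
- rewrite x0; have F m : flat m 0 = 0 by rewrite /flat ltxx.
  rewrite !F mulr0 subrr; apply/is_deriveP => e e0.
  pose K : R := n.+2%:R ^+ n.+2.
  have K0 : 0 < K by rewrite exprn_gt0// ltr0n.
  exists (e / K); first by rewrite divr_gt0.
  move=> h hd; rewrite add0r F mul0r !subr0.
  have [h0|h0] := leP h 0.
    by rewrite /flat ltNge h0/= normr0 mulr_ge0// ltW.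
  rewrite (ger0_norm (flat_ge0 _ _)) (le_trans (flat_le n h0))//.
  move: hd; rewrite !gtr0_norm// ltr_pdivlMr// -/K => /ltW hd.
  by rewrite expr2 mulrA ler_pM2r// mulrC.
Unshelve. all: by end_near. Qed.

Inductive flat_span : (R -> R) -> Prop :=
| flat_span1 n : flat_span (flat n)
| flat_spanD c f g : flat_span f -> flat_span g -> flat_span (fun x => f x + c * g x).

Lemma smooth_flat n : smooth (flat n).
Proof.
apply: (@smooth_class flat_span); last exact: flat_span1.
move=> f; elim=> [m|c g h _ [g' Cg dg] _ [h' Ch dh]].
  exists (fun x => flat m.+2 x + (- m%:R) * flat m.+1 x).
    by apply: flat_spanD; exact: flat_span1.
  by move=> x; apply: (is_derive_eq (derive_flat m x)); rewrite mulNr.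
exists (fun x => g' x + c * h' x); first exact: flat_spanD.
by move=> x; apply: derive_add => //; exact: derive_cmul.
Qed.

(* x^(-m) is smooth only on (0, +oo): products with functions that vanish
   near (-oo, 0]. *)
Inductive pole_span : (R -> R) -> Prop :=
| pole_span1 g m : smooth g -> (exists2 a : R, 0 < a & forall x, x < a -> g x = 0) ->
    pole_span (fun x => g x * x ^- m)
| pole_spanD c f g : pole_span f -> pole_span g -> pole_span (fun x => f x + c * g x).

Lemma derive_expV_vanish f m a x : 0 < a -> (forall x, x < a -> f x = 0) -> smooth f ->
  is_derive x 1 (fun x => f x * x ^- m)
    (derive1 f x * x ^- m + f x * (- m%:R * x ^- m.+1)).
Proof.
move=> a0 f0 sf; have [xa|ax] := ltP x a.
  rewrite (derive1_lt0 f0 xa) f0// !mul0r addr0.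
  apply: (@derive_near (fun=> 0)).
  by near=> y; rewrite f0 ?mul0r//; near: y; exact: lt_nbhsl.
apply: derive_mul; first exact: smooth_derive.
by apply: derive_expV; rewrite gt_eqF// (lt_le_trans a0).
Unshelve. all: by end_near. Qed.

Lemma smooth_expV f m a : 0 < a -> (forall x, x < a -> f x = 0) -> smooth f ->
  smooth (fun x => f x * x ^- m).
Proof.
move=> a0 f0 sf; apply: (@smooth_class pole_span); last first.
  by apply: pole_span1 => //; exists a.
move=> g; elim=> [{a0 f0 sf}h n sh [{}a a0 h0]|c g1 g2 _ [g1' C1 d1] _ [g2' C2 d2]].
  exists (fun x => derive1 h x * x ^- n + (- n%:R) * (h x * x ^- n.+1)).
    apply: pole_spanD; apply: pole_span1 => //; last by exists a.
      exact: smooth_derive1.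
    by exists a => // x xa; exact: derive1_lt0 xa.
  move=> x; apply: (is_derive_eq (derive_expV_vanish n x a0 h0 sh)).
  by rewrite mulrCA.
exists (fun x => g1' x + c * g2' x); first exact: pole_spanD.
by move=> x; apply: derive_add => //; exact: derive_cmul.
Qed.

Let bump x := flat 0 (x - 1) * flat 0 (2 - x).

Let bump_ge0 x : 0 <= bump x.
Proof. by rewrite mulr_ge0 ?flat_ge0. Qed.

Let bump_gt0 x : 1 < x -> x < 2 -> 0 < bump x.
Proof.
move=> x1 x2; rewrite /bump /flat !subr_gt0 x1 x2.
by rewrite !mulr_gt0 ?expR_gt0// invr_gt0 exprn_gt0// subr_gt0.
Qed.

Let bump_le1 x : x <= 1 -> bump x = 0.
Proof. by move=> x1; rewrite /bump /flat ltNge subr_le0 x1 mul0r. Qed.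

Let bump_ge2 x : 2 <= x -> bump x = 0.
Proof. by move=> x1; rewrite /bump /flat (ltNge 0 (2 - x)) subr_le0 x1 mulr0. Qed.

Let smooth_bump : smooth bump.
Proof.
apply: smoothM.
  exact: (@smooth_shift (flat 0) (- 1) (smooth_flat 0)).
have := @smooth_affine (flat 0) (- 1) 2 (smooth_flat 0).
by under eq_fun do rewrite mulN1r addrC.
Qed.

Let bump_bounded : exists2 M : R, 0 < M & forall x, `|bump x| <= M.
Proof.
have /compact_bounded[M [_ HM]] : compact (bump @` `[1, 2]).
  apply: continuous_compact; last exact: segment_compact.
  exact/continuous_subspaceT/smooth_cont/smooth_bump.
exists (`|M| + 1); first by rewrite ltr_wpDl.
move=> x; have [x1|x1] := leP x 1; first by rewrite bump_le1// normr0 addr_ge0.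
have [x2|x2] := leP 2 x; first by rewrite bump_ge2// normr0 addr_ge0.
apply: HM; first by rewrite (le_lt_trans (ler_norm _))// ltrDl.
by exists x => //=; rewrite in_itv/= !ltW.
Qed.

Let measurable_bump : measurable_fun setT (bump : measurableTypeR R -> R).
Proof. by apply: continuous_measurable_fun; exact/smooth_cont/smooth_bump. Qed.

Let summable_bump D : measurable (D : set (measurableTypeR R)) -> summable_on D bump.
Proof.
move=> mD; apply: (@summableS _ _ setT) => //.
suff : summable_on setT (bump \_ `[1, 2]).
  apply: summable_eq => // x _; rewrite patchE; case: ifPn => // /negP xn.
  have [x1|x1] := leP x 1; first by rewrite bump_le1.
  have [x2|x2] := leP 2 x; first by rewrite bump_ge2.
  by exfalso; apply: xn; rewrite inE/= in_itv/= !ltW.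
rewrite /summable_on -restrict_EFin; apply/integrable_restrict => //=.
rewrite setTI; apply: bounded_summable => //; split.
  exact: measurable_funS measurable_bump.
by have [M _ HM] := bump_bounded; exists M => x _; exact: HM.
Qed.

Let F x := \int[mu]_(t in `]-oo, x]) bump t.

Let derive_F x : is_derive x 1 F (bump x).
Proof.
have x1 : x < x + 1 by rewrite ltrDl.
have [dF F'] := @continuous_FTC1 R bump -oo%O x (x + 1) x1
  (summable_bump (measurable_itv _)) (ltNyr x) (@smooth_cont _ smooth_bump x).
by rewrite -F' derive1E; apply: derivableP.
Qed.

Let F_le1 x : x <= 1 -> F x = 0.
Proof.
move=> x1; rewrite /F (@eq_Rintegral _ _ _ mu _ (fun=> 0)).
  by rewrite Rintegral_cst// mul0r.
by move=> t /set_mem/=; rewrite in_itv/= => tx; rewrite bump_le1// (le_trans tx).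
Qed.

Let F_ge2 x : 2 <= x -> F x = F 2.
Proof.
move=> x2; rewrite /F; apply: Rintegral_zero => //.
  by move=> t /=; rewrite !in_itv/= => /le_trans; apply.
by move=> t /= _; rewrite in_itv/= => /negP; rewrite -ltNge => /ltW; exact: bump_ge2.
Qed.

Let F_cont : continuous F.
Proof.
move=> x; apply: differentiable_continuous; apply/derivable1_diffP.
by have [] := derive_F x.
Qed.

Let F_le x y : x <= y -> F x <= F y.
Proof.
move=> xy; have [||c _ E] := @MVT_segment _ F bump x y xy.
- by move=> z _; exact: derive_F.
- exact: continuous_subspaceT.
by rewrite -subr_ge0 E mulr_ge0// subr_ge0.
Qed.

Let F2_gt0 : 0 < F 2.
Proof.
have [|||c] := @MVT _ F bump 1 2 _.
- by rewrite ltr1n.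
- by move=> z _; exact: derive_F.
- exact: continuous_subspaceT.
rewrite in_itv/= => /andP[c1 c2]; rewrite (F_le1 (lexx _)) subr0 => ->.
by rewrite mulr_gt0 ?bump_gt0// subr_gt0 ltr1n.
Qed.

(** One minus the normalised primitive of a bump that lives on [1, 2]. *)
Lemma smooth_step : exists S : R -> R, exists M : R, [/\ smooth S,
  (forall x, x <= 1 -> S x = 1), (forall x, 2 <= x -> S x = 0),
  (forall x, 0 <= S x <= 1) &
  (0 < M /\ forall x, - M <= derive1 S x <= 0)].
Proof.
pose S x := 1 - (F 2)^-1 * F x.
have dS x : is_derive x 1 S (- ((F 2)^-1 * bump x)).
  apply: (is_derive_eq (derive_sub (derive_cst 1 x) (derive_cmul _ (derive_F x)))).
  by rewrite sub0r.
have F0 := F2_gt0; have Fi : 0 < (F 2)^-1 by rewrite invr_gt0.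
have [M M0 HM] := bump_bounded.
exists S, ((F 2)^-1 * M); split.
- apply: (@smooth_class (fun f => smooth f \/ f = S)); last by right.
  move=> f [sf|->].
    exists (derive1 f); first by left; exact: smooth_derive1.
    by move=> x; exact: smooth_derive.
  exists (fun x => - ((F 2)^-1 * bump x)); last by [].
  by left; apply: smoothN; apply: smoothZ; exact: smooth_bump.
- by move=> x x1; rewrite /S (F_le1 x1) mulr0 subr0.
- by move=> x x2; rewrite /S (F_ge2 x2) mulVf ?subrr// gt_eqF.
- move=> x; rewrite /S; have F0x : 0 <= F x.
    by rewrite -(F_le1 (lexx 1)); have [x1|/ltW/F_le//] := leP x 1; rewrite (F_le1 x1) F_le1.
  rewrite subr_ge0 lerBlDl lerDr mulr_ge0 ?(ltW Fi)// andbT.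
  rewrite mulrC ler_pdivrMr// mul1r.
  by have [x2|/ltW/F_le//] := leP 2 x; rewrite (F_ge2 x2).
- split; first by rewrite mulr_gt0.
  move=> x; rewrite (is_derive1E (dS x)) oppr_le0 mulr_ge0 ?(ltW Fi)// andbT lerN2.
  by rewrite ler_pM2l// (le_trans _ (HM x))// ler_norm.
Qed.

End Smooth.

(** * Density of compactly supported smooth functions in L^2 *)

Section Density.
Context (R : realType).
Local Notation mu := (@lebesgue_measure R).
Implicit Types (f g h : R -> R) (a b c d e r x y z t : R).

Definition vanishes_off a b f := forall x, ~~ (a <= x <= b) -> f x = 0.

Lemma smooth_lipschitz f C : smooth f -> (forall x, `|derive1 f x| <= C) ->
  forall x y, `|f x - f y| <= C * `|x - y|.
Proof.
move=> sf fC x y; wlog xy : x y / y <= x.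
  move=> H; have [/H//|/ltW yx] := leP y x.
  by rewrite distrC (distrC x); exact: H.
have [||c _ ->] := @MVT_segment _ f (derive1 f) y x xy.
- by move=> z _; exact: smooth_derive.
- exact/continuous_subspaceT/smooth_cont.
by rewrite normrM ler_wpM2r.
Qed.

Lemma vanishes_off_derive f a b : vanishes_off a b f -> vanishes_off a b (derive1 f).
Proof.
move=> f0 x; rewrite negb_and -!ltNge => /orP[xa|bx].
  by apply: (@derive1_lt0 _ _ a) => // y ya; apply: f0; rewrite negb_and -!ltNge ya.
by apply: (@derive1_gt0 _ _ b) => // y ya; apply: f0; rewrite negb_and -!ltNge ya orbT.
Qed.

Lemma vanishes_off_bounded f a b : continuous f -> vanishes_off a b f ->
  exists2 M : R, 0 < M & forall x, `|f x| <= M.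
Proof.
move=> cf f0.
have /compact_bounded[M [_ HM]] : compact (f @` `[a, b]).
  by apply: continuous_compact; [exact: continuous_subspaceT|exact: segment_compact].
exists (`|M| + 1); first by rewrite ltr_wpDl.
move=> x; have [xab|/f0 ->] := boolP (a <= x <= b); last by rewrite normr0 addr_ge0.
apply: HM; first by rewrite (le_lt_trans (ler_norm _))// ltrDl.
by exists x.
Qed.

Lemma continuous_measurable f : continuous f ->
  measurable_fun setT (f : measurableTypeR R -> R).
Proof. exact: continuous_measurable_fun. Qed.

Lemma vanishes_off_bounded_on f a b : continuous f -> vanishes_off a b f ->
  bounded_on setT f.
Proof.
move=> cf /(vanishes_off_bounded cf)[M _ HM]; split; first exact: continuous_measurable.
by exists M.
Qed.

Lemma summable_extend f a b : vanishes_off a b f -> summable_on `[a, b] f ->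
  summable_on setT f.
Proof.
move=> f0 If; apply: (@summable_eq _ _ _ (f \_ `[a, b])) => //.
  move=> x _; rewrite patchE; case: ifPn => // /negP xn; rewrite f0//.
  by apply/negP => xab; apply: xn; rewrite inE/= in_itv.
by rewrite /summable_on -restrict_EFin; apply/integrable_restrict => //=; rewrite setTI.
Qed.

Lemma Rintegral_extend f a b : vanishes_off a b f ->
  \int[mu]_x f x = \int[mu]_(x in `[a, b]) f x.
Proof.
move=> f0; apply: Rintegral_zero => // x _ /= xn; apply: f0.
by apply/negP => xab; apply: xn; rewrite in_itv.
Qed.

Lemma vanishes_off_square_summable f a b : continuous f -> vanishes_off a b f ->
  square_summable_on setT f.
Proof.
move=> cf f0; split; first exact: continuous_measurable.
apply: (@summable_extend _ a b); first by move=> x /f0 ->; rewrite expr0n.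
have [M _ HM] := vanishes_off_bounded cf f0.
apply: bounded_summable => //; split.
  by apply: measurable_funX; apply: measurable_funTS; exact: continuous_measurable.
exists (M ^+ 2) => x _; rewrite normrX lerXn2r ?nnegrE//.
by rewrite (le_trans _ (HM x)).
Qed.

(** A smoothed staircase through the values of [f] at the nodes [X m]: between two nodes the smooth
    transition [th] leads from one value to the next, and [f] oscillates by at most [e / 2] over a
    step. *)
Lemma smooth_uniform_approx f a b e : 0 < a -> a <= b -> continuous f -> 0 < e ->
  exists2 g : R -> R, smooth g & forall x, a <= x <= b -> `|g x - f x| <= e.
Proof.
move=> a0 ab cf e0.
have [S [M [sS S1 S2 S01 _]]] := smooth_step R.
pose th y := 1 - S (y + 1).
have th0 y : y <= 0 -> th y = 0 by move=> y0; rewrite /th S1 ?subrr//; lra.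
have th1 y : 1 <= y -> th y = 1 by move=> y0; rewrite /th S2 ?subr0//; lra.
have th01 y : 0 <= th y <= 1 by rewrite /th; have := S01 (y + 1); lra.
have sth : smooth th.
  by apply: smoothB; [exact: smooth_cst|exact: smooth_shift].
have e2 : 0 < e / 2 by rewrite divr_gt0.
(* The last node may lie beyond [b], by at most [h <= 1]; hence the uniform continuity up to
   [b + 1]. *)
have [d d0 Hd] := continuous_pos_unif (b + 1) a0 (continuous_continuous_pos cf) e2.
pose h := Num.min d 1.
have h0 : 0 < h by rewrite lt_min d0 ltr01.
have hd : h <= d by rewrite ge_min lexx.
have h1 : h <= 1 by rewrite ge_min lexx orbT.
pose X (n : nat) := a + n%:R * h.
have [n nb] : exists n : nat, X n <= b + 1 /\ b <= X n.
  exists (Num.truncn ((b - a) / h)).+1; rewrite /X; split.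
    rewrite -natr1 mulrDl mul1r addrA lerD//.
    rewrite -lerBrDl -ler_pdivlMr//.
    have /truncn_itv/andP[//] : 0 <= (b - a) / h by rewrite divr_ge0 ?subr_ge0// ltW.
  rewrite -lerBlDl -ler_pdivrMr//; apply: ltW; exact: truncnS_gt.
have XS m : X m.+1 = X m + h by rewrite /X -natr1 mulrDl mul1r addrA.
have Xmono m : (m <= n)%N -> X m <= b + 1.
  by move=> mn; apply: le_trans nb.1; rewrite lerD2l ler_wpM2r ?ler_nat// ltW.
have aX m : a <= X m by rewrite lerDl mulr_ge0// ltW.
have G m : (m <= n)%N -> exists2 g : R -> R, smooth g &
    (forall x, a <= x <= X m -> `|g x - f x| <= e) /\ (forall x, X m <= x -> g x = f (X m)).
  elim: m => [_|m IH mn].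
    exists (fun=> f a); first exact: smooth_cst.
    rewrite /X mul0r addr0; split => // x xa.
    have -> : x = a by lra.
    by rewrite subrr normr0 ltW.
  have [g sg [g1 g2]] := IH (ltnW mn).
  exists (fun x => g x + (f (X m.+1) - f (X m)) * th (h^-1 * x - h^-1 * X m)).
    apply: smoothD => //; apply: smoothZ.
    exact: (@smooth_affine _ th h^-1 (- (h^-1 * X m)) sth).
  have thE x : th (h^-1 * x - h^-1 * X m) = th ((x - X m) / h).
    by rewrite -mulrBr mulrC.
  split=> x.
    move=> /andP[ax xX]; rewrite thE; have [xm|mx] := leP x (X m).
      rewrite th0; first by rewrite mulr0 addr0 g1// ax xm.
      by rewrite pmulr_lle0 ?invr_gt0// subr_le0.
    rewrite g2 ?(ltW mx)//.
    set w := th _; have w01 : 0 <= w <= 1 by exact: th01.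
    have -> : f (X m) + (f (X m.+1) - f (X m)) * w - f x =
      (f (X m) - f x) + (f (X m.+1) - f (X m)) * w by ring.
    rewrite (le_trans (ler_normD _ _))// (splitr e) lerD//.
      rewrite distrC; apply: Hd; first by rewrite aX Xmono// ltnW.
      by rewrite XS in xX; rewrite ler_norml; lra.
    rewrite normrM -[leRHS]mulr1; apply: ler_pM => //.
      apply: Hd; first by rewrite aX Xmono// ltnW.
      by rewrite XS ler_norml; lra.
    by rewrite ger0_norm; lra.
  move=> Xx; have Xx' : X m <= x by rewrite XS in Xx; lra.
  rewrite g2// thE th1 ?mulr1; first by ring.
  by rewrite ler_pdivlMr// mul1r; rewrite XS in Xx; lra.
have [g sg [g1 _]] := G n (leqnn n).
by exists g => // x /andP[ax xb]; apply: g1; rewrite ax (le_trans xb) ?nb.2.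
Qed.

(** The inverse of the signed square is Hölder continuous of exponent 1/2: for equal signs
    [(x - y) ^+ 2] is at most the difference of the squares, for opposite signs at most twice their
    sum. *)
Lemma sqr_le_signed x y : (x - y) ^+ 2 <= 2 * `|x * `|x| - y * `|y| |.
Proof.
have D (u v : R) : 0 <= u -> 0 <= v -> (u - v) ^+ 2 <= `|u ^+ 2 - v ^+ 2|.
  move=> u0 v0; wlog uv : u v u0 v0 / v <= u.
    move=> H; have [/H|/ltW vu] := leP v u; first exact.
    by rewrite distrC -sqrrN opprB; exact: H.
  by rewrite ger0_norm ?subr_ge0 ?lerXn2r ?nnegrE//; nra.
have [x0|x0] := leP 0 x; have [y0|y0] := leP 0 y.
- rewrite (ger0_norm x0) (ger0_norm y0) -!expr2; have := D _ _ x0 y0; have := normr_ge0 (x ^+ 2 - y ^+ 2); lra.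
- rewrite (ger0_norm x0) (ltr0_norm y0).
  have := ler_norm (x * x - y * - y); have := sqr_ge0 (x + y); nra.
- rewrite (ltr0_norm x0) (ger0_norm y0).
  have := ler_norm (- (x * - x - y * y)); rewrite normrN.
  have := sqr_ge0 (x + y); nra.
- rewrite (ltr0_norm x0) (ltr0_norm y0).
  have := D (- x) (- y); rewrite !oppr_ge0 !sqrrN => /(_ (ltW x0) (ltW y0)).
  rewrite (_ : x * - x - y * - y = - (x ^+ 2 - y ^+ 2)); last by ring.
  rewrite normrN; have := normr_ge0 (x ^+ 2 - y ^+ 2); lra.
Qed.

(* Applying L^1-density to f|f| yields L^2-density for f. *)
Lemma continuous_L2_dense f a b e : square_summable_on `[a, b] f -> 0 < e ->
  exists2 g : R -> R, continuous g & \int[mu]_(x in `[a, b]) ((f x - g x) ^+ 2) <= e.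
Proof.
move=> [mf If] e0.
have Ih : summable_on `[a, b] (fun x => f x * `|f x|).
  apply: le_summable If => //.
    by apply: measurable_funM => //; exact: measurableT_comp.
  by move=> x _; rewrite normrM normr_id -expr2 real_normK ?num_real.
have [g_ [cg Ig g0]] := approximation_continuous_integrable
  (measurable_segment a b) (segment_lty a b) Ih.
have e2 : 0 < e / 2 by rewrite divr_gt0.
have [n Hn] : exists n, (\int[mu]_(x in `[a, b]) `|(f x * `|f x| - g_ n x)%:E| <= (e / 2)%:E)%E.
  move/fine_cvgP : g0 => [fing] /cvgrPdist_le/(_ _ e2).
  move=> H; have : \forall n \near \oo, (\int[mu]_(x in `[a, b]) `|(f x * `|f x| - g_ n x)%:E| <= (e / 2)%:E)%E.
    near=> n; have H1 : `|0 - fine (\int[mu]_(x in `[a, b]) `|(f x * `|f x| - g_ n x)%:E|)| <= e / 2.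
      by near: n.
    rewrite -(@fineK _ (\int[mu]_(x in `[a, b]) _)) ?lee_fin; last by near: n.
    by move: H1; rewrite sub0r normrN; exact/le_trans/ler_norm.
  by move=> /filter_ex.
pose G := g_ n.
(* The signed square root of [G], written with its positive and negative parts so that continuity is
   clear. *)
pose phi x := Num.sqrt ((`|G x| + G x) / 2) - Num.sqrt ((`|G x| - G x) / 2).
have phiE x : phi x * `|phi x| = G x.
  rewrite /phi; have [G0|G0] := leP 0 (G x).
    rewrite (ger0_norm G0) subrr mul0r sqrtr0 subr0 (_ : (G x + G x) / 2 = G x); last by field.
    by rewrite ger0_norm ?sqrtr_ge0// -expr2 sqr_sqrtr.
  rewrite (ltr0_norm G0) (addrC (- G x)) subrr mul0r sqrtr0 sub0r (_ : (- G x - G x) / 2 = - G x); last by field.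
  by rewrite normrN ger0_norm ?sqrtr_ge0// mulNr -expr2 sqr_sqrtr ?opprK// oppr_ge0 ltW.
have cphi : continuous phi.
  have cG : continuous G := cg n.
  have cn x : (fun x => `|G x|) @ x --> `|G x| by apply: cvg_norm; exact: cG.
  move=> x; apply: cvgB.
    apply: (continuous_comp (f := fun x => (`|G x| + G x) / 2)); last exact: sqrt_continuous.
    by apply: cvgMr_tmp; apply: cvgD; [exact: cn|exact: cG].
  apply: (continuous_comp (f := fun x => (`|G x| - G x) / 2)); last exact: sqrt_continuous.
  by apply: cvgMr_tmp; apply: cvgB; [exact: cn|exact: cG].
exists phi => //.
have Iphi : square_summable_on `[a, b] (fun x => f x - phi x).
  apply: square_summableB => //.
  apply: bounded_square_summable => //; split.
    by apply: measurable_funTS; exact: continuous_measurable.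
  have /compact_bounded[M [_ HM]] : compact (phi @` `[a, b]).
    by apply: continuous_compact; [exact: continuous_subspaceT|exact: segment_compact].
  exists (`|M| + 1) => x xab.
  apply: HM; first by rewrite (le_lt_trans (ler_norm _))// ltrDl.
  by exists x.
have ID : summable_on `[a, b] (fun x => `|f x * `|f x| - G x|).
  by apply: summable_norm => //; apply: summableB => //; exact: Ig.
have : \int[mu]_(x in `[a, b]) `|f x * `|f x| - G x| <= e / 2.
  rewrite -lee_fin (le_trans _ Hn)// /Rintegral fineK//.
  exact: integrable_fin_num.
move=> HD.
apply: (@le_trans _ _ (\int[mu]_(x in `[a, b]) (2 * `|f x * `|f x| - G x|))).
  apply: le_Rintegral_segment; [by case: Iphi|exact: summableZ|].
  by move=> x _; rewrite -phiE; exact: sqr_le_signed.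
by rewrite RintegralZl//; ilra.
Unshelve. all: by end_near. Qed.

(** Three approximations: by a continuous function in L^2, by a smooth one uniformly on [[a', b']],
    and a cutoff [chi] equal to 1 there. The error is split into [e / 2] for the middle and [e / 8]
    for each of the two collars. *)
Lemma smooth_L2_dense f a a' b' b e : 0 < a -> a < a' -> a' <= b' -> b' < b ->
  square_summable_on setT f -> vanishes_off a' b' f -> 0 < e ->
  exists2 g : R -> R, smooth g /\ vanishes_off a b g & \int[mu]_x ((f x - g x) ^+ 2) <= e.
Proof.
move=> a0 aa' ab' bb' sf f0 e0.
have a'0 : 0 < a' by lra.
have sf' : square_summable_on `[a', b'] f by apply: square_summableS sf.
have [phi cphi Hphi] := continuous_L2_dense sf' (divr_gt0 e0 (ltr0n R 8)).
pose e1 := Num.min 1 (e / 8 / (b' - a' + 1)).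
have ba1 : 0 < b' - a' + 1 by lra.
have e10 : 0 < e1 by rewrite lt_min ltr01/= !divr_gt0.
have [G sG HG] := smooth_uniform_approx a'0 ab' cphi e10.
have cG := smooth_cont sG.
have /compact_bounded[M0 [_ HM0]] : compact (G @` `[a, b]).
  by apply: continuous_compact; [exact: continuous_subspaceT|exact: segment_compact].
pose M := `|M0| + 1.
have M_gt0 : 0 < M by rewrite ltr_wpDl.
have HM x : a <= x <= b -> `|G x| <= M.
  move=> xab; apply: HM0; first by rewrite (le_lt_trans (ler_norm _))// ltrDl.
  by exists x.
have [S [MS [sS S1 S2 S01 _]]] := smooth_step R.
(* Width of the collars in which [chi] is switched off: they stay inside [[a, b]] and are so thin
   that [M ^+ 2 * d <= e / 8]. *)
pose d := Num.min (Num.min (a' - a) (b - b')) (e / 8 / M ^+ 2).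
have d0 : 0 < d by rewrite !lt_min !subr_gt0 aa' bb' !divr_gt0 ?exprn_gt0.
have d1 : d <= a' - a by rewrite !ge_min lexx.
have d2 : d <= b - b' by rewrite !ge_min lexx orbT.
have d3 : d <= e / 8 / M ^+ 2 by rewrite !ge_min lexx orbT.
pose chi x := S (d^-1 * (x - b') + 1) * S (d^-1 * (a' - x) + 1).
have schi : smooth chi.
  apply: smoothM.
    have := @smooth_affine _ S d^-1 (1 - d^-1 * b') sS.
    by congr smooth; apply/funext => x; congr S; ring.
  have := @smooth_affine _ S (- d^-1) (1 + d^-1 * a') sS.
  by congr smooth; apply/funext => x; congr S; ring.
have chi1 x : a' <= x <= b' -> chi x = 1.
  move=> /andP[ax xb]; have di : 0 < d^-1 by rewrite invr_gt0.
  by rewrite /chi !S1 ?mulr1// gerDr pmulr_rle0// subr_le0.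
have chi0 x : ~~ (a' - d <= x <= b' + d) -> chi x = 0.
  rewrite negb_and -!ltNge => /orP[xa|bx].
    rewrite /chi (S2 (_ * (a' - x) + _)) ?mulr0//.
    have : 1 <= d^-1 * (a' - x) by rewrite mulrC ler_pdivlMr// mul1r; lra.
    lra.
  rewrite /chi (S2 (_ * (x - b') + _)) ?mul0r//.
  have : 1 <= d^-1 * (x - b') by rewrite mulrC ler_pdivlMr// mul1r; lra.
  lra.
have chi01 x : `|chi x| <= 1.
  rewrite /chi normrM; have := S01 (d^-1 * (x - b') + 1); have := S01 (d^-1 * (a' - x) + 1).
  move=> /andP[? ?] /andP[? ?]; rewrite !ger0_norm// mulr_ile1//.
pose g x := G x * chi x.
have sg : smooth g by exact: smoothM.
have g0 : vanishes_off (a' - d) (b' + d) g by move=> x /chi0; rewrite /g => ->; rewrite mulr0.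
have g0' : vanishes_off a b g.
  move=> x; rewrite negb_and -!ltNge => xab; apply: g0; rewrite negb_and -!ltNge; lra.
exists g => //.
have sfg : square_summable_on setT (fun x => f x - g x).
  by apply: square_summableB => //; apply: vanishes_off_square_summable g0; exact: smooth_cont.
have fg0 : vanishes_off (a' - d) (b' + d) (fun x => (f x - g x) ^+ 2).
  move=> x xn; rewrite g0// f0 ?subrr ?expr0n//.
  by apply: contra xn => /andP[? ?]; lra.
rewrite (Rintegral_extend fg0).
have Ifg c1 c2 : summable_on `[c1, c2] (fun x => (f x - g x) ^+ 2).
  by apply: summableS sfg.2.
rewrite (@Rintegral_itv_split _ (a' - d) a')//; try lra.
rewrite (@Rintegral_itv_split _ a' b')//; try lra.
have edge c1 c2 : c2 - c1 = d -> (forall x, c1 < x < c2 -> ~~ (a' <= x <= b') /\ a <= x <= b) ->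
    \int[mu]_(x in `[c1, c2]) ((f x - g x) ^+ 2) <= e / 8.
  move=> cd Hc; have c12 : c1 <= c2 by lra.
  rewrite -(@Rintegral_itv_obnd_cbnd _ c1 (BRight c2)); last first.
    by apply: summableS (Ifg c1 c2) => //; exact: subset_itv_oc_cc.
  rewrite -(@Rintegral_itv_bndo_bndc _ (BRight c1)); last first.
    by apply: summableS (Ifg c1 c2) => //; exact: subset_itv_oo_cc.
  apply: (@le_trans _ _ (\int[mu]_(x in `]c1, c2[) (M ^+ 2))).
    apply: le_Rintegral => //.
    - by apply: summableS (Ifg c1 c2) => //; exact: subset_itv_oo_cc.
    - apply: (@summableS _ _ `[c1, c2]) => //; first exact: subset_itv_oo_cc.
      by apply: bounded_summable => //; split => //; exists (M ^+ 2) => x _; rewrite ger0_norm ?sqr_ge0.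
    - move=> x /=; rewrite in_itv/= => /Hc[xn xab]; rewrite f0// sub0r sqrrN /g.
      rewrite -(real_normK (num_real (G x * chi x))) lerXn2r ?nnegrE ?(ltW M_gt0)// normrM.
      by rewrite -[leRHS]mulr1 ler_pM// HM.
  rewrite Rintegral_cst//= lebesgue_measure_itv/= lte_fin ifT; last by lra.
  by rewrite -EFinB/= cd mulrC -ler_pdivlMr ?exprn_gt0.
have E1 : \int[mu]_(x in `[(a' - d), a']) ((f x - g x) ^+ 2) <= e / 8.
  by apply: edge; [ring|move=> x /andP[? ?]; rewrite negb_and -!ltNge; lra].
have E2 : \int[mu]_(x in `[b', (b' + d)]) ((f x - g x) ^+ 2) <= e / 8.
  by apply: edge; [ring|move=> x /andP[? ?]; rewrite negb_and -!ltNge; lra].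
suff E3 : \int[mu]_(x in `[a', b']) ((f x - g x) ^+ 2) <= e / 2.
  by apply: le_trans (lerD E1 (lerD E3 E2)) _; lra.
have sphi h : continuous h -> square_summable_on `[a', b'] h.
  by move=> ch; apply: continuous_pos_square_summable => //; exact: continuous_continuous_pos.
have s1 : square_summable_on `[a', b'] (fun x => f x - phi x).
  by apply: square_summableB => //; exact: sphi.
have s2 : square_summable_on `[a', b'] (fun x => phi x - G x).
  by apply: square_summableB => //; exact: sphi.
apply: (@le_trans _ _ (\int[mu]_(x in `[a', b']) (2 * (f x - phi x) ^+ 2 + 2 * (phi x - G x) ^+ 2))).
  apply: le_Rintegral_segment => //.
    by apply: summableD => //; apply: summableZ => //; [case: s1|case: s2].
  move=> x xab; rewrite /g chi1// mulr1.
  by have := sqr_ge0 ((f x - phi x) - (phi x - G x)); nra.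
have J1 : summable_on `[a', b'] (fun x => 2 * (f x - phi x) ^+ 2).
  by apply: summableZ => //; case: s1.
have J2 : summable_on `[a', b'] (fun x => 2 * (phi x - G x) ^+ 2).
  by apply: summableZ => //; case: s2.
rewrite RintegralD//.
have J3 : summable_on `[a', b'] (fun x => (f x - phi x) ^+ 2) by case: s1.
have J4 : summable_on `[a', b'] (fun x => (phi x - G x) ^+ 2) by case: s2.
rewrite !RintegralZl//.
have : \int[mu]_(x in `[a', b']) ((phi x - G x) ^+ 2) <= \int[mu]_(x in `[a', b']) e1.
  apply: le_Rintegral_segment; first by case: s2.
    by apply: continuous_pos_summable => //; exact: continuous_pos_cst.
  move=> x xab; have H := HG x xab.
  rewrite -(real_normK (num_real _)) distrC.
  have e11 : e1 <= 1 by rewrite ge_min lexx.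
  by have := normr_ge0 (G x - phi x); nra.
rewrite Rintegral_cst_segment//.
have : e1 * (b' - a') <= e / 8.
  have : e1 <= e / 8 / (b' - a' + 1) by rewrite ge_min lexx orbT.
  rewrite ler_pdivlMr//; have : 0 <= e1 by exact: ltW. nra.
by ilra.
Qed.

End Density.

(** * Transport of squares *)

Section TransportArithmetic.
Context (R : realType).
Implicit Types A B C D e h k x y z : R.

Lemma triangle_square_le A B x e : `|x| <= A * B -> B <= e -> 0 < e -> 0 <= B -> 0 <= A ->
  A ^+ 2 + B ^+ 2 + 2 * x <= (A + e) ^+ 2.
Proof. by have := ler_norm x; nra. Qed.

Lemma duality_le n1 n2 n3 A B C e : n1 ^+ 2 = A + B -> `|B| <= n3 * e ->
  `|A| <= C * n2 -> n2 <= n1 + e -> 0 <= C -> n1 ^+ 2 <= C * n1 + (C + n3) * e :> R.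
Proof.
by have := ler_norm A; have := ler_norm B => ? ? E ? ? ? ?; rewrite E; nra.
Qed.

Lemma triangle3_le x y z e k : `|y| <= e / 5 * k -> `|z| <= e / 5 * k ->
  `|x| <= e / 5 * k -> 0 <= e * k -> `|x + y| + `|z| <= e * k.
Proof. by have := ler_normD x y; lra. Qed.

Lemma triangle3'_le x y z e k : `|y| <= e / 8 * k -> `|x| <= k * (e / 16) ->
  z <= k * (e / 16) -> `|x + y| + z <= e / 4 * k.
Proof. by have := ler_normD x y; lra. Qed.

Lemma triangle4_le x y z w a b c e h : 0 <= h -> 0 <= e -> `|x| <= a * h ^+ 2 -> `|y| <= e / 4 * h ->
  `|z| <= b * h ^+ 2 -> `|w| <= c * h ^+ 2 ->
  (a + 2 * b + c + 1) * h ^+ 2 <= e / 8 * h ->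
  `|x + 2 * y + 2 * z + w| <= e * h.
Proof.
move=> h0 e0 Hx Hy Hz Hw H.
have N1 := ler_normD (x + 2 * y + 2 * z) w.
have N2 := ler_normD (x + 2 * y) (2 * z).
have N3 := ler_normD x (2 * y).
rewrite !normrM (@ger0_norm _ 2)// in N2 N3.
by have := sqr_ge0 h; nra.
Qed.

Lemma margin_le A B e x h k : `|k| < e - `|h| -> A + e <= x + (h + k) <= B - e ->
  A <= x <= B.
Proof.
rewrite ltrBrDr => /(le_lt_trans (ler_normD _ _)); rewrite addrC => kh.
move: (kh); rewrite ltr_norml => /andP[? ?] /andP[? ?]; apply/andP; split; lra.
Qed.

End TransportArithmetic.

Section Transport.
Context (R : realType).
Local Notation mu := (@lebesgue_measure R).
Implicit Types (f g : R -> R) (a b c d e h k r x y z t : R).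

Lemma Cauchy_Schwarz_sqrt (D : set R) f g :
  measurable (D : set (measurableTypeR R)) ->
  square_summable_on D f -> square_summable_on D g ->
  `|\int[mu]_(x in D) (f x * g x)| <=
  Num.sqrt (\int[mu]_(x in D) (f x ^+ 2)) * Num.sqrt (\int[mu]_(x in D) (g x ^+ 2)).
Proof.
move=> mD sf sg; apply: Cauchy_Schwarz_le => //; rewrite ?sqrtr_ge0//.
  by rewrite sqr_sqrtr//; apply: Rintegral_ge0 => x _; exact: sqr_ge0.
by rewrite sqr_sqrtr//; apply: Rintegral_ge0 => x _; exact: sqr_ge0.
Qed.

Lemma smooth_taylor f a b : smooth f -> vanishes_off a b f ->
  exists2 C : R, 0 < C & forall x k : R,
    `|f (x + k) - f x| <= C * `|k| /\
    `|f (x + k) - f x - k * derive1 f x| <= C * k ^+ 2.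
Proof.
move=> sf f0; have sf1 := smooth_derive1 sf; have sf2 := smooth_derive1 sf1.
have f1 := vanishes_off_derive f0; have f2 := vanishes_off_derive f1.
have [C1 C10 H1] := vanishes_off_bounded (smooth_cont sf1) f1.
have [C2 C20 H2] := vanishes_off_bounded (smooth_cont sf2) f2.
have L2 := smooth_lipschitz sf1 H2.
exists (C1 + C2); first by rewrite addr_gt0.
move=> x k; split.
  rewrite (le_trans (smooth_lipschitz sf H1 _ _))// addrAC subrr add0r.
  by rewrite ler_wpM2r// lerDl ltW.
have [c ck ->] : exists2 c : R, `|c - x| <= `|k| & f (x + k) - f x = k * derive1 f c.
  have [k0|k0] := leP 0 k.
    have [|||c cx E] := @MVT_segment _ f (derive1 f) x (x + k).
    - by rewrite lerDl.
    - by move=> z _; exact: smooth_derive.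
    - exact/continuous_subspaceT/smooth_cont.
    exists c; first by move: cx; rewrite in_itv/= => /andP[? ?]; rewrite !ger0_norm; lra.
    by rewrite E; ring.
  have [|||c cx E] := @MVT_segment _ f (derive1 f) (x + k) x.
  - by rewrite gerDl ltW.
  - by move=> z _; exact: smooth_derive.
  - exact/continuous_subspaceT/smooth_cont.
  exists c.
    move: cx; rewrite in_itv/= => /andP[? ?]; rewrite (ltr0_norm k0) ler0_norm; lra.
  by rewrite -opprB E; ring.
rewrite -mulrBr normrM -(real_normK (num_real k)) expr2 mulrA mulrC.
apply: ler_wpM2r => //; rewrite (le_trans (L2 _ _))//.
apply: ler_pM => //; first exact: ltW.
by rewrite lerDr ltW.
Qed.

Lemma mean_value f (df : R -> R) x y : x <= y ->
  (forall z, x <= z <= y -> is_derive z 1 f (df z)) ->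
  exists2 c : R, x <= c <= y & f y - f x = df c * (y - x).
Proof.
move=> xy dfz.
have H1 z : z \in `]x, y[%R -> is_derive z 1 f (df z).
  by rewrite in_itv/= => /andP[? ?]; apply: dfz; rewrite !ltW.
have H2 : {within `[x, y], continuous f}.
  apply: continuous_in_subspaceT => z /set_mem/=; rewrite in_itv/= => /dfz dz.
  apply: differentiable_continuous; apply/derivable1_diffP.
  exact: (@ex_derive _ _ _ _ _ _ _ dz).
have [c cxy E] := MVT_segment xy H1 H2.
by exists c => //; move: cxy; rewrite in_itv.
Qed.

Lemma mean_value_bound f (df : R -> R) h M :
  (forall k, `|k| <= `|h| -> is_derive k 1 f (df k)) ->
  (forall k, `|k| <= `|h| -> `|df k| <= M) -> `|f h - f 0| <= M * `|h|.
Proof.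
move=> dk bk; have [h0|h0] := leP 0 h.
  have [k /andP[k0 kh]|c /andP[c0 ch] ->] := @mean_value f df 0 h h0.
    by apply: dk; rewrite !ger0_norm.
  by rewrite subr0 normrM ler_wpM2r// bk// !ger0_norm.
have [k /andP[k0 kh]|c /andP[c0 ch] E] := @mean_value f df h 0 (ltW h0).
  by apply: dk; rewrite (ltr0_norm h0) ler0_norm// lerN2.
rewrite -normrN opprB E sub0r normrM normrN ler_wpM2r// bk//.
by rewrite (ltr0_norm h0) ler0_norm// lerN2.
Qed.

Variables (L F : R -> R -> R) (s t0 eta K a b : R).
Hypotheses (eta0 : 0 < eta) (K0 : 0 <= K) (a0 : 0 < a).
Hypothesis sL : forall t, `|t - t0| < eta -> square_summable_on setT (L t).
Hypothesis sF : forall t, `|t - t0| < eta -> square_summable_on setT (F t).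
Hypothesis LK : forall t, `|t - t0| < eta -> \int[mu]_x (L t x ^+ 2) <= K ^+ 2.
Hypothesis FK : forall t, `|t - t0| < eta -> \int[mu]_x (F t x ^+ 2) <= K ^+ 2.
(* The weak form of the transport equation (d/dt - s d/dx) L = F. *)
Hypothesis transport : forall (g : R -> R) t, smooth g -> vanishes_off a b g ->
  `|t - t0| < eta ->
  is_derive t 1 (fun t => \int[mu]_x (L t x * g x))
    (\int[mu]_x (F t x * g x) - s * \int[mu]_x (L t x * derive1 g x)).

Let sq f := Num.sqrt (\int[mu]_x (f x ^+ 2)).

Let sq_ge0 f : 0 <= sq f. Proof. exact: sqrtr_ge0. Qed.

Let sqK f : sq f ^+ 2 = \int[mu]_x (f x ^+ 2).
Proof. by rewrite sqr_sqrtr//; apply: Rintegral_ge0 => x _; exact: sqr_ge0. Qed.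

Let sqL t : `|t - t0| < eta -> sq (L t) <= K.
Proof.
move=> tt; rewrite -(@ler_pXn2r _ 2)// ?nnegrE//; first by rewrite sqK LK.
Qed.

Let sqF t : `|t - t0| < eta -> sq (F t) <= K.
Proof.
move=> tt; rewrite -(@ler_pXn2r _ 2)// ?nnegrE//; first by rewrite sqK FK.
Qed.

Let pairL t g : `|t - t0| < eta -> square_summable_on setT g ->
  `|\int[mu]_x (L t x * g x)| <= K * sq g.
Proof.
move=> tt sg; rewrite (le_trans (Cauchy_Schwarz_sqrt measurableT (sL tt) sg))//.
by rewrite ler_wpM2r ?sqL// sqrtr_ge0.
Qed.

Let pairF t g : `|t - t0| < eta -> square_summable_on setT g ->
  `|\int[mu]_x (F t x * g x)| <= K * sq g.
Proof.
move=> tt sg; rewrite (le_trans (Cauchy_Schwarz_sqrt measurableT (sF tt) sg))//.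
by rewrite ler_wpM2r ?sqF// sqrtr_ge0.
Qed.

Let test_sq g c d : smooth g -> vanishes_off c d g -> square_summable_on setT g.
Proof. by move=> sg g0; apply: vanishes_off_square_summable g0; exact: smooth_cont. Qed.

Let vanishes_shift g c d k : vanishes_off c d g ->
  vanishes_off (c - k) (d - k) (fun x => g (x + k)).
Proof. by move=> g0 x xn; apply: g0; apply: contra xn => /andP[? ?]; lra. Qed.

Let vanishes_widen g c d c' d' : c' <= c -> d <= d' -> vanishes_off c d g ->
  vanishes_off c' d' g.
Proof. by move=> ? ? g0 x xn; apply: g0; apply: contra xn => /andP[? ?]; lra. Qed.

Let sq_shift g k : square_summable_on setT g -> sq (fun x => g (x + k)) = sq g.
Proof.
by move=> [_ Ig]; rewrite /sq (@Rintegral_shift _ k (fun x => g x ^+ 2)).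
Qed.

Let square_summable_shift g k : square_summable_on setT g ->
  square_summable_on setT (fun x => g (x + k)).
Proof.
move=> [mg Ig]; split; last exact: (@summable_shift _ k (fun x => g x ^+ 2)).
exact: (measurableT_comp mg (measurable_translation k)).
Qed.

Variable rho : R.
Hypothesis rho0 : 0 < rho.

Let in_eta h k : `|h| < eta -> `|k| <= `|h| -> `|t0 + k - t0| < eta.
Proof. by move=> he kh; rewrite addrAC subrr add0r (le_lt_trans kh). Qed.

(* Along the characteristics the transport term disappears. *)
Let moving g h : smooth g -> vanishes_off (a + rho) (b - rho) g ->
  `|h| < eta -> `|s * h| < rho ->
  is_derive h 1 (fun k => \int[mu]_x (L (t0 + k) x * g (x + s * k)))
    (\int[mu]_x (F (t0 + h) x * g (x + s * h))).
Proof.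
move=> sg g0 he hr.
have hh : `|t0 + h - t0| < eta by apply: in_eta he _.
pose B x := g (x + s * h).
have sB : smooth B by exact: smooth_shift.
have B0' : vanishes_off (a + rho - s * h) (b - rho - s * h) B by exact: vanishes_shift.
move: (hr); rewrite ltr_norml => /andP[hr1 hr2].
have B0 : vanishes_off a b B by apply: vanishes_widen B0'; lra.
have dB : derive1 B = fun x => derive1 g (x + s * h).
  by apply/funext => x; rewrite derive1_shift.
have sB1 := smooth_derive1 sB; have B10 := vanishes_off_derive B0.
have [C C0 HC] := smooth_taylor sg g0.
have d1 := transport sB B0 hh; have d2 := transport sB1 B10 hh.
apply/is_deriveP => e e0.
have e5 : 0 < e / 5 by rewrite divr_gt0.
have /is_deriveP/(_ _ e5)[r1 r10 H1] := d1.
set A2 := (X in is_derive _ _ _ X) in d2.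
pose e6 := e / 5 / (`|s| + 1).
have s1 : 0 < `|s| + 1 by rewrite ltr_wpDl.
have e60 : 0 < e6 by rewrite divr_gt0.
have /is_deriveP/(_ _ ltr01)[r2 r20 H2] := d2.
pose W := C * s ^+ 2 * Num.sqrt (b - a).
have W0 : 0 <= W := mulr_ge0 (mulr_ge0 (ltW C0) (sqr_ge0 s)) (sqrtr_ge0 _).
pose d := Num.min (Num.min r1 r2) (Num.min (Num.min (eta - `|h|) ((rho - `|s * h|) / (`|s| + 1)))
   (Num.min (e6 / (`|A2| + 1)) (e / 5 / (K * W + 1)))).
have KW : 0 < K * W + 1 by rewrite ltr_wpDl// mulr_ge0.
exists d.
  rewrite !lt_min r10 r20 subr_gt0 he !divr_gt0 ?subr_gt0// ?ltr_wpDl//.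
move=> k; rewrite !lt_min => /andP[/andP[k1 k2] /andP[/andP[k3 k4] /andP[k5 k6]]].
have hk : `|t0 + (h + k) - t0| < eta.
  by rewrite addrAC subrr add0r (le_lt_trans (ler_normD _ _))//; lra.
have tk : t0 + (h + k) = t0 + h + k by ring.
have sk : `|s * k| < rho - `|s * h|.
  rewrite normrM; apply: le_lt_trans (_ : (`|s| + 1) * `|k| < _).
    by rewrite ler_wpM2r// lerDl.
  by rewrite mulrC -ltr_pdivlMr.
(* Second order Taylor remainder of the moving test function. Its L^2 norm is [O (k ^+ 2)], so its
   pairing with [L] does not affect the derivative, while the first order part cancels the transport
   term. *)
pose T x := g (x + s * (h + k)) - B x - s * k * derive1 B x.
have TE x : T x = g (x + s * h + s * k) - g (x + s * h) - s * k * derive1 g (x + s * h).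
  by rewrite /T dB /B mulrDr addrA.
have T0 : vanishes_off a b T.
  move=> x xn; rewrite /T B0// B10// mulr0 !subr0.
  by apply: g0; apply: contra xn; rewrite mulrDr; exact: margin_le sk.
have Tle x : `|T x| <= C * (s * k) ^+ 2 by rewrite TE; have [] := HC (x + s * h) (s * k).
have sT : smooth T.
  apply: smoothB; last exact: smoothZ.
  by apply: smoothB => //; exact: smooth_shift.
have ssT := test_sq sT T0; have ssB := test_sq sB B0; have ssB1 := test_sq sB1 B10.
have sqT : sq T <= W * k ^+ 2.
  rewrite -(@ler_pXn2r _ 2)// ?nnegrE ?sq_ge0//; last by rewrite mulr_ge0 ?sqr_ge0.
  have T02 : vanishes_off a b (fun x => T x ^+ 2) by move=> x /T0 ->; rewrite expr0n.
  rewrite sqK (Rintegral_extend T02).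
  have [ab|ba] := leP a b; last first.
    rewrite set_itv_ge; last by rewrite bnd_simp -ltNge.
    by rewrite Rintegral_set0 sqr_ge0.
  apply: (@le_trans _ _ (\int[mu]_(x in `[a, b]) ((C * (s * k) ^+ 2) ^+ 2))).
    apply: le_Rintegral_segment.
    - by apply: summableS ssT.2.
    - by apply: continuous_pos_summable => //; exact: continuous_pos_cst.
    - move=> x _; rewrite -(real_normK (num_real (T x))) lerXn2r ?nnegrE//.
      by rewrite mulr_ge0 ?sqr_ge0// ltW.
  rewrite Rintegral_cst_segment//.
  rewrite [leRHS](_ : _ = (C * (s * k) ^+ 2) ^+ 2 * Num.sqrt (b - a) ^+ 2); last first.
    by rewrite /W; ring.
  by rewrite sqr_sqrtr ?subr_ge0.
have I1 : summable_on setT (fun x => L (t0 + (h + k)) x * B x).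
  by apply: square_summableM => //; exact: sL.
have I2 : summable_on setT (fun x => L (t0 + (h + k)) x * derive1 B x).
  by apply: square_summableM => //; exact: sL.
have I3 : summable_on setT (fun x => L (t0 + (h + k)) x * T x).
  by apply: square_summableM => //; exact: sL.
have -> : \int[mu]_x (L (t0 + (h + k)) x * g (x + s * (h + k))) =
   \int[mu]_x (L (t0 + (h + k)) x * B x) +
   s * k * \int[mu]_x (L (t0 + (h + k)) x * derive1 B x) +
   \int[mu]_x (L (t0 + (h + k)) x * T x).
  have I4 : summable_on setT (fun x => s * k * (L (t0 + (h + k)) x * derive1 B x)).
    exact: summableZ.
  have I5 : summable_on setT (fun x => L (t0 + (h + k)) x * B x +
      s * k * (L (t0 + (h + k)) x * derive1 B x)) by exact: summableD.
  rewrite -RintegralZl// -!RintegralD//.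
  by apply: eq_Rintegral => x _; rewrite /T; ring.
have {}H1 := H1 k k1; have {}H2 := H2 k k2.
have H3 := pairL hk ssT.
rewrite -/B; rewrite tk in I1 I2 I3 H3 *.
set P := \int[mu]_x (L (t0 + h + k) x * B x) in H1 *.
set Q := \int[mu]_x (L (t0 + h + k) x * derive1 B x) in H2 *.
set P0 := \int[mu]_x (L (t0 + h) x * B x) in H1 *.
set Q0 := \int[mu]_x (L (t0 + h) x * derive1 B x) in H1 H2 *.
set FB := \int[mu]_x (F (t0 + h) x * B x) in H1 *.
set TT := \int[mu]_x (L (t0 + h + k) x * T x) in H3 *.
have QQ : `|Q - Q0| <= (`|A2| + 1) * `|k|.
  rewrite (_ : Q - Q0 = (Q - Q0 - A2 * k) + A2 * k); last by ring.
  rewrite mul1r in H2.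
  by rewrite (le_trans (ler_normD _ _))// normrM [leRHS]mulrDl mul1r addrC lerD2l.
rewrite (_ : _ - _ - _ = (P - P0 - (FB - s * Q0) * k) + s * (k * (Q - Q0)) + TT); last by ring.
rewrite (le_trans (ler_normD _ _))//.
have S1 : `|s * (k * (Q - Q0))| <= e / 5 * `|k|.
  rewrite !normrM.
  apply: (@le_trans _ _ ((`|s| + 1) * (`|k| * ((`|A2| + 1) * `|k|)))).
    by rewrite ler_pM ?mulr_ge0// ?lerDl// ler_wpM2l.
  have -> : e / 5 * `|k| = (`|s| + 1) * (`|k| * e6).
    by rewrite /e6; field; rewrite gt_eqF.
  rewrite ler_wpM2l ?(ltW s1)// ler_wpM2l//.
  by rewrite mulrC -ler_pdivlMr ?ltW// ltr_wpDl.
have S2 : `|TT| <= e / 5 * `|k|.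
  apply: le_trans H3 _; apply: (@le_trans _ _ (K * (W * k ^+ 2))); first exact: ler_wpM2l.
  rewrite -(real_normK (num_real k)).
  have -> : K * (W * `|k| ^+ 2) = K * W * `|k| * `|k| by ring.
  rewrite ler_wpM2r//.
  apply: (@le_trans _ _ ((K * W + 1) * `|k|)); first by rewrite ler_wpM2r// lerDl.
  by rewrite mulrC -ler_pdivlMr// ltW.
by apply: triangle3_le => //; rewrite mulr_ge0// ltW.
Qed.

(** The increment of [L] along the characteristic through [(t0, x)], whose velocity is [- s]. *)
Let Delta h x := L (t0 + h) (x - s * h) - L t0 x.

Let t00 : `|t0 - t0| < eta. Proof. by rewrite subrr normr0. Qed.

Let sDelta h : `|h| < eta -> square_summable_on setT (Delta h).
Proof.
move=> he; apply: square_summableB => //; last exact: sL.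
by apply: square_summable_shift; apply: sL; exact: in_eta he _.
Qed.

Let pairing_Delta g h : smooth g -> vanishes_off (a + rho) (b - rho) g -> `|h| < eta ->
  \int[mu]_x (Delta h x * g x) =
  \int[mu]_x (L (t0 + h) x * g (x + s * h)) - \int[mu]_x (L t0 x * g x).
Proof.
move=> sg g0 he; have ssg := test_sq sg g0.
have st : square_summable_on setT (L (t0 + h)) by apply: sL; exact: in_eta he _.
have I1 : summable_on setT (fun x => L (t0 + h) x * g (x + s * h)).
  by apply: square_summableM => //; exact: square_summable_shift.
rewrite -(@Rintegral_shift _ (- (s * h)) _ I1).
rewrite -RintegralB//.
- by apply: eq_Rintegral => x _; rewrite /Delta subrK mulrBl.
- exact: (@summable_shift _ (- (s * h)) _ I1).
- by apply: square_summableM => //; exact: sL.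
Qed.

(** By [moving] the pairing is an increment in time of a differentiable function, and its derivative
    pairs [F] with a translate of [g]. *)
Let pairing_Delta_le g h : smooth g -> vanishes_off (a + rho) (b - rho) g ->
  `|h| < eta -> `|s * h| < rho ->
  `|\int[mu]_x (Delta h x * g x)| <= K * `|h| * sq g.
Proof.
move=> sg g0 he hr; have ssg := test_sq sg g0.
pose xi k := \int[mu]_x (L (t0 + k) x * g (x + s * k)).
pose dxi k := \int[mu]_x (F (t0 + k) x * g (x + s * k)).
have -> : \int[mu]_x (Delta h x * g x) = xi h - xi 0.
  rewrite pairing_Delta// /xi addr0; congr (_ - _).
  by apply: eq_Rintegral => x _; rewrite mulr0 addr0.
have dk k : `|k| <= `|h| -> is_derive k 1 xi (dxi k).
  move=> kh; apply: moving => //; first exact: le_lt_trans he.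
  by rewrite normrM (le_lt_trans _ hr)// normrM ler_wpM2l.
have bk k : `|k| <= `|h| -> `|dxi k| <= K * sq g.
  move=> kh; rewrite -(@sq_shift g (s * k) ssg).
  by apply: pairF; [exact: in_eta he kh|exact: square_summable_shift].
by rewrite mulrAC; apply: mean_value_bound dk bk.
Qed.

Let restriction f c d := f \_ `[c, d].

Let restrictionE f c d x : restriction f c d x = if c <= x <= d then f x else 0.
Proof.
rewrite /restriction patchE; case: ifPn => [/set_mem/=|/negP xn].
  by rewrite in_itv/= => ->.
by case: ifP => // xcd; exfalso; apply: xn; rewrite inE/= in_itv.
Qed.

Let restriction_off f c d : vanishes_off c d (restriction f c d).
Proof. by move=> x xn; rewrite restrictionE (negbTE xn). Qed.

Let square_summable_restriction f c d : square_summable_on setT f ->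
  square_summable_on setT (restriction f c d).
Proof.
move=> [mf If]; apply: (@le_square_summable _ setT _ _ (fun x => f x ^+ 2)) => //.
  by apply/(measurable_restrictT _ _).1 => //; exact: measurable_funTS.
by move=> x _; rewrite restrictionE; case: ifP => // _; rewrite expr0n sqr_ge0.
Qed.

Hypothesis ab4 : a + 3 * rho <= b - 3 * rho.

(** Duality: the increment is paired with smooth functions [g] close to its own restriction [f]. In
    the limit the square of the norm of [f] is at most [K * |h|] times that norm. This Lipschitz
    bound along characteristics is the regularity that makes squares differentiable. *)
Let Delta_le h : `|h| < eta -> `|s * h| < rho ->
  sq (restriction (Delta h) (a + 2 * rho) (b - 2 * rho)) <= K * `|h|.
Proof.
move=> he hr; set f := restriction _ _ _.
have sD := sDelta he.
have sf : square_summable_on setT f by exact: square_summable_restriction.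
have f0 : vanishes_off (a + 2 * rho) (b - 2 * rho) f by exact: restriction_off.
suff H e : 0 < e -> sq f ^+ 2 <= K * `|h| * sq f + (K * `|h| + sq (Delta h)) * e.
  set N := sq f in H *; have N0 : 0 <= N by exact: sq_ge0.
  set A := K * `|h| in H *; have A0 : 0 <= A by rewrite mulr_ge0.
  set B := sq (Delta h) in H; have B0 : 0 <= B by exact: sq_ge0.
  have [->|N1] := eqVneq N 0; first by [].
  have N2 : 0 < N by rewrite lt_neqAle eq_sym N1.
  suff : N * N <= A * N by rewrite ler_pM2r.
  apply/ler_addgt0Pl => e e0; rewrite addrC -expr2.
  have AB : 0 < A + B + 1 by rewrite ltr_wpDl ?addr_ge0.
  apply: le_trans (H (e / (A + B + 1)) _) _; first by rewrite divr_gt0.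
  rewrite lerD2l mulrCA -[leRHS]mulr1 ler_wpM2l ?(ltW e0)//.
  by rewrite ler_pdivrMr// mul1r lerDl.
move=> e0; have e20 : 0 < e ^+ 2 by rewrite exprn_gt0.
have [||||g [sg g0] Hg] := smooth_L2_dense _ _ _ _ sf f0 e20 (a := a + rho) (b := b - rho).
- by rewrite addr_gt0.
- by rewrite ltrD2l mulr_natl mulr2n ltrDl.
- by rewrite (le_trans _ (le_trans ab4 _))// ?lerD2l ?lerN2 ?ler_pM2r// ler_nat.
- by rewrite ltrD2l ltrN2 mulr_natl mulr2n ltrDl.
have ssg := test_sq sg g0.
have sfg : square_summable_on setT (fun x => f x - g x) by exact: square_summableB.
have sqfg : sq (fun x => f x - g x) <= e.
  by rewrite -(@ler_pXn2r _ 2)// ?nnegrE ?sq_ge0//; [rewrite sqK|exact: ltW].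
have I1 : summable_on setT (fun x => Delta h x * g x) by exact: square_summableM.
have I2 : summable_on setT (fun x => Delta h x * (f x - g x)) by exact: square_summableM.
have E : sq f ^+ 2 = \int[mu]_x (Delta h x * g x) + \int[mu]_x (Delta h x * (f x - g x)).
  rewrite sqK -RintegralD//; apply: eq_Rintegral => x _.
  by rewrite -mulrDr addrC subrK /f restrictionE; case: ifP => _; rewrite ?mulr0 ?expr0n.
have H1 : `|\int[mu]_x (Delta h x * (f x - g x))| <= sq (Delta h) * e.
  apply: (le_trans (Cauchy_Schwarz_sqrt measurableT sD sfg)).
  by rewrite ler_wpM2l ?sqrtr_ge0.
have H2 := pairing_Delta_le sg g0 he hr.
have gf : sq g <= sq f + e.
  have If2 : summable_on setT (fun x => f x * (g x - f x)).
    by apply: square_summableM => //; exact: square_summableB.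
  have E2 : sq g ^+ 2 = sq f ^+ 2 + sq (fun x => f x - g x) ^+ 2
      + 2 * \int[mu]_x (f x * (g x - f x)).
    have I3 := sf.2; have I4 := sfg.2.
    have I5 : summable_on setT (fun x => f x ^+ 2 + (f x - g x) ^+ 2) by exact: summableD.
    have I6 : summable_on setT (fun x => 2 * (f x * (g x - f x))) by exact: summableZ.
    rewrite !sqK -RintegralZl// -!RintegralD//.
    by apply: eq_Rintegral => x _; ring.
  have sgf : square_summable_on setT (fun x => g x - f x) by exact: square_summableB.
  have := Cauchy_Schwarz_sqrt measurableT sf sgf.
  have -> : Num.sqrt (\int[mu]_x ((g x - f x) ^+ 2)) = sq (fun x => f x - g x).
    by congr Num.sqrt; apply: eq_Rintegral => x _; rewrite -sqrrN opprB.
  rewrite -/(sq f) => C.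
  rewrite -(@ler_pXn2r _ 2)// ?nnegrE ?sq_ge0//; last by rewrite addr_ge0 ?sq_ge0// ltW.
  by rewrite E2; apply: triangle_square_le C _ _ _ _; rewrite ?sq_ge0.
have KH : 0 <= K * `|h| by rewrite mulr_ge0.
exact: duality_le E H1 H2 gf KH.
Qed.

(** After translation along the characteristics, [L (t0 + h)] becomes [L t0 + Delta h]. Expanding
    the square, the moving weight gives the term with [derive1 g], the cross term gives [2 * F * L],
    and the square of [Delta h] is [O (h ^+ 2)] by [Delta_le]. *)
Lemma transport_square g : smooth g -> vanishes_off (a + 3 * rho) (b - 3 * rho) g ->
  is_derive t0 1 (fun t => \int[mu]_x (g x * L t x ^+ 2))
    (2 * \int[mu]_x (g x * F t0 x * L t0 x) - s * \int[mu]_x (derive1 g x * L t0 x ^+ 2)).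
Proof.
move=> sg g0.
have sL0 := sL t00; have sF0 := sF t00.
have [C C0 HC] := smooth_taylor sg g0.
have bg := vanishes_off_bounded_on (smooth_cont sg) g0.
have [M M0 HM] := vanishes_off_bounded (smooth_cont sg) g0.
pose G x := g x * L t0 x.
have sG : square_summable_on setT G by exact: square_summableMr.
have G0 : vanishes_off (a + 3 * rho) (b - 3 * rho) G.
  by move=> x /g0; rewrite /G => ->; rewrite mul0r.
apply/is_deriveP => e e0.
pose e1 := e / 16 / (K + 1).
have K1 : 0 < K + 1 by rewrite ltr_wpDl.
have e10 : 0 < e1 by rewrite !divr_gt0.
(* The weak equation cannot be tested against [g * L t0], which need not be smooth; it is replaced
   by a smooth [b0] at L^2 distance [e1]. *)
have [||||b0 [sb b00] Hb] := smooth_L2_dense _ _ _ _ sG G0 (exprn_gt0 2 e10) (a := a + 2 * rho) (b := b - 2 * rho).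
- by rewrite addr_gt0// mulr_gt0.
- by rewrite ltrD2l ltr_pM2r// ltr_nat.
- exact: ab4.
- by rewrite ltrD2l ltrN2 ltr_pM2r// ltr_nat.
have ssb := test_sq sb b00.
have b01 : vanishes_off (a + rho) (b - rho) b0.
  by apply: vanishes_widen b00; rewrite ?lerD2l ?lerN2 mulr_natl mulr2n lerDl ltW.
have := @moving b0 0 sb b01; rewrite mulr0 !normr0 => /(_ eta0 rho0).
have e80 : 0 < e / 8 by rewrite divr_gt0.
move=> /is_deriveP/(_ _ e80)[r1 r10 Hr1].
pose Z := C * s ^+ 2 * K ^+ 2 + 2 * (C * `|s| * K * K) + M * K ^+ 2 + 1.
have Z0 : 0 < Z.
  have := mulr_ge0 (mulr_ge0 (ltW C0) (sqr_ge0 s)) (sqr_ge0 K).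
  have := mulr_ge0 (mulr_ge0 (mulr_ge0 (ltW C0) (normr_ge0 s)) K0) K0.
  have := mulr_ge0 (ltW M0) (sqr_ge0 K).
  by rewrite /Z; lra.
exists (Num.min (Num.min r1 eta) (Num.min (rho / (`|s| + 1)) (e / 8 / Z))).
  rewrite !lt_min r10 eta0 !divr_gt0//= ?ltr_wpDl//.
move=> h; rewrite !lt_min => /andP[/andP[h1 he] /andP[h3 h4]].
have hr : `|s * h| < rho.
  rewrite normrM; apply: le_lt_trans (_ : (`|s| + 1) * `|h| < _).
    by rewrite ler_wpM2r// lerDl.
  by rewrite mulrC -ltr_pdivlMr// ltr_wpDl.
have st : square_summable_on setT (L (t0 + h)) by apply: sL; exact: in_eta he _.
have sD := sDelta he.
pose D := restriction (Delta h) (a + 2 * rho) (b - 2 * rho).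
have ssD : square_summable_on setT D by exact: square_summable_restriction.
have DK : sq D <= K * `|h| by exact: Delta_le.
pose gh x := g (x - s * h).
have sgh : smooth gh by exact: smooth_shift.
have gh0 : vanishes_off (a + 2 * rho) (b - 2 * rho) gh.
  apply: vanishes_widen (@vanishes_shift g _ _ (- (s * h)) g0).
    by have := ler_norm (- (s * h)); rewrite normrN; lra.
  by have := ler_norm (s * h); lra.
have bgh := vanishes_off_bounded_on (smooth_cont sgh) gh0.
have gDelta x : gh x * Delta h x = gh x * D x.
  rewrite /D restrictionE; case: ifPn => // /gh0 ->; by rewrite !mul0r.
have GDelta x : g x * Delta h x = g x * D x.
  rewrite /D restrictionE; case: ifPn => // xn; rewrite g0 ?mul0r//.
  by apply: contra xn => /andP[x1 x2]; have r0 := rho0; apply/andP; split; lra.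
have bDelta x : b0 x * Delta h x = b0 x * D x.
  rewrite /D restrictionE; case: ifPn => // xn; rewrite b00 ?mul0r//.
have IL (f : R -> R) : bounded_on setT f -> summable_on setT (fun x => f x * L t0 x ^+ 2).
  by move=> bh; apply: summableMr => //; case: sL0.
have bg' : bounded_on setT (derive1 g).
  exact: (vanishes_off_bounded_on (smooth_cont (smooth_derive1 sg)) (vanishes_off_derive g0)).
have IGD : summable_on setT (fun x => G x * D x) by exact: square_summableM.
have IGF : summable_on setT (fun x => G x * F t0 x) by exact: square_summableM.
pose dg x := gh x - g x.
have bdg : bounded_on setT dg.
  split; first by apply: measurable_funB; [case: bgh|case: bg].
  have [_ [M1 HM1]] := bgh; exists (M1 + M) => x _.
  by rewrite /dg (le_trans (ler_normB _ _))// lerD// HM1.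
have sdgL : square_summable_on setT (fun x => dg x * L t0 x) by exact: square_summableMr.
have IdgD : summable_on setT (fun x => dg x * L t0 x * D x) by exact: square_summableM.
have IDD : summable_on setT (fun x => gh x * D x ^+ 2) by apply: summableMr => //; case: ssD.
(* The integral is translated by [s * h] and expanded. Where [g] or its translate [gh] does not
   vanish, [Delta h] coincides with its restriction [D], the only part that [Delta_le] controls. *)
have E : \int[mu]_x (g x * L (t0 + h) x ^+ 2) =
  \int[mu]_x (gh x * L t0 x ^+ 2) + 2 * (\int[mu]_x (G x * D x)) +
  2 * (\int[mu]_x (dg x * L t0 x * D x)) + \int[mu]_x (gh x * D x ^+ 2).
  have I0 : summable_on setT (fun x => g x * L (t0 + h) x ^+ 2).
    by apply: summableMr => //; case: st.
  rewrite -(@Rintegral_shift _ (- (s * h)) _ I0).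
  have JA := IL _ bgh.
  have JB : summable_on setT (fun x => 2 * (G x * D x)) by exact: summableZ.
  have JC : summable_on setT (fun x => 2 * (dg x * L t0 x * D x)) by exact: summableZ.
  have JAB : summable_on setT (fun x => gh x * L t0 x ^+ 2 + 2 * (G x * D x)).
    exact: summableD.
  have JABC : summable_on setT (fun x => gh x * L t0 x ^+ 2 + 2 * (G x * D x)
      + 2 * (dg x * L t0 x * D x)) by exact: summableD.
  rewrite -!RintegralZl// -!RintegralD//.
  - apply: eq_Rintegral => x _.
    have LE : L (t0 + h) (x - s * h) = L t0 x + Delta h x by rewrite /Delta addrCA subrr addr0.
    rewrite LE -/(gh x) /G /dg.
    have := gDelta x; move: (D x) (Delta h x) (gh x) (g x) (L t0 x) (GDelta x).
    move=> D' D1 g1 g2 l H2 H1.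
    have -> : g1 * (l + D1) ^+ 2 = g1 * l ^+ 2 + 2 * l * (g1 * D1) + (g1 * D1) * D1 by ring.
    rewrite H1; have -> : g1 * D' * D1 = D' * (g1 * D1) by ring.
    by rewrite H1; ring.
have T1 : `|\int[mu]_x (gh x * L t0 x ^+ 2) - \int[mu]_x (g x * L t0 x ^+ 2) +
    s * h * \int[mu]_x (derive1 g x * L t0 x ^+ 2)| <= C * s ^+ 2 * K ^+ 2 * `|h| ^+ 2.
  have J1 := IL _ bgh; have J2 := IL _ bg; have J3 := IL _ bg'.
  have J5 : summable_on setT (fun x => s * h * (derive1 g x * L t0 x ^+ 2)) by exact: summableZ.
  have J6 : summable_on setT (fun x => gh x * L t0 x ^+ 2 - g x * L t0 x ^+ 2) by exact: summableB.
  rewrite -RintegralZl// -RintegralB// -RintegralD//.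
  have J4 : summable_on setT (fun x => gh x * L t0 x ^+ 2 - g x * L t0 x ^+ 2 + s * h * (derive1 g x * L t0 x ^+ 2)).
    exact: summableD.
  rewrite (le_trans (le_normr_Rintegral _ _))//.
  apply: (@le_trans _ _ (\int[mu]_x (C * (s * h) ^+ 2 * L t0 x ^+ 2))).
    apply: le_Rintegral => //; first exact: summable_norm.
      by apply: summableZ => //; case: sL0.
    move=> x _; rewrite -mulrBl (mulrA (s * h)) -mulrDl normrM (ger0_norm (sqr_ge0 (L t0 x))).
    rewrite ler_wpM2r ?sqr_ge0//.
    have [_] := HC x (- (s * h)); rewrite sqrrN; congr (`|_| <= _).
    by rewrite /gh; ring.
  rewrite RintegralZl//; last by case: sL0.
  rewrite real_normK ?num_real// exprMn mulrA [leRHS]mulrAC ler_wpM2l ?LK//.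
  exact: mulr_ge0 (mulr_ge0 (ltW C0) (sqr_ge0 s)) (sqr_ge0 _).
have T2 : `|\int[mu]_x (dg x * L t0 x * D x)| <= C * `|s| * K * K * `|h| ^+ 2.
  rewrite (le_trans (Cauchy_Schwarz_sqrt measurableT sdgL ssD))//.
  have : sq (fun x => dg x * L t0 x) <= C * `|s * h| * K.
    rewrite -(@ler_pXn2r _ 2)// ?nnegrE ?sq_ge0//; last by rewrite !mulr_ge0// ltW.
    rewrite sqK.
    apply: (@le_trans _ _ (\int[mu]_x ((C * `|s * h|) ^+ 2 * L t0 x ^+ 2))).
      apply: le_Rintegral => //; first by case: sdgL.
        by apply: summableZ => //; case: sL0.
      move=> x _; rewrite exprMn ler_wpM2r ?sqr_ge0//.
      rewrite -(real_normK (num_real (dg x))) lerXn2r ?nnegrE ?mulr_ge0// ?(ltW C0)//.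
      by have [] := HC x (- (s * h)); rewrite normrN.
    rewrite RintegralZl//; last by case: sL0.
    by rewrite [leRHS]exprMn ler_wpM2l ?LK ?sqr_ge0.
  move=> H; rewrite normrM in H.
  apply: le_trans (ler_pM (sqrtr_ge0 _) (sqrtr_ge0 _) H DK) _.
  by rewrite le_eqVlt; apply/orP; left; apply/eqP; ring.
have T3 : `|\int[mu]_x (gh x * D x ^+ 2)| <= M * K ^+ 2 * `|h| ^+ 2.
  rewrite (le_trans (le_normr_Rintegral _ _))//.
  apply: (@le_trans _ _ (\int[mu]_x (M * D x ^+ 2))).
    apply: le_Rintegral => //; first exact: summable_norm.
      by apply: summableZ => //; case: ssD.
    by move=> x _; rewrite normrM (ger0_norm (sqr_ge0 (D x))) ler_wpM2r ?sqr_ge0 ?/gh ?HM.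
  rewrite RintegralZl//; last by case: ssD.
  rewrite -sqK -mulrA ler_wpM2l ?(ltW M0)// -exprMn lerXn2r ?nnegrE ?sq_ge0//.
  by rewrite mulr_ge0.
have sGb : square_summable_on setT (fun x => G x - b0 x) by exact: square_summableB.
have sqGb : sq (fun x => G x - b0 x) <= e1.
  by rewrite -(@ler_pXn2r _ 2)// ?nnegrE ?sq_ge0//; [rewrite sqK|exact: ltW].
have Ib : summable_on setT (fun x => Delta h x * b0 x) by exact: square_summableM.
have IbF : summable_on setT (fun x => F t0 x * b0 x) by exact: square_summableM.
have T4 : `|\int[mu]_x (G x * D x) - h * \int[mu]_x (G x * F t0 x)| <= e / 4 * `|h|.
  have IGbD : summable_on setT (fun x => (G x - b0 x) * D x) by exact: square_summableM.
  have IGbF : summable_on setT (fun x => (G x - b0 x) * F t0 x) by exact: square_summableM.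
  have -> : \int[mu]_x (G x * D x) = \int[mu]_x ((G x - b0 x) * D x) + \int[mu]_x (Delta h x * b0 x).
    rewrite -RintegralD//; apply: eq_Rintegral => x _.
    by rewrite mulrBl (mulrC (Delta h x)) bDelta subrK.
  have -> : \int[mu]_x (G x * F t0 x) = \int[mu]_x ((G x - b0 x) * F t0 x) + \int[mu]_x (F t0 x * b0 x).
    rewrite -RintegralD//; apply: eq_Rintegral => x _.
    by rewrite mulrBl (mulrC (F t0 x)) subrK.
  have {}Hr1 := Hr1 h h1.
  rewrite add0r addr0 in Hr1.
  rewrite pairing_Delta//.
  have E2 : \int[mu]_x (L t0 x * b0 (x + s * 0)) = \int[mu]_x (L t0 x * b0 x).
    by apply: eq_Rintegral => x _; rewrite mulr0 addr0.
  have E3 : \int[mu]_x (F t0 x * b0 (x + 0)) = \int[mu]_x (F t0 x * b0 x).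
    by apply: eq_Rintegral => x _; rewrite addr0.
  rewrite E2 E3 in Hr1.
  have B1 : `|\int[mu]_x ((G x - b0 x) * D x)| <= e1 * (K * `|h|).
    rewrite (le_trans (Cauchy_Schwarz_sqrt measurableT sGb ssD))//.
    by rewrite ler_pM ?sqrtr_ge0.
  have B2 : `|\int[mu]_x ((G x - b0 x) * F t0 x)| <= e1 * K.
    rewrite (le_trans (Cauchy_Schwarz_sqrt measurableT sGb sF0))//.
    by rewrite ler_pM ?sqrtr_ge0// sqF.
  have e1K : e1 * K <= e / 16.
    have -> : e / 16 = e1 * (K + 1) by rewrite /e1; field; rewrite gt_eqF.
    by rewrite ler_wpM2l ?(ltW e10)// lerDl.
  set A1 := \int[mu]_x (_ * D x) in B1 *.
  set A2 := \int[mu]_x (_ * F t0 x) in B2 *.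
  set A3 := \int[mu]_x (L (t0 + h) x * _) in Hr1 *.
  set A4 := \int[mu]_x (L t0 x * _) in Hr1 *.
  set A5 := \int[mu]_x (F t0 x * _) in Hr1 *.
  rewrite (_ : _ - _ = A1 + (A3 - A4 - A5 * h) + - (h * A2)); last by ring.
  rewrite (le_trans (ler_normD _ _))// normrN normrM.
  apply: triangle3'_le => //.
    by rewrite (le_trans B1)// mulrA mulrC ler_wpM2l.
  by rewrite ler_wpM2l// (le_trans B2).
have EG : \int[mu]_x (g x * F t0 x * L t0 x) = \int[mu]_x (G x * F t0 x).
  by apply: eq_Rintegral => x _; rewrite /G mulrAC.
rewrite E EG.
have hh : Z * `|h| ^+ 2 <= e / 8 * `|h|.
  by rewrite expr2 mulrA ler_wpM2r// mulrC -ler_pdivlMr// ltW.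
rewrite [X in `|X|](_ : _ = (\int[mu]_x (gh x * L t0 x ^+ 2) - \int[mu]_x (g x * L t0 x ^+ 2)
    + s * h * \int[mu]_x (derive1 g x * L t0 x ^+ 2))
  + 2 * (\int[mu]_x (G x * D x) - h * \int[mu]_x (G x * F t0 x))
  + 2 * \int[mu]_x (dg x * L t0 x * D x) + \int[mu]_x (gh x * D x ^+ 2)); last by ring.
exact: triangle4_le (normr_ge0 h) (ltW e0) T1 T4 T2 T3 hh.
Qed.

End Transport.

(** * Weak form of the wave map equation *)

Section Flow.
Context (R : realType).
Local Notation mu := (@lebesgue_measure R).
Implicit Types (f g h : R -> R) (a b c d e r x y z t : R).

(** Unlike [vanishes_off] this includes the endpoints, so that boundary terms disappear in
    integrations by parts. For continuous functions the two agree. *)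
Definition supported a b f := forall x, ~~ (a < x < b) -> f x = 0.

Lemma supported_vanishes a b f : supported a b f -> vanishes_off a b f.
Proof. by move=> f0 x xn; apply: f0; apply: contra xn => /andP[/ltW-> /ltW->]. Qed.

Lemma supported_le a b f x : supported a b f -> x <= a -> f x = 0.
Proof. by move=> f0 xa; apply: f0; rewrite negb_and -!leNgt xa. Qed.

Lemma supported_ge a b f x : supported a b f -> b <= x -> f x = 0.
Proof. by move=> f0 xa; apply: f0; rewrite negb_and -!leNgt xa orbT. Qed.

Lemma supported_widen a b a' b' f : a' <= a -> b <= b' -> supported a b f -> supported a' b' f.
Proof.
move=> aa bb f0 x xn; apply: f0; apply: contra xn => /andP[ax xb].
by rewrite (le_lt_trans aa ax) (lt_le_trans xb bb).
Qed.

Lemma is_derive_slope f x d : is_derive x 1 f d ->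
  (forall e, 0 < e -> exists2 h : R, 0 < `|h| < e & f (x + h) = f x) -> d = 0.
Proof.
move=> /is_deriveP df H; apply/eqP; rewrite -normr_le0; apply/ler_addgt0Pl => e e0.
have [dl d0 Hd] := df e e0; have [h /andP[h0 hd] fh] := H dl d0.
by rewrite addr0; have := Hd h hd; rewrite fh subrr sub0r normrN normrM ler_pM2r.
Qed.

Lemma derive1_const_le f c a x : smooth f -> (forall y, y <= a -> f y = c) -> x <= a ->
  derive1 f x = 0.
Proof.
move=> sf fc xa; apply: (is_derive_slope (smooth_derive x sf)) => e e0.
exists (- (e / 2)); first by rewrite normrN gtr0_norm ?divr_gt0//; lra.
by rewrite !fc//; lra.
Qed.

Lemma derive1_const_ge f c a x : smooth f -> (forall y, a <= y -> f y = c) -> a <= x ->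
  derive1 f x = 0.
Proof.
move=> sf fc xa; apply: (is_derive_slope (smooth_derive x sf)) => e e0.
exists (e / 2); first by rewrite gtr0_norm ?divr_gt0//; lra.
by rewrite !fc//; lra.
Qed.

Lemma vanishes_supported a b f : continuous f -> vanishes_off a b f -> supported a b f.
Proof.
move=> cf f0.
have H x : (forall e, 0 < e -> exists2 y : R, `|x - y| < e & f y = 0) -> f x = 0.
  move=> Hx; apply/eqP; rewrite -normr_le0; apply/ler_addgt0Pl => e e0; rewrite addr0.
  have /cvgrPdist_le/(_ _ e0)/nbhs_ballP[d /= d0 Hd] := cf x.
  by have [y yd fy] := Hx d d0; have := Hd y yd; rewrite /= fy subr0.
move=> x; rewrite negb_and -!leNgt => /orP[xa|bx]; apply: H => e e0.
  exists (x - e / 2); first by rewrite opprB addrC subrK gtr0_norm ?divr_gt0//; lra.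
  by apply: f0; rewrite negb_and -!ltNge; apply/orP; left; lra.
exists (x + e / 2).
  by rewrite opprD addNKr normrN gtr0_norm ?divr_gt0//; lra.
by apply: f0; rewrite negb_and -!ltNge; apply/orP; right; lra.
Qed.

Lemma smooth_primitive f : smooth f -> primitive f (derive1 f).
Proof.
move=> sf; apply: primitive_derive; first by move=> x _; exact: smooth_derive.
exact/continuous_continuous_pos/smooth_cont/smooth_derive1.
Qed.

Lemma smooth_pos f : smooth f -> continuous_pos f.
Proof. by move=> sf; exact/continuous_continuous_pos/smooth_cont. Qed.

Lemma integration_by_parts_segment f f' g g' a b : primitive f f' -> primitive g g' ->
  0 < a -> a <= b ->
  \int[mu]_(x in `[a, b]) (f' x * g x) =
  f b * g b - f a * g a - \int[mu]_(x in `[a, b]) (f x * g' x).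
Proof.
move=> pf pg a0 ab; have cf := primitive_cont pf; have cg := primitive_cont pg.
have [_ ->//] := primitiveM pf pg.
have If := pf.1; have Ig := pg.1.
have I1 : summable_on `[a, b] (fun x => f' x * g x) by apply: (locally_summableMl cg If).
have I2 : summable_on `[a, b] (fun x => f x * g' x) by apply: (locally_summableMr cf Ig).
by rewrite RintegralD// addrK.
Qed.

Lemma integration_by_parts_supported f f' g a b : primitive f f' -> smooth g ->
  0 < a -> a <= b -> supported a b g ->
  \int[mu]_(x in `[a, b]) (f' x * g x) = - \int[mu]_(x in `[a, b]) (f x * derive1 g x).
Proof.
move=> pf sg a0 ab g0; rewrite (integration_by_parts_segment pf (smooth_primitive sg) a0 ab).
by rewrite (supported_le g0 (lexx a)) (supported_ge g0 (lexx b)) !mulr0 subrr sub0r.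
Qed.

Lemma Rintegral_patch (D : set R) f g :
  \int[mu]_x ((f \_ D) x * g x) = \int[mu]_(x in D) (f x * g x).
Proof.
rewrite [RHS]Rintegral_mkcond; apply: eq_Rintegral => x _; rewrite !patchE.
by case: ifP => // _; rewrite mul0r.
Qed.

Lemma square_summable_patch a b f : square_summable_on `[a, b] f ->
  square_summable_on setT (f \_ `[a, b]).
Proof.
move=> [mf If]; split.
  by apply/(measurable_restrictT _ _).1.
suff : summable_on setT ((fun x => f x ^+ 2) \_ `[a, b]).
  by apply: summable_eq => // x _; rewrite !patchE; case: ifP => // _; rewrite expr0n.
by rewrite /summable_on -restrict_EFin; apply/integrable_restrict => //=; rewrite setTI.
Qed.

Lemma Rintegral_patch_sqr (D : set R) f g :
  \int[mu]_x (g x * (f \_ D) x ^+ 2) = \int[mu]_(x in D) (g x * f x ^+ 2).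
Proof.
rewrite [RHS]Rintegral_mkcond; apply: eq_Rintegral => x _; rewrite !patchE.
by case: ifP => // _; rewrite expr0n mulr0.
Qed.

Variable k : nat.

(** The lower order part of the equation, which reads [w_t = p_r + wave_force u p]. *)
Definition wave_force (u p : R -> R) r := p r / r - k%:R ^+ 2 * (sin (2 * u r) / (2 * r ^+ 2)).

(* u, p and w are the solution, its radial derivative and its time derivative;
   the equations are tested against g(r)/r instead of g(r). *)
Record wave_flow (T : R) (u p w : R -> R -> R) : Prop := WaveFlow {
  flow_primitive : forall t, T < t -> primitive (u t) (p t);
  flow_p : forall t, T < t -> locally_square_summable (p t);
  flow_w : forall t, T < t -> locally_square_summable (w t);
  flow_energy : forall t a b, T < t -> 0 < a -> a <= b ->
    \int[mu]_(r in `[a, b]) (r * (w t r ^+ 2 + p t r ^+ 2 + k%:R ^+ 2 * (sin (u t r) ^+ 2 / r ^+ 2)))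
      <= 8 * k%:R;
  flow_eq1 : forall g a b t, smooth g -> 0 < a -> a <= b -> vanishes_off a b g -> T < t ->
    is_derive t 1 (fun s => \int[mu]_(r in `[a, b]) (u s r * g r))
      (\int[mu]_(r in `[a, b]) (w t r * g r));
  flow_eq2 : forall g a b t, smooth g -> 0 < a -> a <= b -> vanishes_off a b g -> T < t ->
    is_derive t 1 (fun s => \int[mu]_(r in `[a, b]) (w s r * g r))
      (\int[mu]_(r in `[a, b]) (wave_force (u t) (p t) r * g r)
       - \int[mu]_(r in `[a, b]) (p t r * derive1 g r)) }.

Lemma flow_energy_wp T u p w t a b : wave_flow T u p w -> T < t -> 0 < a -> a <= b ->
  \int[mu]_(r in `[a, b]) (w t r ^+ 2 + p t r ^+ 2) <= 8 * k%:R / a.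
Proof.
move=> wf tT a0 ab; rewrite ler_pdivlMr// mulrC.
have cu := primitive_cont (flow_primitive wf tT).
have Iw := locally_summable_sqr (flow_w wf tT).
have Ip := locally_summable_sqr (flow_p wf tT).
have Iwp := locally_summableD Iw Ip.
have Is : locally_summable (fun r => k%:R ^+ 2 * (sin (u t r) ^+ 2 / r ^+ 2)).
  apply/continuous_pos_summable/continuous_posM; first exact: continuous_pos_cst.
  apply: continuous_posM; last exact: continuous_pos_inv.
  exact/continuous_posX/continuous_pos_sin.
have I1 := locally_summableMr (@continuous_pos_id R) (locally_summableD Iwp Is).
have J1 := Iwp a b a0; have J2 := I1 a b a0.
rewrite -RintegralZl//; apply: le_trans (flow_energy wf tT a0 ab).
apply: le_Rintegral_segment => //; first exact: summableZ.
move=> r /andP[ar rb]; apply: ler_pM => //.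
- exact: ltW.
- by rewrite addr_ge0 ?sqr_ge0.
- by rewrite lerDl mulr_ge0 ?sqr_ge0// divr_ge0 ?sqr_ge0.
Qed.

(** The compatibility [p_t = w_r] in weak form: the first equation is tested against [derive1 g] and
    integrated by parts in [r]. *)
Lemma flow_eqp T u p w g a b t : wave_flow T u p w -> smooth g -> 0 < a -> a <= b ->
  vanishes_off a b g -> T < t ->
  is_derive t 1 (fun s => \int[mu]_(r in `[a, b]) (p s r * g r))
    (- \int[mu]_(r in `[a, b]) (w t r * derive1 g r)).
Proof.
move=> wf sg a0 ab g0 tT.
have sg0 := vanishes_supported (smooth_cont sg) g0.
have sg1 := smooth_derive1 sg; have g10 := vanishes_off_derive g0.
apply: derive_near (derive_opp (flow_eq1 wf sg1 a0 ab g10 tT)).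
near=> s; rewrite -(integration_by_parts_supported (flow_primitive wf _) sg a0 ab sg0)//.
near: s; exact: lt_nbhsr.
Unshelve. all: by end_near. Qed.

Lemma locally_square_summable_force u p : continuous_pos u -> locally_square_summable p ->
  locally_square_summable (wave_force u p).
Proof.
move=> cu sp; apply: locally_square_summableB.
  have := locally_square_summableMr (@continuous_pos_inv1 R) sp.
  by under eq_fun do rewrite mulrC.
apply/continuous_pos_square_summable/continuous_posM; first exact: continuous_pos_cst.
have -> : (fun x => sin (2 * u x) / (2 * x ^+ 2)) = (fun x => sin (2 * u x) * (2^-1 * x ^- 2)).
  by apply/funext => x; rewrite invfM.
apply: continuous_posM.
  by apply/continuous_pos_sin/continuous_posM => //; exact: continuous_pos_cst.
apply: continuous_posM; [exact: continuous_pos_cst|exact: continuous_pos_inv].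
Qed.

Lemma Rintegral_shrink a b a' b' f : a' <= a -> b <= b' ->
  (forall x, ~~ (a <= x <= b) -> f x = 0) ->
  \int[mu]_(x in `[a', b']) f x = \int[mu]_(x in `[a, b]) f x.
Proof.
move=> aa bb f0; apply: Rintegral_zero => //; first exact: sub_segment.
by move=> x _ /= xn; apply: f0; apply/negP => xab; apply: xn; rewrite in_itv.
Qed.

Lemma force_sqr_le (x y z r : R) : `|y| <= 1 ->
  (x / r - z * (y / (2 * r ^+ 2))) ^+ 2 <= 2 * r^-1 ^+ 2 * x ^+ 2 + 2 * (z * r^-1 ^+ 2) ^+ 2.
Proof.
move=> y1; rewrite invfM -exprVn.
have y2 : y ^+ 2 <= 1 by rewrite -(real_normK (num_real y)) expr_le1.
have -> : x / r - z * (y * (2^-1 * r^-1 ^+ 2)) = x / r + - (2^-1 * y) * (z * r^-1 ^+ 2) by ring.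
move: (z * r^-1 ^+ 2) => q; move: r^-1 => i.
have : 0 <= q ^+ 2 by exact: sqr_ge0.
have := sqr_ge0 (x * i - - (2^-1 * y) * q); nra.
Qed.

(** As [sg ^+ 2 = 1], the combination [w + sg * p] solves the transport equation
    [L_t - sg * L_r = wave_force u p], so [transport_square] applies to its restriction to a
    window. *)
Lemma flow_square T u p w sg g a b t : wave_flow T u p w -> sg ^+ 2 = 1 -> smooth g ->
  0 < a -> a <= b -> vanishes_off a b g -> T < t ->
  is_derive t 1 (fun s => \int[mu]_(r in `[a, b]) (g r * (w s r + sg * p s r) ^+ 2))
    (2 * \int[mu]_(r in `[a, b]) (g r * wave_force (u t) (p t) r * (w t r + sg * p t r))
     - sg * \int[mu]_(r in `[a, b]) (derive1 g r * (w t r + sg * p t r) ^+ 2)).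
Proof.
move=> wf s2 smg a0 ab g0 tT.
(* [transport_square] needs three margins on each side; here each of them is [a / 6]. *)
pose A := a / 2; pose B := b + a / 2.
have A0 : 0 < A by rewrite divr_gt0.
have Aa : A <= a by rewrite /A; lra.
have bB : b <= B by rewrite /B; lra.
have AB : A <= B by rewrite (le_trans Aa)// (le_trans ab).
pose L s r := ((fun r => w s r + sg * p s r) \_ `[A, B]) r.
pose F s r := (wave_force (u s) (p s) \_ `[A, B]) r.
pose eta := t - T; have eta0 : 0 < eta by rewrite subr_gt0.
have inT s : `|s - t| < eta -> T < s.
  by rewrite ltr_norml => /andP[+ _]; rewrite /eta opprB ltrD2r.
pose E := 8 * k%:R / A; have E0 : 0 <= E by rewrite divr_ge0 ?mulr_ge0// ltW.
pose Kf := 2 * A^-1 ^+ 2 * E + 2 * (k%:R ^+ 2 * A^-1 ^+ 2) ^+ 2 * (B - A).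
have Kf0 : 0 <= Kf.
  apply: addr_ge0; first exact: mulr_ge0 (mulr_ge0 (ler0n _ 2) (sqr_ge0 _)) E0.
  by apply: mulr_ge0 (mulr_ge0 (ler0n _ 2) (sqr_ge0 _)) _; rewrite subr_ge0.
(* The summand 1 gives [K <= K ^+ 2], so that one constant bounds both squared norms. *)
pose K := 1 + 2 * E + Kf.
have K1 : 1 <= K by rewrite /K; lra.
have KK : K <= K ^+ 2 by rewrite expr2 ler_peMr//; lra.
have sw s : T < s -> locally_square_summable (fun r => w s r + sg * p s r).
  move=> sT; apply: locally_square_summableD; first exact: (flow_w wf sT).
  apply: (locally_square_summableMr (@continuous_pos_cst R sg)); exact: (flow_p wf sT).
have cu s : T < s -> continuous_pos (u s) by move=> /(flow_primitive wf)/primitive_cont.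
have sf s : T < s -> locally_square_summable (wave_force (u s) (p s)).
  by move=> sT; apply: locally_square_summable_force; [exact: cu|exact: (flow_p wf sT)].
have Iwp s : T < s -> summable_on `[A, B] (fun r => w s r ^+ 2 + p s r ^+ 2).
  move=> sT; apply: locally_summableD => //; apply: locally_summable_sqr.
    exact: (flow_w wf sT).
  exact: (flow_p wf sT).
have sL s : `|s - t| < eta -> square_summable_on setT (L s).
  by move=> /inT sT; apply: square_summable_patch; exact: sw.
have sF s : `|s - t| < eta -> square_summable_on setT (F s).
  by move=> /inT sT; apply: square_summable_patch; exact: sf.
have one (f : R -> R) : \int[mu]_x ((f \_ `[A, B]) x ^+ 2) = \int[mu]_(x in `[A, B]) (f x ^+ 2).
  have := Rintegral_patch_sqr `[A, B] f (fun=> 1).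
  under eq_Rintegral do rewrite mul1r.
  by under [X in _ = X -> _]eq_Rintegral do rewrite mul1r.
have LK s : `|s - t| < eta -> \int[mu]_x (L s x ^+ 2) <= K ^+ 2.
  move=> /inT sT; rewrite one.
  apply: (@le_trans _ _ (\int[mu]_(r in `[A, B]) (2 * (w s r ^+ 2 + p s r ^+ 2)))).
    apply: le_Rintegral_segment; first by case: (sw s sT A B A0).
      by apply: summableZ => //; exact: Iwp.
    move=> r _; have := sqr_ge0 (w s r - sg * p s r).
    have -> : (w s r - sg * p s r) ^+ 2 = w s r ^+ 2 - 2 * sg * w s r * p s r + sg ^+ 2 * p s r ^+ 2 by ring.
    have -> : (w s r + sg * p s r) ^+ 2 = w s r ^+ 2 + 2 * sg * w s r * p s r + sg ^+ 2 * p s r ^+ 2 by ring.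
    by rewrite s2; lra.
  rewrite RintegralZl//; last exact: Iwp.
  have := flow_energy_wp wf sT A0 AB; rewrite -/E => H.
  apply: le_trans KK; apply: (@le_trans _ _ (2 * E)); first by rewrite ler_pM2l.
  by rewrite /K; lra.
have FK s : `|s - t| < eta -> \int[mu]_x (F s x ^+ 2) <= K ^+ 2.
  move=> /inT sT; rewrite one.
  have Ip : summable_on `[A, B] (fun r => p s r ^+ 2) by case: (flow_p wf sT B A0).
  have Iw : summable_on `[A, B] (fun r => w s r ^+ 2) by case: (flow_w wf sT B A0).
  have Ic : summable_on `[A, B] (fun=> 2 * (k%:R ^+ 2 * A^-1 ^+ 2) ^+ 2 : R).
    by apply: continuous_pos_summable => //; exact: continuous_pos_cst.
  have Ip2 : summable_on `[A, B] (fun r => 2 * A^-1 ^+ 2 * p s r ^+ 2) by exact: summableZ.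
  apply: (@le_trans _ _ (\int[mu]_(r in `[A, B]) (2 * A^-1 ^+ 2 * p s r ^+ 2 + 2 * (k%:R ^+ 2 * A^-1 ^+ 2) ^+ 2))).
    apply: le_Rintegral_segment; first by case: (sf s sT A B A0).
      exact: summableD.
    move=> r /andP[Ar rB]; have r0 : 0 < r by exact: lt_le_trans Ar.
    have ri : 0 <= r^-1 by rewrite invr_ge0 ltW.
    have rA : r^-1 <= A^-1 by rewrite lef_pV2.
    have rA2 : r^-1 ^+ 2 <= A^-1 ^+ 2 by rewrite lerXn2r ?nnegrE// invr_ge0 ltW.
    apply: le_trans (force_sqr_le _ _ _ _) _.
      by rewrite ler_norml sin_geN1 sin_le1.
    apply: lerD.
      by rewrite ler_wpM2r ?sqr_ge0// ler_pM2l.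
    have kr : 0 <= k%:R ^+ 2 * r^-1 ^+ 2 by exact: mulr_ge0 (sqr_ge0 _) (sqr_ge0 _).
    have kA : 0 <= k%:R ^+ 2 * A^-1 ^+ 2 by exact: mulr_ge0 (sqr_ge0 _) (sqr_ge0 _).
    by rewrite ler_pM2l// lerXn2r ?nnegrE// ler_wpM2l ?sqr_ge0.
  rewrite RintegralD// RintegralZl// Rintegral_cst_segment//.
  apply: le_trans KK; apply: (@le_trans _ _ Kf); last by rewrite /K; lra.
  rewrite lerD2r; apply: ler_wpM2l; first exact: mulr_ge0 (ler0n _ 2) (sqr_ge0 _).
  apply: le_trans (flow_energy_wp wf sT A0 AB).
  apply: le_Rintegral_segment => //; first exact: Iwp.
  by move=> r _; rewrite lerDr sqr_ge0.
have tr (h : R -> R) s : smooth h -> vanishes_off A B h -> `|s - t| < eta ->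
    is_derive s 1 (fun s => \int[mu]_x (L s x * h x))
    (\int[mu]_x (F s x * h x) - sg * \int[mu]_x (L s x * derive1 h x)).
  move=> sh h0 /inT sT; rewrite !Rintegral_patch.
  have d1 := flow_eq2 wf sh A0 AB h0 sT; have d2 := flow_eqp wf sh A0 AB h0 sT.
  have split_int s' h' : T < s' -> continuous_pos h' ->
      \int[mu]_(x in `[A, B]) ((w s' x + sg * p s' x) * h' x) =
      \int[mu]_(x in `[A, B]) (w s' x * h' x) + sg * \int[mu]_(x in `[A, B]) (p s' x * h' x).
    move=> sT' ch'.
    have Iw : summable_on `[A, B] (fun r => w s' r * h' r).
      by apply: (locally_summableMl ch' (locally_square_summable_summable (flow_w wf sT'))).
    have Ip : summable_on `[A, B] (fun r => p s' r * h' r).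
      by apply: (locally_summableMl ch' (locally_square_summable_summable (flow_p wf sT'))).
    have Isp : summable_on `[A, B] (fun r => sg * (p s' r * h' r)) by exact: summableZ.
    rewrite -RintegralZl// -RintegralD//; apply: eq_Rintegral => x _; by ring.
  have := derive_add d1 (derive_cmul sg d2).
  rewrite split_int//; last exact/smooth_pos/smooth_derive1.
  move=> H; have {H} : is_derive s 1 (fun s' => \int[mu]_(x in `[A, B]) (w s' x * h x) + sg * \int[mu]_(x in `[A, B]) (p s' x * h x))
     (\int[mu]_(x in `[A, B]) (wave_force (u s) (p s) x * h x) -
    sg * (\int[mu]_(x in `[A, B]) (w s x * derive1 h x) + sg * \int[mu]_(x in `[A, B]) (p s x * derive1 h x))).
    apply: (is_derive_eq H); rewrite mulrDr mulrA -expr2 s2 mul1r; by ring.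
  apply: derive_near; near=> s'; rewrite /L Rintegral_patch split_int//; last exact: smooth_pos.
  by near: s'; exact: lt_nbhsr.
have rho0 : 0 < a / 6 by rewrite divr_gt0.
have e1 : A + 3 * (a / 6) = a by rewrite /A; field.
have e2 : B - 3 * (a / 6) = b by rewrite /B; field.
have := transport_square eta0 (le_trans ler01 K1) A0 sL sF LK FK tr rho0.
rewrite e1 e2 => /(_ ab g smg g0).
have van h f : vanishes_off a b h -> \int[mu]_x (h x * (f \_ `[A, B]) x ^+ 2) =
   \int[mu]_(x in `[a, b]) (h x * f x ^+ 2).
  move=> h0; rewrite Rintegral_patch_sqr; apply: Rintegral_shrink => // x /h0 ->.
  by rewrite mul0r.
rewrite van; last exact: vanishes_off_derive.
have -> : \int[mu]_x (g x * F t x * L t x) =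
    \int[mu]_(r in `[a, b]) (g r * wave_force (u t) (p t) r * (w t r + sg * p t r)).
  rewrite -(@Rintegral_shrink a b A B)//; last by move=> x /g0 ->; rewrite !mul0r.
  rewrite [RHS]Rintegral_mkcond; apply: eq_Rintegral => x _.
  by rewrite /F /L !patchE; case: ifP => // _; rewrite !mulr0.
apply: derive_near; near=> s; exact: van.
Unshelve. all: by end_near. Qed.

Lemma Rintegral_lin2 a b c d f g : 0 < a -> locally_summable f -> locally_summable g ->
  \int[mu]_(x in `[a, b]) (c * f x + d * g x) =
  c * \int[mu]_(x in `[a, b]) f x + d * \int[mu]_(x in `[a, b]) g x.
Proof.
move=> a0 If Ig; have {}If := If a b a0; have {}Ig := Ig a b a0.
have I1 : summable_on `[a, b] (fun x => c * f x) by exact: summableZ.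
have I2 : summable_on `[a, b] (fun x => d * g x) by exact: summableZ.
by rewrite RintegralD// !RintegralZl.
Qed.

Lemma locally_summableZ c f : locally_summable f -> locally_summable (fun x => c * f x).
Proof. exact/locally_summableMr/continuous_pos_cst. Qed.

(** Polarisation: [4 * w * p] is the difference of the squares of [w + p] and [w - p], to which
    [flow_square] applies with both signs. *)
Lemma flow_wp T u p w g a b t : wave_flow T u p w -> smooth g ->
  0 < a -> a <= b -> vanishes_off a b g -> T < t ->
  is_derive t 1 (fun s => \int[mu]_(r in `[a, b]) (g r * (w s r * p s r)))
    (\int[mu]_(r in `[a, b]) (g r * (wave_force (u t) (p t) r * p t r))
     - 2^-1 * \int[mu]_(r in `[a, b]) (derive1 g r * (w t r ^+ 2 + p t r ^+ 2))).
Proof.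
move=> wf sg a0 ab g0 tT.
have d1 := flow_square wf (expr1n _ 2) sg a0 ab g0 tT.
have d2 := flow_square wf (etrans (sqrrN 1) (expr1n _ 2)) sg a0 ab g0 tT.
have sp s c : T < s -> locally_square_summable (fun r => w s r + c * p s r).
  move=> sT; apply: locally_square_summableD; first exact: (flow_w wf sT).
  apply: (locally_square_summableMr (@continuous_pos_cst R c)); exact: (flow_p wf sT).
have I h c s : continuous_pos h -> T < s ->
    locally_summable (fun r => h r * (w s r + c * p s r) ^+ 2).
  by move=> ch sT; apply: locally_summableMr => //; exact: locally_summable_sqr (sp s c sT).
have cg := smooth_pos sg; have cg' := smooth_pos (smooth_derive1 sg).
have H := derive_cmul 4^-1 (derive_sub d1 d2).
have cu := primitive_cont (flow_primitive wf tT).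
have sF := locally_square_summable_force cu (flow_p wf tT).
have IF c : locally_summable (fun r => g r * wave_force (u t) (p t) r * (w t r + c * p t r)).
  have := locally_summableMr cg (locally_summable_squareM sF (sp t c tT)).
  by under eq_fun do rewrite mulrA.
apply: derive_near (is_derive_eq H _).
  near=> s; have sT : T < s by near: s; exact: lt_nbhsr.
  have J1 := I g 1 s cg sT; have J2 := I g (-1) s cg sT.
  rewrite -[X in 4^-1 * X](_ : 1 * \int[mu]_(r in `[a, b]) (g r * (w s r + 1 * p s r) ^+ 2) +
    (-1) * \int[mu]_(r in `[a, b]) (g r * (w s r + -1 * p s r) ^+ 2) = _); last by ring.
  rewrite -Rintegral_lin2// -RintegralZl//; last first.
    by apply: (locally_summableD (locally_summableZ 1 J1) (locally_summableZ (-1) J2)).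
  by apply: eq_Rintegral_segment => r _; field.
have K1 := I _ 1 t cg' tT; have K2 := I _ (-1) t cg' tT.
rewrite [LHS](_ : _ = 2^-1 * \int[mu]_(r in `[a, b]) (g r * wave_force (u t) (p t) r * (w t r + 1 * p t r)) +
   (- 2^-1) * \int[mu]_(r in `[a, b]) (g r * wave_force (u t) (p t) r * (w t r + -1 * p t r)) -
   2^-1 * (2^-1 * \int[mu]_(r in `[a, b]) (derive1 g r * (w t r + 1 * p t r) ^+ 2) +
  2^-1 * \int[mu]_(r in `[a, b]) (derive1 g r * (w t r + -1 * p t r) ^+ 2))); last by field.
rewrite -!Rintegral_lin2//; congr (_ - 2^-1 * _).
  by apply: eq_Rintegral_segment => r _; field.
by apply: eq_Rintegral_segment => r _; field.
Unshelve. all: by end_near. Qed.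

Lemma sin_double x : sin (2 * x) = 2 * (sin x * cos x).
Proof. by rewrite mulr_natl sin_mulr2n -mulr_natl (mulrC (cos x)). Qed.

Lemma primitive_sin f f' : primitive f f' ->
  primitive (fun r => sin (f r)) (fun r => cos (f r) * f' r).
Proof.
move=> pf; apply: (@primitive_comp _ _ _ sin cos) => //.
exact/continuous_pos_cos/(primitive_cont pf).
Qed.

Lemma primitive_cos f f' : primitive f f' ->
  primitive (fun r => cos (f r)) (fun r => - sin (f r) * f' r).
Proof.
move=> pf; apply: (@primitive_comp _ _ _ cos (fun x => - sin x)) => //.
exact/continuous_posN/continuous_pos_sin/(primitive_cont pf).
Qed.

(** The Bogomolny defect. For [c = k] it vanishes on the maps [Q k (r / l)], for [c = - k] on their
    reflections [pi - Q k (r / l)]. *)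
Definition defect c (u p : R -> R) r := r * p r - c * sin (u r).

Lemma locally_square_summable_defect c u p : continuous_pos u -> locally_square_summable p ->
  locally_square_summable (defect c u p).
Proof.
move=> cu sp; apply: locally_square_summableB.
  exact: (locally_square_summableMr (@continuous_pos_id R) sp).
apply/continuous_pos_square_summable/continuous_posM; first exact: continuous_pos_cst.
exact: continuous_pos_sin.
Qed.

(** The multiplier is [phi * r * u_r] for the measure [r dr]. The potential term is integrated by
    parts onto [phi], and in front of [derive1 phi] there appears
    [(r * p) ^+ 2 - k ^+ 2 * sin u ^+ 2], which equals [H ^+ 2 + 2 * k * sin u * H] for the defect
    [H]. *)
Lemma flow_virial T u p w phi a b t : wave_flow T u p w -> smooth phi ->
  0 < a -> a <= b -> vanishes_off a b phi -> T < t ->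
  is_derive t 1 (fun s => \int[mu]_(r in `[a, b]) (r ^+ 2 * phi r * (w s r * p s r)))
    (- (\int[mu]_(r in `[a, b]) (phi r * (r * w t r ^+ 2)))
     - 2^-1 * \int[mu]_(r in `[a, b]) (derive1 phi r * ((r * w t r) ^+ 2
        + defect k%:R (u t) (p t) r ^+ 2
        + 2 * k%:R * (sin (u t r) * defect k%:R (u t) (p t) r)))).
Proof.
move=> wf sphi a0 ab phi0 tT.
have sg : smooth (fun r => r ^+ 2 * phi r) by apply: smoothM => //; exact: smoothX.
have g0 : vanishes_off a b (fun r => r ^+ 2 * phi r) by move=> r /phi0 ->; rewrite mulr0.
have dg : derive1 (fun r => r ^+ 2 * phi r) = fun r => 2 * r * phi r + r ^+ 2 * derive1 phi r.
  apply/funext => r; apply: is_derive1E; apply: derive_mul (derive_pow 2 r) (smooth_derive r sphi).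
apply: (is_derive_eq (flow_wp wf sg a0 ab g0 tT)).
rewrite dg.
have pu := flow_primitive wf tT; have cu := primitive_cont pu.
have sp := flow_p wf tT; have sw := flow_w wf tT.
have cphi := smooth_pos sphi; have cphi' := smooth_pos (smooth_derive1 sphi).
have psin : primitive (fun r => sin (u t r)) (fun r => cos (u t r) * p t r).
  exact: primitive_sin.
have ibp := integration_by_parts_supported (primitiveM psin psin) sphi a0 ab
  (vanishes_supported (smooth_cont sphi) phi0).
have Iw := locally_summable_sqr sw; have Ip := locally_summable_sqr sp.
have c1 : continuous_pos (fun r => r * phi r) by apply: continuous_posM => //; exact: continuous_pos_id.
have c2 : continuous_pos (fun r => r ^+ 2 * derive1 phi r).
  by apply: continuous_posM => //; exact/continuous_posX/continuous_pos_id.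
have cs := continuous_pos_sin cu; have cc := continuous_pos_cos cu.
have Iw1 := locally_summableMr c1 Iw; have Ip1 := locally_summableMr c1 Ip.
have Iw2 := locally_summableMr c2 Iw; have Ip2 := locally_summableMr c2 Ip.
have Is := locally_summableMr (continuous_posM cphi (continuous_posM cs cc)) (locally_square_summable_summable sp).
have Iq := continuous_pos_summable (continuous_posM (continuous_posM cs cs) cphi').
have -> : \int[mu]_(r in `[a, b]) (r ^+ 2 * phi r * (wave_force (u t) (p t) r * p t r)) =
   1 * \int[mu]_(r in `[a, b]) (r * phi r * p t r ^+ 2) +
   (- k%:R ^+ 2) * \int[mu]_(r in `[a, b]) (phi r * (sin (u t r) * cos (u t r)) * p t r).
  rewrite -Rintegral_lin2//; apply: eq_Rintegral_segment => r /andP[ar _].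
  rewrite /wave_force sin_double; field.
  by rewrite gt_eqF// (lt_le_trans a0).
have -> : \int[mu]_(x in `[a, b])
     ((2 * x * phi x + x ^+ 2 * derive1 phi x) * (w t x ^+ 2 + p t x ^+ 2)) =
  2 * (1 * \int[mu]_(r in `[a, b]) (r * phi r * w t r ^+ 2) + 1 * \int[mu]_(r in `[a, b]) (r * phi r * p t r ^+ 2)) +
  1 * (1 * \int[mu]_(r in `[a, b]) (r ^+ 2 * derive1 phi r * w t r ^+ 2) + 1 * \int[mu]_(r in `[a, b]) (r ^+ 2 * derive1 phi r * p t r ^+ 2)).
  rewrite -!Rintegral_lin2//.
  - by apply: eq_Rintegral_segment => r _; ring.
  - exact: locally_summableD (locally_summableZ 1 Iw1) (locally_summableZ 1 Ip1).
  - exact: locally_summableD (locally_summableZ 1 Iw2) (locally_summableZ 1 Ip2).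
have -> : \int[mu]_(r in `[a, b]) (phi r * (r * w t r ^+ 2)) = \int[mu]_(r in `[a, b]) (r * phi r * w t r ^+ 2).
  by apply: eq_Rintegral_segment => r _; ring.
have -> : \int[mu]_(r in `[a, b]) (derive1 phi r * ((r * w t r) ^+ 2
        + defect k%:R (u t) (p t) r ^+ 2
        + 2 * k%:R * (sin (u t r) * defect k%:R (u t) (p t) r))) =
  1 * (1 * \int[mu]_(r in `[a, b]) (r ^+ 2 * derive1 phi r * w t r ^+ 2) + 1 * \int[mu]_(r in `[a, b]) (r ^+ 2 * derive1 phi r * p t r ^+ 2))
  + (- k%:R ^+ 2) * \int[mu]_(r in `[a, b]) (sin (u t r) * sin (u t r) * derive1 phi r).
  rewrite -!Rintegral_lin2//.
    by apply: eq_Rintegral_segment => r _; rewrite /defect; ring.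
  exact: locally_summableD (locally_summableZ 1 Iw2) (locally_summableZ 1 Ip2).
have -> : \int[mu]_(x in `[a, b]) (sin (u t x) * sin (u t x) * derive1 phi x) =
   - (2 * \int[mu]_(r in `[a, b]) (phi r * (sin (u t r) * cos (u t r)) * p t r)).
  rewrite -RintegralZl//; last exact: Is.
  apply: oppr_inj; rewrite -ibp opprK; apply: eq_Rintegral_segment => r _; ring.
by field.
Qed.

Lemma expVS r n : 0 < r -> r ^- n = r ^- n.+1 * r.
Proof.
move=> r0; have := expf_neq0 n (lt0r_neq0 r0); rewrite exprS.
by move=> n0; field; rewrite n0 gt_eqF.
Qed.

Lemma Rintegral_lin4 a b c1 c2 c3 c4 f1 f2 f3 f4 : 0 < a -> locally_summable f1 ->
  locally_summable f2 -> locally_summable f3 -> locally_summable f4 ->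
  \int[mu]_(x in `[a, b]) (c1 * f1 x + c2 * f2 x + c3 * f3 x + c4 * f4 x) =
  c1 * \int[mu]_(x in `[a, b]) f1 x + c2 * \int[mu]_(x in `[a, b]) f2 x
  + c3 * \int[mu]_(x in `[a, b]) f3 x + c4 * \int[mu]_(x in `[a, b]) f4 x.
Proof.
move=> a0 I1 I2 I3 I4.
have J2 := locally_summableD (locally_summableZ c1 I1) (locally_summableZ c2 I2).
have J3 := locally_summableD J2 (locally_summableZ c3 I3).
have K4 := locally_summableZ c4 I4 b a0; have K3 := locally_summableZ c3 I3 b a0.
have {}J2 := J2 a b a0; have {}J3 := J3 a b a0.
rewrite RintegralD// (@RintegralZl _ _ _ mu)//; last exact: I4.
rewrite RintegralD// (@RintegralZl _ _ _ mu)//; last exact: I3.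
by rewrite Rintegral_lin2.
Qed.

(** The function [r ^- k] is a zero mode of the equation linearised at [u = pi]. What remains is a
    bulk term with the factor [1 + cos u], quadratically small in [pi - u], and a term on the
    support of [derive1 om]. *)
Lemma flow_linear T u p w om a b t : wave_flow T u p w -> smooth om ->
  0 < a -> a <= b -> vanishes_off a b om -> T < t ->
  is_derive t 1 (fun s => \int[mu]_(r in `[a, b]) (w s r * (om r * r ^- k * r)))
    (k%:R * \int[mu]_(r in `[a, b]) ((1 + cos (u t r)) * om r * r ^- k.+1 * defect k%:R (u t) (p t) r)
     - \int[mu]_(r in `[a, b]) (derive1 om r * r ^- k * defect k%:R (u t) (p t) r)).
Proof.
move=> wf som a0 ab om0 tT.
have oma x : x < a -> om x = 0 by move=> xa; apply: om0; rewrite negb_and -!ltNge xa.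
have sh : smooth (fun r => om r * r ^- k) by exact: smooth_expV oma som.
have h0 : vanishes_off a b (fun r => om r * r ^- k) by move=> r /om0 ->; rewrite mul0r.
have sg : smooth (fun r => om r * r ^- k * r) by apply: smoothM => //; exact: smooth_id.
have g0 : vanishes_off a b (fun r => om r * r ^- k * r) by move=> r /h0 ->; rewrite mul0r.
pose h' r := derive1 om r * r ^- k + om r * (- k%:R * r ^- k.+1).
have dh : derive1 (fun r => om r * r ^- k) = h'.
  by apply/funext => r; apply: is_derive1E; exact: derive_expV_vanish oma som.
have dg : derive1 (fun r => om r * r ^- k * r) = fun r => h' r * r + om r * r ^- k.
  apply/funext => r; apply: is_derive1E.
  rewrite -dh -[X in _ + X]mulr1.
  exact: derive_mul (smooth_derive r sh) (is_derive_id r 1).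
apply: (is_derive_eq (flow_eq2 wf sg a0 ab g0 tT)); rewrite dg.
have pu := flow_primitive wf tT; have cu := primitive_cont pu.
have sp := flow_p wf tT; have Ip := locally_square_summable_summable sp.
have com := smooth_pos som; have com' := smooth_pos (smooth_derive1 som).
have cs := continuous_pos_sin cu; have cc := continuous_pos_cos cu.
have sF := locally_square_summable_force cu sp.
have sH := locally_square_summable_defect k%:R cu sp.
have psin := primitive_sin pu.
have ibp := integration_by_parts_supported psin sh a0 ab (vanishes_supported (smooth_cont sh) h0).
rewrite dh in ibp.
have ch := smooth_pos sh; have cg := smooth_pos sg.
have ch' : continuous_pos h' by rewrite -dh; exact/smooth_pos/smooth_derive1.
have cg' : continuous_pos (fun r => h' r * r + om r * r ^- k).
  by rewrite -dg; exact/smooth_pos/smooth_derive1.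
have I1 := locally_summableMl cg (locally_square_summable_summable sF).
have I2 := locally_summableMl cg' Ip.
have I3 := locally_summableMl ch psin.1.
have I4 := continuous_pos_summable (continuous_posM cs ch').
have I5 : locally_summable (fun r => (1 + cos (u t r)) * om r * r ^- k.+1 * defect k%:R (u t) (p t) r).
  apply: locally_summableMr (locally_square_summable_summable sH).
  apply: continuous_posM; last exact: continuous_pos_inv.
  by apply: continuous_posM com; apply: continuous_posD => //; exact: continuous_pos_cst.
have I6 : locally_summable (fun r => derive1 om r * r ^- k * defect k%:R (u t) (p t) r).
  apply: locally_summableMr (locally_square_summable_summable sH).
  by apply: continuous_posM; last exact: continuous_pos_inv.
(* The last two summands cancel by [ibp]; with them added the integrands on both sides agree
   pointwise. *)
rewrite [LHS](_ : _ = 1 * \int[mu]_(r in `[a, b]) (wave_force (u t) (p t) r * (om r * r ^- k * r)) +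
  (- 1) * \int[mu]_(r in `[a, b]) (p t r * (h' r * r + om r * r ^- k)) +
  k%:R * \int[mu]_(x in `[a, b]) (cos (u t x) * p t x * (om x * x ^- k)) +
  k%:R * \int[mu]_(x in `[a, b]) (sin (u t x) * h' x)); last first.
  by rewrite ibp; ring.
rewrite [RHS](_ : _ = k%:R * \int[mu]_(r in `[a, b]) ((1 + cos (u t r)) * om r * r ^- k.+1 * defect k%:R (u t) (p t) r) +
   (-1) * \int[mu]_(r in `[a, b]) (derive1 om r * r ^- k * defect k%:R (u t) (p t) r)); last by ring.
rewrite -Rintegral_lin4// -Rintegral_lin2//.
apply: eq_Rintegral_segment => r /andP[ar _]; have r0 := lt_le_trans a0 ar.
rewrite /h' /defect /wave_force sin_double (expVS k r0); move: (r ^- k.+1) => i.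
by field; rewrite gt_eqF.
Qed.

End Flow.

(** * Profiles close to the two-bubble *)

Section Profile.
Context (R : realType).
Local Notation mu := (@lebesgue_measure R).
Implicit Types (f g h E : R -> R) (a b c d e r s x y z : R).

Lemma norm_sin_le x : `|sin x| <= `|x|.
Proof.
have := @mean_value_bound R sin cos x 1; rewrite sin0 subr0 mul1r; apply => y _.
exact: cos_max.
Qed.

Lemma cos_ge_quadratic x : 1 - x ^+ 2 / 2 <= cos x.
Proof.
have -> : cos x = cos ((x / 2) *+ 2) by congr cos; rewrite mulr2n; field.
rewrite cos_mulr2n cos2sin2.
have := norm_sin_le (x / 2); rewrite -(@ler_pXn2r _ 2)// ?nnegrE// !real_normK ?num_real//.
by rewrite -[(1 - _) *+ 2]mulr_natl expr_div_n; lra.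
Qed.

Lemma sin_cubic x : `|x - sin x| <= `|x| ^+ 3.
Proof.
pose f y : R := y - sin y.
have d y : is_derive y 1 f (1 - cos y) by exact: derive_sub.
have := @mean_value_bound R f (fun y => 1 - cos y) x (`|x| ^+ 2) (fun y _ => d y).
rewrite /f sin0 subrr subr0 -exprSr; apply => y yx.
rewrite ger0_norm ?subr_ge0 ?cos_le1//.
have := cos_ge_quadratic y.
have : y ^+ 2 <= `|x| ^+ 2 by rewrite -(real_normK (num_real y)) lerXn2r ?nnegrE.
have := sqr_ge0 y; lra.
Qed.

Lemma cos_ge_half x : `|x| <= 1 / 2 -> 7 / 8 <= cos x.
Proof.
move=> x2; have := cos_ge_quadratic x.
have : x ^+ 2 <= (1 / 2) ^+ 2 by rewrite -(real_normK (num_real x)) lerXn2r ?nnegrE.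
rewrite expr_div_n; lra.
Qed.

(* tan (x / 2) *)
Definition half_tan x : R := sin x / (1 + cos x).

Lemma sin_half_tan x : `|x| <= 1 / 2 -> sin x = half_tan x * (1 + cos x).
Proof. by move=> /cos_ge_half ?; rewrite /half_tan divfK// gt_eqF//; lra. Qed.

Lemma norm_half_tan_le x : `|x| <= 1 / 2 -> `|half_tan x| <= `|x|.
Proof.
move=> x2; have c := cos_ge_half x2; have p : 0 < 1 + cos x by lra.
rewrite /half_tan normrM normfV (gtr0_norm p) ler_pdivrMr//.
apply: le_trans (norm_sin_le x) _; rewrite ler_peMr//; lra.
Qed.

(** The difference [sin x - 2 * half_tan x] is [half_tan x * (cos x - 1)], a product of a linear and
    a quadratic quantity. *)
Lemma half_tan_approx x : `|x| <= 1 / 2 ->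
  `|sin x - 2 * half_tan x| <= `|x| ^+ 3 /\ `|x - 2 * half_tan x| <= 2 * `|x| ^+ 3.
Proof.
move=> x2; have H : `|sin x - 2 * half_tan x| <= `|x| ^+ 3.
  rewrite (sin_half_tan x2) mulrC -mulrBl normrM.
  have c := cos_le1 x; have c2 := cos_ge_quadratic x.
  rewrite (_ : `|1 + cos x - 2| = 1 - cos x); last by rewrite ler0_norm; lra.
  have p : 0 <= 1 - cos x by lra.
  have le : 1 - cos x <= `|x| ^+ 2.
    by rewrite (real_normK (num_real x)); have := sqr_ge0 x; lra.
  by rewrite exprSr; apply: ler_pM => //; exact: norm_half_tan_le.
split => //; rewrite [X in `|X|](_ : _ = (x - sin x) + (sin x - 2 * half_tan x)); last by ring.
by rewrite (le_trans (ler_normD _ _))//; have := sin_cubic x; lra.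
Qed.

Lemma norm_le_half_tan x : `|x| <= 1 / 2 -> `|x| <= 4 * `|half_tan x|.
Proof.
move=> x2; have [_ H] := half_tan_approx x2.
have H1 : `|x| ^+ 3 <= `|x| * (1 / 2) ^+ 2.
  by rewrite exprS ler_wpM2l// lerXn2r ?nnegrE.
have := ler_normB (x - 2 * half_tan x) (- (2 * half_tan x)).
rewrite opprK subrK normrN (normrM 2) (@ger0_norm _ 2)//.
move: H1; rewrite expr_div_n; lra.
Qed.

Lemma one_sub_cos x : `|x| <= 1 / 2 -> 1 - cos x <= 2 * half_tan x ^+ 2.
Proof.
move=> x2; have c := cos_ge_half x2; have p : 0 < 1 + cos x by lra.
have E : 1 - cos x = half_tan x ^+ 2 * (1 + cos x).
  rewrite /half_tan expr_div_n sin2cos2; field; lra.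
rewrite E mulrC ler_wpM2r ?sqr_ge0//; have := cos_le1 x; lra.
Qed.

Lemma weighted_Cauchy_Schwarz a b f g : 0 < a -> locally_square_summable f ->
  locally_square_summable g ->
  (\int[mu]_(x in `[a, b]) (f x * g x / x)) ^+ 2 <=
  (\int[mu]_(x in `[a, b]) (f x ^+ 2 / x)) * (\int[mu]_(x in `[a, b]) (g x ^+ 2 / x)).
Proof.
move=> a0 sf sg; pose s x : R := Num.sqrt x^-1.
have cs : continuous_pos s.
  apply: (@continuous_pos_comp R (@Num.sqrt R) (fun x => x^-1)); first exact: sqrt_continuous.
  exact: continuous_pos_inv1.
have ss x : 0 < x -> s x ^+ 2 = x^-1 by move=> x0; rewrite sqr_sqrtr// invr_ge0 ltW.
have := Cauchy_Schwarz (measurable_segment a b) (locally_square_summableMr cs sf b a0)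
  (locally_square_summableMr cs sg b a0).
rewrite (@eq_Rintegral_segment _ _ (fun x => f x * g x / x)); last first.
  by move=> x /andP[ax _]; rewrite -(ss _ (lt_le_trans a0 ax)); ring.
rewrite (@eq_Rintegral_segment _ (fun x => (s x * f x) ^+ 2) (fun x => f x ^+ 2 / x)); last first.
  by move=> x /andP[ax _]; rewrite -(ss _ (lt_le_trans a0 ax)); ring.
rewrite (@eq_Rintegral_segment _ (fun x => (s x * g x) ^+ 2) (fun x => g x ^+ 2 / x))//.
by move=> x /andP[ax _]; rewrite -(ss _ (lt_le_trans a0 ax)); ring.
Qed.

Lemma locally_summable_div f : locally_summable f -> locally_summable (fun x => f x / x).
Proof. exact/locally_summableMl/continuous_pos_inv1. Qed.

(** The half-angle tangent linearises [r f' = - s sin f]: it satisfies [r q' = - s q]. The function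
    [E], a multiple of [x] to the power [s], is the integrating factor, so the product [E * q]
    changes only through the defect. *)
Lemma half_tan_increment E s f f' a b : (forall x, 0 < x -> is_derive x 1 E (s * E x / x)) ->
  primitive f f' -> (forall x, 0 < x -> `|f x| <= 1 / 2) -> 0 < a -> a <= b ->
  E b * half_tan (f b) - E a * half_tan (f a) =
  \int[mu]_(x in `[a, b]) (E x / (1 + cos (f x)) * (x * f' x + s * sin (f x)) / x).
Proof.
move=> dE pf f2 a0 ab; have cf := primitive_cont pf.
have cE : continuous_pos E.
  move=> x x0; apply: differentiable_continuous; apply/derivable1_diffP.
  by have [] := dE x x0.
have pE : primitive E (fun x => s * E x / x).
  apply: primitive_derive => //; apply: continuous_posM; last exact: continuous_pos_inv1.
  by apply: continuous_posM => //; exact: continuous_pos_cst.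
have pos x : 0 < x -> 0 < 1 + cos (f x) by move=> /f2/cos_ge_half; lra.
have cI : continuous_pos (fun x => (1 + cos (f x))^-1).
  apply: continuous_posV; last by move=> x /pos/lt0r_neq0.
  by apply: continuous_posD; [exact: continuous_pos_cst|exact: continuous_pos_cos].
have pq : primitive (fun x => half_tan (f x)) (fun x => (1 + cos (f x))^-1 * f' x).
  apply: (@primitive_comp _ _ _ half_tan (fun y => (1 + cos y)^-1)) => // x x0.
  have px := pos x x0; have nz : 1 + cos (f x) != 0 by rewrite gt_eqF.
  have d1 : is_derive (f x) 1 (fun y => 1 + cos y) (- sin (f x)).
    by apply: (is_derive_eq (derive_add (derive_cst 1 _) (is_derive_cos _))); rewrite add0r.
  have d2 := @is_deriveV R (fun y => 1 + cos y) (f x) _ 1 nz d1.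
  apply: (is_derive_eq (derive_mul (is_derive_sin (f x)) d2)).
  rewrite /GRing.scale/=; have := sin2cos2 (f x).
  move: (sin (f x)) => S; move: nz; move: (cos (f x)) => C nz SC.
  have -> : C * (1 + C)^-1 + S * (- (1 + C) ^- 2 * - S) = C * (1 + C)^-1 + S ^+ 2 / (1 + C) ^+ 2 by ring.
  by rewrite SC; field.
have [_ ->//] := primitiveM pE pq.
apply: eq_Rintegral_segment => x /andP[ax _]; have x0 := lt_le_trans a0 ax.
rewrite /half_tan; field; by rewrite !gt_eqF ?pos.
Qed.

(** Cauchy-Schwarz for the measure [dx / x]. Since [1 + cos f >= 15 / 8], the factor
    [(8 / 15) ^+ 2 = 64 / 225] appears, and [E ^+ 2 / x] integrates to the increment of
    [E ^+ 2 / (2 * s)]. *)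
Lemma half_tan_growth E s f f' a b : s != 0 ->
  (forall x, 0 < x -> is_derive x 1 E (s * E x / x)) ->
  primitive f f' -> locally_square_summable f' ->
  (forall x, 0 < x -> `|f x| <= 1 / 2) -> 0 < a -> a <= b ->
  (E b * half_tan (f b) - E a * half_tan (f a)) ^+ 2 <=
  64 / 225 * \int[mu]_(x in `[a, b]) ((x * f' x + s * sin (f x)) ^+ 2 / x)
   * ((E b ^+ 2 - E a ^+ 2) / (2 * s)).
Proof.
move=> s0 dE pf sf f2 a0 ab; have cf := primitive_cont pf.
rewrite (half_tan_increment dE pf f2 a0 ab).
have cE : continuous_pos E.
  move=> x x0; apply: differentiable_continuous; apply/derivable1_diffP.
  by have [] := dE x x0.
have pos x : 0 < x -> 0 < 1 + cos (f x) by move=> /f2/cos_ge_half; lra.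
have cI : continuous_pos (fun x => E x / (1 + cos (f x))).
  apply: continuous_posM => //; apply: continuous_posV; last by move=> x /pos/lt0r_neq0.
  by apply: continuous_posD; [exact: continuous_pos_cst|exact: continuous_pos_cos].
have sG : locally_square_summable (fun x => x * f' x + s * sin (f x)).
  apply: locally_square_summableD; first exact: (locally_square_summableMr (@continuous_pos_id R) sf).
  apply/continuous_pos_square_summable/continuous_posM; first exact: continuous_pos_cst.
  exact: continuous_pos_sin.
apply: le_trans (weighted_Cauchy_Schwarz b a0 (continuous_pos_square_summable cI) sG) _.
rewrite [leRHS]mulrAC ler_wpM2r//.
  apply: Rintegral_ge0_segment => x /andP[ax _].
  by rewrite divr_ge0 ?sqr_ge0// (le_trans (ltW a0)).
have pE : primitive E (fun x => s * E x / x).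
  apply: primitive_derive => //; apply: continuous_posM; last exact: continuous_pos_inv1.
  by apply: continuous_posM => //; exact: continuous_pos_cst.
have IE : locally_summable (fun x => E x ^+ 2 / x).
  by apply: locally_summable_div; exact/continuous_pos_summable/continuous_posX.
have EE : (E b ^+ 2 - E a ^+ 2) / (2 * s) = \int[mu]_(x in `[a, b]) (E x ^+ 2 / x).
  have [_ H] := primitiveM pE pE.
  rewrite !expr2 H// mulrC -RintegralZl//; last exact: (primitiveM pE pE).1.
  apply: eq_Rintegral_segment => x /andP[ax _].
  by field; rewrite s0 gt_eqF// (lt_le_trans a0).
have IE1 := IE a b a0.
rewrite EE -RintegralZl//; apply: le_Rintegral_segment.
- by apply: locally_summable_div a0; exact/continuous_pos_summable/continuous_posX.
- exact: summableZ.
move=> x /andP[ax _]; have x0 := lt_le_trans a0 ax.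
rewrite mulrA ler_wpM2r ?invr_ge0 ?(ltW x0)// expr_div_n mulrC ler_wpM2r ?sqr_ge0//.
have -> : 64 / 225 = ((15 / 8) ^+ 2)^-1 :> R by field.
have := cos_ge_half (f2 x x0) => c.
by rewrite lef_pV2 ?posrE ?exprn_gt0//; [rewrite lerXn2r ?nnegrE//; lra|lra].
Qed.

Definition clamp a b x : R := Num.max a (Num.min b x).

Lemma clamp_id a b x : a <= x <= b -> clamp a b x = x.
Proof. by move=> /andP[ax xb]; rewrite /clamp min_r// max_r. Qed.

Lemma clamp_in a b x : a <= b -> a <= clamp a b x <= b.
Proof. by move=> ab; rewrite /clamp le_max lexx/= ge_max ab ge_min lexx. Qed.

Lemma primitive_clamp f f' a b : 0 < a -> a <= b -> primitive f f' ->
  primitive (fun x => f (clamp a b x)) (f' \_ `[a, b]).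
Proof.
move=> a0 ab [If' ff'].
have I0 : summable_on setT (f' \_ `[a, b]).
  rewrite /summable_on -restrict_EFin; apply/integrable_restrict => //=.
  by rewrite setTI; exact: If'.
split; first by move=> c d _; apply: summableS I0.
move=> c d c0 cd.
have /andP[c1 c2] := clamp_in c ab; have /andP[d1 d2] := clamp_in d ab.
have ccd : clamp a b c <= clamp a b d.
  have H : Num.min b c <= Num.min b d by rewrite le_min !ge_min lexx cd orbT.
  by rewrite /clamp ge_max !le_max lexx/= H orbT.
rewrite ff'//; last exact: lt_le_trans c1.
have in1 y z x : (x \in (`[y, z]%classic : set R)) = (y <= x <= z).
  apply/idP/idP => H; first by have := set_mem H; rewrite /= ?in_itv.
  by apply: mem_set; rewrite /= ?in_itv.
have [bc|cb] := ltP b c.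
  have -> : clamp a b c = b by rewrite /clamp min_l ?max_r// ltW.
  have -> : clamp a b d = b by rewrite /clamp min_l ?max_r// ltW// (lt_le_trans bc).
  rewrite set_itv1 Rintegral_set1 (@eq_Rintegral_segment _ _ (fun=> 0)) ?Rintegral_cst ?mul0r//.
  by move=> x /andP[cx _]; rewrite patchE in1 (leNgt x) (lt_le_trans bc cx) andbF.
have [da|ad] := ltP d a.
  have -> : clamp a b d = a by rewrite /clamp max_l// ge_min (ltW da) orbT.
  have -> : clamp a b c = a by rewrite /clamp max_l// ge_min (le_trans cd (ltW da)) orbT.
  rewrite set_itv1 Rintegral_set1 (@eq_Rintegral_segment _ _ (fun=> 0)) ?Rintegral_cst ?mul0r//.
  by move=> x /andP[_ xd]; rewrite patchE in1 (leNgt a) (le_lt_trans xd da).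
have cE : clamp a b c = Num.max a c by rewrite /clamp min_r.
have dE : clamp a b d = Num.min b d by rewrite /clamp max_r// le_min ab.
rewrite [RHS](@Rintegral_zero _ `[clamp a b c, clamp a b d])//.
- apply: eq_Rintegral_segment => x /andP[x1 x2]; rewrite patchE in1 ifT//.
  by rewrite (le_trans c1 x1) (le_trans x2 d2).
- by apply: sub_segment; rewrite ?cE ?dE ?le_max ?ge_min ?lexx ?orbT.
- move=> x /=; rewrite !in_itv/= => /andP[cx xd] xn; rewrite patchE in1 ifF//.
  apply/negP => /andP[ax xb]; apply: xn.
  by rewrite cE dE ge_max le_min ax cx xb xd.
Qed.

(* Estimates on [a, b] for a function that is small there, obtained from
   half_tan_growth by freezing it outside of [a, b]. *)
Lemma half_tan_growth_segment E s f f' a b : s != 0 ->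
  (forall x, 0 < x -> is_derive x 1 E (s * E x / x)) ->
  primitive f f' -> locally_square_summable f' ->
  (forall x, a <= x <= b -> `|f x| <= 1 / 2) -> 0 < a -> a <= b ->
  (E b * half_tan (f b) - E a * half_tan (f a)) ^+ 2 <=
  64 / 225 * \int[mu]_(x in `[a, b]) ((x * f' x + s * sin (f x)) ^+ 2 / x)
   * ((E b ^+ 2 - E a ^+ 2) / (2 * s)).
Proof.
move=> s0 dE pf sf f2 a0 ab.
have sf' : locally_square_summable (f' \_ `[a, b]).
  move=> c d c0; apply: (@square_summableS _ _ setT) => //.
  by apply: square_summable_patch; exact: sf.
have := half_tan_growth s0 dE (primitive_clamp a0 ab pf) sf' (fun x _ => f2 _ (clamp_in x ab)) a0 ab.
rewrite !clamp_id ?lexx ?ab//.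
rewrite (@eq_Rintegral_segment _ _ (fun x => (x * f' x + s * sin (f x)) ^+ 2 / x))//.
move=> x xab; rewrite clamp_id// patchE ifT// inE/=; by rewrite in_itv.
Qed.

Variable k : nat.
Hypothesis k0 : (0 < k)%N.

Let k_gt0 : 0 < k%:R :> R. Proof. by rewrite ltr0n. Qed.

Lemma derive_pow_div x : 0 < x ->
  is_derive x 1 (fun x : R => x ^+ k) (k%:R * x ^+ k / x).
Proof.
move=> x0; apply: (is_derive_eq (derive_pow k x)); case: k k0 => // n _ /=.
by rewrite exprSr mulrA mulfK// gt_eqF.
Qed.

Lemma derive_inv_pow_div x : 0 < x ->
  is_derive x 1 (fun x : R => x ^- k) (- k%:R * x ^- k / x).
Proof.
move=> x0; apply: (is_derive_eq (derive_expV k (lt0r_neq0 x0))).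
by rewrite exprS invfM; ring.
Qed.

(** The integrating factor [x ^+ k], normalised at the right end [b]; its value at [a] is dropped
    from the last factor. *)
Lemma half_tan_growth_up f f' a b A : primitive f f' -> locally_square_summable f' ->
  (forall x, a <= x <= b -> `|f x| <= 1 / 2) -> 0 < a -> a <= b ->
  \int[mu]_(x in `[a, b]) ((x * f' x + k%:R * sin (f x)) ^+ 2 / x) <= A ->
  (half_tan (f b) - (a / b) ^+ k * half_tan (f a)) ^+ 2 <= 32 / 225 / k%:R * A.
Proof.
move=> pf sf f2 a0 ab HA; have b0 := lt_le_trans a0 ab.
have := half_tan_growth_segment (lt0r_neq0 k_gt0) derive_pow_div pf sf f2 a0 ab.
set I := Rintegral _ _ _ in HA * => H.
have e0 : (0 : R) < 64 / 225 by lra.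
have I0 : 0 <= I.
  apply: Rintegral_ge0_segment => x /andP[ax _].
  by rewrite divr_ge0 ?sqr_ge0// (le_trans (ltW a0)).
have B0 : 0 < (b ^+ k) ^+ 2 by rewrite !exprn_gt0.
rewrite -(ler_pM2l B0) -exprMn.
rewrite [X in X ^+ 2](_ : _ = b ^+ k * half_tan (f b) - a ^+ k * half_tan (f a)); last first.
  by rewrite expr_div_n; field; rewrite expf_neq0// gt_eqF.
apply: le_trans H _.
rewrite [leRHS](_ : _ = 64 / 225 * A * ((b ^+ k) ^+ 2 / (2 * k%:R))); last by field; rewrite gt_eqF.
apply: ler_pM.
- exact: mulr_ge0 (ltW e0) I0.
- by rewrite divr_ge0 ?mulr_ge0// subr_ge0 lerXn2r ?nnegrE ?exprn_ge0 ?lerXn2r ?nnegrE// ltW.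
- by rewrite ler_pM2l.
- by rewrite ler_pM2r ?invr_gt0 ?mulr_gt0// gerBl sqr_ge0.
Qed.

(** The integrating factor [x ^- k], normalised at the left end [a]. *)
Lemma half_tan_growth_down f f' a b A : primitive f f' -> locally_square_summable f' ->
  (forall x, a <= x <= b -> `|f x| <= 1 / 2) -> 0 < a -> a <= b ->
  \int[mu]_(x in `[a, b]) ((x * f' x - k%:R * sin (f x)) ^+ 2 / x) <= A ->
  (half_tan (f a) - (a / b) ^+ k * half_tan (f b)) ^+ 2 <= 32 / 225 / k%:R * A.
Proof.
move=> pf sf f2 a0 ab HA; have b0 := lt_le_trans a0 ab.
have s0 : - k%:R != 0 :> R by rewrite oppr_eq0 gt_eqF.
have := half_tan_growth_segment s0 derive_inv_pow_div pf sf f2 a0 ab.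
under eq_Rintegral do rewrite mulNr.
set I := Rintegral _ _ _ in HA * => H.
have e0 : (0 : R) < 64 / 225 by lra.
have I0 : 0 <= I.
  apply: Rintegral_ge0_segment => x /andP[ax _].
  by rewrite divr_ge0 ?sqr_ge0// (le_trans (ltW a0)).
have A0 : 0 < (a ^- k) ^+ 2 by rewrite exprn_gt0// invr_gt0 exprn_gt0.
rewrite -(ler_pM2l A0) -exprMn.
rewrite [X in X ^+ 2](_ : _ = - (b ^- k * half_tan (f b) - a ^- k * half_tan (f a))); last first.
  by rewrite expr_div_n; field; rewrite !expf_neq0// gt_eqF.
rewrite sqrrN; apply: le_trans H _.
rewrite [leRHS](_ : _ = 64 / 225 * A * ((a ^- k) ^+ 2 / (2 * k%:R))); last first.
  by field; rewrite expf_neq0 ?gt_eqF.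
rewrite [X in _ * X <= _](_ : _ = ((a ^- k) ^+ 2 - (b ^- k) ^+ 2) / (2 * k%:R)); last first.
  by field; rewrite !expf_neq0 ?gt_eqF.
apply: ler_pM.
- exact: mulr_ge0 (ltW e0) I0.
- rewrite divr_ge0 ?mulr_ge0// subr_ge0 lerXn2r ?nnegrE ?invr_ge0 ?exprn_ge0 ?(ltW a0) ?(ltW b0)//.
  by rewrite lef_pV2 ?posrE ?exprn_gt0// lerXn2r ?nnegrE// ltW.
- by rewrite ler_pM2l.
- by rewrite ler_pM2r ?invr_gt0 ?mulr_gt0// gerBl sqr_ge0.
Qed.

(* The excess of the energy over that of the two harmonic maps that pass
   through u(rho) at rho, one inside and one outside. *)
Lemma bogomolny_segment (u p w : R -> R) a rho c : primitive u p ->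
  locally_square_summable p -> locally_square_summable w ->
  \int[mu]_(r in `[a, c]) (r * (w r ^+ 2 + p r ^+ 2 + k%:R ^+ 2 * (sin (u r) ^+ 2 / r ^+ 2)))
    <= 8 * k%:R -> 0 < a -> a <= rho -> rho <= c ->
  \int[mu]_(r in `[a, c]) (r * w r ^+ 2)
  + \int[mu]_(r in `[a, rho]) (defect k%:R u p r ^+ 2 / r)
  + \int[mu]_(r in `[rho, c]) (defect (- k%:R) u p r ^+ 2 / r)
  <= 8 * k%:R - 2 * k%:R * (cos (u a) + cos (u c)) + 4 * k%:R * cos (u rho).
Proof.
move=> pu sp sw HE a0 ar rc; have cu := primitive_cont pu.
have r0 := lt_le_trans a0 ar; have ac := le_trans ar rc.
have Iw := locally_summableMr (@continuous_pos_id R) (locally_summable_sqr sw).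
have Id s := locally_summable_div (locally_summable_sqr (locally_square_summable_defect s cu sp)).
have pc := primitive_cos pu; have Ic := pc.1.
(* Completing the square: the cross term [2 * s * sin u * p] is the derivative of [- 2 * s * cos u].
   It is used with [s = k] inside of [rho] and [s = - k] outside. *)
have E s x y : 0 < x -> x <= y ->
   \int[mu]_(r in `[x, y]) (r * p r ^+ 2 + s ^+ 2 * (sin (u r) ^+ 2 / r)) =
   \int[mu]_(r in `[x, y]) (defect s u p r ^+ 2 / r) + 2 * s * (cos (u x) - cos (u y)).
  move=> x0 xy.
  have -> : 2 * s * (cos (u x) - cos (u y)) = (- 2 * s) * \int[mu]_(r in `[x, y]) (- sin (u r) * p r).
    by rewrite -pc.2//; ring.
  rewrite -[X in X + _]mul1r -Rintegral_lin2//.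
  apply: eq_Rintegral_segment => r /andP[xr _]; rewrite /defect; field.
  by rewrite gt_eqF// (lt_le_trans x0).
have Ip s : locally_summable (fun r => r * p r ^+ 2 + s ^+ 2 * (sin (u r) ^+ 2 / r)).
  apply: locally_summableD.
    exact: locally_summableMr (@continuous_pos_id R) (locally_summable_sqr sp).
  apply/continuous_pos_summable/continuous_posM; first exact: continuous_pos_cst.
  apply: continuous_posM; [exact/continuous_posX/continuous_pos_sin|exact: continuous_pos_inv1].
have Eq : \int[mu]_(r in `[a, c]) (r * (w r ^+ 2 + p r ^+ 2 + k%:R ^+ 2 * (sin (u r) ^+ 2 / r ^+ 2))) =
  1 * \int[mu]_(r in `[a, c]) (r * w r ^+ 2) + 1 * \int[mu]_(r in `[a, c]) (r * p r ^+ 2 + k%:R ^+ 2 * (sin (u r) ^+ 2 / r)).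
  rewrite -Rintegral_lin2//.
  apply: eq_Rintegral_segment => r /andP[xr _]; field.
  by rewrite gt_eqF// (lt_le_trans a0).
rewrite {}Eq (@Rintegral_itv_split _ a rho c (fun r => r * p r ^+ 2 + _))// in HE; last exact: Ip.
have E2 := E (- k%:R) rho c r0 rc; rewrite sqrrN in E2; rewrite E// E2 in HE.
by rewrite !mul1r in HE; move: HE; set I1 := Rintegral _ _ _; set I2 := Rintegral _ _ _;
  set I3 := Rintegral _ _ _; move: I1 I2 I3 => I1 I2 I3; lra.
Qed.

(** The ends are sent to 0 and to infinity, where [cos u] tends to 1. The energy bound [8 * k] is
    exactly the cost of going from 0 to [pi] and back, so the excess is governed by the distance of
    [u rho] from [pi]. *)
Lemma bogomolny (u p w : R -> R) a rho c : primitive u p ->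
  locally_square_summable p -> locally_square_summable w ->
  (forall a c, 0 < a -> a <= c ->
  \int[mu]_(r in `[a, c]) (r * (w r ^+ 2 + p r ^+ 2 + k%:R ^+ 2 * (sin (u r) ^+ 2 / r ^+ 2)))
    <= 8 * k%:R) ->
  u r @[r --> 0^'+] --> (0 : R) -> u r @[r --> +oo] --> (0 : R) ->
  0 < a -> a <= rho -> rho <= c ->
  \int[mu]_(r in `[a, c]) (r * w r ^+ 2)
  + \int[mu]_(r in `[a, rho]) (defect k%:R u p r ^+ 2 / r)
  + \int[mu]_(r in `[rho, c]) (defect (- k%:R) u p r ^+ 2 / r)
  <= 4 * k%:R * (1 + cos (u rho)).
Proof.
move=> pu sp sw HE u0 uoo a0 ar rc; have cu := primitive_cont pu.
have cosn (v : R -> R) F : Filter F -> v r @[r --> F] --> (0 : R) -> forall e, 0 < e ->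
    \forall r \near F, 1 - e <= cos (v r).
  move=> FF vF e e0; have m0 : 0 < Num.min 1 e by rewrite lt_min ltr01.
  move: vF => /cvgrPdist_le/(_ _ m0); apply: filterS => r; rewrite sub0r normrN le_min => /andP[v1 ve].
  have := cos_ge_quadratic (v r); rewrite -(real_normK (num_real (v r))).
  have := normr_ge0 (v r); move: v1 ve; move: `|v r| (cos (v r)) => q C; nra.
apply/ler_addgt0Pl => e e0.
have e1 : 0 < e / (4 * k%:R) by rewrite divr_gt0// mulr_gt0.
have [x [x0 [xa ux]]] : exists x, 0 < x /\ x <= a /\ 1 - e / (4 * k%:R) <= cos (u x).
  have : \forall x \near 0^'+, 0 < x /\ x <= a /\ 1 - e / (4 * k%:R) <= cos (u x).
    near=> x; split => //; split; last by near: x; exact: cosn.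
    by near: x; exact: nbhs_right_le.
  by move=> /filter_ex.
have [y [cy uy]] : exists y, c <= y /\ 1 - e / (4 * k%:R) <= cos (u y).
  have : \forall y \near +oo, c <= y /\ 1 - e / (4 * k%:R) <= cos (u y).
    near=> y; split; last by near: y; exact: cosn.
    by near: y; apply: nbhs_pinfty_ge; rewrite num_real.
  by move=> /filter_ex.
have xr := le_trans xa ar; have ry := le_trans rc cy; have xy := le_trans xr ry.
have := bogomolny_segment pu sp sw (HE x y x0 xy) x0 xr ry.
have Iw := locally_summableMr (@continuous_pos_id R) (locally_summable_sqr sw).
have Id s := locally_summable_div (locally_summable_sqr (locally_square_summable_defect s cu sp)).
have sub (f : R -> R) b d b' d' : locally_summable f -> (forall x, 0 < x -> 0 <= f x) -> 0 < b' ->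
    b' <= b -> d <= d' -> \int[mu]_(r in `[b, d]) f r <= \int[mu]_(r in `[b', d']) f r.
  move=> If f0 b'0 bb dd; apply: ge0_subset_Rintegral => //; first exact: sub_segment.
    exact: If.
  by move=> z /=; rewrite in_itv/= => /andP[/(lt_le_trans b'0)/f0].
have s1 : \int[mu]_(r in `[a, c]) (r * w r ^+ 2) <= \int[mu]_(r in `[x, y]) (r * w r ^+ 2).
  by apply: sub => // z z0; rewrite mulr_ge0 ?sqr_ge0// ltW.
have dge s z : 0 < z -> 0 <= defect s u p z ^+ 2 / z by move=> z0; rewrite divr_ge0 ?sqr_ge0// ltW.
have s2 : \int[mu]_(r in `[a, rho]) (defect k%:R u p r ^+ 2 / r) <=
   \int[mu]_(r in `[x, rho]) (defect k%:R u p r ^+ 2 / r).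
  exact: sub (Id _) (dge _) x0 xa (lexx _).
have s3 : \int[mu]_(r in `[rho, c]) (defect (- k%:R) u p r ^+ 2 / r) <=
   \int[mu]_(r in `[rho, y]) (defect (- k%:R) u p r ^+ 2 / r).
  exact: sub (Id _) (dge _) (lt_le_trans a0 ar) (lexx _) cy.
have ke : k%:R * (2 - 2 * (e / (4 * k%:R))) <= k%:R * (cos (u x) + cos (u y)).
  by rewrite ler_pM2l//; move: ux uy; set q := e / _; lra.
have kE : k%:R * (2 - 2 * (e / (4 * k%:R))) = 2 * k%:R - e / 2 by field; rewrite gt_eqF.
rewrite {}kE in ke; move: s1 s2 s3 ke; set I1 := Rintegral _ _ _; set I2 := Rintegral _ _ _;
  set I3 := Rintegral _ _ _; set I4 := Rintegral _ _ _; set I5 := Rintegral _ _ _;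
  set I6 := Rintegral _ _ _.
move: I1 I2 I3 I4 I5 I6 (cos (u x)) (cos (u y)) (cos (u rho)) (k%:R : R) => I1 I2 I3 I4 I5 I6 X Y Z K.
by rewrite -(mulrA 2 K) mulrDr -(mulrA 4 K (1 + Z)) (mulrDr K) -(mulrA 4 K Z); move: (K * X) (K * Y) (K * Z) => *; lra.
Unshelve. all: by end_near. Qed.

End Profile.

(** * Quantitative estimates for profiles close to the two-bubble *)

Section Core.
Context (R : realType).
Local Notation mu := (@lebesgue_measure R).
Implicit Types (u p w : R -> R) (a b c d e r x y z m q A C D E : R).
Variable k : nat.

(* At scale m ^+ 6 a profile close to the two-bubble with scales of order
   m ^+ 6 and 1. *)
Record shape b d m u p w : Prop := Shape {
  shape_primitive : primitive u p;
  shape_p : locally_square_summable p;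
  shape_w : locally_square_summable w;
  shape_excess : forall a rho c, 0 < a -> a <= rho -> rho <= c ->
    \int[mu]_(r in `[a, c]) (r * w r ^+ 2)
    + \int[mu]_(r in `[a, rho]) (defect k%:R u p r ^+ 2 / r)
    + \int[mu]_(r in `[rho, c]) (defect (- k%:R) u p r ^+ 2 / r)
    <= 4 * k%:R * (1 + cos (u rho));
  shape_inner : forall r, 0 < r -> r <= m ^+ 6 / 8 -> `|u r| <= 1 / 2;
  shape_middle : forall r, 8 * m ^+ 6 <= r <= b -> `|pi - u r| <= 1 / 2;
  shape_left : d <= pi - u (8 * m ^+ 6);
  shape_right : d <= pi - u b }.

(** What the virial estimates use of a profile. The number [X] in [core_tail] is the strength of the
    tail of the inner bubble: the almost constant value of both [r ^+ k * sin u] and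
    [r ^+ k * (pi - u)]. The lower bound [core_sin] records the presence of the outer bubble. *)
Record core C c m u p w : Prop := Core {
  core_primitive : primitive u p;
  core_p : locally_square_summable p;
  core_w : locally_square_summable w;
  core_kinetic : forall a b, 0 < a -> a <= b ->
    \int[mu]_(r in `[a, b]) (r * w r ^+ 2) <= (C * (m ^+ k) ^+ 3) ^+ 2;
  core_in : forall a, 0 < a -> a <= m ^+ 3 ->
    \int[mu]_(r in `[a, m ^+ 3]) (defect k%:R u p r ^+ 2 / r) <= (C * (m ^+ k) ^+ 3) ^+ 2;
  core_out : forall b, m ^+ 3 <= b ->
    \int[mu]_(r in `[m ^+ 3, b]) (defect (- k%:R) u p r ^+ 2 / r) <= (C * (m ^+ k) ^+ 3) ^+ 2;
  core_tail : exists2 X : R, c * (m ^+ k) ^+ 6 <= X <= C * (m ^+ k) ^+ 6 &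
    forall r, m ^+ 5 <= r <= m ^+ 3 ->
      `|r ^+ k * sin (u r) - X| <= C * (m ^+ k) ^+ 3 * r ^+ k /\
      `|r ^+ k * (pi - u r) - X| <= C * (m ^+ k) ^+ 3 * r ^+ k;
  core_mid : forall r, 8 * m ^+ 6 <= r <= m ^+ 3 ->
    `|sin (u r)| <= C * ((m ^+ k) ^+ 6 * r ^- k + (m ^+ k) ^+ 3);
  core_right : forall r, m ^+ 3 <= r <= 2 * m ^+ 2 ->
    `|sin (u r)| <= C * (r ^+ k + (m ^+ k) ^+ 3);
  core_sin : forall r, m ^+ 2 <= r <= 2 * m ^+ 2 -> c * r ^+ k <= sin (u r);
  core_small : forall r, 0 < r -> r <= m ^+ 10 -> `|sin (u r)| <= C * (m ^+ k) ^+ 3;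
  core_cos : forall r, 8 * m ^+ 6 <= r <= 2 * m ^+ 2 -> cos (u r) <= 0 }.

Lemma sin_pi_sub x : sin (pi - x) = sin x :> R.
Proof. by rewrite sinB sinpi cospi mul0r sub0r mulN1r opprK. Qed.

Lemma cos_pi_sub x : cos (pi - x) = - cos x :> R.
Proof. by rewrite cosB sinpi cospi mul0r addr0 mulN1r. Qed.

Lemma half_tan_ge x : 0 <= x <= 1 / 2 -> x / 4 <= half_tan x.
Proof.
move=> /andP[x0 x2]; have x2' : `|x| <= 1 / 2 by rewrite ger0_norm.
have [_] := half_tan_approx x2'; rewrite (ger0_norm x0) => H.
have : x ^+ 3 <= x * (1 / 2) ^+ 2 by rewrite exprS ler_wpM2l// lerXn2r ?nnegrE//; lra.
have := ler_norm (x - 2 * half_tan x); rewrite expr_div_n; lra.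
Qed.

(* The contributions of both sides leave a factor 256/225 < 2. *)
Lemma two_sided_absorption q (e1 e2 : R) E : `|e1| <= E -> `|e2| <= E ->
  (q - e1) ^+ 2 + (q - e2) ^+ 2 <= 256 / 225 * q ^+ 2 -> `|q| <= 5 * E.
Proof.
move=> h1 h2 H; rewrite leNgt; apply/negP => qE.
have E0 : 0 <= E by exact: le_trans h1.
(* If [|q| > 5 * E], each square is at least [16 / 25 * q ^+ 2], and [32 / 25 = 288 / 225] exceeds
   [256 / 225]. *)
have F e : `|e| <= E -> 4 / 5 * `|q| <= `|q - e|.
  by move=> he; have := ler_normB (q - e) (- e); rewrite opprK subrK normrN; lra.
have G e : `|e| <= E -> 16 / 25 * q ^+ 2 <= (q - e) ^+ 2.
  have p0 : 0 <= 4 / 5 * `|q| by have := normr_ge0 q; lra.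
  move=> /F; rewrite -(@ler_pXn2r _ 2)// ?nnegrE//.
  by rewrite exprMn !real_normK ?num_real//; lra.
have q0 : 0 < q ^+ 2.
  rewrite lt_neqAle sqr_ge0 andbT eq_sym sqrf_eq0; apply/eqP => q0.
  by move: qE; rewrite q0 normr0; lra.
by have := G _ h1; have := G _ h2; lra.
Qed.

Hypothesis k0 : (0 < k)%N.

Let k_gt0 : 0 < k%:R :> R. Proof. by rewrite ltr0n. Qed.
Let k_ge1 : 1 <= k%:R :> R. Proof. by rewrite ler1n. Qed.

Lemma norm_le_of_sqr x y A : 0 <= A -> (x - y) ^+ 2 <= A ^+ 2 -> `|x - y| <= A :> R.
Proof. by move=> A0; rewrite -(real_normK (num_real (x - y))) ler_pXn2r ?nnegrE. Qed.

Section ShapeCore.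
Variables (b d m : R) (u p w : R -> R).
Hypotheses (b0 : 0 < b) (d0 : 0 < d) (m0 : 0 < m) (m8 : m <= 1 / 8) (mb : 2 * m ^+ 2 <= b).
Hypothesis sh : shape b d m u p w.

Let M := m ^+ k.
Let kap : R := 8 ^+ k.
Let bet := b ^- k.
Let C1 := 20 * k%:R * (kap + bet).
Let D := C1 * M ^+ 3.
Let v r := pi - u r.
Let q r := half_tan (v r).

Let M0 : 0 < M. Proof. exact: exprn_gt0. Qed.
Let M1 : M <= 1. Proof. by rewrite exprn_ile1//; [exact: ltW|have := m8; lra]. Qed.
Let kap0 : 0 < kap. Proof. by rewrite exprn_gt0. Qed.
Let bet0 : 0 < bet. Proof. by rewrite invr_gt0 exprn_gt0. Qed.
Let C10 : 0 <= C1. Proof. by rewrite !mulr_ge0// addr_ge0// ltW. Qed.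
Let D0 : 0 <= D. Proof. by rewrite mulr_ge0// exprn_ge0// ltW. Qed.
Let mn_le n l : (l <= n)%N -> m ^+ n <= m ^+ l.
Proof.
move=> nl; have -> : m ^+ n = m ^+ l * m ^+ (n - l) by rewrite -exprD subnKC.
rewrite ler_piMr ?exprn_ge0 ?(ltW m0)// exprn_ile1 ?(ltW m0)//; have := m8; lra.
Qed.
Let mn_le8 n : 8 * m ^+ n.+1 <= m ^+ n.
Proof.
rewrite exprS mulrA ler_piMl ?exprn_ge0 ?(ltW m0)//; have := m8; lra.
Qed.
Let m36 : 8 * m ^+ 6 <= m ^+ 3. Proof. exact: le_trans (mn_le8 5) (mn_le _). Qed.
Let m65 : 8 * m ^+ 6 <= m ^+ 5. Proof. exact: mn_le8. Qed.
Let m60 : 0 < 8 * m ^+ 6. Proof. by rewrite mulr_gt0// exprn_gt0. Qed.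
Let m30 : 0 < m ^+ 3. Proof. exact: exprn_gt0. Qed.
Let m32 : m ^+ 3 <= m ^+ 2. Proof. exact: mn_le. Qed.
Let m2b : m ^+ 2 <= b. Proof. by have := exprn_ge0 2 (ltW m0); have := mb; lra. Qed.
Let m3b : m ^+ 3 <= b. Proof. exact: le_trans m2b. Qed.

Let pv : primitive v (fun r => - p r).
Proof.
have := primitiveD (primitive_cst pi) (primitiveZ (-1) (shape_primitive sh)).
by apply: primitive_eq => x _; rewrite ?add0r mulN1r.
Qed.

Let spv : locally_square_summable (fun r => - p r).
Proof. exact: locally_square_summableN (shape_p sh). Qed.

Let q_half r : 8 * m ^+ 6 <= r <= b -> `|q r| <= 1 / 2.
Proof. by move=> /(shape_middle sh) H; exact: le_trans (norm_half_tan_le H) H. Qed.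

Let pow6 : (8 * m ^+ 6) ^+ k = kap * M ^+ 6.
Proof. by rewrite exprMn -!exprM mulnC. Qed.

Let int_up x y A : 8 * m ^+ 6 <= x -> x <= y -> y <= b ->
  \int[mu]_(r in `[x, y]) (defect k%:R u p r ^+ 2 / r) <= A ->
  (q y - (x / y) ^+ k * q x) ^+ 2 <= 32 / 225 / k%:R * A.
Proof.
move=> mx xy yb HA; apply: (half_tan_growth_up k0 pv spv) => //.
- by move=> z /andP[xz zy]; apply: (shape_middle sh); rewrite (le_trans mx xz) (le_trans zy).
- exact: lt_le_trans mx.
rewrite (@eq_Rintegral_segment _ _ (fun r => defect k%:R u p r ^+ 2 / r))// => r _.
by congr (_ / _); rewrite -sqrrN sin_pi_sub /defect; congr (_ ^+ 2); ring.
Qed.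

Let int_down x y A : 8 * m ^+ 6 <= x -> x <= y -> y <= b ->
  \int[mu]_(r in `[x, y]) (defect (- k%:R) u p r ^+ 2 / r) <= A ->
  (q x - (x / y) ^+ k * q y) ^+ 2 <= 32 / 225 / k%:R * A.
Proof.
move=> mx xy yb HA; apply: (half_tan_growth_down k0 pv spv) => //.
- by move=> z /andP[xz zy]; apply: (shape_middle sh); rewrite (le_trans mx xz) (le_trans zy).
- exact: lt_le_trans mx.
rewrite (@eq_Rintegral_segment _ _ (fun r => defect (- k%:R) u p r ^+ 2 / r))// => r _.
by congr (_ / _); rewrite -sqrrN sin_pi_sub /defect; congr (_ ^+ 2); ring.
Qed.

Let Int_ge0 s x y : 0 < x -> 0 <= \int[mu]_(r in `[x, y]) (defect s u p r ^+ 2 / r).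
Proof.
move=> x0; apply: Rintegral_ge0_segment => z /andP[xz _].
by rewrite divr_ge0 ?sqr_ge0// (le_trans (ltW x0)).
Qed.

Let Iw_ge0 x y : 0 < x -> 0 <= \int[mu]_(r in `[x, y]) (r * w r ^+ 2).
Proof.
move=> x0; apply: Rintegral_ge0_segment => z /andP[xz _].
by rewrite mulr_ge0 ?sqr_ge0// (le_trans (ltW x0)).
Qed.

Let cos_rho : 1 + cos (u (m ^+ 3)) <= 2 * q (m ^+ 3) ^+ 2.
Proof.
rewrite -[cos _]opprK -cos_pi_sub; apply: one_sub_cos.
by apply: (shape_middle sh); rewrite m36 m3b.
Qed.

(** The excess at [rho = m ^+ 3] is at most [8 * k * q ^+ 2], and the growth estimates on both sides
    bound two squared increments of [q] by [32 / (225 * k)] times that. The values at the far ends,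
    damped by [kap * M ^+ 3] and [bet * M ^+ 3], are absorbed by [two_sided_absorption]. *)
Let q_rho : `|q (m ^+ 3)| <= 5 * ((kap + bet) * M ^+ 3).
Proof.
have H := shape_excess sh m60 m36 m3b.
have H1 := int_up (lexx _) m36 m3b (lexx _).
have H2 := int_down m36 m3b (lexx _) (lexx _).
have M30 : 0 <= M ^+ 3 by rewrite exprn_ge0// ltW.
have pw : (8 * m ^+ 6 / m ^+ 3) ^+ k = kap * M ^+ 3.
  have -> : 8 * m ^+ 6 / m ^+ 3 = 8 * m ^+ 3 by field; rewrite gt_eqF.
  by rewrite exprMn -!exprM mulnC.
have pw2 : (m ^+ 3 / b) ^+ k = bet * M ^+ 3.
  by rewrite expr_div_n -!exprM mulnC mulrC.
rewrite pw in H1; rewrite pw2 in H2.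
have e1 : `|kap * M ^+ 3 * q (8 * m ^+ 6)| <= (kap + bet) * M ^+ 3.
  have K3 := mulr_ge0 (ltW kap0) M30; rewrite normrM (ger0_norm K3).
  apply: (@le_trans _ _ (kap * M ^+ 3 * 1)).
    rewrite ler_wpM2l//.
    by apply: le_trans (q_half _) _; [rewrite lexx (le_trans m36)|lra].
  by rewrite mulr1 ler_wpM2r// lerDl ltW.
have e2 : `|bet * M ^+ 3 * q b| <= (kap + bet) * M ^+ 3.
  have K3 := mulr_ge0 (ltW bet0) M30; rewrite normrM (ger0_norm K3).
  apply: (@le_trans _ _ (bet * M ^+ 3 * 1)).
    rewrite ler_wpM2l//.
    by apply: le_trans (q_half _) _; [rewrite lexx (le_trans m36)|lra].
  by rewrite mulr1 ler_wpM2r// lerDr ltW.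
apply: two_sided_absorption e1 e2 _.
have W0 := Iw_ge0 b m60.
apply: le_trans (lerD H1 H2) _; rewrite -mulrDr.
apply: (@le_trans _ _ (32 / 225 / k%:R * (4 * k%:R * (2 * q (m ^+ 3) ^+ 2)))).
  apply: ler_wpM2l; first by apply: divr_ge0; [lra|exact: ltW].
  apply: (@le_trans _ _ (4 * k%:R * (1 + cos (u (m ^+ 3))))).
    by apply: le_trans H; rewrite -addrA lerDr.
  by rewrite ler_pM2l ?mulr_gt0.
by rewrite le_eqVlt; apply/orP; left; apply/eqP; field; rewrite gt_eqF.
Qed.

Let excess_le : 4 * k%:R * (1 + cos (u (m ^+ 3))) <= D ^+ 2.
Proof.
apply: (@le_trans _ _ (4 * k%:R * (2 * (5 * ((kap + bet) * M ^+ 3)) ^+ 2))).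
  rewrite ler_pM2l ?mulr_gt0//; apply: le_trans cos_rho _; rewrite ler_pM2l//.
  rewrite -(real_normK (num_real (q _))) lerXn2r ?nnegrE ?q_rho//.
  exact: le_trans (normr_ge0 _) q_rho.
rewrite /D /C1.
have -> : (20 * k%:R * (kap + bet) * M ^+ 3) ^+ 2 = k%:R * (400 * (k%:R * ((kap + bet) * M ^+ 3) ^+ 2)) by ring.
have -> : 4 * k%:R * (2 * (5 * ((kap + bet) * M ^+ 3)) ^+ 2) = k%:R * (200 * ((kap + bet) * M ^+ 3) ^+ 2) by ring.
rewrite ler_pM2l//; have := sqr_ge0 ((kap + bet) * M ^+ 3); have := k_ge1.
by move: (_ ^+ 2) (k%:R : R) => A B; nra.
Qed.

Let in_le a : 0 < a -> a <= m ^+ 3 ->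
  \int[mu]_(r in `[a, m ^+ 3]) (defect k%:R u p r ^+ 2 / r) <= D ^+ 2.
Proof.
move=> a0 am; apply: le_trans excess_le; apply: le_trans (shape_excess sh a0 am (lexx _)).
by rewrite set_itv1 Rintegral_set1 addr0 lerDr Iw_ge0.
Qed.

Let out_le c : m ^+ 3 <= c ->
  \int[mu]_(r in `[m ^+ 3, c]) (defect (- k%:R) u p r ^+ 2 / r) <= D ^+ 2.
Proof.
move=> mc; apply: le_trans excess_le; apply: le_trans (shape_excess sh m30 (lexx _) mc).
by rewrite lerDr set_itv1 Rintegral_set1 addr0 Iw_ge0.
Qed.

Let kinetic_le a c : 0 < a -> a <= c -> \int[mu]_(r in `[a, c]) (r * w r ^+ 2) <= D ^+ 2.
Proof.
move=> a0 ac; pose a' := Num.min a (m ^+ 3); pose c' := Num.max c (m ^+ 3).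
have a'0 : 0 < a' by rewrite lt_min a0.
have a'm : a' <= m ^+ 3 by rewrite ge_min lexx orbT.
have mc' : m ^+ 3 <= c' by rewrite le_max lexx orbT.
have Iw := locally_summableMr (@continuous_pos_id R) (locally_summable_sqr (shape_w sh)).
apply: (@le_trans _ _ (\int[mu]_(r in `[a', c']) (r * w r ^+ 2))).
  apply: ge0_subset_Rintegral => //; first by apply: sub_segment; rewrite ?ge_min ?le_max lexx.
    exact: Iw.
  move=> z /=; rewrite in_itv/= => /andP[xz _].
  by rewrite mulr_ge0 ?sqr_ge0// (le_trans (ltW a'0)).
apply: le_trans excess_le; apply: le_trans (shape_excess sh a'0 a'm mc').
by rewrite -addrA lerDl addr_ge0// Int_ge0.
Qed.

Let coef_le A : 0 <= A -> 32 / 225 / k%:R * A <= A.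
Proof.
move=> A0; apply: (ler_piMl A0); rewrite ler_pdivrMr ?k_gt0 ?mul1r; have := k_ge1; lra.
Qed.

(** Half of the tail strength: the value of [r ^+ k * q r] at [r = 8 * m ^+ 6], transported outwards
    up to [m ^+ 3] by [q_in]. *)
Let X0 := kap * M ^+ 6 * q (8 * m ^+ 6).

Let q_in r : 8 * m ^+ 6 <= r <= m ^+ 3 -> `|q r - X0 * r ^- k| <= D.
Proof.
move=> /andP[mr rm]; have r0 := lt_le_trans m60 mr.
have -> : X0 * r ^- k = (8 * m ^+ 6 / r) ^+ k * q (8 * m ^+ 6).
  by rewrite expr_div_n pow6 /X0; ring.
apply: norm_le_of_sqr => //; apply: le_trans (coef_le (sqr_ge0 D)).
apply: int_up => //; first exact: le_trans rm m3b.
apply: le_trans (in_le m60 m36).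
have Id := locally_summable_div (locally_summable_sqr (locally_square_summable_defect k%:R
  (primitive_cont (shape_primitive sh)) (shape_p sh))).
apply: ge0_subset_Rintegral => //; first exact: sub_segment.
  exact: Id.
move=> z /=; rewrite in_itv/= => /andP[xz _].
by rewrite divr_ge0 ?sqr_ge0// (le_trans (ltW m60)).
Qed.

Let q_out r : m ^+ 3 <= r <= b -> `|q r - bet * r ^+ k * q b| <= D.
Proof.
move=> /andP[mr rb]; have r0 := lt_le_trans m30 mr.
have -> : bet * r ^+ k * q b = (r / b) ^+ k * q b by rewrite expr_div_n /bet; ring.
apply: norm_le_of_sqr => //; apply: le_trans (coef_le (sqr_ge0 D)).
apply: int_down => //; first exact: le_trans mr.
apply: le_trans (out_le m3b).
have Id := locally_summable_div (locally_summable_sqr (locally_square_summable_defect (- k%:R)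
  (primitive_cont (shape_primitive sh)) (shape_p sh))).
apply: ge0_subset_Rintegral => //; first exact: sub_segment.
  exact: Id.
move=> z /=; rewrite in_itv/= => /andP[xz _].
by rewrite divr_ge0 ?sqr_ge0// (le_trans (ltW m30)).
Qed.

Let q_small r : 0 < r -> r <= m ^+ 6 / 8 ->
  `|half_tan (u r) - kap * (r / m ^+ 6) ^+ k * half_tan (u (m ^+ 6 / 8))| <= D.
Proof.
move=> r0 rm; have m6 : 0 < m ^+ 6 by exact: exprn_gt0.
have mm : m ^+ 6 / 8 <= m ^+ 3 by have := m36; lra.
have -> : kap * (r / m ^+ 6) ^+ k * half_tan (u (m ^+ 6 / 8)) =
   (r / (m ^+ 6 / 8)) ^+ k * half_tan (u (m ^+ 6 / 8)).
  by rewrite -exprMn; congr (_ ^+ _ * _); field; rewrite gt_eqF.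
apply: norm_le_of_sqr => //; apply: le_trans (coef_le (sqr_ge0 D)).
apply: (half_tan_growth_down k0 (shape_primitive sh) (shape_p sh)) => //.
  by move=> x /andP[rx xm]; apply: (shape_inner sh) => //; exact: lt_le_trans rx.
apply: le_trans (in_le r0 (le_trans rm mm)).
have Id := locally_summable_div (locally_summable_sqr (locally_square_summable_defect k%:R
  (primitive_cont (shape_primitive sh)) (shape_p sh))).
apply: ge0_subset_Rintegral => //; first exact: sub_segment.
  exact: Id.
move=> z /=; rewrite in_itv/= => /andP[xz _].
by rewrite divr_ge0 ?sqr_ge0// (le_trans (ltW r0)).
Qed.

Let C2 := 4 * (kap + C1).
Let C3 := 2 * C1 + 16 * C2 ^+ 3.
Let C4 := 4 * (bet + C1).

Let C20 : 0 <= C2. Proof. by rewrite mulr_ge0// addr_ge0// ltW. Qed.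
Let C30 : 0 <= C3. Proof. by rewrite addr_ge0// mulr_ge0// exprn_ge0. Qed.
Let C40 : 0 <= C4. Proof. by rewrite mulr_ge0// addr_ge0// ltW. Qed.

Let sin_v r : sin (u r) = sin (v r). Proof. by rewrite /v sin_pi_sub. Qed.

Let v_le r e : 8 * m ^+ 6 <= r <= b -> `|q r| <= e -> `|v r| <= 4 * e.
Proof. by move=> /(shape_middle sh)/norm_le_half_tan => H qe; apply: le_trans H _; rewrite ler_pM2l. Qed.

Let in_b r : 8 * m ^+ 6 <= r <= m ^+ 3 -> 8 * m ^+ 6 <= r <= b.
Proof. by move=> /andP[-> rm]; exact: le_trans rm m3b. Qed.

Let M6 : 0 <= M ^+ 6. Proof. by rewrite exprn_ge0// ltW. Qed.
Let M3 : 0 <= M ^+ 3. Proof. by rewrite exprn_ge0// ltW. Qed.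

Let q1_bounds : d / 4 <= q (8 * m ^+ 6) <= 1 / 2.
Proof.
have H1 := shape_left sh.
have H2 : 8 * m ^+ 6 <= 8 * m ^+ 6 <= b by rewrite lexx (le_trans m36).
have H3 := shape_middle sh H2; have H4 := q_half H2; apply/andP; split.
  apply: (@le_trans _ _ (v (8 * m ^+ 6) / 4)); first by rewrite ler_pM2r.
  apply: half_tan_ge; have := ler_norm (pi - u (8 * m ^+ 6)); rewrite /v; have := d0; lra.
by apply: le_trans (ler_norm _) _.
Qed.

Let qb_bounds : d / 4 <= q b <= 1 / 2.
Proof.
have H1 := shape_right sh.
have H2 : 8 * m ^+ 6 <= b <= b by rewrite lexx (le_trans m36).
have H3 := shape_middle sh H2; have H4 := q_half H2; apply/andP; split.
  apply: (@le_trans _ _ (v b / 4)); first by rewrite ler_pM2r.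
  apply: half_tan_ge; have := ler_norm (pi - u b); rewrite /v; have := d0; lra.
by apply: le_trans (ler_norm _) _.
Qed.

Let X0_bounds : kap * d / 4 * M ^+ 6 <= X0 <= kap * M ^+ 6 / 2.
Proof.
have /andP[h1 h2] := q1_bounds; have K : 0 <= kap * M ^+ 6 by rewrite mulr_ge0// ltW.
apply/andP; split.
  have -> : kap * d / 4 * M ^+ 6 = kap * M ^+ 6 * (d / 4) by ring.
  exact: ler_wpM2l.
by rewrite /X0 -[X in _ <= _ * X]mul1r; exact: ler_wpM2l.
Qed.

Let X00 : 0 <= X0.
Proof.
have /andP[h _] := X0_bounds; apply: le_trans h.
by rewrite !mulr_ge0// ltW.
Qed.

Let v_mid r : 8 * m ^+ 6 <= r <= m ^+ 3 -> `|v r| <= C2 * (M ^+ 6 * r ^- k + M ^+ 3).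
Proof.
move=> rr; have H := q_in rr.
have r0 : 0 < r by case/andP: rr => mr _; exact: lt_le_trans mr.
have ri : 0 <= r ^- k by rewrite invr_ge0 exprn_ge0// ltW.
have qe : `|q r| <= kap * M ^+ 6 * r ^- k + D.
  rewrite -[q r](subrK (X0 * r ^- k)) addrC (le_trans (ler_normD _ _))// lerD//.
  rewrite (ger0_norm (mulr_ge0 X00 ri)) ler_wpM2r//; have /andP[_] := X0_bounds.
  by have := mulr_ge0 (ltW kap0) M6; move: (kap * M ^+ 6) X0 => *; lra.
apply: le_trans (v_le (in_b rr) qe) _.
have E : C2 * (M ^+ 6 * r ^- k + M ^+ 3) =
    4 * (kap * M ^+ 6 * r ^- k + D) + 4 * (C1 * (M ^+ 6 * r ^- k) + kap * M ^+ 3).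
  by rewrite /C2 /D; ring.
rewrite E lerDl; apply: mulr_ge0 => //; apply: addr_ge0; last exact: mulr_ge0 (ltW kap0) M3.
exact: mulr_ge0 C10 (mulr_ge0 M6 ri).
Qed.

Let m5_in r : m ^+ 5 <= r <= m ^+ 3 -> 8 * m ^+ 6 <= r <= m ^+ 3.
Proof. by move=> /andP[mr ->]; rewrite (le_trans m65 mr). Qed.

(** From [m ^+ 5] on, a factor [1 / m] outside of the inner scale, [M ^+ 6 * r ^- k] is at most [M].
    The cubic errors of [half_tan_approx] are then of order [M ^+ 3], like [D]. *)
Let v_tail r : m ^+ 5 <= r <= m ^+ 3 -> `|v r| <= 2 * C2 * M.
Proof.
move=> rr; apply: le_trans (v_mid (m5_in rr)) _.
rewrite [leRHS](_ : _ = C2 * (M + M)); last by ring.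
rewrite ler_wpM2l// lerD//; last by rewrite exprS ler_piMr ?(ltW M0)// exprn_ile1// ltW.
have m5 : 0 < m ^+ 5 by rewrite exprn_gt0.
have /andP[mr _] := rr; have r0 := lt_le_trans m5 mr.
rewrite ler_pdivrMr ?exprn_gt0// exprS ler_wpM2l ?(ltW M0)//.
by rewrite -exprM mulnC exprM lerXn2r ?nnegrE// ltW.
Qed.

Let tail r : m ^+ 5 <= r <= m ^+ 3 ->
  `|sin (v r) - 2 * X0 * r ^- k| <= C3 * M ^+ 3 /\ `|v r - 2 * X0 * r ^- k| <= C3 * M ^+ 3.
Proof.
move=> rr; have H := q_in (m5_in rr); have Hv := v_tail rr.
have [H1 H2] := half_tan_approx (shape_middle sh (in_b (m5_in rr))).
have v3 : `|v r| ^+ 3 <= 8 * C2 ^+ 3 * M ^+ 3.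
  have -> : 8 * C2 ^+ 3 * M ^+ 3 = (2 * C2 * M) ^+ 3 by ring.
  rewrite lerXn2r ?nnegrE//; exact: mulr_ge0 (mulr_ge0 (ler0n _ 2) C20) (ltW M0).
have v30 : 0 <= `|v r| ^+ 3 by rewrite exprn_ge0.
have C3E : C3 * M ^+ 3 = 2 * D + 2 * (8 * C2 ^+ 3 * M ^+ 3) by rewrite /C3 /D; ring.
have N (x : R) : `|x - 2 * q r| <= 2 * `|v r| ^+ 3 -> `|x - 2 * X0 * r ^- k| <= C3 * M ^+ 3.
  move=> Hx; rewrite (_ : x - _ = (x - 2 * q r) + 2 * (q r - X0 * r ^- k)); last by ring.
  rewrite (le_trans (ler_normD _ _))// normrM (@ger0_norm _ 2)// C3E.
  rewrite [leLHS]addrC; apply: lerD; first by rewrite ler_pM2l.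
  by apply: le_trans Hx _; rewrite ler_pM2l.
split; apply: N => //; apply: le_trans H1 _.
by rewrite ler_peMl// ler1n.
Qed.

Let q_right r : m ^+ 3 <= r <= b -> `|q r| <= bet * r ^+ k + D.
Proof.
move=> rr; have H := q_out rr.
have r0 : 0 < r by case/andP: rr => mr _; exact: lt_le_trans mr.
have K : 0 <= bet * r ^+ k by rewrite mulr_ge0 ?(ltW bet0)// exprn_ge0// ltW.
rewrite -[q r](subrK (bet * r ^+ k * q b)) addrC (le_trans (ler_normD _ _))// lerD//.
rewrite normrM (ger0_norm K) ler_piMr//.
by apply: le_trans (q_half _) _; [rewrite lexx (le_trans m36)|lra].
Qed.

Hypothesis small : C1 * m <= bet * d / 8.
Hypothesis k1 : M <= m.

Let C := C1 + C2 + C3 + C4 + kap.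
Let c := Num.min (kap * d / 2) (bet * d / 8).

Let wk x A : 0 <= x -> A <= C -> A * x <= C * x.
Proof. by move=> x0 AC; exact: ler_wpM2r. Qed.

Let out_b r : m ^+ 3 <= r <= 2 * m ^+ 2 -> m ^+ 3 <= r <= b /\ 8 * m ^+ 6 <= r <= b.
Proof. by move=> /andP[mr rm]; rewrite mr (le_trans rm)// (le_trans m36 mr). Qed.

Let sin_right r : m ^+ 3 <= r <= 2 * m ^+ 2 -> `|sin (u r)| <= C * (r ^+ k + M ^+ 3).
Proof.
move=> /out_b[rr rb]; rewrite sin_v; apply: le_trans (norm_sin_le _) _.
apply: le_trans (v_le rb (q_right rr)) _.
have r0 : 0 < r by case/andP: rr => mr _; exact: lt_le_trans mr.
have rk : 0 <= r ^+ k by rewrite exprn_ge0// ltW.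
apply: (@le_trans _ _ (C4 * (r ^+ k + M ^+ 3))).
  rewrite /C4 /D -mulrA ler_pM2l// mulrDr lerD//; last by rewrite ler_wpM2r// lerDr ltW.
  by rewrite ler_wpM2r// lerDl.
by apply: wk; [exact: addr_ge0|rewrite /C; have := kap0; have := C10; have := C20; have := C30; lra].
Qed.

(** The contribution of the outer bubble, transported inwards from [b], dominates: from [m ^+ 2] on
    [r ^+ k] is at least [M ^+ 2], whereas the error [D] is of order [M ^+ 3]. *)
Let sin_ge r : m ^+ 2 <= r <= 2 * m ^+ 2 -> c * r ^+ k <= sin (u r).
Proof.
move=> /andP[mr rm]; have rr : m ^+ 3 <= r <= 2 * m ^+ 2 by rewrite (le_trans m32 mr).
have [r3 r6] := out_b rr; rewrite sin_v.
have m2 : 0 < m ^+ 2 by rewrite exprn_gt0.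
have r0 := lt_le_trans m2 mr; have rk : 0 < r ^+ k by rewrite exprn_gt0.
have rM : M ^+ 2 <= r ^+ k by rewrite -exprM mulnC exprM lerXn2r ?nnegrE// ltW.
have Dle : D <= bet * d / 8 * r ^+ k.
  apply: (@le_trans _ _ (bet * d / 8 * M ^+ 2)).
    rewrite /D exprS mulrA; apply: ler_pM => //; [by rewrite mulr_ge0// ltW|exact: exprn_ge0 (ltW M0)|].
    by apply: le_trans small; rewrite ler_wpM2l.
  by rewrite ler_wpM2l// !mulr_ge0// ltW.
have qlow : bet * d / 8 * r ^+ k <= q r.
  have H := q_out r3; have /andP[qb _] := qb_bounds.
  have : bet * r ^+ k * (d / 4) <= bet * r ^+ k * q b by rewrite ler_wpM2l// mulr_ge0// ltW.
  have E : bet * r ^+ k * (d / 4) = 2 * (bet * d / 8 * r ^+ k) by field.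
  rewrite E; move: H Dle; rewrite ler_norml => /andP[+ _].
  by move: (bet * r ^+ k * q b) (bet * d / 8 * r ^+ k) (q r) D => *; lra.
have q0 : 0 <= q r by apply: le_trans qlow; rewrite !mulr_ge0// ltW.
have vh := shape_middle sh r6; rewrite (sin_half_tan vh).
apply: (@le_trans _ _ (q r)).
  by apply: le_trans qlow; rewrite ler_wpM2r ?(ltW rk)// ge_min lexx orbT.
rewrite ler_peMr// lerDl; have := cos_ge_half vh; rewrite /v; lra.
Qed.

(** Deep inside of the inner bubble the profile decays like [(r / m ^+ 6) ^+ k], which is at most
    [M ^+ 4] for [r <= m ^+ 10]; only the error [D] is left. *)
Let sin_small r : 0 < r -> r <= m ^+ 10 -> `|sin (u r)| <= C * M ^+ 3.
Proof.
move=> r0 rm.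
have m6 : 0 < m ^+ 6 by rewrite exprn_gt0.
have rm6 : r <= m ^+ 6 / 8.
  by rewrite ler_pdivlMr// mulrC (le_trans _ (mn_le (isT : (6 <= 9)%N)))// (le_trans _ (mn_le8 9))// ler_pM2l.
have H := q_small r0 rm6; have Hu := shape_inner sh r0 rm6.
have m68 : 0 < m ^+ 6 / 8 by rewrite divr_gt0.
have Hu1 := shape_inner sh m68 (lexx _); have qu1 := norm_half_tan_le Hu1.
apply: le_trans (norm_sin_le _) _; apply: le_trans (norm_le_half_tan Hu) _.
have rk : (r / m ^+ 6) ^+ k <= M ^+ 3.
  apply: (@le_trans _ _ (M ^+ 4)); last by rewrite exprS ler_piMl.
  rewrite -exprM mulnC exprM lerXn2r ?nnegrE ?divr_ge0 ?exprn_ge0 ?(ltW m0) ?(ltW r0)//.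
  by rewrite ler_pdivrMr// -exprD.
have rk0 : 0 <= (r / m ^+ 6) ^+ k by rewrite exprn_ge0// divr_ge0// ltW.
have qe : `|half_tan (u r)| <= kap * M ^+ 3 + D.
  rewrite -[half_tan _](subrK (kap * (r / m ^+ 6) ^+ k * half_tan (u (m ^+ 6 / 8)))) addrC.
  rewrite (le_trans (ler_normD _ _))// lerD// normrM ger0_norm ?mulr_ge0 ?(ltW kap0)//.
  apply: (@le_trans _ _ (kap * (r / m ^+ 6) ^+ k)).
    by rewrite ler_piMr ?mulr_ge0 ?(ltW kap0)//; lra.
  by rewrite ler_pM2l.
apply: (@le_trans _ _ (C2 * M ^+ 3)).
  by rewrite /C2 -mulrA ler_pM2l// mulrDl.
by apply: wk => //; rewrite /C; have := kap0; have := C10; have := C40; have := C30; lra.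
Qed.

Lemma core_of_shape_at : core C c m u p w.
Proof.
have DC : D <= C * M ^+ 3.
  by apply: wk => //; rewrite /C; have := kap0; have := C20; have := C40; have := C30; lra.
have DC2 : D ^+ 2 <= (C * M ^+ 3) ^+ 2 by rewrite lerXn2r ?nnegrE// (le_trans D0).
split; [exact: shape_primitive sh|exact: shape_p sh|exact: shape_w sh|..].
- by move=> x y x0 xy; exact: le_trans (kinetic_le x0 xy) DC2.
- by move=> x x0 xm; exact: le_trans (in_le x0 xm) DC2.
- by move=> x mx; exact: le_trans (out_le mx) DC2.
- exists (2 * X0).
    have /andP[h1 h2] := X0_bounds; apply/andP; split.
      apply: (@le_trans _ _ (kap * d / 2 * M ^+ 6)).
        by rewrite ler_wpM2r// ge_min lexx.
      rewrite [leLHS](_ : _ = 2 * (kap * d / 4 * M ^+ 6)); last by field.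
      by rewrite ler_pM2l.
    apply: (@le_trans _ _ (kap * M ^+ 6)).
      by move: h2; move: X0 (kap * M ^+ 6) => x y; lra.
    by apply: wk => //; rewrite /C; have := C10; have := C20; have := C40; have := C30; lra.
  move=> r rr; have [t1 t2] := tail rr.
  have r0 : 0 < r by case/andP: rr => mr _; apply: lt_le_trans mr; exact: exprn_gt0.
  have rk : 0 < r ^+ k by exact: exprn_gt0.
  have K : C3 * M ^+ 3 <= C * M ^+ 3.
    by apply: wk => //; rewrite /C; have := kap0; have := C20; have := C40; have := C10; lra.
  have mulN (x : R) : `|x - 2 * X0 * r ^- k| <= C3 * M ^+ 3 ->
      `|r ^+ k * x - 2 * X0| <= C * M ^+ 3 * r ^+ k.
    move=> Hx; rewrite (_ : _ - _ = r ^+ k * (x - 2 * X0 * r ^- k)); last first.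
      by field; rewrite expf_neq0// gt_eqF.
    by rewrite normrM gtr0_norm// mulrC ler_pM2r// (le_trans Hx).
  by rewrite sin_v; split; exact: mulN.
- move=> r rr; rewrite sin_v; apply: le_trans (norm_sin_le _) _; apply: le_trans (v_mid rr) _.
  have r0 : 0 < r by case/andP: rr => mr _; exact: lt_le_trans mr.
  apply: wk; first by rewrite addr_ge0// mulr_ge0// invr_ge0 exprn_ge0// ltW.
  by rewrite /C; have := kap0; have := C10; have := C40; have := C30; lra.
- exact: sin_right.
- exact: sin_ge.
- exact: sin_small.
- move=> r /andP[mr rm]; have rb : 8 * m ^+ 6 <= r <= b by rewrite mr (le_trans rm).
  have := cos_ge_half (shape_middle sh rb); rewrite cos_pi_sub; lra.
Qed.

End ShapeCore.

Lemma core_of_shape b d : 0 < b -> 0 < d -> exists C c m1, [/\ 0 < C, 0 < c, 0 < m1, m1 <= 1 / 8 &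
  forall m u p w, 0 < m -> m <= m1 -> shape b d m u p w -> core C c m u p w].
Proof.
move=> b0 d0.
pose kap : R := 8 ^+ k; pose bet := b ^- k; pose C1 := 20 * k%:R * (kap + bet).
have kap0 : 0 < kap by rewrite exprn_gt0.
have bet0 : 0 < bet by rewrite invr_gt0 exprn_gt0.
have C10 : 0 < C1 by rewrite !mulr_gt0// addr_gt0.
(* [C] and [c] are those of [core_of_shape_at], read off by unification; they depend on [k], [b] and
   [d] but not on [m]. The threshold enforces the smallness hypotheses of that lemma. *)
do 2 eexists; exists (Num.min (1 / 8) (Num.min (b / 2) (bet * d / 8 / C1))); split; last first.
- move=> m u p w m0; rewrite !le_min => /and3P[m8 mb2 mC] sh.
  apply: (@core_of_shape_at b d m u p w b0 d0 m0 m8 _ sh).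
  + rewrite expr2 mulrA; apply: (@le_trans _ _ (2 * m)).
      by rewrite mulrAC ler_piMr ?mulr_ge0 ?(ltW m0)//; lra.
    by move: mb2; lra.
  + by rewrite mulrC -ler_pdivlMr.
  + by case: k k0 => // n _; rewrite exprS ler_piMr ?(ltW m0)// exprn_ile1 ?(ltW m0)//; lra.
- by rewrite ge_min lexx.
- by rewrite !lt_min !divr_gt0// mulr_gt0.
- by rewrite lt_min !divr_gt0// mulr_gt0.
- rewrite ltr_wpDl// !addr_ge0//.
  all: rewrite ?mulr_ge0 ?addr_ge0 ?exprn_ge0 ?mulr_ge0 ?addr_ge0 ?(ltW C10) ?(ltW kap0) ?(ltW bet0)//.
Qed.

End Core.

(** * The virial functional *)

Section Cutoff.
Context (R : realType).
Local Notation mu := (@lebesgue_measure R).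
Implicit Types (f g h X : R -> R) (a b c d e r x y z L D : R).

(** The slope [e] is measured on the logarithmic scale, so it is invariant under dilations. *)
Record cutoff a b e f : Prop := Cutoff {
  cutoff_smooth : smooth f;
  cutoff_left : forall x, x <= a -> f x = 1;
  cutoff_right : forall x, b <= x -> f x = 0;
  cutoff_range : forall x, 0 <= f x <= 1;
  cutoff_slope : forall x, 0 < x -> - e <= x * derive1 f x <= 0 }.

(* An average of n dyadic translates of a step has slope of order 1/n on the
   logarithmic scale, since the translates vary on disjoint intervals. *)
Lemma dyadic_steps : exists2 M : R, 0 < M & forall n : nat, exists G : R -> R,
  [/\ smooth G, (forall x, x <= 1 -> G x = n%:R), (forall x, 2 ^+ n <= x -> G x = 0),
      (forall x, 0 <= G x <= n%:R) & forall x, 0 < x -> - M <= x * derive1 G x <= 0].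
Proof.
have [S [M [sS S1 S2 S01 [M0 S']]]] := smooth_step R.
have yS y : 0 < y -> - (2 * M) <= y * derive1 S y <= 0.
  move=> y0; have /andP[l1 l2] := S' y; rewrite (mulr_ge0_le0 (ltW y0) l2) andbT.
  have [y2|y2] := leP y 2; last first.
    by rewrite (@derive1_const_ge _ _ 0 2 _ sS S2 (ltW y2)) mulr0 oppr_le0 mulr_ge0// ltW.
  apply: (@le_trans _ _ (y * - M)); last by rewrite ler_pM2l.
  by rewrite mulrN lerN2 ler_pM2r.
exists (2 * M); first exact: mulr_gt0.
elim=> [|n [G [sG G1 G2 G01 G']]].
  exists (fun=> 0); split => //.
  - exact: smooth_cst.
  - by move=> x; rewrite lexx.
  - by move=> x x0; rewrite (is_derive1E (derive_cst 0 x)) mulr0 lexx oppr_le0 mulr_ge0// ltW.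
have pn : 0 < 2 ^- n :> R by rewrite invr_gt0 exprn_gt0.
have sSn : smooth (fun x => S (2 ^- n * x)) by exact: smooth_scale.
have p1 : 1 <= 2 ^+ n :> R by rewrite exprn_ege1// ler1n.
have half x : (2 ^- n * x <= 1) = (x <= 2 ^+ n).
  by rewrite mulrC ler_pdivrMr ?exprn_gt0// mul1r.
exists (fun x => G x + S (2 ^- n * x)); split.
- exact: smoothD.
- by move=> x x1; rewrite G1// S1 ?natr1// half (le_trans x1).
- move=> x xn; have xn' : 2 ^+ n <= x.
    by apply: le_trans xn; rewrite exprS ler_peMl ?exprn_ge0// ler1n.
  by rewrite G2// S2 ?addr0// mulrC ler_pdivlMr ?exprn_gt0// -exprS.
- move=> x; have /andP[g1 g2] := G01 x; have /andP[s1 s2] := S01 (2 ^- n * x).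
  have -> : n.+1%:R = n%:R + 1 :> R by rewrite natr1.
  by rewrite addr_ge0//= lerD.
- move=> x x0.
  have -> : derive1 (fun x => G x + S (2 ^- n * x)) x = derive1 G x + 2 ^- n * derive1 S (2 ^- n * x).
    apply: is_derive1E; apply: derive_add; first exact: smooth_derive.
    by rewrite -derive1_scale//; exact: smooth_derive.
  rewrite mulrDr; have [xn|xn] := leP x (2 ^+ n).
    by rewrite (@derive1_const_le _ S 1 1)// ?half// !mulr0 addr0 G'.
  by rewrite (@derive1_const_ge _ G 0 (2 ^+ n) x)// ?(ltW xn)// mulr0 add0r mulrCA mulrA yS// mulr_gt0.
Qed.

Lemma dyadic_cutoff : exists2 M : R, 0 < M & forall n a, 0 < a ->
  exists f, cutoff a (2 ^+ n.+1 * a) (M / n.+1%:R) f.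
Proof.
have [M M0 HM] := dyadic_steps; exists M => // n a a0.
have [G [sG G1 G2 G01 G']] := HM n.+1.
have n0 : 0 < n.+1%:R :> R by rewrite ltr0n.
exists (fun x => n.+1%:R^-1 * G (a^-1 * x)); split.
- by apply: smoothZ; exact: smooth_scale.
- by move=> x xa; rewrite G1 ?mulVf ?gt_eqF// mulrC ler_pdivrMr// mul1r.
- by move=> x xa; rewrite G2 ?mulr0// mulrC ler_pdivlMr.
- move=> x; have /andP[g1 g2] := G01 (a^-1 * x).
  by rewrite mulr_ge0 ?invr_ge0 ?(ltW n0)//= mulrC ler_pdivrMr// mul1r.
- move=> x x0.
  have -> : derive1 (fun x => n.+1%:R^-1 * G (a^-1 * x)) x = n.+1%:R^-1 * (a^-1 * derive1 G (a^-1 * x)).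
    apply: is_derive1E; apply: derive_cmul; rewrite -derive1_scale//.
    by apply: smooth_derive; exact: smooth_scale.
  have ax : 0 < a^-1 * x by rewrite mulr_gt0// invr_gt0.
  have -> : x * (n.+1%:R^-1 * (a^-1 * derive1 G (a^-1 * x))) = n.+1%:R^-1 * (a^-1 * x * derive1 G (a^-1 * x)).
    by ring.
  have /andP[h1 h2] := G' _ ax; have ni : 0 <= n.+1%:R^-1 :> R by rewrite invr_ge0 ltW.
  by rewrite (mulr_ge0_le0 ni h2) andbT mulrC -mulrN ler_wpM2l.
Qed.

(** The ratio [L] of the ends of the transition depends on [e] only, not on the place [a]; later it
    is compared with powers of [m]. *)
Lemma slow_cutoff e : 0 < e -> exists2 L, 1 <= L &
  forall a, 0 < a -> exists f, cutoff a (L * a) e f.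
Proof.
have [M M0 HM] := dyadic_cutoff; move=> e0.
have [n nM] : exists n : nat, M / e < n.+1%:R.
  by exists (Num.truncn (M / e)); exact: truncnS_gt.
exists (2 ^+ n.+1); first by rewrite exprn_ege1// ler1n.
move=> a a0; have [f [s1 s2 s3 s4 s5]] := HM n a a0; exists f; split => // x x0.
have /andP[h1 ->] := s5 x x0; rewrite andbT; apply: le_trans h1; rewrite lerN2.
by rewrite ler_pdivrMr// mulrC -ler_pdivrMr// ltW.
Qed.

Lemma standard_cutoff : exists2 M : R, 0 < M & forall a, 0 < a ->
  exists f, cutoff a (2 * a) M f.
Proof.
have [M M0 HM] := dyadic_cutoff; exists M => // a a0.
by have := HM 0 a a0; rewrite divr1.
Qed.

Section Bump.
Variables (a b e : R) (f : R -> R).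
Hypotheses (a0 : 0 < a) (ab : a <= b) (cf : cutoff a b e f).

Lemma cutoff_derive_supported : supported a b (derive1 f).
Proof.
move=> x; rewrite negb_and -!leNgt => /orP[xa|bx].
  exact: (derive1_const_le (cutoff_smooth cf) (cutoff_left cf)).
exact: (derive1_const_ge (cutoff_smooth cf) (cutoff_right cf)).
Qed.

Lemma cutoff_derive_le0 x : derive1 f x <= 0.
Proof.
have [x0|x0] := ltP 0 x.
  by have /andP[_] := cutoff_slope cf x0; rewrite pmulr_rle0.
rewrite cutoff_derive_supported// negb_and -!leNgt; apply/orP; left.
exact: le_trans x0 (ltW a0).
Qed.

Lemma cutoff_derive_cont : continuous_pos (derive1 f).
Proof. exact/smooth_pos/smooth_derive1/(cutoff_smooth cf). Qed.

Lemma cutoff_shrink A B g : A <= a -> b <= B ->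
  \int[mu]_(r in `[A, B]) (derive1 f r * g r) = \int[mu]_(r in `[a, b]) (derive1 f r * g r).
Proof.
move=> Aa bB; apply: Rintegral_shrink => // x xn.
by rewrite (supported_vanishes cutoff_derive_supported xn) mul0r.
Qed.

Lemma cutoff_mass : \int[mu]_(r in `[a, b]) (- derive1 f r) = 1.
Proof.
have [If H] := smooth_primitive (cutoff_smooth cf).
have I1 := If a b a0; rewrite RintegralN// -H//.
by rewrite (cutoff_left cf (lexx _)) (cutoff_right cf (lexx _)); ring.
Qed.

Lemma cutoff_square X D : locally_square_summable X ->
  \int[mu]_(r in `[a, b]) (X r ^+ 2 / r) <= D ->
  - (\int[mu]_(r in `[a, b]) (derive1 f r * X r ^+ 2)) <= e * D.
Proof.
move=> sX XD; have IX := locally_summable_sqr sX.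
have I1 := locally_summableMr cutoff_derive_cont IX b a0.
have I2 := locally_summable_div IX b a0.
rewrite -RintegralN//.
apply: (@le_trans _ _ (e * \int[mu]_(r in `[a, b]) (X r ^+ 2 / r))).
  rewrite -RintegralZl//; apply: le_Rintegral_segment; [exact: summableN|exact: summableZ|].
  move=> x /andP[ax _]; have x0 := lt_le_trans a0 ax.
  have /andP[h _] := cutoff_slope cf x0.
  rewrite -mulNr mulrA [leRHS]mulrAC ler_wpM2r ?sqr_ge0// ler_pdivlMr// mulrC mulrN.
  by rewrite lerNl.
have e0 : 0 <= e by have /andP[h1 h2] := cutoff_slope cf a0; rewrite -oppr_le0 (le_trans h1).
exact: ler_wpM2l.
Qed.

(** Cauchy-Schwarz for [dr / r]. In the factor [(r * derive1 f r * F r) ^+ 2 / r] one copy of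
    [r * derive1 f r] is bounded by [e] and the other integrates to the total mass 1, so a linear
    term gains the square root of the slope, whatever the length of the transition. *)
Lemma cutoff_linear F X B D s : continuous_pos F -> locally_square_summable X ->
  (forall r, a <= r <= b -> `|F r| <= B) -> 0 <= B -> 0 <= D -> 0 <= s -> e <= s ^+ 2 ->
  \int[mu]_(r in `[a, b]) (X r ^+ 2 / r) <= D ^+ 2 ->
  `|\int[mu]_(r in `[a, b]) (derive1 f r * (F r * X r))| <= B * D * s.
Proof.
move=> cF sX FB B0 D0 s0 es XD.
have cG : continuous_pos (fun r => r * derive1 f r * F r).
  apply: continuous_posM cF; apply: continuous_posM cutoff_derive_cont.
  exact: continuous_pos_id.
have := weighted_Cauchy_Schwarz b a0 (continuous_pos_square_summable cG) sX.
rewrite (@eq_Rintegral_segment _ _ (fun r => derive1 f r * (F r * X r))); last first.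
  by move=> r /andP[ar _]; field; rewrite gt_eqF// (lt_le_trans a0).
move=> H; rewrite -(@ler_pXn2r _ 2)// ?nnegrE ?mulr_ge0// real_normK ?num_real//.
apply: le_trans H _.
have -> : (B * D * s) ^+ 2 = (s ^+ 2 * B ^+ 2) * D ^+ 2 by ring.
apply: ler_pM => //.
- by apply: Rintegral_ge0_segment => r /andP[ar _]; rewrite divr_ge0 ?sqr_ge0// (le_trans (ltW a0)).
- by apply: Rintegral_ge0_segment => r /andP[ar _]; rewrite divr_ge0 ?sqr_ge0// (le_trans (ltW a0)).
rewrite -[leRHS]mulr1 -cutoff_mass.
have If : summable_on `[a, b] (fun r => - derive1 f r).
  by apply: summableN => //; exact: continuous_pos_summable cutoff_derive_cont _ _ a0.
rewrite -RintegralZl//; apply: le_Rintegral_segment.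
- by apply: locally_summable_div a0; exact/continuous_pos_summable/continuous_posX.
- exact: summableZ.
move=> r rab; have /andP[ar rb] := rab; have r0 := lt_le_trans a0 ar.
have /andP[h1 h2] := cutoff_slope cf r0.
have F2 : F r ^+ 2 <= B ^+ 2.
  by rewrite -(real_normK (num_real (F r))) lerXn2r ?nnegrE ?FB// normr_ge0.
have f0 := cutoff_derive_le0 r.
have -> : (r * derive1 f r * F r) ^+ 2 / r = (- (r * derive1 f r)) * F r ^+ 2 * (- derive1 f r).
  by field; rewrite gt_eqF.
rewrite ler_wpM2r ?oppr_ge0//; apply: ler_pM; rewrite ?oppr_ge0 ?sqr_ge0//.
by rewrite lerNl (le_trans _ h1)// lerN2.
Qed.

End Bump.

Lemma Rintegral_inv_sqr a b : 0 < a -> a <= b -> \int[mu]_(r in `[a, b]) (r^-1 ^+ 2) <= a^-1.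
Proof.
move=> a0 ab.
have p : primitive (fun r : R => - r ^- 1) (fun r => r ^- 2).
  apply: primitive_derive; last exact: continuous_pos_inv.
  move=> x x0; apply: (is_derive_eq (derive_opp (derive_expV 1 (lt0r_neq0 x0)))).
  by rewrite mulN1r opprK.
have [_ H] := p; rewrite (@eq_Rintegral_segment _ _ (fun r => r ^- 2)); last by move=> r _; rewrite exprVn.
rewrite -H// opprK addrC !expr1 gerDl oppr_le0 invr_ge0; exact: le_trans (ltW a0) ab.
Qed.

End Cutoff.

(** * Derivative, size and comparison of the virial functional *)

Section Virial.
Context (R : realType).
Local Notation mu := (@lebesgue_measure R).
Implicit Types (f g h X u p w : R -> R) (a b c d e r x y z L D T : R).
Variable k : nat.

Lemma norm_le_sqr x A : 0 <= A -> x ^+ 2 <= A ^+ 2 -> `|x| <= A :> R.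
Proof. by move=> A0; rewrite -(real_normK (num_real x)) ler_pXn2r ?nnegrE. Qed.

(** Writes [r * r ^- (2 * k)] as [r ^- n * r ^- 2] with [n = 2 * k - 3]. The first factor is bounded
    by its value at the left end, and only the integral of [r ^- 2] has to be computed. *)
Lemma double_sub3 n : (2 <= n)%N -> (2 * n)%N = (2 * n - 3).+3.
Proof. lia. Qed.

Lemma expV_shift z n : z != 0 -> z ^- n / z = z ^+ 2 / z ^+ n.+3.
Proof. by move=> z0; rewrite !exprS; field; rewrite expf_neq0 ?z0. Qed.

Lemma virial_sum (M K s C C5 A B D c m : R) (i0 i4 i10 i4c i10s i5 i9 i2o i2s : R) :
  i4 <= s ^+ 2 * C ^+ 2 * M -> i10 <= 0 -> - i4c <= C5 * C * s * M ->
  i10s <= K * C * C * s * M -> i5 <= m * A * M -> i9 <= m * B * M ->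
  - i2o <= m * D * M -> i2s <= - (K ^+ 2 * c ^+ 2 * M) -> 0 <= i0 ->
  - i0 + i4 + i10 - i4c + i10s + i5 + i9 - i2o + i2s <=
  (s * (s * C ^+ 2 + (C5 + K * C) * C) + m * (A + B + D) - K ^+ 2 * c ^+ 2) * M.
Proof.
have -> : (s * (s * C ^+ 2 + (C5 + K * C) * C) + m * (A + B + D) - K ^+ 2 * c ^+ 2) * M =
  s ^+ 2 * C ^+ 2 * M + C5 * C * s * M + K * C * C * s * M + m * A * M + m * B * M + m * D * M
  - K ^+ 2 * c ^+ 2 * M by ring.
move: (s ^+ 2 * C ^+ 2 * M) (C5 * C * s * M) (K * C * C * s * M) (m * A * M) (m * B * M) (m * D * M)
  (K ^+ 2 * c ^+ 2 * M) => *; lra.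
Qed.

(* m^6 is the scale of the inner bubble; its region ends at m^4, and the
   interaction with the outer bubble is tested between m^4 and m^2. *)
Record frame L s s0 m (P10 P5 P4 P2 : R -> R) : Prop := Frame {
  frame_m0 : 0 < m;
  frame_m8 : m <= 1 / 8;
  frame_L1 : 1 <= L;
  frame_Lm : L * m <= 1;
  frame_s : 0 <= s;
  frame_s0 : 0 <= s0;
  frame_10 : cutoff (m ^+ 10 / L) (m ^+ 10) (s ^+ 2) P10;
  frame_5 : cutoff (m ^+ 5) (2 * m ^+ 5) (s0 ^+ 2) P5;
  frame_4 : cutoff (m ^+ 4) (L * m ^+ 4) (s ^+ 2) P4;
  frame_2 : cutoff (m ^+ 2) (2 * m ^+ 2) (s0 ^+ 2) P2 }.

Section Frame.
Variables (L s s0 m : R) (P10 P5 P4 P2 : R -> R).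
Hypothesis fr : frame L s s0 m P10 P5 P4 P2.

(** One window that contains the supports of [phi], [om] and [g5], so that all integrals have the
    same domain. *)
Let J := `[m ^+ 11, m]%classic : set R.
(** Equal to 1 between [m ^+ 10] and [m ^+ 4]. The inner cut keeps the support away from the origin,
    as required of test functions. *)
Let phi r := P4 r - P10 r.
Let om r := P2 r - P4 r.
Let g5 r := r ^+ k * - derive1 P5 r.

(* Measures k r^k (pi - u) around r = m^5, where this quantity is almost
   constant. *)
Definition tail_coef u : R := k%:R * \int[mu]_(r in J) ((pi - u r) * g5 r).

Definition virial u p w : R :=
  \int[mu]_(r in J) (r ^+ 2 * phi r * (w r * p r))
  + tail_coef u * \int[mu]_(r in J) (w r * (om r * r ^- k * r)).

Definition virial_rate u p w : R :=
  (- (\int[mu]_(r in J) (phi r * (r * w r ^+ 2)))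
     - 2^-1 * \int[mu]_(r in J) (derive1 phi r * ((r * w r) ^+ 2
        + defect k%:R u p r ^+ 2 + 2 * k%:R * (sin (u r) * defect k%:R u p r))))
  + (k%:R * - (\int[mu]_(r in J) (w r * g5 r)) * \int[mu]_(r in J) (w r * (om r * r ^- k * r))
     + tail_coef u * (k%:R * \int[mu]_(r in J) ((1 + cos (u r)) * om r * r ^- k.+1 * defect k%:R u p r)
     - \int[mu]_(r in J) (derive1 om r * r ^- k * defect k%:R u p r))).

Let m0 : 0 < m. Proof. exact: frame_m0 fr. Qed.
Let m1 : m <= 1. Proof. have := frame_m8 fr; lra. Qed.
Let L1 : 1 <= L. Proof. exact: frame_L1 fr. Qed.
Let L0 : 0 < L. Proof. exact: lt_le_trans L1. Qed.
Let mp n : 0 < m ^+ n. Proof. exact: exprn_gt0. Qed.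
Let mn_le n l : (l <= n)%N -> m ^+ n <= m ^+ l.
Proof.
move=> nl; have -> : m ^+ n = m ^+ l * m ^+ (n - l) by rewrite -exprD subnKC.
by rewrite ler_piMr ?exprn_ge0 ?(ltW m0)// exprn_ile1 ?(ltW m0).
Qed.
Let mn_le8 n : 8 * m ^+ n.+1 <= m ^+ n.
Proof.
rewrite exprS mulrA ler_piMl ?exprn_ge0 ?(ltW m0)//; have := frame_m8 fr; lra.
Qed.
Let Lm n : L * m ^+ n.+1 <= m ^+ n.
Proof. by rewrite exprS mulrA ler_piMl ?exprn_ge0 ?(ltW m0)// (frame_Lm fr). Qed.
Let mn_le2 n : 2 * m ^+ n.+1 <= m ^+ n.
Proof. by apply: le_trans (mn_le8 n); rewrite ler_pM2r// ler_nat. Qed.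

Let j0 : 0 < m ^+ 11. Proof. exact: mp. Qed.
Let j1 : m ^+ 11 <= m. Proof. by have := mn_le (isT : (1 <= 11)%N). Qed.
Let a10 : m ^+ 11 <= m ^+ 10 / L.
Proof. by rewrite ler_pdivlMr// mulrC; exact: Lm. Qed.
Let a10' : 0 < m ^+ 10 / L. Proof. by rewrite divr_gt0. Qed.
Let b10 : m ^+ 10 / L <= m ^+ 10.
Proof. by rewrite ler_pdivrMr// ler_peMr// ltW. Qed.
Let b5 : m ^+ 5 <= 2 * m ^+ 5. Proof. by rewrite ler_peMl ?(ltW (mp _))// ler1n. Qed.
Let b4 : m ^+ 4 <= L * m ^+ 4. Proof. by rewrite ler_peMl// ltW. Qed.
Let b2 : m ^+ 2 <= 2 * m ^+ 2. Proof. by rewrite ler_peMl ?(ltW (mp _))// ler1n. Qed.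
Let mm n : (0 < n)%N -> m ^+ n <= m. Proof. by move=> n0; have := mn_le n0; rewrite expr1. Qed.
Let c4 : L * m ^+ 4 <= m ^+ 3. Proof. exact: Lm. Qed.
Let c2 : 2 * m ^+ 2 <= m. Proof. by have := mn_le2 1; rewrite expr1. Qed.
Let c5 : 2 * m ^+ 5 <= m ^+ 4. Proof. exact: mn_le2. Qed.

Let s10 := cutoff_smooth (frame_10 fr).
Let s5 := cutoff_smooth (frame_5 fr).
Let s4 := cutoff_smooth (frame_4 fr).
Let s2 := cutoff_smooth (frame_2 fr).

Let sphi : smooth phi. Proof. exact: smoothB. Qed.
Let som : smooth om. Proof. exact: smoothB. Qed.
Let sg5 : smooth g5.
Proof. by apply: smoothM; [exact: smoothX|apply: smoothN; exact: smooth_derive1]. Qed.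

Let phi_supp : supported (m ^+ 10 / L) (L * m ^+ 4) phi.
Proof.
move=> x; rewrite negb_and -!leNgt /phi => /orP[xa|bx].
  rewrite (cutoff_left (frame_10 fr))// (cutoff_left (frame_4 fr)) ?subrr//.
  by rewrite (le_trans xa)// (le_trans b10)// mn_le.
rewrite (cutoff_right (frame_4 fr))// (cutoff_right (frame_10 fr)) ?subrr//.
by rewrite (le_trans _ bx)// (le_trans _ b4)// mn_le.
Qed.

Let om_supp : supported (m ^+ 4) (2 * m ^+ 2) om.
Proof.
move=> x; rewrite negb_and -!leNgt /om => /orP[xa|bx].
  rewrite (cutoff_left (frame_4 fr))// (cutoff_left (frame_2 fr)) ?subrr//.
  by rewrite (le_trans xa)// mn_le.
rewrite (cutoff_right (frame_2 fr))// (cutoff_right (frame_4 fr)) ?subrr//.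
by rewrite (le_trans _ bx)// (le_trans c4)// (le_trans _ b2)// mn_le.
Qed.

Let g5_supp : supported (m ^+ 5) (2 * m ^+ 5) g5.
Proof.
by move=> x xn; rewrite /g5 (cutoff_derive_supported (frame_5 fr))// oppr0 mulr0.
Qed.

Let van f a b : supported a b f -> m ^+ 11 <= a -> b <= m -> vanishes_off (m ^+ 11) m f.
Proof. by move=> sf ha hb; apply: supported_vanishes; apply: supported_widen sf. Qed.

Let phi_van : vanishes_off (m ^+ 11) m phi.
Proof. by apply: van phi_supp _ _ => //; rewrite (le_trans c4)// mm. Qed.
Let om_van : vanishes_off (m ^+ 11) m om.
Proof. by apply: van om_supp _ _ => //; exact: mn_le. Qed.
Let g5_van : vanishes_off (m ^+ 11) m g5.
Proof. by apply: van g5_supp _ _ => //; [exact: mn_le|rewrite (le_trans c5)// mm]. Qed.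

Lemma flow_virial_rate T (u p w : R -> R -> R) t : wave_flow k T u p w -> T < t ->
  is_derive t 1 (fun t => virial (u t) (p t) (w t)) (virial_rate (u t) (p t) (w t)).
Proof.
move=> wf tT; apply: derive_add; first exact: flow_virial wf sphi j0 j1 phi_van tT.
apply: derive_mul; last exact: flow_linear wf som j0 j1 om_van tT.
apply: derive_cmul.
have d := derive_sub (derive_cst (\int[mu]_(r in J) (pi * g5 r)) t) (flow_eq1 wf sg5 j0 j1 g5_van tT).
have cg := smooth_pos sg5.
apply: derive_near (is_derive_eq d _); last by rewrite sub0r.
near=> t'; have t'T : T < t' by near: t'; exact: lt_nbhsr.
have cu := primitive_cont (flow_primitive wf t'T).
have I1 := continuous_pos_summable (continuous_posM (@continuous_pos_cst R pi) cg) m j0.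
have I2 := continuous_pos_summable (continuous_posM cu cg) m j0.
by rewrite /J -RintegralB//; apply: eq_Rintegral_segment => r _; rewrite mulrBl.
Unshelve. all: by end_near. Qed.

Section Rate.
Variables (u p w : R -> R) (C c : R).
Hypotheses (k2 : (2 <= k)%N) (C0 : 0 < C) (c0 : 0 < c).
Hypothesis co : core k C c m u p w.

Let M := m ^+ k.
Let D := C * M ^+ 3.
Let H := defect k%:R u p.
Let Ho := defect (- k%:R) u p.
Let X r := r * w r.
Let N := tail_coef u.

Let cu : continuous_pos u. Proof. exact: primitive_cont (core_primitive co). Qed.
Let sH : locally_square_summable H.
Proof. exact: locally_square_summable_defect cu (core_p co). Qed.
Let sHo : locally_square_summable Ho.
Proof. exact: locally_square_summable_defect cu (core_p co). Qed.
Let sX : locally_square_summable X.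
Proof. exact: locally_square_summableMr (@continuous_pos_id R) (core_w co). Qed.
Let csin : continuous_pos (fun r => sin (u r)). Proof. exact: continuous_pos_sin. Qed.
Let ccos : continuous_pos (fun r => cos (u r)). Proof. exact: continuous_pos_cos. Qed.
Let cinv : continuous_pos (fun r : R => r ^- k). Proof. exact: continuous_pos_inv. Qed.
Let d10 : continuous_pos (derive1 P10). Proof. exact/smooth_pos/smooth_derive1. Qed.
Let d5 : continuous_pos (derive1 P5). Proof. exact/smooth_pos/smooth_derive1. Qed.
Let d4 : continuous_pos (derive1 P4). Proof. exact/smooth_pos/smooth_derive1. Qed.
Let d2 : continuous_pos (derive1 P2). Proof. exact/smooth_pos/smooth_derive1. Qed.

Let I4a := \int[mu]_(r in J) (derive1 P4 r * X r ^+ 2).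
Let I4b := \int[mu]_(r in J) (derive1 P4 r * H r ^+ 2).
Let I10a := \int[mu]_(r in J) (derive1 P10 r * X r ^+ 2).
Let I10b := \int[mu]_(r in J) (derive1 P10 r * H r ^+ 2).
Let I4c := \int[mu]_(r in J) (derive1 P4 r * ((k%:R * sin (u r) - N * r ^- k) * H r)).
Let I10s := \int[mu]_(r in J) (derive1 P10 r * (sin (u r) * H r)).
Let I2o := \int[mu]_(r in J) (derive1 P2 r * (r ^- k * Ho r)).
Let I2s := \int[mu]_(r in J) (derive1 P2 r * (r ^- k * sin (u r))).
Let I0 := \int[mu]_(r in J) (phi r * (r * w r ^+ 2)).
Let I5 := \int[mu]_(r in J) (w r * g5 r).
Let Il := \int[mu]_(r in J) (w r * (om r * r ^- k * r)).
Let I9 := \int[mu]_(r in J) ((1 + cos (u r)) * om r * r ^- k.+1 * H r).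

Let IL f Y : continuous_pos f -> locally_square_summable Y -> locally_summable (fun r => f r * Y r).
Proof. by move=> cf sY; apply: locally_summableMr cf _; exact: locally_square_summable_summable. Qed.

Let IL2 f Y : continuous_pos f -> locally_square_summable Y -> locally_summable (fun r => f r * Y r ^+ 2).
Proof. by move=> cf sY; apply: locally_summableMr cf _; exact: locally_summable_sqr. Qed.

(** The cancellation behind the choice of [tail_coef]. As [phi] and [om] share the cutoff [P4], the
    terms [k * sin u * H] and [N * r ^- k * H] appear there as a difference, in [I4c]. At the outer
    cut [P2] the defect [H] is written as [Ho - 2 * k * sin u], since only [Ho] is small there; this
    produces [I2s], the term with a sign. *)
Let rate_split : virial_rate u p w =
  - I0 - 2^-1 * (I4a + I4b) + 2^-1 * (I10a + I10b) - I4c + k%:R * I10s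
  + k%:R * - I5 * Il + N * (k%:R * I9) - N * I2o + 2 * k%:R * N * I2s.
Proof.
have dphi : derive1 phi = fun r => derive1 P4 r - derive1 P10 r.
  by apply/funext => r; apply: is_derive1E; apply: derive_sub; exact: smooth_derive.
have dom : derive1 om = fun r => derive1 P2 r - derive1 P4 r.
  by apply/funext => r; apply: is_derive1E; apply: derive_sub; exact: smooth_derive.
pose K4s := \int[mu]_(r in J) (derive1 P4 r * sin (u r) * H r).
pose K4i := \int[mu]_(r in J) (derive1 P4 r * r ^- k * H r).
have c4s := continuous_posM d4 csin; have c4i := continuous_posM d4 cinv.
have i4a := IL2 d4 sX; have i4b := IL2 d4 sH; have i4s := IL c4s sH; have i4i := IL c4i sH.
have i10a := IL2 d10 sX; have i10b := IL2 d10 sH.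
have i10s : locally_summable (fun r => derive1 P10 r * (sin (u r) * H r)).
  by have := IL (continuous_posM d10 csin) sH; under eq_fun do rewrite -mulrA.
have i2o : locally_summable (fun r => derive1 P2 r * (r ^- k * Ho r)).
  by have := IL (continuous_posM d2 cinv) sHo; under eq_fun do rewrite -mulrA.
have i2s : locally_summable (fun r => derive1 P2 r * (r ^- k * sin (u r))).
  by apply: continuous_pos_summable; do 2!apply: continuous_posM => //.
have E1 : \int[mu]_(r in J) (derive1 phi r * ((r * w r) ^+ 2
        + defect k%:R u p r ^+ 2 + 2 * k%:R * (sin (u r) * defect k%:R u p r))) =
    1 * (1 * I4a + 1 * I4b + 2 * k%:R * K4s + 0 * K4s)
    + (-1) * (1 * I10a + 1 * I10b + 2 * k%:R * I10s + 0 * I10s).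
  rewrite -!Rintegral_lin4// -Rintegral_lin2//.
  - by rewrite dphi; apply: eq_Rintegral => r _; rewrite /X /H; ring.
  - do 2!(apply: locally_summableD; last exact: locally_summableZ).
    by apply: locally_summableD; exact: locally_summableZ.
  - do 2!(apply: locally_summableD; last exact: locally_summableZ).
    by apply: locally_summableD; exact: locally_summableZ.
have E2 : \int[mu]_(r in J) (derive1 om r * r ^- k * defect k%:R u p r) =
    1 * I2o + (- 2 * k%:R) * I2s + (-1) * K4i + 0 * K4i.
  rewrite -Rintegral_lin4//; rewrite dom; apply: eq_Rintegral => r _.
  by rewrite /H /Ho /defect; ring.
have E3 : I4c = k%:R * K4s + (- N) * K4i.
  by rewrite -Rintegral_lin2//; apply: eq_Rintegral => r _; ring.
rewrite /virial_rate E1 E2 E3 -/I0 -/I5 -/Il -/I9 -/N.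
by field.
Qed.

Let M0 : 0 < M. Proof. exact: mp. Qed.
Let D0 : 0 < D. Proof. by rewrite mulr_gt0// exprn_gt0. Qed.

Let norm2_le a b Y A E : 0 < a -> a <= b -> locally_square_summable Y ->
  A <= a -> b <= E -> 0 < A -> \int[mu]_(r in `[A, E]) (Y r ^+ 2 / r) <= D ^+ 2 ->
  \int[mu]_(r in `[a, b]) (Y r ^+ 2 / r) <= D ^+ 2.
Proof.
move=> a0 ab sY Aa bE A0; apply: le_trans.
apply: ge0_subset_Rintegral => //; first exact: sub_segment.
  exact: locally_summable_div (locally_summable_sqr sY) _ _ A0.
by move=> r /=; rewrite in_itv/= => /andP[Ar _]; rewrite divr_ge0 ?sqr_ge0// (le_trans (ltW A0)).
Qed.

Let X_le a b : 0 < a -> a <= b -> \int[mu]_(r in `[a, b]) (X r ^+ 2 / r) <= D ^+ 2.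
Proof.
move=> a0 ab; apply: le_trans (core_kinetic co a0 ab).
rewrite (@eq_Rintegral_segment _ _ (fun r => r * w r ^+ 2))// => r /andP[ar _].
by rewrite /X; field; rewrite gt_eqF// (lt_le_trans a0).
Qed.

Let H_le a b : 0 < a -> a <= b -> b <= m ^+ 3 -> \int[mu]_(r in `[a, b]) (H r ^+ 2 / r) <= D ^+ 2.
Proof.
move=> a0 ab bm; apply: (norm2_le a0 ab sH (lexx _) bm a0).
exact: (core_in co a0 (le_trans ab bm)).
Qed.

Let Ho_le a b : m ^+ 3 <= a -> a <= b -> \int[mu]_(r in `[a, b]) (Ho r ^+ 2 / r) <= D ^+ 2.
Proof.
move=> ma ab; apply: (norm2_le (lt_le_trans (mp 3) ma) ab sHo ma (lexx _) (mp 3)).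
exact: (core_out co (le_trans ma ab)).
Qed.

Let pow_inv_le a r n : 0 < a -> a <= r -> r ^- n <= a ^- n.
Proof.
move=> a0 ar; rewrite lef_pV2 ?posrE ?exprn_gt0 ?(lt_le_trans a0 ar)//.
by rewrite lerXn2r ?nnegrE// ltW// (lt_le_trans a0 ar).
Qed.

Let powM n : (m ^+ n) ^+ k = M ^+ n. Proof. by rewrite -!exprM mulnC. Qed.

Let M_le_m : M <= m ^+ 2. Proof. exact: mn_le. Qed.
Let M1 : M <= 1. Proof. by apply: le_trans M_le_m _; rewrite exprn_ile1// ltW. Qed.
Let Mn_le n l : (l <= n)%N -> M ^+ n <= M ^+ l.
Proof.
move=> nl; have -> : M ^+ n = M ^+ l * M ^+ (n - l) by rewrite -exprD subnKC.
by apply: ler_piMr; [exact: exprn_ge0 (ltW M0)|exact: exprn_ile1 (ltW M0) M1].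
Qed.

Let K2 : 1 <= 2 ^+ k :> R. Proof. by rewrite exprn_ege1// ler1n. Qed.
Let k1 : 1 <= k%:R :> R. Proof. by rewrite ler1n; case: k k2. Qed.
Let kC : 0 < k%:R * C. Proof. by rewrite mulr_gt0// (lt_le_trans _ k1). Qed.

Let m43 : m ^+ 4 <= m ^+ 3. Proof. exact: mn_le. Qed.

(** The weight [- derive1 P5] has mass 1, so [N / k] is an average of [r ^+ k * (pi - u)] over
    [r <= 2 * m ^+ 5], where the error in [core_tail] is of order [M ^+ 3 * M ^+ 5]. *)
Let tail_le : exists2 Y : R, c * M ^+ 6 <= Y <= C * M ^+ 6 /\
    `|N - k%:R * Y| <= k%:R * C * 2 ^+ k * M ^+ 8 &
  forall r, m ^+ 5 <= r <= m ^+ 3 -> `|r ^+ k * sin (u r) - Y| <= C * M ^+ 3 * r ^+ k.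
Proof.
have [Y Yb HY] := core_tail co; exists Y; last by move=> r /HY[].
split=> //; have k0 : 0 <= k%:R :> R by exact: le_trans k1.
have cv : continuous_pos (fun r => (pi - u r) * r ^+ k).
  apply: continuous_posM; last exact/continuous_posX/continuous_pos_id.
  by apply: continuous_posB cu; exact: continuous_pos_cst.
have cn5 := continuous_posN d5.
have I1 := continuous_pos_summable (continuous_posM cv cn5).
have I2 := continuous_pos_summable cn5.
have m5 := mp 5.
have mass := cutoff_mass m5 b5 (frame_5 fr).
pose e5 r := r ^+ k * (pi - u r) - Y.
have ce5 : continuous_pos e5.
  apply: continuous_posB; last exact: continuous_pos_cst.
  by have := cv; under eq_fun do rewrite mulrC.
have I3 := continuous_pos_summable (continuous_posM cn5 ce5).
have E : N - k%:R * Y = k%:R * \int[mu]_(r in `[m ^+ 5, (2 * m ^+ 5)]) (- derive1 P5 r * e5 r).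
  have -> : \int[mu]_(r in `[m ^+ 5, (2 * m ^+ 5)]) (- derive1 P5 r * e5 r) =
     1 * \int[mu]_(r in `[m ^+ 5, (2 * m ^+ 5)]) ((pi - u r) * r ^+ k * - derive1 P5 r)
     + (- Y) * \int[mu]_(r in `[m ^+ 5, (2 * m ^+ 5)]) (- derive1 P5 r).
    by rewrite -Rintegral_lin2//; apply: eq_Rintegral_segment => r _; rewrite /e5; ring.
  rewrite mass mul1r mulr1 mulrBr; congr (_ - _); rewrite /N /tail_coef; congr (_ * _).
  rewrite /J (@Rintegral_shrink _ (m ^+ 5) (2 * m ^+ 5)).
  - by apply: eq_Rintegral_segment => r _; rewrite /g5; ring.
  - exact: mn_le.
  - by rewrite (le_trans c5)// mm.
  - by move=> r rn; rewrite (supported_vanishes g5_supp rn) mulr0.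
have I2' := I2 (m ^+ 5) (2 * m ^+ 5) m5; have I3' := I3 (m ^+ 5) (2 * m ^+ 5) m5.
rewrite E normrM (ger0_norm k0) -!mulrA ler_wpM2l//.
apply: (le_trans (le_normr_Rintegral _ _)) => //.
apply: (@le_trans _ _ (\int[mu]_(r in `[m ^+ 5, (2 * m ^+ 5)]) (C * M ^+ 3 * (2 * m ^+ 5) ^+ k * (- derive1 P5 r)))).
  apply: le_Rintegral_segment; [exact: summable_norm|exact: summableZ|].
  move=> r /andP[ar br]; have f0 := cutoff_derive_le0 m5 (frame_5 fr) r.
  have r0 := lt_le_trans m5 ar.
  rewrite normrM ger0_norm ?oppr_ge0// mulrC ler_wpM2r ?oppr_ge0//.
  have [_ h] := HY r (introT andP (conj ar (le_trans br (le_trans c5 m43)))).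
  apply: le_trans h _; rewrite ler_wpM2l ?(ltW D0)//.
  by rewrite lerXn2r ?nnegrE ?(ltW r0)// (le_trans (ltW r0)).
rewrite RintegralZl// mass mulr1 exprMn powM.
by rewrite le_eqVlt; apply/orP; left; apply/eqP; ring.
Qed.

Hypothesis small : C * 2 ^+ k * M ^+ 2 <= c / 2.

Let C5 := k%:R * C * (1 + 2 ^+ k).

Let C50 : 0 < C5. Proof. by rewrite mulr_gt0// ltr_wpDr. Qed.

(** The tail is measured at [m ^+ 5] and used from [m ^+ 4] on: there [r ^- k <= M ^- 4] turns the
    error [M ^+ 8] of the coefficient into [M ^+ 4]. What is left of the cross term is of order
    [M ^+ 3]. *)
Let N_bounds : k%:R * c / 2 * M ^+ 6 <= N <= C5 * M ^+ 6 /\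
  forall r, m ^+ 4 <= r <= L * m ^+ 4 -> `|k%:R * sin (u r) - N * r ^- k| <= C5 * M ^+ 3.
Proof.
have [Y [/andP[Y1 Y2] HN] HY] := tail_le.
have K0 : 0 < k%:R :> R by exact: lt_le_trans k1.
have M6 : 0 < M ^+ 6 := exprn_gt0 _ M0.
have M3 : 0 < M ^+ 3 := exprn_gt0 _ M0.
have M8 : k%:R * C * 2 ^+ k * M ^+ 8 <= k%:R * (c / 2) * M ^+ 6.
  rewrite [leLHS](_ : _ = k%:R * (C * 2 ^+ k * M ^+ 2) * M ^+ 6); last by ring.
  by rewrite ler_pM2r// ler_pM2l.
have kY1 : k%:R * (c * M ^+ 6) <= k%:R * Y by rewrite ler_pM2l.
have kY2 : k%:R * Y <= k%:R * (C * M ^+ 6) by rewrite ler_pM2l.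
have M86 : k%:R * C * 2 ^+ k * M ^+ 8 <= k%:R * C * 2 ^+ k * M ^+ 6.
  by rewrite ler_wpM2l ?Mn_le// mulr_ge0 ?(ltW kC)// (le_trans _ K2).
split.
  move: HN; rewrite ler_norml => /andP[n1 n2]; apply/andP; split.
    have E : k%:R * (c * M ^+ 6) = k%:R * (c / 2) * M ^+ 6 + k%:R * c / 2 * M ^+ 6 by field.
    by move: n1 M8 kY1; rewrite E; move: (k%:R * (c / 2) * M ^+ 6) (k%:R * c / 2 * M ^+ 6) (k%:R * Y) (_ * M ^+ 8) => *; lra.
  have E : C5 * M ^+ 6 = k%:R * (C * M ^+ 6) + k%:R * C * 2 ^+ k * M ^+ 6 by rewrite /C5; ring.
  by move: n2 M86 kY2; rewrite E; move: (k%:R * C * 2 ^+ k * M ^+ 6) (k%:R * (C * M ^+ 6)) (k%:R * Y) (_ * M ^+ 8) => *; lra.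
move=> r /andP[ar br]; have r0 := lt_le_trans (mp 4) ar.
have rk : 0 < r ^+ k := exprn_gt0 _ r0.
have rin : m ^+ 5 <= r <= m ^+ 3 by rewrite (le_trans _ ar) ?mn_le//= (le_trans br).
have h := HY r rin.
rewrite (_ : _ - _ = r ^- k * (k%:R * (r ^+ k * sin (u r) - Y)) - r ^- k * (N - k%:R * Y)); last first.
  by field; rewrite gt_eqF.
rewrite (le_trans (ler_normB _ _))//.
have -> : C5 * M ^+ 3 = k%:R * C * M ^+ 3 + k%:R * C * 2 ^+ k * M ^+ 3 by rewrite /C5; ring.
have ri : 0 < r ^- k by rewrite invr_gt0.
apply: lerD.
  rewrite [leRHS](_ : _ = r ^- k * (k%:R * (C * M ^+ 3 * r ^+ k))); last by field; rewrite gt_eqF.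
  by rewrite !normrM (gtr0_norm ri) (gtr0_norm K0) ler_pM2l// ler_pM2l.
rewrite normrM (gtr0_norm ri).
apply: (@le_trans _ _ (M ^- 4 * (k%:R * C * 2 ^+ k * M ^+ 8))).
  apply: ler_pM => //; first exact: ltW.
  by rewrite -powM; exact: pow_inv_le.
rewrite [leLHS](_ : _ = k%:R * C * 2 ^+ k * M ^+ 4); last by field; rewrite gt_eqF.
by rewrite ler_wpM2l ?Mn_le// mulr_ge0 ?(ltW kC)// (le_trans _ K2).
Qed.

Let N0 : 0 < N.
Proof.
have [/andP[h _] _] := N_bounds; apply: lt_le_trans h.
have K0 : 0 < k%:R :> R by exact: lt_le_trans k1.
have M6 : 0 < M ^+ 6 := exprn_gt0 _ M0.
by rewrite mulr_gt0// divr_gt0// mulr_gt0.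
Qed.

Let I4_le : - (I4a + I4b) <= 2 * s ^+ 2 * D ^+ 2.
Proof.
have ia : - I4a <= s ^+ 2 * D ^+ 2.
  rewrite /I4a /J (cutoff_shrink (frame_4 fr)) ?mn_le//; last by rewrite (le_trans c4)// mm.
  apply: (cutoff_square (mp 4) (frame_4 fr) sX); exact: X_le.
have ib : - I4b <= s ^+ 2 * D ^+ 2.
  rewrite /I4b /J (cutoff_shrink (frame_4 fr)) ?mn_le//; last by rewrite (le_trans c4)// mm.
  apply: (cutoff_square (mp 4) (frame_4 fr) sH); exact: H_le.
by rewrite opprD -mulrA mulr_natl mulr2n; exact: lerD.
Qed.

(** The quadratic boundary terms at the inner end have a favourable sign, since [P10] decreases and
    enters [phi] negatively. *)
Let I10_le : I10a + I10b <= 0.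
Proof.
have neg Y : locally_square_summable Y -> \int[mu]_(r in J) (derive1 P10 r * Y r ^+ 2) <= 0.
  move=> sY; have I := IL2 d10 sY m j0.
  rewrite /J -oppr_ge0 -RintegralN//; apply: Rintegral_ge0_segment => r _.
  rewrite oppr_ge0 mulr_le0_ge0 ?sqr_ge0//; exact: cutoff_derive_le0 a10' (frame_10 fr) r.
by rewrite -[0]addr0; apply: lerD; exact: neg.
Qed.

Let I0_ge : 0 <= I0.
Proof.
apply: Rintegral_ge0_segment => r /andP[jr _].
have r0 : 0 <= r by exact: le_trans (ltW j0) jr.
apply: mulr_ge0; last by rewrite mulr_ge0 ?sqr_ge0.
rewrite subr_ge0; have [rm|rm] := leP r (m ^+ 4).
  by rewrite (cutoff_left (frame_4 fr) rm); have /andP[] := cutoff_range (frame_10 fr) r.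
rewrite (cutoff_right (frame_10 fr)); first by have /andP[] := cutoff_range (frame_4 fr) r.
by rewrite (le_trans _ (ltW rm))// mn_le.
Qed.

(** After the cancellation both factors are of order [M ^+ 3]; the slow cutoff adds the factor
    [s]. *)
Let I4c_le : `|I4c| <= C5 * M ^+ 3 * D * s.
Proof.
rewrite /I4c /J (cutoff_shrink (frame_4 fr)) ?mn_le//; last by rewrite (le_trans c4)// mm.
apply: (cutoff_linear (mp 4) b4 (frame_4 fr) _ sH) => //.
- apply: continuous_posB; apply: continuous_posM => //; exact: continuous_pos_cst.
- by have [_] := N_bounds.
- exact: mulr_ge0 (ltW C50) (exprn_ge0 _ (ltW M0)).
- exact: ltW.
- exact: frame_s fr.
- exact: H_le.
Qed.

Let I10s_le : `|I10s| <= C * M ^+ 3 * D * s.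
Proof.
rewrite /I10s /J (cutoff_shrink (frame_10 fr))//; last by rewrite mm.
apply: (cutoff_linear a10' b10 (frame_10 fr) csin sH) => //.
- move=> r /andP[ar br]; exact: (core_small co (lt_le_trans a10' ar) br).
- exact: ltW.
- exact: ltW.
- exact: frame_s fr.
- by apply: H_le => //; exact: mn_le.
Qed.

Let I2o_le : `|I2o| <= M ^- 2 * D * s0.
Proof.
rewrite /I2o /J (cutoff_shrink (frame_2 fr)) ?mn_le//.
apply: (cutoff_linear (mp 2) b2 (frame_2 fr) cinv sHo) => //.
- move=> r /andP[ar br]; rewrite ger0_norm ?invr_ge0 ?exprn_ge0//; last exact: le_trans (ltW (mp 2)) ar.
  by rewrite -powM; exact: pow_inv_le.
- by rewrite invr_ge0 exprn_ge0// ltW.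
- exact: ltW.
- exact: frame_s0 fr.
- by apply: Ho_le => //; exact: mn_le.
Qed.

(** The source of the drift: the tail [r ^- k] of the inner bubble meets [sin u >= c * r ^+ k] of
    the outer one, against a weight of mass 1. *)
Let I2s_le : I2s <= - c.
Proof.
rewrite /I2s /J (cutoff_shrink (frame_2 fr)) ?mn_le//.
have I : locally_summable (fun r => derive1 P2 r * (r ^- k * sin (u r))).
  by apply: continuous_pos_summable; do 2!apply: continuous_posM => //.
have J2 := I (m ^+ 2) (2 * m ^+ 2) (mp 2).
have J1 := continuous_pos_summable (continuous_posN d2) (2 * m ^+ 2) (mp 2).
rewrite (_ : c = c * \int[mu]_(r in `[m ^+ 2, (2 * m ^+ 2)]) (- derive1 P2 r)); last first.
  by rewrite (cutoff_mass (mp 2) b2 (frame_2 fr)) mulr1.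
rewrite -lerN2 opprK -RintegralN// -RintegralZl//.
apply: le_Rintegral_segment; [exact: summableZ|exact: summableN|].
move=> r /andP[ar br]; have f0 := cutoff_derive_le0 (mp 2) (frame_2 fr) r.
have r0 := lt_le_trans (mp 2) ar.
rewrite mulrC -mulNr ler_wpM2l ?oppr_ge0// mulrC ler_pdivlMr ?exprn_gt0//.
by apply: (core_sin co); rewrite ar.
Qed.

Let om_le1 r : `|om r| <= 1.
Proof.
have /andP[a1 a2] := cutoff_range (frame_4 fr) r; have /andP[a3 a4] := cutoff_range (frame_2 fr) r.
by rewrite ler_norml; apply/andP; split; rewrite /om; lra.
Qed.

(** Up to the factor [- k] this is the time derivative of [tail_coef]. One power of [r] in the
    weight is given to [X r = r * w r], which leaves [r ^+ k.-1]. *)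
Let I5_le : `|I5| <= (2 * m ^+ 5) ^+ k.-1 * D * s0.
Proof.
rewrite /I5 (@eq_Rintegral_segment _ _ (fun r => - (derive1 P5 r * (r ^+ k.-1 * X r)))); last first.
  move=> r _; rewrite /g5 /X; case: (k) k2 => // n _ /=; rewrite exprS; ring.
have ce : continuous_pos (fun r => derive1 P5 r * r ^+ k.-1).
  by apply: continuous_posM => //; exact/continuous_posX/continuous_pos_id.
have I : locally_summable (fun r => derive1 P5 r * (r ^+ k.-1 * X r)).
  by have := IL ce sX; under eq_fun do rewrite -mulrA.
have I' := I _ m j0.
rewrite RintegralN// normrN (cutoff_shrink (frame_5 fr)) ?mn_le//; last by rewrite (le_trans c5)// mm.
apply: (cutoff_linear (mp 5) b5 (frame_5 fr) _ sX) => //.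
- exact/continuous_posX/continuous_pos_id.
- move=> r /andP[ar br]; have r0 := lt_le_trans (mp 5) ar.
  rewrite ger0_norm ?exprn_ge0 ?(ltW r0)// lerXn2r ?nnegrE ?(ltW r0)//.
  exact: le_trans (ltW r0) br.
- by rewrite exprn_ge0// mulr_ge0// ltW.
- exact: ltW.
- exact: frame_s0 fr.
- exact: X_le.
Qed.

Let Il_le : `|Il| <= M ^- 4 * m ^+ 4 * D.
Proof.
pose G r := om r * r ^- k * r.
have cG : continuous_pos G.
  apply: continuous_posM; last exact: continuous_pos_id.
  by apply: continuous_posM => //; exact: smooth_pos.
rewrite /Il /J (@Rintegral_shrink _ (m ^+ 4) (2 * m ^+ 2)) ?mn_le//; last first.
  by move=> r rn; rewrite (supported_vanishes om_supp rn) !mul0r mulr0.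
have m4 := mp 4.
have m42 : m ^+ 4 <= 2 * m ^+ 2 by apply: le_trans b2; exact: mn_le.
rewrite (@eq_Rintegral_segment _ _ (fun r => G r * X r / r)); last first.
  by move=> r /andP[ar _]; rewrite /G /X; field; rewrite expf_neq0 ?gt_eqF// (lt_le_trans m4).
have A0 : 0 <= M ^- 4 * m ^+ 4 by rewrite mulr_ge0 ?invr_ge0 ?exprn_ge0// ltW.
apply: norm_le_sqr (mulr_ge0 A0 (ltW D0)) _.
apply: le_trans (weighted_Cauchy_Schwarz _ m4 (continuous_pos_square_summable cG) sX) _.
rewrite exprMn; apply: ler_pM; last exact: X_le.
- by apply: Rintegral_ge0_segment => r /andP[ar _]; rewrite divr_ge0 ?sqr_ge0// (le_trans (ltW m4)).
- by apply: Rintegral_ge0_segment => r /andP[ar _]; rewrite divr_ge0 ?sqr_ge0// (le_trans (ltW m4)).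
have Ii : summable_on `[m ^+ 4, 2 * m ^+ 2] (fun r : R => r^-1 ^+ 2).
  by apply: (continuous_pos_summable (continuous_posX (@continuous_pos_inv1 R))).
pose n := (2 * k - 3)%N.
have nE : (2 * k)%N = n.+3 := double_sub3 k2.
apply: (@le_trans _ _ (\int[mu]_(r in `[m ^+ 4, (2 * m ^+ 2)]) ((m ^+ 4) ^- n * r^-1 ^+ 2))).
  apply: le_Rintegral_segment; [|exact: summableZ|].
    apply: (continuous_pos_summable _ _ m4); apply: continuous_posM; last exact: continuous_pos_inv1.
    exact: continuous_posX.
  move=> r /andP[ar br]; have r0 := lt_le_trans m4 ar.
  have -> : G r ^+ 2 / r = om r ^+ 2 * (r ^- n * r^-1 ^+ 2).
    have -> : r ^- n * r^-1 ^+ 2 = r * r ^- (2 * k).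
      by rewrite nE !exprS; field; rewrite expf_neq0 ?gt_eqF.
    by rewrite /G mulnC exprM; field; rewrite expf_neq0 ?gt_eqF.
  have o2 : om r ^+ 2 <= 1 by rewrite -(real_normK (num_real _)) expr_le1.
  have rr : 0 <= r ^- n * r^-1 ^+ 2 by rewrite mulr_ge0 ?sqr_ge0// invr_ge0 exprn_ge0// ltW.
  apply: le_trans (ler_piMl rr o2) _; rewrite ler_wpM2r ?sqr_ge0//; exact: pow_inv_le.
rewrite RintegralZl//.
apply: (@le_trans _ _ ((m ^+ 4) ^- n * (m ^+ 4)^-1)).
  apply: ler_wpM2l; first by rewrite invr_ge0 exprn_ge0// ltW.
  exact: Rintegral_inv_sqr m4 m42.
have -> : (M ^- 4 * m ^+ 4) ^+ 2 = (m ^+ 4) ^+ 2 * (m ^+ 4) ^- (2 * k).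
  have -> : M ^- 4 = (m ^+ 4) ^- k by rewrite powM.
  by rewrite [LHS]exprMn [LHS]mulrC exprVn -(exprM _ k 2) (mulnC k).
by rewrite nE expV_shift// gt_eqF.
Qed.

Let C6 := C * (2 ^+ k + 1).

Let C60 : 0 < C6. Proof. by rewrite mulr_gt0// addr_gt0// exprn_gt0. Qed.

(** Up to [m ^+ 3] the tail of the inner bubble is largest at [m ^+ 4], beyond it the outer bubble
    is largest at [2 * m ^+ 2]; both are of order [M ^+ 2]. *)
Let sin_le r : m ^+ 4 <= r <= 2 * m ^+ 2 -> `|sin (u r)| <= C6 * M ^+ 2.
Proof.
move=> /andP[ar br]; have r0 := lt_le_trans (mp 4) ar.
have M32 : M ^+ 3 <= M ^+ 2 by exact: Mn_le.
have M20 : 0 <= M ^+ 2 by rewrite exprn_ge0// ltW.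
have -> : C6 * M ^+ 2 = C * (2 ^+ k * M ^+ 2 + M ^+ 2) by rewrite /C6; ring.
have [rm|mr] := leP r (m ^+ 3).
  have mr6 : 8 * m ^+ 6 <= r.
    by apply: le_trans ar; apply: le_trans (mn_le8 5) _; exact: mn_le.
  apply: le_trans (core_mid co (introT andP (conj mr6 rm))) _.
  rewrite ler_wpM2l ?(ltW C0)//; apply: lerD => //.
  apply: (@le_trans _ _ (1 * M ^+ 2)); last by rewrite ler_wpM2r.
  rewrite mul1r ler_pdivrMr ?exprn_gt0//.
  rewrite -/M (_ : M ^+ 6 = M ^+ 2 * M ^+ 4); last by rewrite -exprD.
  by rewrite ler_wpM2l// -powM lerXn2r ?nnegrE ?(ltW r0)// ltW.
apply: le_trans (core_right co (introT andP (conj (ltW mr) br))) _.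
rewrite ler_wpM2l ?(ltW C0)//; apply: lerD => //.
rewrite -powM -exprMn lerXn2r ?nnegrE ?(ltW r0)//.
exact: le_trans (ltW r0) br.
Qed.

(** Beyond [m ^+ 3] the small defect is [Ho], and [H = Ho - 2 * k * sin u] costs the square of
    [sin u], of order [M ^+ 4]. This loss is affordable because the term [I9] has a further small
    factor. *)
Let H_wide : \int[mu]_(r in `[m ^+ 4, (2 * m ^+ 2)]) (H r ^+ 2 / r) <=
  (3 * C ^+ 2 + 16 * k%:R ^+ 2 * C6 ^+ 2) * (M ^+ 4 / m).
Proof.
have m4 := mp 4; have m3 := mp 3.
have m32 : m ^+ 3 <= 2 * m ^+ 2 by apply: le_trans b2; exact: mn_le.
have IH := locally_summable_div (locally_summable_sqr sH).
have IHo := locally_summable_div (locally_summable_sqr sHo).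
rewrite (@Rintegral_itv_split _ _ (m ^+ 3))//; last exact: IH.
have H1 := H_le m4 m43 (lexx _).
have H2 := Ho_le (lexx _) m32.
pose B := 8 * k%:R ^+ 2 * (C6 * M ^+ 2) ^+ 2 * m ^- 3.
have I1 := IHo (m ^+ 3) (2 * m ^+ 2) m3.
have Ic : summable_on `[m ^+ 3, 2 * m ^+ 2] (fun=> B).
  by apply: continuous_pos_summable => //; exact: continuous_pos_cst.
have H3 : \int[mu]_(r in `[m ^+ 3, (2 * m ^+ 2)]) (H r ^+ 2 / r) <=
    \int[mu]_(r in `[m ^+ 3, (2 * m ^+ 2)]) (2 * (Ho r ^+ 2 / r) + B).
  apply: le_Rintegral_segment; [exact: IH|by apply: summableD => //; exact: summableZ|].
  move=> r /andP[ar br]; have r0 := lt_le_trans m3 ar.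
  have sb : sin (u r) ^+ 2 <= (C6 * M ^+ 2) ^+ 2.
    rewrite -(real_normK (num_real (sin _))) lerXn2r ?nnegrE//.
      by rewrite mulr_ge0 ?exprn_ge0// ltW.
    by apply: sin_le; rewrite (le_trans m43 ar).
  have ri : r^-1 <= m ^- 3 by rewrite lef_pV2 ?posrE.
  have r1 : 0 <= r^-1 by rewrite invr_ge0 ltW.
  apply: (@le_trans _ _ (2 * (Ho r ^+ 2 / r) + 8 * k%:R ^+ 2 * sin (u r) ^+ 2 / r)).
    rewrite mulrA -mulrDl ler_wpM2r// /H /Ho /defect.
    have := sqr_ge0 (r * p r + 3 * k%:R * sin (u r)).
    by move: (r * p r) (sin (u r)) (k%:R : R) => x y z; rewrite mulNr; nra.
  rewrite lerD2l /B; apply: ler_pM => //.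
    exact: mulr_ge0 (mulr_ge0 (ler0n _ 8) (sqr_ge0 _)) (sqr_ge0 _).
  by rewrite ler_wpM2l// mulr_ge0 ?sqr_ge0.
rewrite RintegralD// in H3; last exact: summableZ.
rewrite RintegralZl// Rintegral_cst_segment// in H3.
have B0 : 0 <= B.
  apply: mulr_ge0; last by rewrite invr_ge0 ltW.
  exact: mulr_ge0 (mulr_ge0 (ler0n _ 8) (sqr_ge0 _)) (sqr_ge0 _).
have H4 : B * (2 * m ^+ 2 - m ^+ 3) <= 16 * k%:R ^+ 2 * C6 ^+ 2 * (M ^+ 4 / m).
  apply: (@le_trans _ _ (B * (2 * m ^+ 2))).
    by rewrite ler_wpM2l// gerBl ltW.
  by rewrite /B le_eqVlt; apply/orP; left; apply/eqP; field; rewrite gt_eqF.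
have H5 : 3 * D ^+ 2 <= 3 * C ^+ 2 * (M ^+ 4 / m).
  have -> : 3 * D ^+ 2 = 3 * C ^+ 2 * (M ^+ 4 * M ^+ 2) by rewrite /D; ring.
  apply: ler_wpM2l; first exact: mulr_ge0 (ler0n _ 3) (sqr_ge0 _).
  apply: ler_wpM2l; first exact: exprn_ge0 (ltW M0).
  apply: (@le_trans _ _ 1); first exact: exprn_ile1 (ltW M0) M1.
  by rewrite invf_ge1.
rewrite [leRHS]mulrDl; move: H1 H2 H3 H4 H5.
set i1 := Rintegral _ _ _; set i2 := Rintegral _ _ _; set i3 := Rintegral _ _ _.
move: i1 i2 i3 (D ^+ 2) (B * _) (_ * (M ^+ 4 / m)) (_ * (M ^+ 4 / m)) => *; lra.
Qed.

Let C8 := 1 + 2 * C6 ^+ 4 * (3 * C ^+ 2 + 16 * k%:R ^+ 2 * C6 ^+ 2).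

Let C81 : 1 <= C8.
Proof.
rewrite /C8 lerDl; apply: mulr_ge0; first by rewrite mulr_ge0// exprn_ge0// ltW.
apply: addr_ge0; first exact: mulr_ge0 (ler0n _ 3) (sqr_ge0 _).
exact: mulr_ge0 (mulr_ge0 (ler0n _ 16) (sqr_ge0 _)) (sqr_ge0 _).
Qed.

(** As [cos u <= 0] there, [1 + cos u <= sin u ^+ 2 = O (M ^+ 4)], which compensates
    [r ^- k <= M ^- 4]. With [H_wide] the square of the integral is of order [M ^+ 4 / m ^+ 3], and
    [M <= m ^+ 2] because [k >= 2]. *)
Let I9_le : `|I9| <= C8 * m.
Proof.
pose G r := (1 + cos (u r)) * om r * r ^- k.
have cG : continuous_pos G.
  apply: continuous_posM => //; apply: continuous_posM; last exact: smooth_pos.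
  by apply: continuous_posD => //; exact: continuous_pos_cst.
rewrite /I9 /J (@Rintegral_shrink _ (m ^+ 4) (2 * m ^+ 2)) ?mn_le//; last first.
  by move=> r rn; rewrite (supported_vanishes om_supp rn) mulr0 !mul0r.
have m4 := mp 4.
have m42 : m ^+ 4 <= 2 * m ^+ 2 by apply: le_trans b2; exact: mn_le.
rewrite (@eq_Rintegral_segment _ _ (fun r => G r * H r / r)); last first.
  move=> r /andP[ar _]; rewrite /G exprS; field.
  by rewrite expf_neq0 ?gt_eqF// (lt_le_trans m4).
have C80 : 0 <= C8 by exact: le_trans C81.
apply: norm_le_sqr; first by rewrite mulr_ge0// ltW.
apply: le_trans (weighted_Cauchy_Schwarz _ m4 (continuous_pos_square_summable cG) sH) _.
have G2 r : m ^+ 4 <= r <= 2 * m ^+ 2 -> G r ^+ 2 / r <= C6 ^+ 4 / m ^+ 4.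
  move=> /andP[ar br]; have r0 := lt_le_trans m4 ar.
  have mr6 : 8 * m ^+ 6 <= r.
    by apply: le_trans ar; apply: le_trans (mn_le8 5) _; exact: mn_le.
  have cn := core_cos co (introT andP (conj mr6 br)).
  have c1 := cos_geN1 (u r).
  have cs : 1 + cos (u r) <= (C6 * M ^+ 2) ^+ 2.
    apply: (@le_trans _ _ (sin (u r) ^+ 2)).
      by rewrite sin2cos2; move: (cos (u r)) cn c1 => y *; nra.
    rewrite -(real_normK (num_real (sin _))) lerXn2r ?nnegrE//.
      by rewrite mulr_ge0 ?exprn_ge0// ltW.
    by apply: sin_le; rewrite ar.
  have ri : r ^- k <= M ^- 4 by rewrite -powM; exact: pow_inv_le.
  have ri0 : 0 <= r ^- k by rewrite invr_ge0 exprn_ge0// ltW.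
  have Gle : `|G r| <= C6 ^+ 2.
    rewrite /G !normrM (ger0_norm ri0) (@ger0_norm _ (1 + _)); last by lra.
    apply: (@le_trans _ _ ((C6 * M ^+ 2) ^+ 2 * 1 * M ^- 4)).
      have p1 : 0 <= 1 + cos (u r) by lra.
      apply: (ler_pM (mulr_ge0 p1 (normr_ge0 _)) ri0 _ ri).
      exact: (ler_pM p1 (normr_ge0 _) cs (om_le1 r)).
    rewrite le_eqVlt; apply/orP; left; apply/eqP; field; by rewrite gt_eqF.
  apply: ler_pM; rewrite ?sqr_ge0 ?invr_ge0 ?(ltW r0)//; last by rewrite lef_pV2 ?posrE.
  have -> : C6 ^+ 4 = (C6 ^+ 2) ^+ 2 by rewrite -exprM.
  by rewrite -(real_normK (num_real (G r))) lerXn2r ?nnegrE// sqr_ge0.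
have IG : \int[mu]_(r in `[m ^+ 4, (2 * m ^+ 2)]) (G r ^+ 2 / r) <= 2 * C6 ^+ 4 / m ^+ 2.
  have C64 : 0 <= C6 ^+ 4 / m ^+ 4 by rewrite divr_ge0 ?exprn_ge0// ltW.
  apply: (@le_trans _ _ (\int[mu]_(r in `[m ^+ 4, (2 * m ^+ 2)]) (C6 ^+ 4 / m ^+ 4))).
    apply: le_Rintegral_segment => //.
      apply: (continuous_pos_summable _ _ m4); apply: continuous_posM; last exact: continuous_pos_inv1.
      exact: continuous_posX.
    by apply: continuous_pos_summable => //; exact: continuous_pos_cst.
  rewrite Rintegral_cst_segment//; apply: (@le_trans _ _ (C6 ^+ 4 / m ^+ 4 * (2 * m ^+ 2))).
    by rewrite ler_wpM2l// gerBl ltW.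
  by rewrite le_eqVlt; apply/orP; left; apply/eqP; field; rewrite gt_eqF.
have IG0 : 0 <= \int[mu]_(r in `[m ^+ 4, (2 * m ^+ 2)]) (G r ^+ 2 / r).
  by apply: Rintegral_ge0_segment => r /andP[ar _]; rewrite divr_ge0 ?sqr_ge0// (le_trans (ltW m4)).
have IH0 : 0 <= \int[mu]_(r in `[m ^+ 4, (2 * m ^+ 2)]) (H r ^+ 2 / r).
  by apply: Rintegral_ge0_segment => r /andP[ar _]; rewrite divr_ge0 ?sqr_ge0// (le_trans (ltW m4)).
apply: le_trans (ler_pM IG0 IH0 IG H_wide) _.
set K := (3 * C ^+ 2 + _).
have -> : 2 * C6 ^+ 4 / m ^+ 2 * (K * (M ^+ 4 / m)) = (2 * C6 ^+ 4 * K) * (M ^+ 4 / m ^+ 3).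
  by field; rewrite gt_eqF.
have K0 : 0 <= 2 * C6 ^+ 4 * K by move: C81; rewrite /C8 -/K lerDl.
rewrite [leRHS]exprMn; apply: ler_pM => //.
- by rewrite divr_ge0 ?exprn_ge0// ltW.
- apply: (@le_trans _ _ C8); first by rewrite /C8 lerDr.
  by rewrite expr2 ler_peMr.
- rewrite ler_pdivrMr// -exprD; apply: (@le_trans _ _ ((m ^+ 2) ^+ 4)).
    by rewrite lerXn2r ?nnegrE ?(ltW M0) ?(ltW (mp 2)).
  by rewrite -exprM mn_le.
Qed.

(** All terms are of order [M ^+ 6]. Those at the slow cutoffs carry a factor [s], the remaining
    errors a factor [m], and the interaction contributes [- k ^+ 2 * c ^+ 2]. *)
Lemma virial_rate_le : virial_rate u p w <=
  (s * (s * C ^+ 2 + (C5 + k%:R * C) * C)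
   + m * (k%:R * 2 ^+ k * C ^+ 2 * s0 + C5 * k%:R * C8 + C5 * C * s0) - k%:R ^+ 2 * c ^+ 2) * M ^+ 6.
Proof.
rewrite rate_split.
have K0 : 0 < k%:R :> R by exact: lt_le_trans k1.
have M6 : 0 < M ^+ 6 := exprn_gt0 _ M0.
have ss := frame_s fr; have ss0 := frame_s0 fr.
have [/andP[N1 N2] _] := N_bounds.
have t1 : - 2^-1 * (I4a + I4b) <= s ^+ 2 * C ^+ 2 * M ^+ 6.
  have -> : s ^+ 2 * C ^+ 2 * M ^+ 6 = 2^-1 * (2 * s ^+ 2 * D ^+ 2) by rewrite /D; field.
  by rewrite mulNr -mulrN ler_wpM2l.
have t2 : 2^-1 * (I10a + I10b) <= 0 by rewrite pmulr_rle0.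
have t3 : - I4c <= C5 * C * s * M ^+ 6.
  have -> : C5 * C * s * M ^+ 6 = C5 * M ^+ 3 * D * s by rewrite /D; ring.
  by apply: le_trans I4c_le; rewrite -normrN ler_norm.
have t4 : k%:R * I10s <= k%:R * C * C * s * M ^+ 6.
  have -> : k%:R * C * C * s * M ^+ 6 = k%:R * (C * M ^+ 3 * D * s) by rewrite /D; ring.
  by rewrite ler_pM2l// (le_trans _ I10s_le)// ler_norm.
have t5 : k%:R * - I5 * Il <= m * (k%:R * 2 ^+ k * C ^+ 2 * s0) * M ^+ 6.
  apply: (@le_trans _ _ (k%:R * ((2 * m ^+ 5) ^+ k.-1 * D * s0 * (M ^- 4 * m ^+ 4 * D)))).
    rewrite -mulrA ler_pM2l//; apply: le_trans (ler_norm _) _; rewrite normrM normrN.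
    exact: (ler_pM (normr_ge0 _) (normr_ge0 _) I5_le Il_le).
  (* Completes the power [k.-1] to [k] at the cost of a factor [2 * m ^+ 5]. *)
  have Mk : (2 * m ^+ 5) ^+ k.-1 * m ^+ 5 * 2 = 2 ^+ k * M ^+ 5.
    rewrite /M -exprM mulnC exprM -exprMn; case: (k) k2 => // n _ /=.
    by rewrite [RHS]exprSr; move: ((2 * m ^+ 5) ^+ n) => t; ring.
  have -> : k%:R * ((2 * m ^+ 5) ^+ k.-1 * D * s0 * (M ^- 4 * m ^+ 4 * D)) =
     k%:R * C ^+ 2 * s0 * (M ^+ 2 / m) * 2^-1 * ((2 * m ^+ 5) ^+ k.-1 * m ^+ 5 * 2).
    by rewrite /D; field; rewrite gt_eqF//= gt_eqF.
  rewrite Mk.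
  have -> : k%:R * C ^+ 2 * s0 * (M ^+ 2 / m) * 2^-1 * (2 ^+ k * M ^+ 5) =
     (2^-1 * M / m) * (k%:R * 2 ^+ k * C ^+ 2 * s0) * M ^+ 6.
    by field; rewrite gt_eqF.
  rewrite ler_wpM2r ?(ltW M6)// ler_wpM2r//.
    by apply: mulr_ge0 ss0; rewrite mulr_ge0 ?sqr_ge0// mulr_ge0 ?exprn_ge0// ltW.
  rewrite ler_pdivrMr// -expr2; apply: le_trans M_le_m.
  by rewrite ler_piMl ?(ltW M0)//; lra.
have t6 : N * (k%:R * I9) <= m * (C5 * k%:R * C8) * M ^+ 6.
  apply: (@le_trans _ _ (C5 * M ^+ 6 * (k%:R * (C8 * m)))).
    apply: (@le_trans _ _ (N * (k%:R * (C8 * m)))).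
      by rewrite ler_pM2l// ler_pM2l// (le_trans _ I9_le)// ler_norm.
    rewrite ler_wpM2r// mulr_ge0 ?(ltW K0)// mulr_ge0 ?(ltW m0)//; exact: le_trans C81.
  by rewrite le_eqVlt; apply/orP; left; apply/eqP; ring.
have t7 : - (N * I2o) <= m * (C5 * C * s0) * M ^+ 6.
  apply: (@le_trans _ _ (N * (M ^- 2 * D * s0))).
    by rewrite -mulrN ler_pM2l// (le_trans _ I2o_le)// -normrN ler_norm.
  have e0 : 0 <= C * M * s0 by rewrite mulr_ge0// mulr_ge0// ltW.
  have -> : M ^- 2 * D * s0 = C * M * s0 by rewrite /D; field; rewrite gt_eqF.
  apply: (@le_trans _ _ (C5 * M ^+ 6 * (C * M * s0))); first by rewrite ler_wpM2r.
  have -> : C5 * M ^+ 6 * (C * M * s0) = M * (C5 * C * s0) * M ^+ 6 by ring.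
  rewrite ler_wpM2r ?(ltW M6)// ler_wpM2r//.
    by rewrite mulr_ge0// mulr_ge0 ?(ltW C50) ?(ltW C0).
  by rewrite (le_trans M_le_m)// mm.
have t8 : 2 * k%:R * N * I2s <= - (k%:R ^+ 2 * c ^+ 2 * M ^+ 6).
  apply: (@le_trans _ _ (2 * k%:R * N * - c)).
    by rewrite ler_pM2l// mulr_gt0// mulr_gt0.
  rewrite mulrN lerN2.
  have -> : k%:R ^+ 2 * c ^+ 2 * M ^+ 6 = 2 * k%:R * c * (k%:R * c / 2 * M ^+ 6) by field.
  rewrite [leRHS](_ : _ = 2 * k%:R * c * N); last by ring.
  by rewrite ler_pM2l// !mulr_gt0.
by rewrite -mulNr; exact: virial_sum t1 t2 t3 t4 t5 t6 t7 t8 I0_ge.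
Qed.

(** Cauchy-Schwarz with [r * w] of norm at most [D] and [r * p = H + k * sin u]. The number [T]
    dominates both contributions: [b * D] for the defect, and the weighted L^2 norm of [sin u]. *)
Let piece f a b T : continuous_pos f -> (forall r, `|f r| <= 1) -> 0 < a -> a <= b -> b <= m ^+ 3 ->
  0 <= T -> b * D <= T -> \int[mu]_(r in `[a, b]) (r * sin (u r) ^+ 2) <= T ^+ 2 ->
  `|\int[mu]_(r in `[a, b]) (r ^+ 2 * f r * (w r * p r))| <= 2 * k%:R * D * T.
Proof.
move=> cf f1 a0 ab bm T0 bT ST; pose Y r := f r * r * (r * p r).
have sY : locally_square_summable Y.
  apply: locally_square_summableMr; first by apply: continuous_posM => //; exact: continuous_pos_id.
  exact: locally_square_summableMr (@continuous_pos_id R) (core_p co).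
rewrite (@eq_Rintegral_segment _ _ (fun r => Y r * X r / r)); last first.
  by move=> r /andP[ar _]; rewrite /Y /X; field; rewrite gt_eqF// (lt_le_trans a0).
have K0 : 0 <= 2 * k%:R * D * T.
  by apply: mulr_ge0 T0; apply: mulr_ge0 (ltW D0); apply: mulr_ge0 (le_trans ler01 k1).
apply: norm_le_sqr K0 _; apply: le_trans (weighted_Cauchy_Schwarz _ a0 sY sX) _.
have ge0 Z : 0 <= \int[mu]_(r in `[a, b]) (Z r ^+ 2 / r).
  by apply: Rintegral_ge0_segment => r /andP[ar _]; rewrite divr_ge0 ?sqr_ge0// (le_trans (ltW a0)).
have -> : (2 * k%:R * D * T) ^+ 2 = (4 * k%:R ^+ 2 * T ^+ 2) * D ^+ 2 by ring.
apply: ler_pM => //; last exact: X_le.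
have IH := locally_summable_div (locally_summable_sqr sH).
have Is : locally_summable (fun r => r * sin (u r) ^+ 2).
  by apply: continuous_pos_summable; apply: continuous_posM; [exact: continuous_pos_id|exact: continuous_posX].
have IY := locally_summable_div (locally_summable_sqr sY) b a0.
have b0 := lt_le_trans a0 ab.
apply: (@le_trans _ _ (2 * b ^+ 2 * \int[mu]_(r in `[a, b]) (H r ^+ 2 / r)
   + 2 * k%:R ^+ 2 * \int[mu]_(r in `[a, b]) (r * sin (u r) ^+ 2))).
  rewrite -Rintegral_lin2//; apply: le_Rintegral_segment => //.
    exact: locally_summableD (locally_summableZ _ IH) (locally_summableZ _ Is) _ _ a0.
  move=> r /andP[ar br]; have r0 := lt_le_trans a0 ar.
  have f2 : f r ^+ 2 <= 1 by rewrite -(real_normK (num_real _)) expr_le1.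
  have E : Y r ^+ 2 / r = f r ^+ 2 * (r * (r * p r) ^+ 2) by rewrite /Y; field; rewrite gt_eqF.
  have e0 : 0 <= r * (r * p r) ^+ 2 by rewrite mulr_ge0 ?sqr_ge0// ltW.
  rewrite E; apply: le_trans (ler_piMl e0 f2) _.
  apply: (@le_trans _ _ (2 * r ^+ 2 * (H r ^+ 2 / r) + 2 * k%:R ^+ 2 * (r * sin (u r) ^+ 2))).
    have -> : 2 * r ^+ 2 * (H r ^+ 2 / r) + 2 * k%:R ^+ 2 * (r * sin (u r) ^+ 2) =
       r * (2 * H r ^+ 2 + 2 * (k%:R * sin (u r)) ^+ 2) by field; rewrite gt_eqF.
    rewrite ler_pM2l//.
    have -> : r * p r = H r + k%:R * sin (u r) by rewrite /H /defect subrK.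
    by move: (H r) (k%:R * sin (u r)) => y z; have := sqr_ge0 (y - z); nra.
  rewrite lerD2r; apply: ler_wpM2r; first by rewrite divr_ge0 ?sqr_ge0// ltW.
  by rewrite ler_pM2l// lerXn2r ?nnegrE// ltW.
have k21 : 1 <= k%:R ^+ 2 :> R by rewrite exprn_ege1.
have h1 : 2 * b ^+ 2 * \int[mu]_(r in `[a, b]) (H r ^+ 2 / r) <= 2 * T ^+ 2.
  apply: (@le_trans _ _ (2 * b ^+ 2 * D ^+ 2)).
    apply: ler_wpM2l; last exact: H_le.
    exact: mulr_ge0 (ler0n _ 2) (sqr_ge0 _).
  rewrite -mulrA ler_pM2l// -exprMn lerXn2r ?nnegrE//.
  exact: mulr_ge0 (ltW b0) (ltW D0).
have h2 : 2 * k%:R ^+ 2 * \int[mu]_(r in `[a, b]) (r * sin (u r) ^+ 2) <= 2 * k%:R ^+ 2 * T ^+ 2.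
  by apply: ler_wpM2l ST; exact: mulr_ge0 (ler0n _ 2) (sqr_ge0 _).
apply: le_trans (lerD h1 h2) _.
have T2 : T ^+ 2 <= k%:R ^+ 2 * T ^+ 2 by rewrite ler_peMl// sqr_ge0.
by rewrite -!mulrA; move: (k%:R ^+ 2 * T ^+ 2) (T ^+ 2) T2 => *; lra.
Qed.

Let sin_int_inner a b : 0 < a -> a <= b -> \int[mu]_(r in `[a, b]) (r * sin (u r) ^+ 2) <= b ^+ 2.
Proof.
move=> a0 ab; have b0 := lt_le_trans a0 ab.
have Is : locally_summable (fun r => r * sin (u r) ^+ 2).
  by apply: continuous_pos_summable; apply: continuous_posM; [exact: continuous_pos_id|exact: continuous_posX].
apply: (@le_trans _ _ (\int[mu]_(r in `[a, b]) b)).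
  apply: le_Rintegral_segment; [exact: Is| |].
    by apply: continuous_pos_summable => //; exact: continuous_pos_cst.
  move=> r /andP[ar rb]; rewrite -[leRHS]mulr1; apply: ler_pM; rewrite ?sqr_ge0//.
    exact: le_trans (ltW a0) ar.
by rewrite Rintegral_cst_segment// expr2 ler_pM2l// gerBl ltW.
Qed.

Let sin_int_mid a b : 8 * m ^+ 6 <= a -> a <= b -> b <= m ^+ 3 ->
  \int[mu]_(r in `[a, b]) (r * sin (u r) ^+ 2) <=
  2 * C ^+ 2 * (M ^+ 12 * (a ^+ 2 / a ^+ (2 * k)) + M ^+ 6 * b ^+ 2).
Proof.
move=> ma ab bm.
have a0 : 0 < a by apply: lt_le_trans ma; rewrite mulr_gt0.
have b0 := lt_le_trans a0 ab.
have Is : locally_summable (fun r => r * sin (u r) ^+ 2).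
  by apply: continuous_pos_summable; apply: continuous_posM; [exact: continuous_pos_id|exact: continuous_posX].
have Iv := continuous_pos_summable (continuous_posX (n := 2) (@continuous_pos_inv1 R)).
have Ib := continuous_pos_summable (@continuous_pos_cst R b).
pose n := (2 * k - 3)%N.
have nE : (2 * k)%N = n.+3 := double_sub3 k2.
have c20 : 0 <= 2 * C ^+ 2 := mulr_ge0 (ler0n _ 2) (sqr_ge0 _).
have M60 : 0 <= M ^+ 6 := exprn_ge0 _ (ltW M0).
have M120 : 0 <= M ^+ 12 := exprn_ge0 _ (ltW M0).
apply: (@le_trans _ _ (2 * C ^+ 2 * M ^+ 12 * a ^- n * \int[mu]_(r in `[a, b]) (r^-1 ^+ 2)
   + 2 * C ^+ 2 * M ^+ 6 * \int[mu]_(r in `[a, b]) b)).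
  rewrite -Rintegral_lin2//; apply: le_Rintegral_segment; [exact: Is| |].
    exact: locally_summableD (locally_summableZ _ Iv) (locally_summableZ _ Ib) _ _ a0.
  move=> r /andP[ar rb]; have r0 := lt_le_trans a0 ar.
  have sn := core_mid co (introT andP (conj (le_trans ma ar) (le_trans rb bm))).
  have ri0 : 0 <= r ^- k by rewrite invr_ge0 exprn_ge0// ltW.
  have sq : sin (u r) ^+ 2 <= 2 * C ^+ 2 * ((M ^+ 6 * r ^- k) ^+ 2 + (M ^+ 3) ^+ 2).
    apply: (@le_trans _ _ ((C * (M ^+ 6 * r ^- k + M ^+ 3)) ^+ 2)).
      rewrite -(real_normK (num_real (sin _))) lerXn2r ?nnegrE//.
      by apply: mulr_ge0 (ltW C0) _; apply: addr_ge0; [exact: mulr_ge0|exact: exprn_ge0 (ltW M0)].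
    rewrite exprMn -[2 * C ^+ 2 * _]mulrA [leRHS]mulrCA ler_wpM2l ?sqr_ge0//.
    by move: (M ^+ 6 * r ^- k) (M ^+ 3) => y z; have := sqr_ge0 (y - z); nra.
  apply: (@le_trans _ _ (r * (2 * C ^+ 2 * ((M ^+ 6 * r ^- k) ^+ 2 + (M ^+ 3) ^+ 2)))).
    by rewrite ler_pM2l.
  have -> : r * (2 * C ^+ 2 * ((M ^+ 6 * r ^- k) ^+ 2 + (M ^+ 3) ^+ 2)) =
    2 * C ^+ 2 * M ^+ 12 * (r * r ^- k ^+ 2) + 2 * C ^+ 2 * M ^+ 6 * r by ring.
  apply: lerD; last by apply: ler_wpM2l rb; exact: mulr_ge0.
  rewrite -[leRHS]mulrA; apply: ler_wpM2l; first exact: mulr_ge0.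
  have -> : r * r ^- k ^+ 2 = r ^- n * r^-1 ^+ 2.
    rewrite exprVn -exprM mulnC nE !exprS; field.
    by rewrite expf_neq0 ?gt_eqF.
  by rewrite ler_wpM2r ?sqr_ge0//; exact: pow_inv_le.
rewrite Rintegral_cst_segment// [leRHS]mulrDr; apply: lerD.
  rewrite nE -expV_shift ?gt_eqF//.
  rewrite [leRHS](_ : _ = 2 * C ^+ 2 * M ^+ 12 * a ^- n * a^-1); last by ring.
  apply: ler_wpM2l; last exact: Rintegral_inv_sqr.
  by apply: mulr_ge0; [exact: mulr_ge0|rewrite invr_ge0 exprn_ge0// ltW].
rewrite [leRHS]mulrA; apply: ler_wpM2l; first exact: mulr_ge0.
by rewrite expr2 ler_pM2l// gerBl ltW.
Qed.

Let phi_le1 r : `|phi r| <= 1.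
Proof.
have /andP[a1 a2] := cutoff_range (frame_4 fr) r; have /andP[a3 a4] := cutoff_range (frame_10 fr) r.
by rewrite ler_norml; apply/andP; split; rewrite /phi; lra.
Qed.

Let M2k a t : 0 < t -> t <= a -> a ^+ 2 / a ^+ (2 * k) <= t ^+ 2 / t ^+ (2 * k).
Proof.
move=> t0 ta; have a0 := lt_le_trans t0 ta; have nE := double_sub3 k2.
rewrite nE -!expV_shift ?gt_eqF//; apply: ler_pM.
- by rewrite invr_ge0 exprn_ge0// ltW.
- by rewrite invr_ge0 ltW.
- exact: pow_inv_le.
- by rewrite lef_pV2 ?posrE.
Qed.

Hypothesis m512 : 2 ^+ 9 * m <= 1.

Let m256 : 256 * m <= 1.
Proof.
have E : 2 ^+ 9 * m = 2 * (256 * m) by ring.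
have : 0 < 256 * m by exact: mulr_gt0 (ltr0n _ 256) m0.
by have := m512; rewrite E; lra.
Qed.

Let C11 := 2 * k%:R * C * (2 ^+ 9 * (1 + C)) + 2 * k%:R * C * (2 * C * (32 ^+ k + 1)) + C5 * C.

Let D_le : D <= C.
Proof. by rewrite ler_piMr ?(ltW C0)//; exact: exprn_ile1 (ltW M0) M1. Qed.

Let Mm_le n l j : (l <= n + 2 * j)%N -> M ^+ j * m ^+ n <= m ^+ l.
Proof.
move=> ln; apply: (@le_trans _ _ ((m ^+ 2) ^+ j * m ^+ n)).
  apply: ler_wpM2r; first exact: ltW.
  by rewrite lerXn2r ?nnegrE ?(ltW M0) ?(ltW (mp 2)).
by rewrite -exprM -exprD mn_le// addnC.
Qed.

Let k0R : 0 <= k%:R :> R. Proof. exact: le_trans k1. Qed.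

Let inner_piece f a b e : continuous_pos f -> (forall r, `|f r| <= 1) -> 0 < a -> a <= b -> b <= m ^+ 3 ->
  b <= e -> `|\int[mu]_(r in `[a, b]) (r ^+ 2 * f r * (w r * p r))| <= 2 * k%:R * D * ((1 + C) * e).
Proof.
move=> cf f1 a0 ab bm be; have b0 := lt_le_trans a0 ab; have e0 := lt_le_trans b0 be.
have C1 : 0 < 1 + C by rewrite addr_gt0.
apply: piece => //.
- by rewrite mulr_ge0 ?(ltW C1) ?(ltW e0).
- rewrite mulrC; apply: ler_pM; rewrite ?(ltW D0) ?(ltW b0)//.
  by apply: le_trans D_le _; rewrite lerDr.
- apply: le_trans (sin_int_inner a0 ab) _.
  rewrite lerXn2r ?nnegrE ?mulr_ge0 ?(ltW C1) ?(ltW b0) ?(ltW e0)//.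
  by apply: le_trans be _; rewrite ler_peMl ?(ltW e0)// lerDl ltW.
Qed.

Let X9 x : m / 2 <= x <= 2 * m -> [/\ m ^+ 10 <= x ^+ 9, x ^+ 9 <= 2 ^+ 9 * m ^+ 9,
  m ^+ 5 / 32 <= x ^+ 5 & x ^+ 5 <= m ^+ 4].
Proof.
move=> /andP[x1 x2]; have h0 : 0 < m / 2 by rewrite divr_gt0.
have x0 := lt_le_trans h0 x1; have mm9 := mp 9; have mm4 := mp 4.
split.
- apply: (@le_trans _ _ ((m / 2) ^+ 9)); last by rewrite lerXn2r ?nnegrE ?(ltW h0) ?(ltW x0).
  rewrite expr_div_n ler_pdivlMr ?exprn_gt0// (exprS m 9) mulrAC (mulrC m) ler_piMl ?(ltW mm9)//.
- rewrite -exprMn.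
  by rewrite lerXn2r ?nnegrE ?(ltW x0) ?mulr_ge0 ?(ltW m0).
- have -> : m ^+ 5 / 32 = (m / 2) ^+ 5 by rewrite expr_div_n -natrX.
  by rewrite lerXn2r ?nnegrE ?(ltW h0) ?(ltW x0).
- apply: (@le_trans _ _ ((2 * m) ^+ 5)); first by rewrite lerXn2r ?nnegrE ?(ltW x0) ?mulr_ge0 ?(ltW m0).
  rewrite exprMn (exprS m 4) mulrA ler_piMl ?(ltW mm4)//.
  have -> : 2 ^+ 5 * m = 256 * m / 8 by field.
  have := m256; lra.
Qed.

Let m56 : 8 * m ^+ 6 <= m ^+ 5 / 32.
Proof.
rewrite ler_pdivlMr// (_ : 8 * m ^+ 6 * 32 = 256 * m * m ^+ 5); last by ring.
exact: ler_piMl (ltW (mp 5)) m256.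
Qed.

Let Lphi := L * m ^+ 4.

(** From [m ^+ 5 / 32] on [sin u] is small: its tail part gives [M * m ^+ 5] at the inner end, and
    the error [M ^+ 3] gives [L * m ^+ 4 * M ^+ 3] at the outer end, which is no larger. *)
Let mid_piece x : m / 2 <= x <= 2 * m ->
  `|\int[mu]_(r in `[x ^+ 5, Lphi]) (r ^+ 2 * phi r * (w r * p r))|
   <= 2 * k%:R * D * (2 * C * (32 ^+ k + 1) * (M * m ^+ 5)).
Proof.
move=> /X9[_ _ h5 h4]; have m532 : 0 < m ^+ 5 / 32 by rewrite divr_gt0.
have x50 := lt_le_trans m532 h5.
have xL : x ^+ 5 <= Lphi by apply: le_trans h4 b4.
have K0 : 0 < 2 * C * (32 ^+ k + 1).
  by apply: mulr_gt0; [exact: mulr_gt0|apply: addr_gt0 => //; exact: exprn_gt0].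
have Mm0 : 0 < M * m ^+ 5 by exact: mulr_gt0.
have L0' : 0 < Lphi by apply: mulr_gt0.
have LM3 : Lphi * M ^+ 3 <= M * m ^+ 5.
  rewrite (_ : Lphi * M ^+ 3 = (L * m) * (m ^+ 3 * M ^+ 2) * M); last by rewrite /Lphi; ring.
  rewrite [leRHS]mulrC ler_pM2r//.
  apply: (@le_trans _ _ (1 * (m ^+ 3 * M ^+ 2))).
    apply: ler_wpM2r (frame_Lm fr); apply: mulr_ge0; first exact: ltW.
    exact: exprn_ge0 (ltW M0).
  by rewrite mul1r mulrC Mm_le.
apply: piece => //.
- exact: smooth_pos.
- by apply: mulr_ge0; exact: ltW.
- rewrite /D mulrCA (mulrC (2 * C * _)) -mulrA.
  apply: (@le_trans _ _ (C * (M * m ^+ 5))); first by rewrite ler_pM2l.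
  rewrite [leLHS]mulrC; apply: ler_wpM2l; first exact: ltW.
  have t0 : 0 <= 32 ^+ k :> R by exact: exprn_ge0.
  by move: (32 ^+ k) t0 (ltW C0) => t t0 h; have := mulr_ge0 h t0; lra.
- apply: le_trans (sin_int_mid (le_trans m56 h5) xL c4) _.
  have e1 : M ^+ 12 * (x ^+ 5 ^+ 2 / x ^+ 5 ^+ (2 * k)) <= (32 ^+ k) ^+ 2 * (M * m ^+ 5) ^+ 2.
    apply: (@le_trans _ _ (M ^+ 12 * ((m ^+ 5 / 32) ^+ 2 / (m ^+ 5 / 32) ^+ (2 * k)))).
      by apply: ler_wpM2l; [exact: exprn_ge0 (ltW M0)|exact: M2k].
    have -> : (m ^+ 5 / 32) ^+ (2 * k) = (M ^+ 5 / 32 ^+ k) ^+ 2.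
      by rewrite mulnC exprM expr_div_n powM.
    have t0 : 0 < 32 ^+ k :> R by exact: exprn_gt0.
    move: (32 ^+ k) t0 => t t0.
    have -> : M ^+ 12 * ((m ^+ 5 / 32) ^+ 2 / (M ^+ 5 / t) ^+ 2) = 1024^-1 * (t ^+ 2 * (M * m ^+ 5) ^+ 2).
      by field; rewrite !gt_eqF.
    by apply: ler_piMl; [exact: mulr_ge0 (sqr_ge0 _) (sqr_ge0 _)|lra].
  have e2 : M ^+ 6 * Lphi ^+ 2 <= (M * m ^+ 5) ^+ 2.
    rewrite (_ : M ^+ 6 * Lphi ^+ 2 = (Lphi * M ^+ 3) ^+ 2); last by ring.
    rewrite lerXn2r ?nnegrE ?(ltW Mm0)//.
    by apply: mulr_ge0; [exact: ltW|exact: exprn_ge0 (ltW M0)].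
  rewrite [leRHS]exprMn.
  apply: (@le_trans _ _ (2 * C ^+ 2 * ((32 ^+ k) ^+ 2 * (M * m ^+ 5) ^+ 2 + (M * m ^+ 5) ^+ 2))).
    apply: ler_wpM2l (lerD e1 e2); exact: mulr_ge0 (ler0n _ 2) (sqr_ge0 _).
  have t0 : 0 <= 32 ^+ k :> R by exact: exprn_ge0.
  have z0 : 0 <= C ^+ 2 * (M * m ^+ 5) ^+ 2 := mulr_ge0 (sqr_ge0 _) (sqr_ge0 _).
  move: (32 ^+ k) t0 ((M * m ^+ 5) ^+ 2) z0 => t t0 z z0.
  rewrite (_ : 2 * C ^+ 2 * (t ^+ 2 * z + z) = (2 * t ^+ 2 + 2) * (C ^+ 2 * z)); last by ring.
  rewrite (_ : (2 * C * (t + 1)) ^+ 2 * z = (4 * (t + 1) ^+ 2) * (C ^+ 2 * z)); last by ring.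
  by apply: ler_wpM2r => //; nra.
Qed.

(** For [x] within a factor 2 of [m] the window from [x ^+ 9] to [x ^+ 5] lies where [phi = 1], so
    the comparison integral depends on [x] only. Everything else, including the second functional,
    is smaller by a factor [m] than the size [M ^+ 3 * m ^+ 6] of [virial]. *)
Lemma virial_anchor x : m / 2 <= x <= 2 * m ->
  `|virial u p w - \int[mu]_(r in `[x ^+ 9, x ^+ 5]) (r ^+ 2 * (w r * p r))| <= C11 * (M ^+ 3 * m ^+ 7).
Proof.
move=> xm; have [h9 h9' h5 h5'] := X9 xm.
have cphi : continuous_pos phi by exact: smooth_pos.
have I : locally_summable (fun r => r ^+ 2 * phi r * (w r * p r)).
  apply: locally_summableMr; last exact: locally_summable_squareM (core_w co) (core_p co).
  by apply: continuous_posM => //; exact/continuous_posX/continuous_pos_id.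
have x90 : 0 < x ^+ 9 by apply: lt_le_trans h9; exact: mp.
have x95 : x ^+ 9 <= x ^+ 5.
  apply: (le_trans h9'); apply: le_trans h5; rewrite ler_pdivlMr//.
  rewrite (_ : 2 ^+ 9 * m ^+ 9 * 32 = (2 ^+ 9 * m) * (32 * m ^+ 3) * m ^+ 5); last by ring.
  rewrite ler_piMl ?(ltW (mp 5))//; apply: (@le_trans _ _ (1 * 1)); last by rewrite mulr1.
  apply: ler_pM; [by rewrite mulr_ge0 ?exprn_ge0// ltW|by rewrite mulr_ge0// ltW|exact: m512|].
  have := mn_le (isT : (1 <= 3)%N); rewrite expr1; have := m256; lra.
have L0' : 0 < Lphi by exact: mulr_gt0.
have xL : x ^+ 5 <= Lphi by apply: le_trans h5' b4.
have jx : m ^+ 11 <= x ^+ 9 by apply: le_trans h9; exact: mn_le.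
have x93 : x ^+ 9 <= m ^+ 3 by apply: le_trans x95 (le_trans h5' m43).
have E : \int[mu]_(r in J) (r ^+ 2 * phi r * (w r * p r)) =
   \int[mu]_(r in `[m ^+ 11, x ^+ 9]) (r ^+ 2 * phi r * (w r * p r))
   + (\int[mu]_(r in `[x ^+ 9, x ^+ 5]) (r ^+ 2 * (w r * p r))
   + \int[mu]_(r in `[x ^+ 5, Lphi]) (r ^+ 2 * phi r * (w r * p r))).
  rewrite /J (@Rintegral_shrink _ (m ^+ 11) Lphi)//.
  - rewrite (@Rintegral_itv_split _ _ (x ^+ 9))//; [|exact: le_trans xL|exact: I].
    rewrite (@Rintegral_itv_split _ (x ^+ 9) (x ^+ 5))//; last exact: I.
    congr (_ + (_ + _)); apply: eq_Rintegral_segment => r /andP[r9 r5].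
    rewrite /phi (cutoff_left (frame_4 fr)) ?(le_trans r5)// (cutoff_right (frame_10 fr)) ?(le_trans h9)//.
    by rewrite subr0 mulr1.
  - by rewrite /Lphi (le_trans c4)// mm.
  - move=> r rn; rewrite (_ : phi r = 0) ?mulr0 ?mul0r//; apply: phi_supp.
    by apply: contra rn => /andP[r1 r2]; rewrite (le_trans a10 (ltW r1)) (ltW r2).
rewrite /virial E -/N -/Il.
set A := \int[mu]_(r in `[m ^+ 11, x ^+ 9]) _; set B := \int[mu]_(r in `[x ^+ 9, x ^+ 5]) _.
set Z := \int[mu]_(r in `[x ^+ 5, Lphi]) _.
rewrite (_ : A + (B + Z) + N * Il - B = A + Z + N * Il); last by ring.
have M3 : 0 < M ^+ 3 by exact: exprn_gt0.
have hA : `|A| <= 2 * k%:R * C * (2 ^+ 9 * (1 + C)) * (M ^+ 3 * m ^+ 7).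
  apply: le_trans (inner_piece cphi phi_le1 j0 jx x93 h9') _.
  rewrite (_ : 2 * k%:R * D * ((1 + C) * (2 ^+ 9 * m ^+ 9)) = 2 * k%:R * C * (2 ^+ 9 * (1 + C)) * (M ^+ 3 * m ^+ 9)); last by rewrite /D; ring.
  apply: ler_wpM2l; last by rewrite ler_pM2l// mn_le.
  by apply: mulr_ge0; [apply: mulr_ge0 (ltW C0); exact: mulr_ge0|rewrite mulr_ge0 ?exprn_ge0 ?addr_ge0 ?ler01 ?ler0n// ltW].
have hZ : `|Z| <= 2 * k%:R * C * (2 * C * (32 ^+ k + 1)) * (M ^+ 3 * m ^+ 7).
  apply: le_trans (mid_piece xm) _.
  rewrite (_ : 2 * k%:R * D * (2 * C * (32 ^+ k + 1) * (M * m ^+ 5)) =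
    2 * k%:R * C * (2 * C * (32 ^+ k + 1)) * (M ^+ 3 * (M * m ^+ 5))); last by rewrite /D; ring.
  apply: ler_wpM2l; last by rewrite ler_pM2l// -[M]expr1 Mm_le.
  apply: mulr_ge0; first by apply: mulr_ge0 (ltW C0); exact: mulr_ge0.
  by apply: mulr_ge0; [exact: mulr_ge0 (ler0n _ 2) (ltW C0)|apply: addr_ge0 => //; exact: exprn_ge0].
have hN : `|N * Il| <= C5 * C * (M ^+ 3 * m ^+ 7).
  rewrite normrM (gtr0_norm N0); have [/andP[_ N2] _] := N_bounds.
  apply: le_trans (ler_pM (ltW N0) (normr_ge0 _) N2 Il_le) _.
  rewrite (_ : C5 * M ^+ 6 * (M ^- 4 * m ^+ 4 * D) = C5 * C * (M ^+ 3 * (M ^+ 2 * m ^+ 4))); last first.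
    by rewrite /D; field; rewrite gt_eqF.
  apply: ler_wpM2l; first by apply: mulr_ge0; exact: ltW.
  by rewrite ler_pM2l// Mm_le.
rewrite (_ : C11 * _ = 2 * k%:R * C * (2 ^+ 9 * (1 + C)) * (M ^+ 3 * m ^+ 7)
  + 2 * k%:R * C * (2 * C * (32 ^+ k + 1)) * (M ^+ 3 * m ^+ 7) + C5 * C * (M ^+ 3 * m ^+ 7)); last by rewrite /C11; ring.
apply: le_trans (ler_normD _ _) _; apply: lerD hN; apply: le_trans (ler_normD _ _) _; exact: lerD.
Qed.

Let C12 := C11 + 2 * k%:R * C * (8 * (1 + C)) + 2 * k%:R * C * (12 * C).

(** The anchor with [x = m], split at [8 * m ^+ 6]: below, [sin u] is only bounded by 1 and the
    radius gives [m ^+ 6]; above, [core_mid] gives the same order. *)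
Lemma virial_size : `|virial u p w| <= C12 * (M ^+ 3 * m ^+ 6).
Proof.
have xm : m / 2 <= m <= 2 * m by have := m0; lra.
have HV := virial_anchor xm; have [h9 h9' h5 h5'] := X9 xm.
have M3 : 0 < M ^+ 3 by exact: exprn_gt0.
have m60 : 0 < 8 * m ^+ 6 by exact: mulr_gt0.
have m96 : m ^+ 9 <= 8 * m ^+ 6.
  by apply: (@le_trans _ _ (m ^+ 6)); [exact: mn_le|rewrite ler_peMl ?(ltW (mp 6))//; lra].
have m65 : 8 * m ^+ 6 <= m ^+ 5 := mn_le8 5.
have c1 : continuous_pos (fun=> 1 : R) by exact: continuous_pos_cst.
have n1 r : `|(fun=> 1 : R) r| <= 1 by rewrite normr1.
have I : locally_summable (fun r => r ^+ 2 * 1 * (w r * p r)).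
  apply: locally_summableMr; last exact: locally_summable_squareM (core_w co) (core_p co).
  by apply: continuous_posM => //; exact/continuous_posX/continuous_pos_id.
have m53 : m ^+ 5 <= m ^+ 3 by exact: mn_le.
have hA := inner_piece c1 n1 (mp 9) m96 (le_trans m65 m53) (lexx _).
have hB : `|\int[mu]_(r in `[8 * m ^+ 6, m ^+ 5]) (r ^+ 2 * 1 * (w r * p r))| <=
    2 * k%:R * D * (12 * C * m ^+ 6).
  have T0 : 0 < 12 * C * m ^+ 6 by apply: mulr_gt0 => //; exact: mulr_gt0.
  apply: piece => //.
  - exact: ltW.
  - rewrite /D (_ : 12 * C * m ^+ 6 = C * (12 * m ^+ 6)); last by ring.
    rewrite mulrCA ler_pM2l//; apply: (@le_trans _ _ (m ^+ 6)); first by rewrite mulrC Mm_le.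
    by rewrite ler_peMl ?ler1n ?(ltW (mp 6)).
  - apply: le_trans (sin_int_mid (lexx _) m65 m53) _.
    have e1 : M ^+ 12 * ((8 * m ^+ 6) ^+ 2 / (8 * m ^+ 6) ^+ (2 * k)) <= 64 * (m ^+ 6) ^+ 2.
      have -> : (8 * m ^+ 6) ^+ (2 * k) = (8 ^+ k * M ^+ 6) ^+ 2 by rewrite mulnC exprM exprMn powM.
      have t0 : 1 <= 8 ^+ k :> R by rewrite exprn_ege1// ler1n.
      move: (8 ^+ k) t0 => t t0; have t1 : 0 < t by exact: lt_le_trans t0.
      have -> : M ^+ 12 * ((8 * m ^+ 6) ^+ 2 / (t * M ^+ 6) ^+ 2) = t^-1 ^+ 2 * (64 * (m ^+ 6) ^+ 2).
        by field; rewrite !gt_eqF.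
      apply: ler_piMl; first exact: mulr_ge0 (ler0n _ 64) (sqr_ge0 _).
      by apply: exprn_ile1; [rewrite invr_ge0 ltW|rewrite invf_le1].
    have e2 : M ^+ 6 * (m ^+ 5) ^+ 2 <= (m ^+ 6) ^+ 2.
      rewrite -(exprM m 5 2) -(exprM m 6 2); exact: Mm_le.
    rewrite [leRHS](_ : _ = 2 * C ^+ 2 * (72 * (m ^+ 6) ^+ 2)); last by ring.
    apply: ler_wpM2l; first exact: mulr_ge0 (ler0n _ 2) (sqr_ge0 _).
    apply: le_trans (lerD e1 e2) _; have := sqr_ge0 (m ^+ 6); move: ((m ^+ 6) ^+ 2) => z; clear n1; lra.
have E : \int[mu]_(r in `[m ^+ 9, m ^+ 5]) (r ^+ 2 * (w r * p r)) =
  \int[mu]_(r in `[m ^+ 9, 8 * m ^+ 6]) (r ^+ 2 * 1 * (w r * p r))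
  + \int[mu]_(r in `[8 * m ^+ 6, m ^+ 5]) (r ^+ 2 * 1 * (w r * p r)).
  rewrite -Rintegral_itv_split//; last exact: I.
  by apply: eq_Rintegral_segment => r _; rewrite mulr1.
clear n1; rewrite {}E in HV; set V := virial u p w in HV *; move: HV hA hB.
set A := \int[mu]_(r in `[m ^+ 9, 8 * m ^+ 6]) _; set B := \int[mu]_(r in `[8 * m ^+ 6, m ^+ 5]) _.
move=> HV hA hB.
have C110 : 0 <= C11.
  rewrite /C11; apply: addr_ge0; last by apply: mulr_ge0; exact: ltW.
  have kC0 : 0 <= 2 * k%:R * C by apply: mulr_ge0 (ltW C0); exact: mulr_ge0.
  apply: addr_ge0; apply: mulr_ge0 => //; first by rewrite mulr_ge0 ?exprn_ge0 ?addr_ge0 ?ler01 ?ler0n// ltW.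
  by apply: mulr_ge0; [exact: mulr_ge0 (ler0n _ 2) (ltW C0)|apply: addr_ge0 => //; exact: exprn_ge0].
have H1 : C11 * (M ^+ 3 * m ^+ 7) <= C11 * (M ^+ 3 * m ^+ 6).
  by apply: ler_wpM2l => //; rewrite ler_pM2l// mn_le.
rewrite (_ : C12 * (M ^+ 3 * m ^+ 6) = C11 * (M ^+ 3 * m ^+ 6) + 2 * k%:R * D * ((1 + C) * (8 * m ^+ 6))
  + 2 * k%:R * D * (12 * C * m ^+ 6)); last by rewrite /C12 /D; ring.
have := ler_normD (V - (A + B)) (A + B); rewrite subrK; have := ler_normD A B.
move: (`|V|) (`|V - (A + B)|) (`|A + B|) (`|A|) (`|B|) HV H1 hA hB => *; lra.
Qed.

End Rate.

End Frame.

End Virial.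

(** * Choice of the cutoffs and uniform drift *)

Section Drift.
Context (R : realType).
Local Notation mu := (@lebesgue_measure R).
Implicit Types (u p w : R -> R) (b d e r x y z L C c m s : R).
Variable k : nat.
Hypothesis k2 : (2 <= k)%N.

(** Restates [virial_rate_le] with constants that depend on [k] and [C] only, fixed before the
    cutoffs and [m], so that [s], [L] and [m] can be chosen in this order. *)
Lemma virial_rate_bound C : 0 < C -> exists A1 A2 A3 A4 A5 : R,
  forall L s s0 m P10 P5 P4 P2 u p w c, frame L s s0 m P10 P5 P4 P2 -> 0 < c ->
  core k C c m u p w -> C * 2 ^+ k * (m ^+ k) ^+ 2 <= c / 2 ->
  virial_rate k m P10 P5 P4 P2 u p w <=
  (s * (s * A1 + A2) + m * (A3 * s0 + A4 + A5 * s0) - k%:R ^+ 2 * c ^+ 2) * (m ^+ k) ^+ 6.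
Proof.
move=> C0; do 5!eexists; move=> L s s0 m P10 P5 P4 P2 u p w c fr c0 co small.
by apply: le_trans (virial_rate_le fr k2 C0 c0 co small) _; exact: lexx.
Qed.

Lemma virial_bounds C : 0 < C -> exists2 A : R, 0 < A &
  forall L s s0 m P10 P5 P4 P2 u p w c, frame L s s0 m P10 P5 P4 P2 -> 0 < c ->
  core k C c m u p w -> C * 2 ^+ k * (m ^+ k) ^+ 2 <= c / 2 -> 2 ^+ 9 * m <= 1 ->
  `|virial k m P10 P5 P4 P2 u p w| <= A * ((m ^+ k) ^+ 3 * m ^+ 6) /\
  forall x, m / 2 <= x <= 2 * m ->
  `|virial k m P10 P5 P4 P2 u p w - \int[mu]_(r in `[x ^+ 9, x ^+ 5]) (r ^+ 2 * (w r * p r))|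
    <= A * ((m ^+ k) ^+ 3 * m ^+ 7).
Proof.
move=> C0.
have [A1 H1] : exists A : R, forall L s s0 m P10 P5 P4 P2 u p w c,
    frame L s s0 m P10 P5 P4 P2 -> 0 < c -> core k C c m u p w -> C * 2 ^+ k * (m ^+ k) ^+ 2 <= c / 2 -> 2 ^+ 9 * m <= 1 ->
    `|virial k m P10 P5 P4 P2 u p w| <= A * ((m ^+ k) ^+ 3 * m ^+ 6).
  by eexists; move=> L s s0 m P10 P5 P4 P2 u p w c fr c0 co small m9; exact: (virial_size fr k2 C0 c0 co small m9).
have [A2 H2] : exists A : R, forall L s s0 m P10 P5 P4 P2 u p w c,
    frame L s s0 m P10 P5 P4 P2 -> 0 < c -> core k C c m u p w -> C * 2 ^+ k * (m ^+ k) ^+ 2 <= c / 2 -> 2 ^+ 9 * m <= 1 ->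
    forall x, m / 2 <= x <= 2 * m ->
    `|virial k m P10 P5 P4 P2 u p w - \int[mu]_(r in `[x ^+ 9, x ^+ 5]) (r ^+ 2 * (w r * p r))|
    <= A * ((m ^+ k) ^+ 3 * m ^+ 7).
  by eexists; move=> L s s0 m P10 P5 P4 P2 u p w c fr c0 co small m9 x xm; exact: (virial_anchor fr k2 C0 c0 co small m9 xm).
have A0 : 0 < `|A1| + `|A2| + 1 by rewrite ltr_wpDl// addr_ge0.
exists (`|A1| + `|A2| + 1) => // L s s0 m P10 P5 P4 P2 u p w c fr c0 co small m9; have m0 := frame_m0 fr.
have X n : 0 <= (m ^+ k) ^+ 3 * m ^+ n by rewrite mulr_ge0 ?exprn_ge0// ltW.
have l1 : A1 <= `|A1| + `|A2| + 1.
  by rewrite (le_trans (ler_norm _))// -addrA lerDl addr_ge0.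
have l2 : A2 <= `|A1| + `|A2| + 1.
  by rewrite (le_trans (ler_norm _))// addrAC lerDr addr_ge0.
split; first by apply: le_trans (H1 _ _ _ _ _ _ _ _ _ _ _ _ fr c0 co small m9) _; rewrite ler_wpM2r.
by move=> x xm; apply: le_trans (H2 _ _ _ _ _ _ _ _ _ _ _ _ fr c0 co small m9 _ xm) _; rewrite ler_wpM2r.
Qed.

(* The last field makes the functionals of neighbouring frames comparable. *)
Record drift b d gam K m (V V' : (R -> R) -> (R -> R) -> (R -> R) -> R) : Prop := Drift {
  drift_flow : forall T (u p w : R -> R -> R) t, wave_flow k T u p w -> T < t ->
    is_derive t 1 (fun t => V (u t) (p t) (w t)) (V' (u t) (p t) (w t));
  drift_rate : forall u p w, shape k b d m u p w -> V' u p w <= - (gam * (m ^+ k) ^+ 6);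
  drift_size : forall u p w, shape k b d m u p w -> `|V u p w| <= K * ((m ^+ k) ^+ 3 * m ^+ 6);
  drift_anchor : forall u p w, shape k b d m u p w -> forall x, m / 2 <= x <= 2 * m ->
    `|V u p w - \int[mu]_(r in `[x ^+ 9, x ^+ 5]) (r ^+ 2 * (w r * p r))|
      <= K * ((m ^+ k) ^+ 3 * m ^+ 7) }.

Lemma small_factor (A e : R) : 0 < e -> exists2 s, 0 < s <= 1 & forall x, 0 <= x <= s -> x * A <= e.
Proof.
move=> e0; have A0 : 0 < `|A| + 1 by rewrite ltr_wpDl.
exists (Num.min 1 (e / (`|A| + 1))) => [|x /andP[x0]].
  by rewrite lt_min ltr01 divr_gt0//= ge_min lexx.
rewrite le_min => /andP[_]; rewrite ler_pdivlMr// => xe; apply: le_trans xe.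
by rewrite ler_wpM2l// (le_trans (ler_norm _))// lerDl.
Qed.

(** Order of choice: [C] and [c] from the profile, then the slope [s] of the slow cutoffs, then
    their ratio [L], and last the bound on [m]. The slope terms and the scale terms each cost a
    quarter of [k ^+ 2 * c ^+ 2]; half of it remains as [gam]. *)
Lemma drift_exists b d : 0 < b -> 0 < d -> exists gam K m1,
  [/\ 0 < gam, 0 < K, 0 < m1, m1 <= 1 / 8 & forall m, 0 < m -> m <= m1 ->
  exists V V', drift b d gam K m V V'].
Proof.
move=> b0 d0; have [C [c [m2 [C0 c0 m20 m28 HC]]]] := core_of_shape (ltnW k2) b0 d0.
have [A1 [A2 [A3 [A4 [A5 HA]]]]] := virial_rate_bound C0; have [K K0 HK] := virial_bounds C0.
have [M M0 HM] := standard_cutoff R; pose s0 := Num.sqrt M.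
pose e := k%:R ^+ 2 * c ^+ 2; have e0 : 0 < e by rewrite mulr_gt0 ?exprn_gt0// ltr0n (leq_trans _ k2).
have e4 : 0 < e / 4 by rewrite divr_gt0.
have [s /andP[s_gt0 s1] Hs] := small_factor (`|A1| + `|A2|) e4.
have [L L1 HL] := slow_cutoff (exprn_gt0 2 s_gt0).
have [m3 /andP[m30 _] Hm3] := small_factor (A3 * s0 + A4 + A5 * s0) e4.
have c20 : 0 < c / 2 by rewrite divr_gt0.
have [m4 /andP[m40 _] Hm4] := small_factor (C * 2 ^+ k) c20.
have [m5 /andP[m50 _] Hm5] := small_factor (L + 2 ^+ 9) (@ltr01 R).
exists (e / 2), K, (Num.min (Num.min m2 m3) (Num.min m4 m5)); split => //.
- by rewrite divr_gt0.
- by rewrite !lt_min m20 m30 m40.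
- by rewrite !ge_min m28.
move=> m m0; rewrite !le_min => /andP[/andP[mm2 mm3] /andP[mm4 mm5]].
have L0 : 0 < L by exact: lt_le_trans L1.
have m18 := le_trans mm2 m28.
have H5 := Hm5 m (introT andP (conj (ltW m0) mm5)).
have Lm : L * m <= 1.
  by apply: le_trans H5; rewrite mulrC ler_pM2l// lerDl exprn_ge0.
have m9 : 2 ^+ 9 * m <= 1.
  by apply: le_trans H5; rewrite mulrC ler_pM2l// lerDr ltW.
have [P10 h10] := HL _ (divr_gt0 (exprn_gt0 10 m0) L0).
rewrite (_ : L * (m ^+ 10 / L) = m ^+ 10) in h10; last by rewrite mulrC divfK ?gt_eqF.
have [P5 h5] := HM _ (exprn_gt0 5 m0); have [P4 h4] := HL _ (exprn_gt0 4 m0).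
have [P2 h2] := HM _ (exprn_gt0 2 m0).
have fr : frame L s s0 m P10 P5 P4 P2.
  by split => //; rewrite ?sqr_sqrtr ?(ltW M0)// ?sqrtr_ge0// ltW.
have small : C * 2 ^+ k * (m ^+ k) ^+ 2 <= c / 2.
  apply: le_trans (Hm4 m (introT andP (conj (ltW m0) mm4))).
  rewrite [leRHS]mulrC ler_wpM2l ?mulr_ge0 ?exprn_ge0 ?(ltW C0)//.
  have mk1 : m ^+ k <= m.
    have k0 : (0 < k)%N by exact: leq_trans k2.
    rewrite -(prednK k0) exprS ler_piMr ?(ltW m0)// exprn_ile1 ?(ltW m0)//; lra.
  rewrite expr2; apply: le_trans (ler_piMr _ _) mk1; first by rewrite exprn_ge0// ltW.
  by rewrite exprn_ile1 ?(ltW m0)//; lra.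
have co u p w : shape k b d m u p w -> core k C c m u p w by exact: HC.
exists (virial k m P10 P5 P4 P2), (virial_rate k m P10 P5 P4 P2); split.
- by move=> T u p w t wf tT; exact: (flow_virial_rate fr wf tT).
- move=> u p w /co hc; apply: le_trans (HA _ _ _ _ _ _ _ _ _ _ _ _ fr c0 hc small) _.
  rewrite -[leRHS]mulNr; apply: ler_wpM2r; first by rewrite !exprn_ge0// ltW.
  have hm := Hm3 m (introT andP (conj (ltW m0) mm3)).
  have hs := Hs s (introT andP (conj (ltW s_gt0) (lexx s))).
  have : s * (s * A1 + A2) <= s * (`|A1| + `|A2|).
    rewrite ler_pM2l//; apply: lerD; last exact: ler_norm.
    apply: le_trans (ler_norm _) _; rewrite normrM (gtr0_norm s_gt0).
    by rewrite ler_piMl.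
  rewrite -/e; move: hm hs; move: (s * (s * A1 + A2)) (s * (`|A1| + `|A2|)) (m * (A3 * s0 + A4 + A5 * s0)).
  by move=> *; lra.
- by move=> u p w /co hc; have [] := HK _ _ _ _ _ _ _ _ _ _ _ _ fr c0 hc small m9.
- by move=> u p w /co hc; have [] := HK _ _ _ _ _ _ _ _ _ _ _ _ fr c0 hc small m9.
Qed.

End Drift.

(** * Slow variation of the scale *)

Section Bubbles.
Context (R : realType).
Local Notation mu := (@lebesgue_measure R).
Implicit Types (f g : R -> R) (a b d e l n r x y z m t : R).
Variable k : nat.
Hypothesis k2 : (2 <= k)%N.

Lemma atan_gap x y X : 0 <= x -> x <= y -> y <= X -> (y - x) / (1 + X ^+ 2) <= atan y - atan x.
Proof.
move=> x0 xy yX; have [c /andP[xc cy] ->] := mean_value (f := atan) xy (fun z _ => is_derive1_atan z).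
have c0 := le_trans x0 xc; rewrite mulrC ler_wpM2r ?subr_ge0//.
by rewrite lef_pV2 ?posrE ?ltr_pwDl ?sqr_ge0// lerD2l lerXn2r ?nnegrE// ?(le_trans cy)// (le_trans c0)// (le_trans cy).
Qed.

Lemma atan_ge0_le x : 0 <= x -> 0 <= atan x <= x.
Proof.
move=> x0; rewrite -{1}(@atan0 R) le_atan//=.
have [c _] := mean_value (f := atan) x0 (fun z _ => is_derive1_atan z).
rewrite atan0 !subr0 => ->; rewrite ler_piMl// invf_le1 ?lerDl ?sqr_ge0//.
by rewrite ltr_pwDl ?sqr_ge0.
Qed.

Lemma atanV x : 0 < x -> atan x^-1 = pi / 2 - atan x.
Proof.
move=> x0; have a0 : 0 < atan x by rewrite -(@atan0 R) lt_atan.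
have a1 := atan_ltpi2 x.
rewrite -[RHS]tanK; last by rewrite in_itv/=; apply/andP; split; have := pi_gt0 R; lra.
congr atan; rewrite -[in LHS](atanK x) /tan sinB cosB sin_pihalf cos_pihalf.
by rewrite !mul0r !mul1r add0r subr0 invf_div.
Qed.

Lemma Q_le x : 0 <= x -> 0 <= Q k x <= 2 * x ^+ k.
Proof.
by move=> x0; have /andP[h1 h2] := atan_ge0_le (exprn_ge0 k x0); rewrite /Q mulr_ge0//= ler_pM2l.
Qed.

Lemma QV x : 0 < x -> Q k x^-1 = pi - Q k x.
Proof. by move=> x0; rewrite /Q exprVn atanV ?exprn_gt0//; field. Qed.

Lemma Q_inner r l : 0 <= r -> 0 < l -> 4 * r <= l -> 0 <= Q k (r / l) <= 1 / 8.
Proof.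
move=> r0 l0 rl; have h0 : 0 <= r / l by rewrite divr_ge0 ?(ltW l0).
have /andP[-> h] := Q_le h0; apply: le_trans h _.
have h1 : r / l <= 4^-1 by rewrite ler_pdivrMr//; lra.
have h2 : (r / l) ^+ k <= (r / l) ^+ 2.
  by rewrite ler_wiXn2l//; lra.
have : (r / l) ^+ 2 <= 4^-1 ^+ 2 by rewrite lerXn2r ?nnegrE ?invr_ge0.
lra.
Qed.

Lemma Q_outer r l : 0 < l -> 4 * l <= r -> pi - 1 / 8 <= Q k (r / l) <= pi.
Proof.
move=> l0 lr; have r0 : 0 < r by apply: lt_le_trans lr; rewrite mulr_gt0.
have /andP[h1 h2] := Q_inner (ltW l0) r0 lr; rewrite -invf_div QV ?divr_gt0// in h1 h2.
by apply/andP; split; lra.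
Qed.

Lemma le_Q x y : 0 <= x -> x <= y -> Q k x <= Q k y.
Proof.
by move=> x0 xy; rewrite /Q ler_pM2l// le_atan// lerXn2r ?nnegrE// (le_trans x0).
Qed.

(** With scales known up to a factor 2, the ratios [l / (8 * m ^+ 6)] and [(mu0 / 8) / n] are at
    least 1/16, so each bubble keeps [pi - u] above [Q k 16^-1] up to the distance to the
    two-bubble; half is reserved for that distance. *)
Let d0 : R := Q k 16^-1 / 2.

Lemma Q_lower_gt0 : 0 < d0.
Proof.
rewrite divr_gt0// mulr_gt0// -(@atan0 R) lt_atan// exprn_gt0// invr_gt0.
Qed.

Let g0 : R := (1 + (4 ^+ k) ^+ 2)^-1.

Let g00 : 0 < g0. Proof. by rewrite invr_gt0 ltr_pwDl// exprn_ge0. Qed.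

(** Doubling or halving the scale of a bubble moves it by a fixed amount at comparable radii. This
    is how a change of the inner scale is detected. *)
Lemma Q_half x : 1 <= x -> x <= 4 -> g0 <= Q k x - Q k (x / 2).
Proof.
move=> x1 x4; have x0 : 0 <= x by exact: le_trans x1.
have y0 : 0 <= x / 2 by rewrite divr_ge0.
have h1 : (x / 2) ^+ k <= x ^+ k / 2.
  rewrite expr_div_n ler_wpM2l ?exprn_ge0// lef_pV2 ?posrE ?exprn_gt0//.
  by rewrite -[leLHS]expr1 ler_weXn2l ?ler1n// ltnW.
have h2 : 1 <= x ^+ k by exact: exprn_ege1.
have h3 : (x / 2) ^+ k <= x ^+ k by lra.
have h4 : x ^+ k <= 4 ^+ k by rewrite lerXn2r ?nnegrE.
rewrite /Q -mulrBr; apply: le_trans (_ : 2 * ((x ^+ k - (x / 2) ^+ k) / (1 + (4 ^+ k) ^+ 2)) <= _).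
  by rewrite mulrA ler_peMl ?(ltW g00)//; lra.
by rewrite ler_pM2l//; exact: atan_gap (exprn_ge0 _ y0) h3 h4.
Qed.

(** At radii a factor 4 away from its scale a bubble is within 1/8 of its limit. The factors 8 in
    [shape] leave room for scales known only up to a factor 2. *)
Lemma two_bubble_shape m l n mu0 e u p w : 0 < m -> 0 < mu0 -> m ^+ 6 <= mu0 -> e <= 1 / 16 -> e <= d0 ->
  m ^+ 6 / 2 <= l <= 2 * m ^+ 6 -> mu0 / 2 <= n <= 2 * mu0 ->
  (forall r, 0 < r -> `|u r - (Q k (r / l) - Q k (r / n))| <= e) ->
  primitive u p -> locally_square_summable p -> locally_square_summable w ->
  (forall a c, 0 < a -> a <= c ->
  \int[mu]_(r in `[a, c]) (r * (w r ^+ 2 + p r ^+ 2 + k%:R ^+ 2 * (sin (u r) ^+ 2 / r ^+ 2)))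
    <= 8 * k%:R) ->
  u r @[r --> 0^'+] --> (0 : R) -> u r @[r --> +oo] --> (0 : R) ->
  shape k (mu0 / 8) d0 m u p w.
Proof.
move=> m0 mu00 mmu e1 ed /andP[l1 l2] /andP[n1 n2] close pu sp sw HE u0 uoo.
have m60 : 0 < m ^+ 6 by exact: exprn_gt0.
have l0 : 0 < l by apply: lt_le_trans l1; rewrite divr_gt0.
have n0 : 0 < n by apply: lt_le_trans n1; rewrite divr_gt0.
have E16 : Q k 16^-1 = 2 * d0 by rewrite /d0; field.
split => //.
- by move=> a rho c; exact: (bogomolny (ltnW k2) pu sp sw HE u0 uoo).
- move=> r r0 rm; have := close r r0; rewrite !ler_norml.
  have rl : 4 * r <= l by move: (m ^+ 6) m60 rm l1 => *; lra.
  have rn : 4 * r <= n by move: (m ^+ 6) m60 rm mmu => *; lra.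
  have := Q_inner (ltW r0) l0 rl; have := Q_inner (ltW r0) n0 rn.
  by move: (Q k _) (Q k _) => A B *; lra.
- move=> r /andP[mr rb]; have r0 : 0 < r by apply: lt_le_trans mr; rewrite mulr_gt0.
  have := close r r0; rewrite !ler_norml.
  have rl : 4 * l <= r by move: (m ^+ 6) m60 mr l2 => *; lra.
  have rn : 4 * r <= n by lra.
  have := Q_outer l0 rl; have := Q_inner (ltW r0) n0 rn.
  by move: (Q k _) (Q k _) => A B *; lra.
- have r0 : 0 < 8 * m ^+ 6 by rewrite mulr_gt0.
  have := close _ r0; rewrite ler_norml.
  have h : 16^-1 <= l / (8 * m ^+ 6).
    by rewrite ler_pdivlMr//; move: (m ^+ 6) m60 l1 => *; lra.
  have h0 : 0 <= 16^-1 :> R by rewrite invr_ge0.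
  have := le_Q h0 h; rewrite E16; have := QV (divr_gt0 l0 r0); rewrite invf_div.
  have /andP[+ _] := Q_le (ltW (divr_gt0 r0 n0)).
  by move: (Q k _) (Q k _) (Q k _) d0 ed => *; lra.
- have r0 : 0 < mu0 / 8 by rewrite divr_gt0.
  have := close _ r0; rewrite ler_norml.
  have h : 16^-1 <= mu0 / 8 / n by rewrite ler_pdivlMr//; lra.
  have h0 : 0 <= 16^-1 :> R by rewrite invr_ge0.
  have := le_Q h0 h; rewrite E16; have := QV (divr_gt0 l0 r0); rewrite invf_div.
  have /andP[+ _] := Q_le (ltW (divr_gt0 l0 r0)).
  by move: (Q k _) (Q k _) (Q k _) d0 ed => *; lra.
Qed.

(** Continuity argument: [t1] is the infimum of the times outside of the open range. The closed
    bounds hold up to [t1], the hypothesis then excludes the endpoint values at [t1], and by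
    continuity the range is kept a little longer. *)
Lemma exit_time f a b lo hi : lo < f a < hi -> a <= b ->
  (forall t, a <= t <= b -> {for t, continuous f}) ->
  (forall t, a <= t <= b -> (forall x, a <= x <= t -> lo <= f x <= hi) -> f t != lo /\ f t != hi) ->
  forall t, a <= t <= b -> lo < f t < hi.
Proof.
move=> fa ab cf H t2 t2ab; apply: contrapT => nt2.
pose A := [set t | a <= t <= b /\ ~ lo < f t < hi].
have A2 : A t2 by [].
have lA : lbound A a by move=> t [/andP[]].
have iA : has_inf A by split; [exists t2|exists a].
pose t1 := inf A.
have at1 : a <= t1 by apply: lb_le_inf => //; exists t2.
have t1b : t1 <= b.
  by apply: le_trans (_ : t2 <= _); [apply: ge_inf => //; exists a|case/andP: t2ab].
have before t : a <= t -> t < t1 -> lo < f t < hi.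
  move=> h1 h2; apply: contrapT => h3; suff : t1 <= t by rewrite leNgt h2.
  apply: ge_inf; first by exists a.
  by split => //; rewrite h1 (le_trans (ltW h2) t1b).
have ct := cf t1 (introT andP (conj at1 t1b)).
have closed_at : lo <= f t1 <= hi.
  have [->|t1a] := eqVneq t1 a; first by case/andP: fa => h1 h2; rewrite !ltW.
  have at1' : a < t1 by rewrite lt_neqAle eq_sym t1a.
  apply/andP; split; rewrite leNgt; apply/negP => h.
    have /nbhs_ballP[e /= e0 He] := ct _ (lt_nbhsl h).
    pose s := Num.max a (t1 - e / 2).
    have /andP[s1 _] : lo < f s < hi.
      by apply: before; rewrite /s ?le_max ?lexx// gt_max at1' ltrBlDr ltrDl divr_gt0.
    move: s1; rewrite ltNge => /negP; apply; apply: ltW; apply: He.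
    rewrite /ball/= /s ltr_norml; case: (leP a (t1 - e / 2)) => hs; rewrite ?max_l ?max_r//; lra.
  have /nbhs_ballP[e /= e0 He] := ct _ (lt_nbhsr h).
  pose s := Num.max a (t1 - e / 2).
  have /andP[_ s1] : lo < f s < hi.
    by apply: before; rewrite /s ?le_max ?lexx// gt_max at1' ltrBlDr ltrDl divr_gt0.
  move: s1; rewrite ltNge => /negP; apply; apply: ltW; apply: He.
  rewrite /ball/= /s ltr_norml; case: (leP a (t1 - e / 2)) => hs; rewrite ?max_l ?max_r//; lra.
have [|n1 n2] := H t1 (introT andP (conj at1 t1b)).
  move=> x /andP[ax]; rewrite le_eqVlt => /predU1P[->//|xt].
  by have /andP[h1 h2] := before _ ax xt; rewrite !ltW.
have /andP[c1 c2] := closed_at.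
have o1 : lo < f t1 by rewrite lt_neqAle eq_sym n1.
have o2 : f t1 < hi by rewrite lt_neqAle n2.
have /nbhs_ballP[e /= e0 He] : nbhs t1 [set t | lo < f t /\ f t < hi].
  by apply: filterI; [exact: ct _ (lt_nbhsr o1)|exact: ct _ (lt_nbhsl o2)].
have [t [tab nt] tt1] := inf_adherent e0 iA; have t1t : t1 <= t := ge_inf (ex_intro _ a lA) (conj tab nt).
apply: nt.
by have [] := He t; [rewrite /ball/= ltr_norml; rewrite -/t1 in tt1; lra|move=> h1 h2; rewrite h1].
Qed.

Lemma anchor_step (A B I X a b c : R) : `|A - I| <= a -> A - X <= - (2 * c) -> `|B - I| <= b ->
  a + b <= c -> B <= X - c.
Proof. by rewrite !ler_norml => *; lra. Qed.

(** The two-bubble reduced to what the dynamics needs: a weak flow, sup-norm closeness instead of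
    the energy norm, and the scales [lam] and [nu] of the inner and outer bubble. *)
Record bubbles T (u p w : R -> R -> R) (lam nu : R -> R) (mu0 : R) : Prop := Bubbles {
  bubbles_flow : wave_flow k T u p w;
  bubbles_at0 : forall t, T < t -> u t r @[r --> 0^'+] --> (0 : R);
  bubbles_aty : forall t, T < t -> u t r @[r --> +oo] --> (0 : R);
  bubbles_scale : forall t, T < t -> 0 < lam t;
  bubbles_cont : forall t, T < t -> {for t, continuous lam};
  bubbles_mu0 : 0 < mu0;
  bubbles_near : forall e, 0 < e -> exists2 T', T < T' & forall t, T' <= t ->
    [/\ lam t <= e, mu0 / 2 <= nu t <= 2 * mu0 &
     forall r, 0 < r -> `|u t r - (Q k (r / lam t) - Q k (r / nu t))| <= e] }.

Section SlowScale.
Variables (T : R) (u p w : R -> R -> R) (lam nu : R -> R) (mu0 : R).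
Hypothesis bu : bubbles T u p w lam nu mu0.

Let wf := bubbles_flow bu.
Let mu00 := bubbles_mu0 bu.

Lemma bubbles_shape : exists2 T1, T < T1 & forall t m, T1 <= t -> 0 < m ->
  m ^+ 6 / 2 <= lam t <= 2 * m ^+ 6 -> shape k (mu0 / 8) d0 m (u t) (p t) (w t).
Proof.
pose e := Num.min (Num.min (1 / 16) d0) (mu0 / 2).
have e0 : 0 < e by rewrite !lt_min Q_lower_gt0 !divr_gt0.
have [T1 TT1 H] := bubbles_near bu e0; exists T1 => // t m T1t m0 lm.
have [l_e nt close] := H t T1t; have tT := lt_le_trans TT1 T1t.
have ee : e <= 1 / 16 /\ e <= d0 /\ e <= mu0 / 2 by rewrite /e !ge_min !lexx !orbT.
have [e1 [e2 e3]] := ee.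
apply: (two_bubble_shape m0 mu00 _ e1 e2 lm nt close) => //.
- by case/andP: lm => l1 _; move: (m ^+ 6) l1 => y l1; lra.
- exact (flow_primitive wf tT).
- exact (flow_p wf tT).
- exact (flow_w wf tT).
- by move=> a c; exact (flow_energy wf tT).
- exact (bubbles_at0 bu tT).
- exact (bubbles_aty bu tT).
Qed.

(** The profile is paired with the probability density [h = - derive1 f] at the inner scale. A
    change of the scale by a factor 2 moves the pairing by at least [g0 / 2], whereas its time
    derivative is at most [C * M ^+ 3 * s / m ^+ 6] in absolute value by the kinetic bound. *)
Lemma scale_test s M t0 t1 m f e C c : 0 < m -> lam t0 = m ^+ 6 -> T < t0 -> t0 <= t1 ->
  cutoff (m ^+ 6) (2 * m ^+ 6) M f -> 0 <= s -> M <= s ^+ 2 -> 0 < C ->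
  e <= g0 / 16 -> 8 * m ^+ 6 <= g0 / 8 * mu0 -> 4 * m ^+ 6 <= mu0 ->
  (forall t, t0 <= t <= t1 -> core k C c m (u t) (p t) (w t)) ->
  (forall t, t0 <= t <= t1 -> mu0 / 2 <= nu t /\
     forall r, 0 < r -> `|u t r - (Q k (r / lam t) - Q k (r / nu t))| <= e) ->
  lam t1 = m ^+ 6 / 2 \/ lam t1 = 2 * m ^+ 6 ->
  g0 / 2 * m ^+ 6 <= (t1 - t0) * (C * (m ^+ k) ^+ 3 * s).
Proof.
move=> m0 lt0 Tt0 t01 cf s0 Ms C0 e16 m8 m4 co near lt1.
pose a := m ^+ 6; have a0 : 0 < a by exact: exprn_gt0.
have a2 : a <= 2 * a by lra.
pose h r := - derive1 f r.
have sh : smooth h by apply/smoothN/smooth_derive1/(cutoff_smooth cf).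
have ch : continuous_pos h by exact: smooth_pos.
have vh : vanishes_off a (2 * a) h.
  by move=> x xn; rewrite /h (supported_vanishes (cutoff_derive_supported cf) xn) oppr0.
have h0 r : 0 <= h r by rewrite oppr_ge0 (cutoff_derive_le0 a0 cf).
have mass : \int[mu]_(r in `[a, 2 * a]) h r = 1 := cutoff_mass a0 a2 cf.
have [t|z /andP[z0 z1] E] := @mean_value R (fun t => \int[mu]_(r in `[a, 2 * a]) (u t r * h r))
  (fun t => \int[mu]_(r in `[a, 2 * a]) (w t r * h r)) _ _ t01.
  move=> /andP[t0t _]; exact: (flow_eq1 wf sh a0 a2 vh (lt_le_trans Tt0 t0t)).
have coz := co z (introT andP (conj z0 z1)).
have rate : `|\int[mu]_(r in `[a, 2 * a]) (w z r * h r)| <= a^-1 * (C * (m ^+ k) ^+ 3) * s.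
  have sX : locally_square_summable (fun r => r * w z r).
    by apply: locally_square_summableMr; [exact: continuous_pos_id|exact: core_w coz].
  have -> : \int[mu]_(r in `[a, 2 * a]) (w z r * h r) =
      - \int[mu]_(r in `[a, 2 * a]) (derive1 f r * (r^-1 * (r * w z r))).
    rewrite -RintegralN//; last first.
      apply: (locally_summableMr (cutoff_derive_cont cf) _ _ a0).
      apply: locally_summableMr; first exact: continuous_pos_inv1.
      exact: locally_square_summable_summable.
    apply: eq_Rintegral_segment => r /andP[ar _]; have r0 := lt_le_trans a0 ar.
    by rewrite /h mulKf ?gt_eqF// mulrN mulrC.
  rewrite normrN; apply: (cutoff_linear a0 a2 cf) => //.
  - exact: continuous_pos_inv1.
  - move=> r /andP[ar _]; have r0 := lt_le_trans a0 ar.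
    by rewrite ger0_norm ?invr_ge0 ?(ltW r0)// lef_pV2.
  - by rewrite invr_ge0 ltW.
  - by rewrite mulr_ge0 ?(ltW C0)// !exprn_ge0// ltW.
  - apply: le_trans (core_kinetic coz a0 a2).
    rewrite le_eqVlt; apply/orP; left; apply/eqP; apply: eq_Rintegral_segment => r /andP[ar _].
    by field; rewrite gt_eqF// (lt_le_trans a0).
(* Of the gap [g0] between the two inner bubbles, the two errors [e] cost at most [g0 / 16] each and
   the outer bubbles at most [g0 / 8]. *)
have gap : g0 / 2 <= `|\int[mu]_(r in `[a, 2 * a]) (u t1 r * h r) - \int[mu]_(r in `[a, 2 * a]) (u t0 r * h r)|.
  have cu t : T < t -> continuous_pos (u t) by move=> tT; exact: primitive_cont (flow_primitive wf tT).
  have I t : T < t -> locally_summable (fun r => u t r * h r).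
    by move=> tT; apply: continuous_pos_summable; apply: continuous_posM; [exact: cu|].
  have Tt1 := lt_le_trans Tt0 t01.
  have key (v1 v2 : R -> R) : locally_summable (fun r => v1 r * h r) -> locally_summable (fun r => v2 r * h r) ->
     (forall r, a <= r <= 2 * a -> g0 / 2 <= v1 r - v2 r) ->
     g0 / 2 <= \int[mu]_(r in `[a, 2 * a]) (v1 r * h r) - \int[mu]_(r in `[a, 2 * a]) (v2 r * h r).
    move=> I1 I2 v12; rewrite -RintegralB//; [|exact: I1|exact: I2].
    have -> : g0 / 2 = g0 / 2 * \int[mu]_(r in `[a, 2 * a]) h r by rewrite mass mulr1.
    rewrite -RintegralZl//; last by apply: continuous_pos_summable.
    apply: le_Rintegral_segment.
    - by apply: locally_summableZ a0; exact: continuous_pos_summable.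
    - by apply: locally_summableB a0.
    - by move=> r rab; rewrite -mulrBl ler_wpM2r// v12.
  have [n0 c0] := near t0 (introT andP (conj (lexx t0) t01)).
  have [n1 c1] := near t1 (introT andP (conj t01 (lexx t1))).
  have outer n r : a <= r <= 2 * a -> mu0 / 2 <= n -> 0 <= Q k (r / n) <= g0 / 8.
    move=> /andP[ar ra] n2; have r0 := lt_le_trans a0 ar.
    have nn0 : 0 < n by apply: lt_le_trans n2; rewrite divr_gt0.
    have /andP[-> h2] := Q_le (ltW (divr_gt0 r0 nn0)); apply: le_trans h2 _.
    have q1 : r / n <= 1.
      by rewrite ler_pdivrMr// mul1r; move: m4; rewrite -/a; lra.
    have q2 : (r / n) ^+ k <= r / n.
      by rewrite -[leRHS]expr1 ler_wiXn2l ?(ltW (divr_gt0 r0 nn0))// ltnW.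
    have q3 : 2 * (r / n) <= g0 / 8.
      rewrite mulrA ler_pdivrMr//.
      have : g0 / 8 * (mu0 / 2) <= g0 / 8 * n by rewrite ler_pM2l// divr_gt0.
      by move: m8; rewrite -/a; move: (g0 / 8) (g0 / 8 * n) => G X; lra.
    by apply: le_trans q3; rewrite ler_pM2l.
  have inner r : a <= r <= 2 * a -> 1 <= r / a /\ r / a <= 2.
    by move=> /andP[ar ra]; rewrite ler_pdivlMr// ler_pdivrMr// mul1r.
  case: lt1 => lt1.
  - apply: le_trans (ler_norm _); apply: key; [exact: I|exact: I|] => r rab.
    have [r1 r2] := inner r rab; have r0 : 0 < r by case/andP: rab => ar _; exact: lt_le_trans ar.
    have := outer _ _ rab n0; have := outer _ _ rab n1; have := c0 r r0; have := c1 r r0.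
    have x1 : 1 <= 2 * (r / a) by lra.
    have x4 : 2 * (r / a) <= 4 by lra.
    have := Q_half x1 x4; rewrite lt0 lt1 -/a.
    rewrite (_ : 2 * (r / a) / 2 = r / a); last by field; rewrite gt_eqF.
    rewrite (_ : r / (a / 2) = 2 * (r / a)); last by field; rewrite gt_eqF.
    rewrite !ler_norml; move: (Q k _) (Q k _) (Q k _) (Q k _) g0 e16 => *; lra.
  - rewrite distrC; apply: le_trans (ler_norm _); apply: key; [exact: I|exact: I|] => r rab.
    have [r1 r2] := inner r rab; have r0 : 0 < r by case/andP: rab => ar _; exact: lt_le_trans ar.
    have := outer _ _ rab n0; have := outer _ _ rab n1; have := c0 r r0; have := c1 r r0.
    have x4 : r / a <= 4 by lra.
    have := Q_half r1 x4; rewrite lt0 lt1 -/a.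
    rewrite (_ : r / a / 2 = r / (2 * a)); last by field; rewrite gt_eqF.
    rewrite !ler_norml; move: (Q k _) (Q k _) (Q k _) (Q k _) g0 e16 => *; lra.
rewrite E normrM (ger0_norm (_ : 0 <= t1 - t0)) ?subr_ge0// in gap.
have b0 : 0 <= t1 - t0 by rewrite subr_ge0.
have := le_trans gap (ler_wpM2r b0 rate); rewrite -!mulrA ler_pdivlMl//.
rewrite -/a; move=> h1; apply: le_trans (_ : a * (g0 * 2^-1) <= _).
  by rewrite le_eqVlt; apply/orP; left; apply/eqP; ring.
apply: le_trans h1 _.
by rewrite le_eqVlt; apply/orP; left; apply/eqP; ring.
Qed.

Lemma exp6_le x y : 0 <= x -> 0 <= y -> (x ^+ 6 <= y ^+ 6) = (x <= y).
Proof. by move=> x0 y0; rewrite ler_pXn2r. Qed.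

Lemma slow_scale : exists c T1, [/\ 0 < c, T < T1 & forall t0 m, T1 <= t0 -> 0 < m -> lam t0 = m ^+ 6 ->
  forall t, t0 <= t <= t0 + c * (m ^+ 6 / (m ^+ k) ^+ 3) -> m ^+ 6 / 2 < lam t < 2 * m ^+ 6].
Proof.
have [T1 TT1 HS] := bubbles_shape.
have b0 : 0 < mu0 / 8 by rewrite divr_gt0.
have [C [c [m1 [C0 c0 m10 _ HC]]]] := core_of_shape (ltnW k2) b0 Q_lower_gt0.
have [M M0 HM] := standard_cutoff R; pose s := Num.sqrt M.
have s0 : 0 < s by rewrite sqrtr_gt0.
pose e := Num.min (Num.min (g0 / 16) (g0 / 64 * mu0)) (Num.min (mu0 / 4) (m1 ^+ 6)).
have e0 : 0 < e.
  by rewrite !lt_min exprn_gt0// !divr_gt0// !andbT mulr_gt0// divr_gt0.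
have [e1 [e2 [e3 e4]]] : e <= g0 / 16 /\ e <= g0 / 64 * mu0 /\ e <= mu0 / 4 /\ e <= m1 ^+ 6.
  by rewrite /e !ge_min !lexx !orbT.
have [T2 TT2 HE] := bubbles_near bu e0.
have Cs0 : 0 < C * s by rewrite mulr_gt0.
(* Half of the time that [scale_test] requires for a change of the scale by a factor 2. *)
exists (g0 / (4 * (C * s))), (Num.max T1 T2); split.
- by rewrite divr_gt0// mulr_gt0.
- by rewrite lt_max TT1.
move=> t0 m; rewrite ge_max => /andP[T1t0 T2t0] m0 lt0; apply: exit_time.
- have m60 := exprn_gt0 6 m0; rewrite lt0; move: (m ^+ 6) m60 => x x0; apply/andP; split; lra.
- rewrite lerDl; apply: mulr_ge0.
    by rewrite ltW// divr_gt0// mulr_gt0.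
  by rewrite ltW// divr_gt0 ?exprn_gt0.
- by move=> t /andP[t0t _]; apply: (bubbles_cont bu); apply: lt_le_trans t0t; exact: lt_le_trans TT1 T1t0.
move=> t /andP[t0t tb] Hx.
have [l_e _ _] := HE t0 T2t0; rewrite lt0 in l_e.
have mm1 : m <= m1 by rewrite -exp6_le ?(ltW m0) ?(ltW m10)// (le_trans l_e).
have N : ~ (lam t = m ^+ 6 / 2 \/ lam t = 2 * m ^+ 6).
  have [f cf] := HM _ (exprn_gt0 6 m0).
  move=> hl; have := scale_test m0 lt0 (lt_le_trans TT1 T1t0) t0t cf (ltW s0) _ C0 e1 _ _ _ _ hl.
  have h1 : M <= s ^+ 2 by rewrite sqr_sqrtr// ltW.
  have h2 : 8 * m ^+ 6 <= g0 / 8 * mu0.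
    have -> : g0 / 8 * mu0 = 8 * (g0 / 64 * mu0) by field.
    by rewrite ler_pM2l// (le_trans l_e).
  have h3 : 4 * m ^+ 6 <= mu0 by rewrite -ler_pdivlMl// mulrC (le_trans l_e).
  have h4 x : t0 <= x <= t -> core k C c m (u x) (p x) (w x).
    by move=> /andP[t0x xt]; apply: HC => //; apply: HS; rewrite ?Hx ?t0x// (le_trans T1t0).
  have h5 x : t0 <= x <= t -> mu0 / 2 <= nu x /\
      forall r, 0 < r -> `|u x r - (Q k (r / lam x) - Q k (r / nu x))| <= e.
    by move=> /andP[t0x xt]; have [_ /andP[]] := HE x (le_trans T2t0 t0x).
  move=> /(_ c h1 h2 h3 h4 h5); apply/negP; rewrite -ltNge.
  have M0' : 0 < C * (m ^+ k) ^+ 3 * s by rewrite mulrAC mulr_gt0// !exprn_gt0.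
  apply: (@le_lt_trans _ _ (g0 / (4 * (C * s)) * (m ^+ 6 / (m ^+ k) ^+ 3) * (C * (m ^+ k) ^+ 3 * s))).
    by rewrite ler_pM2r// lerBlDl.
  have m60 := exprn_gt0 6 m0; have mk0 := exprn_gt0 k m0.
  rewrite (_ : _ * _ = g0 * m ^+ 6 / 4); last by field; rewrite !gt_eqF.
  rewrite (_ : g0 / 2 * m ^+ 6 = g0 * m ^+ 6 / 2); last by field.
  by have := mulr_gt0 g00 m60; move: (g0 * m ^+ 6) => y y0; lra.
by split; apply/eqP => E; apply: N; [left|right].
Qed.

Lemma within_double_refl (x : R) : 0 < x -> x / 2 <= x <= 2 * x.
Proof. by move=> x0; apply/andP; split; lra. Qed.

Lemma within_double_sym (x y : R) : x / 2 <= y <= 2 * x -> y / 2 <= x <= 2 * y.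
Proof. by move=> /andP[? ?]; apply/andP; split; lra. Qed.

Lemma half_double_root (x y : R) : 0 < x -> 0 < y -> x ^+ 6 / 2 < y ^+ 6 < 2 * x ^+ 6 -> x / 2 <= y <= 2 * x.
Proof.
move=> x0 y0 /andP[h1 h2]; have x60 := exprn_gt0 6 x0.
have [x00 y00] := (ltW x0, ltW y0).
rewrite -(@exp6_le (x / 2) y) ?divr_ge0// -(@exp6_le y (2 * x)) ?mulr_ge0//.
rewrite expr_div_n exprMn; move: (x ^+ 6) (y ^+ 6) h1 h2 x60 => a b *.
by apply/andP; split; lra.
Qed.

(** [X t] is the functional in the frame adapted to the scale at time [t]. Over one step the frame
    is kept and the drift acts; then the frame is changed to that of the new scale. The change costs
    a multiple of [M ^+ 3 * m ^+ 7], at most half of the drift once [m] is small. *)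
Lemma bubbles_dynamics (m : R -> R) : (forall t, T < t -> 0 < m t /\ m t ^+ 6 = lam t) ->
  exists (T1 K c g : R) (X : R -> R), [/\ 0 <= T1, T < T1, 0 < K, 0 < c & 0 < g] /\ forall t, T1 <= t ->
  [/\ m t <= 1,
    forall x, t <= x <= t + c * (m t ^+ 6 / (m t ^+ k) ^+ 3) -> m t / 2 <= m x <= 2 * m t,
    `|X t| <= K * ((m t ^+ k) ^+ 3 * m t ^+ 6) &
    X (t + c * (m t ^+ 6 / (m t ^+ k) ^+ 3)) <= X t - g * ((m t ^+ k) ^+ 3 * m t ^+ 6)].
Proof.
move=> mE; have b0 : 0 < mu0 / 8 by rewrite divr_gt0.
have [gam [K [m1 [gam0 K0 m10 m18 HV]]]] := drift_exists k2 b0 Q_lower_gt0.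
have {HV}[V HV] : exists V : R -> (R -> R) -> (R -> R) -> (R -> R) -> R, forall m, 0 < m -> m <= m1 ->
    exists V', drift k (mu0 / 8) d0 gam K m (V m) V'.
  (* One functional is fixed for each admissible [m], so that [X] is a function of time; outside of
     that range it is set to 0. *)
  have /choice[V HV'] : forall m, exists V, 0 < m -> m <= m1 ->
      exists V', drift k (mu0 / 8) d0 gam K m V V'.
    move=> m'; have [[m0 mm1]|n] := pselect (0 < m' /\ m' <= m1).
      by have [V HV'] := HV m' m0 mm1; exists V.
    by exists (fun _ _ _ => 0) => h1 h2; exfalso; apply: n.
  by exists V.
have [c [T1 [c0 TT1 Hc]]] := slow_scale; have [T2 TT2 HS] := bubbles_shape.
(* Accounts for the scale at the end of the step, at most twice that at its beginning, in the error
   of the new frame; [h] is the resulting bound on [m]. *)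
pose Z : R := (2 ^+ k) ^+ 3 * 2 ^+ 7; have Z0 : 0 < Z by rewrite mulr_gt0// !exprn_gt0.
pose h := gam * c / (2 * (K * (1 + Z))).
have h0 : 0 < h by rewrite divr_gt0 ?mulr_gt0// addr_gt0.
pose e := Num.min (Num.min 1 m1) h; have e0 : 0 < e by rewrite !lt_min ltr01 m10.
have [e1 [e2 e3]] : e <= 1 /\ e <= m1 /\ e <= h by rewrite /e !ge_min !lexx !orbT.
have [T3 TT3 HT] := bubbles_near bu (exprn_gt0 6 e0).
exists (Num.max (Num.max 0 T1) (Num.max T2 T3)), K, c, (gam * c / 2), (fun t => V (m t) (u t) (p t) (w t)).
split; first by split; rewrite ?le_max ?lexx ?lt_max ?TT1 ?orbT// divr_gt0// mulr_gt0.
move=> t; rewrite !ge_max => /andP[/andP[_ T1t] /andP[T2t T3t]].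
have m_small x : T3 <= x -> m x <= e.
  move=> T3x; have [m0 mx] := mE x (lt_le_trans TT3 T3x).
  by rewrite -exp6_le ?(ltW m0) ?(ltW e0)// mx; have [] := HT x T3x.
have Tt := lt_le_trans TT1 T1t; have [m0 mt] := mE t Tt; have me := m_small t T3t.
set M := m t ^+ k; have M0 : 0 < M by exact: exprn_gt0.
set tau := c * _; have tau0 : 0 < tau by rewrite mulr_gt0// divr_gt0 ?exprn_gt0.
have tt : t <= t + tau by rewrite lerDl ltW.
have slow x : t <= x <= t + tau -> m t ^+ 6 / 2 < lam x < 2 * m t ^+ 6 by exact: Hc.
have slowm x : t <= x <= t + tau -> m t / 2 <= m x <= 2 * m t.
  move=> tx; have [mx0 mx] : 0 < m x /\ m x ^+ 6 = lam x.
    by apply: mE; case/andP: tx => tx _; exact: lt_le_trans tx.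
  by apply: half_double_root => //; rewrite mx; exact: slow.
have [V' dV] := HV _ m0 (le_trans me e2).
have self x : T2 <= x -> 0 < m x /\ m x ^+ 6 = lam x -> shape k (mu0 / 8) d0 (m x) (u x) (p x) (w x).
  move=> T2x [mx0 mx]; apply: HS => //; rewrite -mx; move: (m x ^+ 6) (exprn_gt0 6 mx0) => y y0.
  by apply/andP; split; lra.
split => //; first exact: le_trans me e1.
  exact: (drift_size dV (self t T2t (conj m0 mt))).
have t1 : T < t + tau by exact: lt_le_trans tt.
have [n0 nt] := mE _ t1.
have T2t' := le_trans T2t tt; have T3t' := le_trans T3t tt.
have [W' dW] := HV _ n0 (le_trans (m_small _ T3t') e2).
have sh x : t <= x <= t + tau -> shape k (mu0 / 8) d0 (m t) (u x) (p x) (w x).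
  move=> tx; apply: HS => //; first by case/andP: tx => tx _; exact: le_trans tx.
  by have /andP[h1 h2] := slow x tx; rewrite !ltW.
have tt' : t <= t + tau <= t + tau by rewrite tt lexx.
(* At the end of the step the old and the new functional are both compared with the integral from
   [m t ^+ 9] to [m t ^+ 5]; the scale at time [t] is admissible for both frames. *)
have A1 := within_double_refl m0.
have A2 := within_double_sym (slowm _ tt').
have D1 := drift_anchor dV (sh _ tt') A1.
have D2 := drift_anchor dW (self _ T2t' (conj n0 nt)) A2.
have [x|z zt E] := @mean_value R (fun x => V (m t) (u x) (p x) (w x)) (fun x => V' (u x) (p x) (w x)) _ _ tt.
  by move=> /andP[tx _]; exact: (drift_flow dV (bubbles_flow bu) (lt_le_trans Tt tx)).
have rate := drift_rate dV (sh z zt).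
rewrite [in RHS]addrC addKr in E.
have D3 : V (m t) (u (t + tau)) (p (t + tau)) (w (t + tau)) - V (m t) (u t) (p t) (w t)
    <= - (gam * c * (M ^+ 3 * m t ^+ 6)).
  rewrite E; apply: le_trans (ler_wpM2r (ltW tau0) rate) _.
  by rewrite le_eqVlt; apply/orP; left; apply/eqP; rewrite /tau -/M; field; rewrite gt_eqF.
have big : (m (t + tau) ^+ k) ^+ 3 * m (t + tau) ^+ 7 <= Z * (M ^+ 3 * m t ^+ 7).
  rewrite (_ : Z * _ = ((2 * m t) ^+ k) ^+ 3 * (2 * m t) ^+ 7); last by rewrite /Z /M !exprMn; ring.
  have n00 := ltW n0; have m20 : 0 <= 2 * m t by rewrite mulr_ge0// ltW.
  have /andP[n1 n2] := slowm _ tt'.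
  apply: ler_pM; rewrite ?exprn_ge0//; last by rewrite lerXn2r ?nnegrE.
  by rewrite lerXn2r ?nnegrE ?exprn_ge0// lerXn2r ?nnegrE.
have D4 := le_trans D2 (ler_wpM2l (ltW K0) big).
have small : K * (1 + Z) * (M ^+ 3 * m t ^+ 7) <= gam * c / 2 * (M ^+ 3 * m t ^+ 6).
  have Z1 : 0 < K * (1 + Z) by rewrite mulr_gt0// addr_gt0.
  rewrite (_ : K * (1 + Z) * (M ^+ 3 * m t ^+ 7) = (K * (1 + Z) * m t) * (M ^+ 3 * m t ^+ 6)); last by ring.
  apply: ler_wpM2r; first by rewrite mulr_ge0// exprn_ge0// ltW.
  apply: (@le_trans _ _ (K * (1 + Z) * h)); first by rewrite ler_pM2l// (le_trans me).
  rewrite /h; move: (K * (1 + Z)) Z1 => y y0.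
  by rewrite (_ : _ * _ = gam * c / 2)//; field; rewrite gt_eqF.
move: D1 D3 D4 small; rewrite -/M.
rewrite (_ : K * (1 + Z) * (M ^+ 3 * m t ^+ 7) = K * (M ^+ 3 * m t ^+ 7) + K * (Z * (M ^+ 3 * m t ^+ 7))); last by ring.
rewrite (_ : gam * c * (M ^+ 3 * m t ^+ 6) = 2 * (gam * c / 2 * (M ^+ 3 * m t ^+ 6))); last by field.
exact: anchor_step.
Qed.

End SlowScale.

End Bubbles.

(** * Discrete dynamics *)

Section Recursion.
Context (R : realType).
Implicit Types (a b d e r x y t : R) (n i j N : nat).

Lemma Bernoulli_le x n : 0 <= x -> x <= 1 -> 1 - n%:R * x <= (1 - x) ^+ n.
Proof.
move=> x0 x1; elim: n => [|n IH]; first by rewrite mul0r subr0 expr0.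
have h : 0 <= 1 - x by rewrite subr_ge0.
rewrite exprS; apply: le_trans (ler_wpM2l h IH).
have := mulr_ge0 (ler0n R n) (sqr_ge0 x).
by rewrite -natr1; move: n%:R => z; nra.
Qed.

Variables (k : nat) (m X : R -> R) (T K c g : R).
Hypotheses (k2 : (2 <= k)%N) (T0 : 0 <= T) (K0 : 0 < K) (c0 : 0 < c) (g0 : 0 < g).

Let tau t := c * (m t ^+ 6 / (m t ^+ k) ^+ 3).
Let a t := (m t ^+ k) ^+ 3 * m t ^+ 6.
(** The length of a step is [c] divided by [m ^+ E]. For [k = 2] this exponent is 0 and all steps
    have length [c]. *)
Let E := (3 * (k - 2))%N.

Hypothesis m_gt0 : forall t, T <= t -> 0 < m t.
Hypothesis m_le1 : forall t, T <= t -> m t <= 1.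
Hypothesis slow : forall t, T <= t -> forall x, t <= x <= t + tau t -> m t / 2 <= m x <= 2 * m t.
Hypothesis X_size : forall t, T <= t -> `|X t| <= K * a t.
Hypothesis X_drop : forall t, T <= t -> X (t + tau t) <= X t - g * a t.

Fixpoint time n : R := if n is n'.+1 then time n' + tau (time n') else T.

Let rate t := m t ^+ E.

Let E3 : (k * 3)%N = (E + 6)%N.
Proof. rewrite /E; lia. Qed.

Let tauE t : T <= t -> tau t = c / rate t.
Proof.
move=> /m_gt0 mt; rewrite /tau -exprM E3 exprD /rate; congr (_ * _).
by rewrite invfM mulrCA mulfV ?mulr1// expf_neq0// gt_eqF.
Qed.

Let rate_bounds t : T <= t -> 0 < rate t <= 1.
Proof. by move=> Tt; rewrite exprn_gt0 ?m_gt0//= exprn_ile1 ?(ltW (m_gt0 Tt)) ?m_le1. Qed.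

Let tau_ge t : T <= t -> c <= tau t.
Proof.
move=> Tt; have /andP[r0 r1] := rate_bounds Tt.
by rewrite tauE// ler_peMr ?(ltW c0)// invf_ge1.
Qed.

Let a_bounds t : T <= t -> 0 < a t <= 1.
Proof.
move=> Tt; have m0 := m_gt0 Tt; rewrite mulr_gt0 ?exprn_gt0//=.
by rewrite /a -exprM -exprD exprn_ile1 ?(ltW m0) ?m_le1.
Qed.

Let timeS n : time n.+1 = time n + tau (time n). Proof. by []. Qed.

Let time_ge n : T <= time n.
Proof.
elim: n => // n IH; rewrite timeS (le_trans IH)// lerDl.
exact: le_trans (ltW c0) (tau_ge IH).
Qed.

Lemma time_lower n : T + n%:R * c <= time n.
Proof.
elim: n => [|n IH]; first by rewrite mul0r addr0.
by rewrite timeS -natr1 mulrDl mul1r addrA lerD// tau_ge.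
Qed.

Lemma time_bracket t : T <= t -> exists n, time n <= t <= time n.+1.
Proof.
move=> Tt; have ex : exists n, t < time n.
  exists (Num.bound ((t - T) / c)); apply: lt_le_trans (time_lower _).
  have : 0 <= (t - T) / c by rewrite divr_ge0 ?subr_ge0// ltW.
  by move=> /archi_boundP; rewrite ltr_pdivrMr// ltrBlDl.
have [n tn min] := ex_minnP ex; case: n tn min => [|n] tn min.
  by move: tn => /=; rewrite ltNge Tt.
by exists n; rewrite (ltW tn) andbT leNgt; apply/negP => /min; rewrite ltnn.
Qed.

Let at_step n t : time n <= t <= time n.+1 -> m (time n) / 2 <= m t <= 2 * m (time n).
Proof. by rewrite timeS; apply: slow; exact: time_ge. Qed.

(* A negative value would force X to decrease linearly, against its bound. *)
Lemma drop_ge0 n : 0 <= X (time n).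
Proof.
rewrite leNgt; apply/negP => Xn; pose d := - X (time n); have d0 : 0 < d by rewrite oppr_gt0.
have drop i : X (time (n + i)) <= - d - i%:R * (g * d / K).
  elim: i => [|i IH]; first by rewrite mul0r subr0 addn0 /d opprK.
  have Xi : X (time (n + i)) <= - d.
    apply: le_trans IH _; rewrite gerBl mulr_ge0// divr_ge0 ?(ltW K0)// mulr_ge0// ltW//.
  rewrite addnS timeS; apply: le_trans (X_drop (time_ge _)) _.
  (* The bound [|X| <= K * a] read backwards: a value below [- d] forces [a >= d / K], so the drop
     of each further step stays bounded below. *)
  have ad : d / K <= a (time (n + i)).
    rewrite ler_pdivrMr// mulrC; apply: le_trans (X_size (time_ge _)).
    by rewrite -normrN; apply: le_trans (ler_norm _); rewrite lerNr.
  have := ler_wpM2l (ltW g0) ad; rewrite (mulrA g d).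
  rewrite (_ : i.+1%:R * (g * d / K) = i%:R * (g * d / K) + g * d / K); last by rewrite -natr1; ring.
  by move: IH; move: (g * d / K) (g * a _) => y z; move: (i%:R * y) => j; lra.
pose i := Num.bound (K / (g * d / K)).
have y0 : 0 < g * d / K by rewrite divr_gt0// mulr_gt0.
have : K / (g * d / K) < i%:R by apply: archi_boundP; rewrite divr_ge0 ?ltW.
rewrite ltr_pdivrMr// => Ki.
have := drop i; have := X_size (time_ge (n + i)); rewrite ler_norml => /andP[h _] h2.
have /andP[_ a1] := a_bounds (time_ge (n + i)); have := ler_wpM2l (ltW K0) a1.
by move: h h2 Ki; move: (K * a _) (i%:R * _) => y z; lra.
Qed.

Let th := 1 - g / K.

Let drop_a n : g * a (time n) <= X (time n).
Proof. by have := drop_ge0 n.+1; have := X_drop (time_ge n); rewrite timeS => h1 h2; lra. Qed.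

Let X_le n : X (time n) <= K * a (time n).
Proof. exact: le_trans (ler_norm _) (X_size (time_ge n)). Qed.

Let gK : g <= K.
Proof.
have /andP[a0 _] := a_bounds (time_ge 0).
by rewrite -(ler_pM2r a0); exact: le_trans (drop_a 0) (X_le 0).
Qed.

Let th_bounds : 0 <= th < 1.
Proof.
by rewrite subr_ge0 ler_pdivrMr// mul1r gK/= gtrBl divr_gt0.
Qed.

(** Each drop [g * a] is at least the fraction [g / K] of [X], because [X <= K * a]. *)
Lemma X_geometric n i : X (time (n + i)) <= th ^+ i * X (time n).
Proof.
have /andP[th0 _] := th_bounds.
elim: i => [|i IH]; first by rewrite addn0 mul1r.
rewrite exprS -mulrA; apply: le_trans (ler_wpM2l th0 IH).
rewrite addnS timeS; apply: le_trans (X_drop (time_ge _)) _.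
rewrite mulrBl mul1r lerD2l lerN2 mulrAC ler_pdivrMr// -mulrA ler_pM2l// mulrC.
exact: X_le.
Qed.

(** [X] lies between [g * a] and [K * a]: the next value of [X] is nonnegative, so the drop [g * a]
    cannot exceed [X]. *)
Lemma a_geometric n i : a (time (n + i)) <= K / g * th ^+ i * a (time n).
Proof.
have /andP[th0 _] := th_bounds.
rewrite mulrAC -mulrA mulrAC ler_pdivlMr//  mulrC; apply: le_trans (drop_a _) _.
apply: le_trans (X_geometric _ _) _; rewrite mulrA [leRHS]mulrC ler_wpM2l ?exprn_ge0//.
Qed.

(** All steps have length [c]. The lower bound needs only that a step at most halves [m]; the upper
    bound is the geometric decay of [a = m ^+ 12]. *)
Lemma exponential_bounds : k = 2%N -> exists D q D' q' : R,
  [/\ 0 < D, 0 < q, 0 < D' & 0 < q'] /\ forall t, T <= t ->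
  D' * expR (- (q' * t)) <= m t /\ m t ^+ 12 <= D * expR (- (q * t)).
Proof.
move=> kE; have tc t : T <= t -> tau t = c.
  by move=> Tt; rewrite tauE// /rate /E kE subnn muln0 expr0 divr1.
have timeE n : time n = T + n%:R * c.
  elim: n => [|n IH]; first by rewrite mul0r addr0.
  by rewrite timeS (tc _ (time_ge n)) IH -natr1 mulrDl mul1r addrA.
(* [th] may be 0, which has no logarithm. *)
pose s := Num.max th (1 / 2).
have s0 : 0 < s by rewrite lt_max divr_gt0 ?orbT.
have s1 : s < 1 by have /andP[_ h] := th_bounds; rewrite gt_max h/=; lra.
have ths : th <= s by rewrite le_max lexx.
have [th0 _] := andP th_bounds.
have ls : 0 < - ln s by rewrite oppr_gt0 ln_lt0// s0.
have l2 : 0 < ln 2 :> R by rewrite ln_gt0// ltr1n.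
exists (2 ^+ 12 * (K / g) * expR (- ln s * (T / c + 1))), (- ln s / c),
  (m T * expR (- ln 2)), (ln 2 / c); split.
  split; rewrite ?(divr_gt0 ls c0) ?(divr_gt0 l2 c0)//.
    by rewrite mulr_gt0 ?expR_gt0// mulr_gt0 ?exprn_gt0// divr_gt0.
  by rewrite mulr_gt0 ?expR_gt0// m_gt0.
move=> t Tt; have [n nt] := time_bracket Tt; have /andP[h1 h2] := at_step nt.
have /andP[n1 n2] := nt; rewrite timeE in n1; rewrite timeE -natr1 in n2.
have m0 := m_gt0 (time_ge n).
split.
  apply: le_trans h1.
  have low i : m T * 2 ^- i <= m (time i).
    elim: i => [|i IH]; first by rewrite expr0 invr1 mulr1.
    have [|h3 _] := andP (@at_step i (time i.+1) _); last first.
      apply: le_trans h3; rewrite exprSr invfM mulrA ler_pM2r// invr_gt0//.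
    by rewrite lexx timeS andbT lerDl (le_trans (ltW c0))// tau_ge.
  apply: le_trans (_ : m T * 2 ^- n / 2 <= _); last by rewrite ler_pM2r ?invr_gt0// low.
  rewrite -!mulrA ler_pM2l ?m_gt0// -expRD.
  have -> : 2 ^- n / 2 = expR (- (ln 2 * n%:R) - ln 2) :> R.
    by rewrite expRD !expRN (mulrC (ln 2)) expRM_natl lnK ?posrE.
  rewrite ler_expR addrC lerD2r lerN2.
  by rewrite ler_pM2l// [leRHS]mulrC ler_pdivlMr//; apply: le_trans n1; rewrite lerDr.
apply: le_trans (_ : (2 * m (time n)) ^+ 12 <= _).
  by rewrite lerXn2r ?nnegrE ?mulr_ge0 ?(ltW m0)// ltW// m_gt0.
rewrite exprMn -2!(mulrA (2 ^+ 12)) ler_pM2l ?exprn_gt0//.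
have -> : m (time n) ^+ 12 = a (time (0 + n)) by rewrite /a add0n kE -!exprM -exprD.
apply: le_trans (a_geometric 0 n) _; rewrite -!(mulrA (K / g)) ler_pM2l ?divr_gt0//.
have /andP[_ a1] := a_bounds (time_ge 0).
apply: le_trans (_ : s ^+ n <= _).
  rewrite -[leRHS]mulr1; apply: ler_pM => //; first exact: exprn_ge0.
    by have /andP[a0 _] := a_bounds (time_ge 0); exact: ltW.
  by rewrite lerXn2r ?nnegrE// ltW.
have -> : s ^+ n = expR (ln s * n%:R) by rewrite (mulrC (ln s)) expRM_natl lnK ?posrE.
rewrite -expRD ler_expR.
have -> : - ln s * (T / c + 1) - - ln s / c * t = ln s * ((t - T) / c - 1) by ring.
rewrite ler_nM2l -?oppr_gt0// lerBlDr ler_pdivrMr// mulrDl mul1r; lra.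
Qed.

(** With [a = m ^+ P] and [rate = m ^+ E], the decay of [a] passes to [rate] through
    [rate ^+ P = a ^+ E]. The Bernoulli inequality supplies [1 - x] with [th ^+ E <= (1 - x) ^+ P],
    in place of a fractional power of [th]. *)
Lemma rate_geometric : (3 <= k)%N -> exists B s : R, [/\ 0 < B, 0 <= s, s < 1 &
  forall n i, rate (time (n + i)) <= B * s ^+ i * rate (time n)].
Proof.
move=> k3; have [th0 th1] := andP th_bounds.
have KG : 1 <= K / g by rewrite ler_pdivlMr// mul1r gK.
pose P := (k * 3 + 6)%N; pose x := (1 - th ^+ E) / P%:R.
have E0 : (0 < E)%N by rewrite /E; lia.
have P0 : (0 < P)%N by rewrite /P; lia.
have thE : th ^+ E < 1 by rewrite exprn_ilt1 ?gtn_eqF.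
have thE0 : 0 <= th ^+ E by exact: exprn_ge0.
have P0R : 0 < P%:R :> R by rewrite ltr0n.
have P1R : 1 <= P%:R :> R by rewrite ler1n.
have x0 : 0 < x by rewrite divr_gt0// subr_gt0.
have x1 : x <= 1 by rewrite ler_pdivrMr// mul1r; lra.
have sP : th ^+ E <= (1 - x) ^+ P.
  apply: le_trans (Bernoulli_le P (ltW x0) x1).
  by rewrite /x mulrC divfK ?gt_eqF//; lra.
have s0 : 0 <= 1 - x by rewrite subr_ge0.
have B0 : 0 < (K / g) ^+ E by rewrite exprn_gt0// divr_gt0.
exists ((K / g) ^+ E), (1 - x); split => //; first by rewrite gtrBl.
move=> n i; have /andP[r0 _] := rate_bounds (time_ge (n + i)).
have /andP[r1 _] := rate_bounds (time_ge n).
have rhs0 : 0 <= (K / g) ^+ E * (1 - x) ^+ i * rate (time n).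
  by rewrite mulr_ge0 ?(ltW r1)// mulr_ge0 ?(ltW B0)// exprn_ge0.
rewrite -(@ler_pXn2r _ P P0) ?nnegrE ?(ltW r0)//.
have aE t : rate t ^+ P = a t ^+ E by rewrite /rate /a -(exprM (m t) k 3) -exprD -!exprM mulnC.
rewrite (_ : (_ * _ * _) ^+ P = ((K / g) ^+ E) ^+ P * ((1 - x) ^+ i) ^+ P * rate (time n) ^+ P); last by rewrite !exprMn.
rewrite !aE; have h := a_geometric n i.
have /andP[a0 _] := a_bounds (time_ge (n + i)); have /andP[a1 _] := a_bounds (time_ge n).
apply: le_trans (_ : (K / g * th ^+ i * a (time n)) ^+ E <= _).
  by rewrite lerXn2r ?nnegrE ?(ltW a0)// (le_trans (ltW a0)).
rewrite (_ : (_ * _ * _) ^+ E = (K / g) ^+ E * (th ^+ i) ^+ E * a (time n) ^+ E); last by rewrite !exprMn.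
rewrite ler_wpM2r ?exprn_ge0 ?(ltW a1)//; apply: ler_pM.
- exact: ltW.
- by rewrite !exprn_ge0.
- by rewrite -[leLHS]expr1 ler_weXn2l// exprn_ege1.
- by rewrite -exprM mulnC exprM -(exprM (1 - x)) mulnC exprM lerXn2r ?nnegrE ?exprn_ge0.
Qed.

(** The length of a step is [c / rate], and [rate] decays geometrically, so the elapsed time is
    comparable with the length of the last steps: at least one of them, at most a geometric series
    of them. Hence [t * rate] is bounded on both sides. *)
Lemma polynomial_bounds : (3 <= k)%N -> exists T' b B : R, [/\ 0 < b, 0 < B, T <= T' &
  forall t, T' <= t -> b <= t * m t ^+ (3 * (k - 2)) <= B].
Proof.
move=> k3; have [B [s [B0 s0 s1 H]]] := rate_geometric k3.
have s1' : 0 < 1 - s by rewrite subr_gt0.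
(* The sum of the step lengths, measured against the [rate] of a later index. The shift [i] carries
   the geometric factor through the induction, whose step amounts to [(1 - s) ^+ 2 >= 0]. *)
have early n i : time n - T <= c * B / (rate (time (n + i)) * (1 - s)) * s ^+ i.
  elim: n i => [|n IH] i.
    have /andP[r0 _] := rate_bounds (time_ge (0 + i)).
    by rewrite subrr mulr_ge0 ?exprn_ge0// divr_ge0 ?mulr_ge0 ?(ltW c0) ?(ltW B0) ?(ltW r0) ?(ltW s1').
  have /andP[r0 _] := rate_bounds (time_ge (n.+1 + i)).
  have /andP[rn _] := rate_bounds (time_ge n).
  rewrite timeS addrAC; have := IH i.+1; rewrite addnS -addSn => h1.
  have h2 : tau (time n) <= c * B / rate (time (n.+1 + i)) * s ^+ i.+1.
    rewrite (tauE (time_ge n)) (_ : _ * _ * _ = c * (B * s ^+ i.+1 / rate (time (n.+1 + i)))); last by ring.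
    rewrite ler_pM2l// ler_pdivlMr// mulrC ler_pdivrMr// addSnnS; exact: H.
  apply: le_trans (lerD h1 h2) _.
  rewrite -subr_ge0 (_ : _ - _ = c * B / (rate (time (n.+1 + i)) * (1 - s)) * s ^+ i * (1 - s) ^+ 2); last first.
    by rewrite exprS; field; rewrite !gt_eqF.
  rewrite mulr_ge0 ?sqr_ge0// mulr_ge0 ?exprn_ge0//.
  by rewrite divr_ge0 ?mulr_ge0 ?(ltW c0) ?(ltW B0) ?(ltW r0) ?(ltW s1').
pose D := c * B / (1 - s); have D0 : 0 < D by rewrite divr_gt0// mulr_gt0.
exists (time 1), (c / 4 ^+ E), (2 ^+ E * (T + D + c)); split => //.
- by rewrite divr_gt0 ?exprn_gt0.
- by rewrite mulr_gt0 ?exprn_gt0// ltr_pwDr// addr_ge0 ?(ltW D0).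
move=> t t1; have Tt := le_trans (time_ge 1) t1; have [n nt] := time_bracket Tt.
have /andP[h1 h2] := at_step nt; have /andP[n1 n2] := nt.
have m0 := m_gt0 (time_ge n); have mt := m_gt0 Tt.
have /andP[r0 r1] := rate_bounds (time_ge n); have /andP[rt0 rt1] := rate_bounds Tt.
have t0 : 0 < t by apply: lt_le_trans t1; rewrite timeS ltr_pwDr// (lt_le_trans c0)// tau_ge.
apply/andP; split.
  (* A step already completed at time [t]: the one before the current step, or step 0 if [n = 0],
     since [t >= time 1]. At most two halvings separate its scale from that at [t]. *)
  have [j [jt rj]] : exists j, time j + tau (time j) <= t /\ m (time j) / 4 <= m t.
    case: n n1 n2 nt h1 h2 m0 r0 r1 => [|n] n1 n2 nt h1 h2 m0 r0 r1.
      exists 0%N; split => //; apply: le_trans h1.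
      by rewrite ler_pM2l// lef_pV2 ?posrE// ler_nat.
    exists n; split => //.
    have [|h3 _] := andP (@at_step n (time n.+1) _).
      by rewrite lexx timeS andbT lerDl (le_trans (ltW c0))// tau_ge.
    by apply: le_trans h1; move: h3; move: (m (time n)) (m (time n.+1)) => y z; lra.
  have mj := m_gt0 (time_ge j); have /andP[rj0 _] := rate_bounds (time_ge j).
  have h3 : rate (time j) / 4 ^+ E <= rate t.
    by rewrite -expr_div_n lerXn2r ?nnegrE ?divr_ge0 ?(ltW mj) ?(ltW mt).
  have h4 : c / rate (time j) <= t.
    by rewrite -tauE//; apply: le_trans jt; rewrite lerDr (le_trans T0).
  apply: le_trans (_ : c / rate (time j) * (rate (time j) / 4 ^+ E) <= _).
    by rewrite mulrA divfK ?gt_eqF.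
  by apply: ler_pM => //; rewrite ltW// divr_gt0// exprn_gt0.
have h3 : rate t <= 2 ^+ E * rate (time n).
  by rewrite -exprMn lerXn2r ?nnegrE ?(ltW mt) ?mulr_ge0 ?(ltW m0).
have h4 : t * rate (time n) <= T + D + c.
  have := early n 0%N; rewrite addn0 expr0 mulr1 => h5.
  have h6 : t <= time n + c / rate (time n) by rewrite -tauE.
  have h7 : t <= T + (D + c) / rate (time n).
    rewrite (_ : (D + c) / _ = c * B / (rate (time n) * (1 - s)) + c / rate (time n)); last first.
      by rewrite /D; field; rewrite !gt_eqF.
    by move: h5 h6; move: (c * B / _) (c / _) => y z; lra.
  apply: le_trans (ler_wpM2r (ltW r0) h7) _; rewrite mulrDl divfK ?gt_eqF// -addrA lerD2r.
  by rewrite ler_piMr.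
apply: le_trans (ler_wpM2l (ltW t0) h3) _; rewrite mulrCA ler_pM2l// exprn_gt0//.
Qed.

End Recursion.

(** * From finite energy solutions to flows *)

Section Finite_energy.
Context (R : realType).
Local Notation mu := (@lebesgue_measure R).
Implicit Types (f g h q : R -> R) (a b c e r x y N C : R) (A D E : set R).

(* Monotonicity of the integral of nonnegative functions needs no measurability;
   none is known for the pointwise derivative of a difference. *)
Lemma le_integral_ge0 D E (f g : R -> \bar R) : D `<=` E ->
  (forall x, D x -> (0 <= f x)%E) -> (forall x, E x -> (0 <= g x)%E) ->
  (forall x, D x -> (f x <= g x)%E) ->
  (\int[mu]_(x in D) f x <= \int[mu]_(x in E) g x)%E.
Proof.
move=> DE f0 g0 fg; rewrite !ge0_integralE//; apply: ereal_sup_le => _ [s /= sf <-].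
exists s => //= x; apply: le_trans (sf x) _; rewrite !patchE.
case: ifPn => [/set_mem Dx|_]; first by rewrite ifT ?fg// inE; exact: DE.
by case: ifPn => // /set_mem; exact: g0.
Qed.

Lemma EFin_Rintegral_segment f a b : summable_on `[a, b] f ->
  (\int[mu]_(x in `[a, b]) f x)%:E = (\int[mu]_(x in `[a, b]) (f x)%:E)%E.
Proof. by move=> If; rewrite fineK//; apply: integrable_fin_num. Qed.

(** Lebesgue differentiation. Off a null set the pointwise derivative of a difference is then the
    difference of the derivatives, which links the pointwise [derive1] in the norms to
    [primitive]. *)
Lemma primitive_derivable_ae f f' a b : primitive f f' -> 0 < a ->
  exists A, [/\ measurable (A : set (measurableTypeR R)), mu A = 0%E &
    forall x, a < x < b -> ~ A x -> derivable f x 1].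
Proof.
move=> [If' ff'] a0; pose h := f' \_ `[a, b].
have Ih : summable_on setT h.
  have /integrable_mkcond := If' a b a0; rewrite /summable_on => /(_ (measurable_segment _ _)).
  by rewrite (_ : _ \_ _ = EFin \o h)//; apply/funext => x; rewrite /h /= !patchE; case: ifP.
have lh : locally_integrable setT h by apply: open_integrable_locally; [exact: openT|].
have Ihy y : mu.-integrable [set` Interval (BLeft a) (BRight y)] (EFin \o h).
  exact: summableS Ih.
have [A [mA A0 sub]] := FTC1 Ihy lh; exists A; split => // x xab nA.
have /contrapT /= P : ~ ~ _ := fun nP => nA (sub x nP).
have [|dF _] := P; first by rewrite ?lte_fin; case/andP: xab.
have dc : derivable (fun x => f a + \int[mu]_(t in `[a, x]) h t) x 1.
  by have [] := derive_add (derive_cst (f a) x) (derivableP dF).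
apply: near_eq_derivable dc; near=> y; have yab : a < y < b.
  near: y; apply: (near_in_itvoo (a := a) (b := b)); rewrite in_itv//.
have ay : a <= y by case/andP: yab => /ltW.
rewrite -[RHS](subrK (f a)) ff'// addrC; congr (_ + _).
apply: eq_Rintegral_segment => z /andP[az zy]; rewrite /h patchE mem_set//= in_itv/= az.
by case/andP: yab => _ yb; rewrite (le_trans zy)// ltW.
Unshelve. all: by end_near. Qed.

(** The derivative [2 * f * f'] of [f ^+ 2] is at most [(f' ^+ 2 + f ^+ 2 / r ^+ 2) * r], and [f]
    vanishes at the origin. *)
Lemma primitive_sup_bound f f' C : primitive f f' -> locally_square_summable f' ->
  f r @[r --> 0^'+] --> (0 : R) -> 
  (forall a b, 0 < a -> a <= b -> \int[mu]_(r in `[a, b]) ((f' r ^+ 2 + f r ^+ 2 / r ^+ 2) * r) <= C) ->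
  forall b, 0 < b -> f b ^+ 2 <= C.
Proof.
move=> pf sf f0 HC b b0; have cf := primitive_cont pf; have [If2 E] := primitiveM pf pf.
apply/ler_addgt0Pr => e e0.
have /cvgrPdist_lt /(_ (Num.sqrt e)) := f0; rewrite sqrtr_gt0 => /(_ e0) H.
near (0 : R)^'+ => a; have a0 : 0 < a by near: a; exact: nbhs_right_gt.
have ab : a <= b by near: a; apply: nbhs_right_le.
have fa : f a ^+ 2 <= e.
  have : `|0 - f a| < Num.sqrt e by near: a.
  rewrite sub0r normrN -(real_normK (num_real (f a))) => h.
  by rewrite -[leRHS]sqr_sqrtr ?(ltW e0)// lerXn2r ?nnegrE ?sqrtr_ge0// ltW.
have If'2 := locally_summable_sqr sf.
have Iv : locally_summable (fun r => f r ^+ 2 / r ^+ 2).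
  by apply: continuous_pos_summable; apply: continuous_posM; [exact: continuous_posX|exact: continuous_pos_inv].
have Iall : locally_summable (fun r => (f' r ^+ 2 + f r ^+ 2 / r ^+ 2) * r).
  by apply: locally_summableMl; [exact: continuous_pos_id|exact: locally_summableD].
have := E a b a0 ab; rewrite -!expr2.
have : \int[mu]_(x in `[a, b]) (f' x * f x + f x * f' x) <= C.
  apply: le_trans (HC a b a0 ab); apply: le_Rintegral_segment; [exact: If2|exact: Iall|].
  move=> x /andP[ax _]; have x0 := lt_le_trans a0 ax.
  rewrite -subr_ge0 (_ : _ - _ = (f' x - f x / x) ^+ 2 * x); last by field; rewrite gt_eqF.
  by rewrite mulr_ge0 ?sqr_ge0// ltW.
by move: fa; move: (\int[mu]_(_ in _) _) (f b ^+ 2) (f a ^+ 2) => *; lra.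
Unshelve. all: by end_near. Qed.

Lemma weakly_differentiable_primitive f : weakly_differentiable f -> primitive f (derive1 f).
Proof.
move=> [[mf _ If] ff']; split => // a b a0; apply/integrableP.
have sub : `[a, b]%classic `<=` halfline R by exact: segment_sub_pos.
split; first by apply/measurable_EFinP; apply: measurable_funS mf => //; exact: measurable_itv.
by have := If _ sub (@segment_compact _ a b).
Qed.

Variable k : nat.
Hypothesis k1 : (1 <= k)%N.

Let k1R : 1 <= k%:R :> R. Proof. by rewrite ler1n. Qed.

(** The embedding of the energy space into bounded functions, for the difference to a smooth [q].
    The norm contains [derive1] of the difference, which equals [h'] only almost everywhere. *)
Lemma H0_norm_sup (v : state R) q q' e : in_H0 k v -> locally_square_summable (derive1 v.1) ->
  (forall x, 0 < x -> is_derive x 1 q (q' x)) -> continuous_pos q' ->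
  q r @[r --> 0^'+] --> (0 : R) -> 0 < e ->
  (H0_norm k (sub_state v (q, fun=> 0%R)) < e%:E)%E -> forall r, 0 < r -> `|v.1 r - q r| <= e.
Proof.
move=> [/weakly_differentiable_primitive pv _ _ v0 _] sv dq cq' q0 e0 He r r0.
pose h x := v.1 x - q x; pose h' x := derive1 v.1 x - q' x.
have ph : primitive h h'.
  have := primitiveD pv (primitiveZ (-1) (primitive_derive dq cq')).
  by apply: primitive_eq => x _; rewrite /h /h' mulN1r.
have sh : locally_square_summable h'.
  by apply: locally_square_summableB => //; exact: continuous_pos_square_summable.
have h0 : h x @[x --> 0^'+] --> (0 : R) by rewrite -[X in _ --> X](subrr 0); exact: cvgB.
have I0 (x : R) : halfline R x -> (0 <= (((derive1 h x) ^+ 2 + k%:R ^+ 2 * (h x ^+ 2 / x ^+ 2)) * x)%:E)%E.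
  rewrite /halfline/= in_itv/= andbT => x0; rewrite lee_fin mulr_ge0 ?(ltW x0)// addr_ge0 ?sqr_ge0//.
  by rewrite mulr_ge0 ?sqr_ge0// divr_ge0 ?sqr_ge0.
have main : (\int[mu]_(x in halfline R)
   (((derive1 h x) ^+ 2 + k%:R ^+ 2 * (h x ^+ 2 / x ^+ 2)) * x)%:E <= (e ^+ 2)%:E)%E.
  move: He; rewrite /H0_norm /sub_state /= => /ltW.
  set X := (\int[mu]_(_ in _) _)%E; set Y := (\int[mu]_(_ in _) _)%E.
  have X0 : (0 <= X)%E by apply: integral_ge0 => x hx; exact: I0.
  have Y0 : (0 <= Y)%E.
    apply: integral_ge0 => x; rewrite /halfline/= in_itv/= andbT => x0.
    by rewrite lee_fin mulr_ge0 ?sqr_ge0// ltW.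
  have XY0 : (0 <= X + Y)%E by exact: adde_ge0.
  move=> le_e; apply: (@le_trans _ _ (X + Y)%E); first exact: leeDl.
  rewrite -(sqr_sqrte XY0) EFin_expe lee_sqr//; [exact: sqrte_ge0|].
  by rewrite lee_fin ltW.
apply: norm_le_sqr (ltW e0) _; apply: (primitive_sup_bound ph sh h0) r0 => a b a0 ab.
have ch := primitive_cont ph.
have Iall : locally_summable (fun r => (h' r ^+ 2 + h r ^+ 2 / r ^+ 2) * r).
  apply: locally_summableMl; first exact: continuous_pos_id.
  apply: locally_summableD; first exact: locally_summable_sqr.
  by apply: continuous_pos_summable; apply: continuous_posM; [exact: continuous_posX|exact: continuous_pos_inv].
rewrite -lee_fin EFin_Rintegral_segment; last exact: Iall.
have a2 : 0 < a / 2 by rewrite divr_gt0.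
(* The window is widened so that all points of [[a, b]] are interior. *)
have [A [mA A0 dA]] := primitive_derivable_ae (b + 1) pv a2.
rewrite (@negligible_integral _ _ _ mu `[a, b]%classic A)//; last exact: Iall.
apply: le_trans main; apply: le_integral_ge0 => [x [+ _]|x [+ _]|//|x [xab nB]].
- exact: segment_sub_pos.
- rewrite /= in_itv/= => /andP[ax _]; have x0 := lt_le_trans a0 ax.
  by rewrite lee_fin mulr_ge0 ?(ltW x0)// addr_ge0 ?sqr_ge0// divr_ge0 ?sqr_ge0.
move: xab; rewrite /= in_itv/= => /andP[ax xb]; have x0 := lt_le_trans a0 ax.
have dv : derivable v.1 x 1 by apply: dA => //; apply/andP; split; lra.
have dh : is_derive x 1 h (h' x).
  have dv' : is_derive x 1 v.1 (derive1 v.1 x) by rewrite derive1E; exact: derivableP.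
  exact: derive_sub dv' (dq x x0).
rewrite (is_derive1E dh) lee_fin ler_pM2r// lerD2l.
by apply: ler_peMl; [rewrite divr_ge0 ?sqr_ge0|exact: exprn_ege1].
Qed.

End Finite_energy.

(** * Energy of the harmonic map, local energy bounds and sup-norm closeness to the two-bubble *)

Section Profile_energy.
Context (R : realType).
Local Notation mu := (@lebesgue_measure R).
Implicit Types (f g h q : R -> R) (a b c e l n r x y C : R).
Variable k : nat.
Hypothesis k1 : (1 <= k)%N.

Lemma sin_2atan x : sin (2 * atan x) = 2 * x / (1 + x ^+ 2).
Proof.
have c0 : 0 < cos (atan x) by apply: cos_gt0_pihalf; rewrite atan_gtNpi2 atan_ltpi2.
have c2 := cos2_tan2 (lt0r_neq0 c0); rewrite atanK in c2.
have s1 : sin (atan x) = x * cos (atan x) by rewrite -{2}(atanK x) /tan divfK// gt_eqF.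
have -> : 2 * atan x = atan x *+ 2 by rewrite mulr_natl.
by rewrite sin_mulr2n s1 -c2 invrK; ring.
Qed.

Let dQ x : R := 2 * ((1 + (x ^+ k) ^+ 2)^-1 * (k%:R * x ^+ k.-1)).

Lemma derive_Q x : is_derive x 1 (Q k) (dQ x).
Proof.
apply: derive_cmul; have h := derive_pow k x.
by have H := @is_derive1_comp R atan (fun y => y ^+ k) x _ _ (is_derive1_atan (x ^+ k)) h; exact H.
Qed.

Let one_sqr_gt0 x : 0 < 1 + x ^+ 2.
Proof. by rewrite ltr_pwDl// sqr_ge0. Qed.

Lemma continuous_dQ : continuous dQ.
Proof.
move=> x; apply: cvgM; first exact: cvg_cst.
apply: cvgM; last by apply: cvgM; [exact: cvg_cst|exact: exprn_continuous].
apply: cvgV; first by rewrite gt_eqF.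
apply: cvgD; first exact: cvg_cst.
by under eq_fun do rewrite -exprM; rewrite -exprM; exact: exprn_continuous.
Qed.

(** The energy density of [Q] times [r]. Its primitive [F] is [- 2 * k * cos Q], which increases
    from [- 2 * k] to [2 * k]. *)
Let f r : R := 4 * k%:R * (2 * k%:R * r ^+ (2 * k).-1) / (1 + r ^+ (2 * k)) ^+ 2.
Let F r : R := 2 * k%:R - 4 * k%:R * (1 + r ^+ (2 * k))^-1.

Let den r : 0 < 1 + r ^+ (2 * k).
Proof. by rewrite mulnC exprM. Qed.

Let dF r : is_derive r 1 F (f r).
Proof.
have d1 : is_derive r 1 (fun r => 1 + r ^+ (2 * k)) (0 + (2 * k)%:R * r ^+ (2 * k).-1).
  exact: derive_add (derive_cst 1 r) (derive_pow (2 * k) r).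
have d2 := @is_deriveV R (fun r => 1 + r ^+ (2 * k)) r _ 1 (lt0r_neq0 (den r)) d1.
apply: is_derive_eq (derive_sub (derive_cst (2 * k%:R) r) (derive_cmul (4 * k%:R) d2)) _.
rewrite /f /GRing.scale/= natrM add0r; move: (r ^+ _.-1) (1 + _) (den r) => y z z0.
by field; rewrite gt_eqF.
Qed.

Let cf : continuous f.
Proof.
move=> x; apply: cvgM.
  by apply: cvgM; [exact: cvg_cst|apply: cvgM; [exact: cvg_cst|exact: exprn_continuous]].
apply: cvgV; first by rewrite gt_eqF// exprn_gt0.
rewrite (_ : (fun _ => _) = fun r => (1 + r ^+ (2 * k)) * (1 + r ^+ (2 * k))); last first.
  by apply/funext => r; rewrite expr2.
by apply: cvgM; apply: cvgD; [exact: cvg_cst|exact: exprn_continuous|exact: cvg_cst|exact: exprn_continuous].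
Qed.

Let Foo : F r @[r --> +oo] --> (2 * k%:R : R).
Proof.
apply/cvgrPdist_le => e e0; near=> r.
have r1 : 1 <= r by near: r; apply: nbhs_pinfty_ge; rewrite num_real.
have re : 4 * k%:R / e <= r by near: r; apply: nbhs_pinfty_ge; rewrite num_real.
have r0 : 0 < r by exact: lt_le_trans r1.
have k0 : 0 <= 4 * k%:R :> R by rewrite mulr_ge0.
rewrite /F opprB addrC subrK ger0_norm; last by rewrite mulr_ge0// invr_ge0 ltW.
rewrite ler_pdivrMr//; rewrite ler_pdivrMr// in re; apply: le_trans re _.
rewrite mulrC ler_pM2l//; apply: (@le_trans _ _ (r ^+ (2 * k))); last by rewrite lerDr.
by rewrite -[leLHS]expr1 ler_weXn2l// muln_gt0.
Unshelve. all: by end_near. Qed.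

Lemma energy_vecQ_le : (energy k (vecQ R k) <= (pi * (4 * k%:R))%:E)%E.
Proof.
rewrite /energy EFinM lee_pmul2l ?lte_fin ?pi_gt0//.
have E : (\int[mu]_(r in `[0%R, +oo[) (f r)%:E = (4 * k%:R)%:E)%E.
  rewrite (@ge0_continuous_FTC2y _ f F 0 (2 * k%:R)).
  - rewrite /F expr0n muln_eq0/= -[k == 0%N]negbK -lt0n k1/= addr0 invr1 mulr1 -EFinB; congr EFin.
    by ring.
  - move=> r r0; rewrite /f !mulr_ge0 ?exprn_ge0 ?invr_ge0 ?exprn_ge0 ?(ltW (den r))//.
  - exact: continuous_subspaceT.
  - exact: Foo.
  - by move=> r _; have [] := dF r.
  - apply: cvg_at_right_filter; apply: differentiable_continuous; apply/derivable1_diffP.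
    by have [] := dF 0.
  - by move=> r _; exact: is_derive1E.
rewrite -E; apply: le_integral_ge0 => r; rewrite /halfline /= !in_itv/= ?andbT.
- exact: ltW.
- move=> r0; rewrite lee_fin mulr_ge0 ?(ltW r0)// !addr_ge0 ?sqr_ge0// mulr_ge0 ?sqr_ge0//.
  by rewrite divr_ge0 ?sqr_ge0.
- by move=> r0; rewrite lee_fin /f !mulr_ge0 ?exprn_ge0 ?invr_ge0 ?exprn_ge0 ?(ltW (den r)).
- move=> r0; rewrite lee_fin (is_derive1E (derive_Q r)) /Q sin_2atan /dQ /f.
  have -> : r ^+ (2 * k).-1 = (r ^+ k) ^+ 2 / r.
    by rewrite -exprM mulnC; case: k k1 => // j _; rewrite mulSn addSn /= exprS mulrC mulKf ?gt_eqF.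
  have -> : r ^+ k.-1 = r ^+ k / r by case: k k1 => // j _; rewrite exprS mulrC mulKf ?gt_eqF.
  have -> : r ^+ (2 * k) = (r ^+ k) ^+ 2 by rewrite mulnC exprM.
  rewrite le_eqVlt; apply/orP; left; apply/eqP; move: (r ^+ k) => y.
  by field; rewrite !gt_eqF// one_sqr_gt0.
Qed.

Lemma energy_integral_le (v : state R) C : (energy k v <= (pi * C)%:E)%E ->
  (\int[mu]_(r in halfline R) ((v.2 r ^+ 2 + derive1 v.1 r ^+ 2
    + k%:R ^+ 2 * (sin (v.1 r) ^+ 2 / r ^+ 2)) * r)%:E <= C%:E)%E.
Proof. by rewrite /energy EFinM lee_pmul2l// ?lte_fin pi_gt0. Qed.

(** All terms of the density are nonnegative, so each is dominated by the total, and on [[a, b]] the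
    weight [r] is at least [a]. *)
Lemma energy_locally (v : state R) C : weakly_differentiable v.1 -> measurable_fun (halfline R) v.2 ->
  (energy k v <= (pi * C)%:E)%E ->
  [/\ locally_square_summable (derive1 v.1), locally_square_summable v.2 &
   forall a b, 0 < a -> a <= b -> \int[mu]_(r in `[a, b])
     (r * (v.2 r ^+ 2 + derive1 v.1 r ^+ 2 + k%:R ^+ 2 * (sin (v.1 r) ^+ 2 / r ^+ 2))) <= C].
Proof.
move=> wd mw /energy_integral_le HC.
have pv := weakly_differentiable_primitive wd; have cv := primitive_cont pv.
have [[mp _ _] _] := wd.
pose G r := (v.2 r ^+ 2 + derive1 v.1 r ^+ 2 + k%:R ^+ 2 * (sin (v.1 r) ^+ 2 / r ^+ 2)) * r.
have mG : measurable_fun (halfline R) G.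
  apply: measurable_funM => //; apply: measurable_funD.
    by apply: measurable_funD; apply: measurable_funX.
  apply: measurable_continuous_pos; apply: continuous_posM; first exact: continuous_pos_cst.
  by apply: continuous_posM; [exact/continuous_posX/continuous_pos_sin|exact: continuous_pos_inv].
have G0 r : 0 < r -> 0 <= G r.
  move=> r0; rewrite mulr_ge0 ?(ltW r0)// !addr_ge0 ?sqr_ge0// mulr_ge0 ?sqr_ge0//.
  by rewrite divr_ge0 ?sqr_ge0.
have le_half a b : 0 < a -> (\int[mu]_(r in `[a, b]) (G r)%:E <= C%:E)%E.
  move=> a0; apply: le_trans HC; apply: le_integral_ge0 => [|r|r|//].
  - exact: segment_sub_pos.
  - by rewrite /= in_itv/= => /andP[ar _]; rewrite lee_fin G0// (lt_le_trans a0).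
  - by rewrite /halfline/= in_itv/= andbT lee_fin => /G0.
have IG : locally_summable G.
  move=> a b a0; apply/integrableP; split.
    by apply/measurable_EFinP; apply: measurable_funS mG; [exact: measurable_itv|exact: segment_sub_pos].
  apply: (@le_lt_trans _ _ C%:E); last exact: ltry.
  apply: le_trans (le_half a b a0); rewrite le_eqVlt; apply/orP; left; apply/eqP; apply: eq_integral => r /set_mem/=.
  by rewrite in_itv/= => /andP[ar _]; rewrite ger0_norm// G0// (lt_le_trans a0).
have sq f' : measurable_fun (halfline R) f' -> (forall r, 0 < r -> f' r ^+ 2 * r <= G r) ->
    locally_square_summable f'.
  move=> mf' le_G a b a0.
  have Ig : summable_on `[a, b] (fun r => a^-1 * G r) by apply: summableZ => //; exact: IG.
  apply: le_square_summable Ig => //.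
  - by apply: measurable_funS mf'; [exact: measurable_itv|exact: segment_sub_pos].
  - move=> r /=; rewrite in_itv/= => /andP[ar _]; have r0 := lt_le_trans a0 ar.
    rewrite ler_pdivlMl//; apply: le_trans (le_G r r0).
    by rewrite mulrC ler_wpM2l ?sqr_ge0.
have pos r : 0 < r -> [/\ 0 <= r, 0 <= v.2 r ^+ 2, 0 <= derive1 v.1 r ^+ 2 &
    0 <= k%:R ^+ 2 * (sin (v.1 r) ^+ 2 / r ^+ 2)].
  by move=> r0; split; rewrite ?sqr_ge0 ?(ltW r0)// mulr_ge0 ?divr_ge0 ?sqr_ge0.
split.
- by apply: sq => // r /pos[r0 h1 h2 h3]; rewrite ler_wpM2r// -addrA addrCA lerDl addr_ge0.
- by apply: sq => // r /pos[r0 h1 h2 h3]; rewrite ler_wpM2r// -addrA lerDl addr_ge0.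
- move=> a b a0 ab; rewrite -lee_fin; apply: le_trans (le_half a b a0).
  rewrite -EFin_Rintegral_segment; last exact: IG.
  rewrite lee_fin le_eqVlt; apply/orP; left; apply/eqP; apply: eq_Rintegral_segment => r _.
  exact: mulrC.
Qed.

(** [H0_norm_sup] for the profile [iota * (Q - Q)]; as [iota ^+ 2 = 1], the sign can be moved onto
    the solution. *)
Lemma two_bubble_near (v : state R) iota l n e : in_H0 k v -> locally_square_summable (derive1 v.1) ->
  iota = 1 \/ iota = -1 -> 0 < l -> 0 < n -> 0 < e ->
  (H0_norm k (sub_state v (two_bubble_state k iota l n)) < e%:E)%E ->
  forall r, 0 < r -> `|iota * v.1 r - (Q k (r / l) - Q k (r / n))| <= e.
Proof.
move=> vH sv io l0 n0 e0 He r r0.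
pose q x := iota * (Q k (x / l) - Q k (x / n)).
pose q' x := iota * (l^-1 * dQ (l^-1 * x + 0) - n^-1 * dQ (n^-1 * x + 0)).
have dq x : 0 < x -> is_derive x 1 q (q' x).
  move=> x0; have d c : is_derive x 1 (fun y => Q k (y / c)) (c^-1 * dQ (c^-1 * x + 0)).
    have := @is_derive_affine R (Q k) c^-1 0 x _ (derive_Q _).
    by under eq_fun do rewrite addr0 mulrC.
  exact: (derive_cmul iota (derive_sub (d l) (d n))).
have cq' : continuous_pos q'.
  have c c' : continuous (fun x => c'^-1 * dQ (c'^-1 * x + 0)).
    move=> x; apply: cvgM; first exact: cvg_cst.
    apply: (continuous_comp (f := fun x => c'^-1 * x + 0) (g := dQ)); last exact: continuous_dQ.
    by apply: cvgD; [apply: cvgM; [exact: cvg_cst|exact: cvg_id]|exact: cvg_cst].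
  by apply: continuous_continuous_pos => x; apply: cvgM; [exact: cvg_cst|apply: cvgB; exact: c].
have q0 : q x @[x --> 0^'+] --> (0 : R).
  have q00 : q 0 = 0 by rewrite /q !mul0r subrr mulr0.
  rewrite -[X in _ --> X]q00.
  apply: cvg_at_right_filter.
  have c c' : (fun y => Q k (y / c')) y @[y --> (0 : R)] --> Q k (0 / c').
    apply: (continuous_comp (f := fun y => y / c') (g := Q k)).
      by apply: cvgM; [exact: cvg_id|exact: cvg_cst].
    by apply: differentiable_continuous; apply/derivable1_diffP; have [] := derive_Q (0 / c').
  by apply: cvgM; [exact: cvg_cst|apply: cvgB; exact: c].
have := H0_norm_sup k1 vH sv dq cq' q0 e0 He r0.
have i2 : `|iota| = 1 by case: io => ->; rewrite ?normrN normr1.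
rewrite -[X in X <= _]mul1r -i2 -normrM mulrBr /q mulrA.
by rewrite (_ : iota * iota = 1) ?mul1r//; case: io => ->; rewrite ?mulrNN mulr1.
Qed.

End Profile_energy.

(** * A finite energy two-bubble solution yields a flow with bubbles *)

Section Solution_flow.
Context (R : realType).
Local Notation mu := (@lebesgue_measure R).
Implicit Types (f g h q : R -> R) (a b c e l n r x y C t : R).
Variable k : nat.
Hypothesis k2 : (2 <= k)%N.

Section Solution.
Variables (Tm : \bar R) (psi : R -> state R) (iota : R).
Hypothesis sol : energy_class_solution k Tm +oo%E psi.
Hypothesis iota_sign : iota = 1 \/ iota = -1.
Hypothesis psi_energy : forall t, time_interval Tm +oo%E t ->
  energy k (psi t) = (2%:E * energy k (vecQ R k))%E.

Let iota2 : iota * iota = 1.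
Proof. by case: iota_sign => ->; rewrite ?mulrNN mulr1. Qed.

Let iota_sin x : sin (iota * x) = iota * sin x.
Proof. by case: iota_sign => ->; rewrite ?mulN1r ?sinN ?mul1r. Qed.

Let u t r := iota * (psi t).1 r.
Let p t r := iota * derive1 (psi t).1 r.
Let w t r := iota * (psi t).2 r.

Let energy_le t : time_interval Tm +oo%E t -> (energy k (psi t) <= (pi * (8 * k%:R))%:E)%E.
Proof.
move=> /psi_energy ->; have -> : (pi * (8 * k%:R))%:E = (2%:E * (pi * (4 * k%:R))%:E)%E :> \bar R.
  by rewrite -EFinM; congr EFin; ring.
by rewrite lee_pmul2l//; exact: energy_vecQ_le (ltnW k2).
Qed.

Let local_energy t : time_interval Tm +oo%E t ->
  [/\ locally_square_summable (derive1 (psi t).1), locally_square_summable (psi t).2 &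
   forall a b, 0 < a -> a <= b -> \int[mu]_(r in `[a, b])
     (r * ((psi t).2 r ^+ 2 + derive1 (psi t).1 r ^+ 2 + k%:R ^+ 2 * (sin ((psi t).1 r) ^+ 2 / r ^+ 2))) <= 8 * k%:R].
Proof.
move=> tI; have [_ H0 _ _ _] := sol; have [wd mw _ _ _] := H0 t tI.
exact: energy_locally wd mw (energy_le tI).
Qed.

Let primitive_psi t : time_interval Tm +oo%E t -> primitive (psi t).1 (derive1 (psi t).1).
Proof.
by move=> tI; have [_ H0 _ _ _] := sol; have [wd _ _ _ _] := H0 t tI; exact: weakly_differentiable_primitive.
Qed.

Section Test.
Variables (g : R -> R) (a b : R).
Hypotheses (sg : smooth g) (a0 : 0 < a) (ab : a <= b) (vg : vanishes_off a b g).

Let g_lt x : x < a -> g x = 0.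
Proof. by move=> xa; apply: vg; rewrite negb_and -!ltNge xa. Qed.

(** Division by [r] turns the measure [r dr] of the equation into [dr], and the factor [iota] passes
    from [psi] to [u = iota * psi], an equivalent solution because [sin] is odd. *)
Let test r := iota * (g r * r ^- 1).

Let test_fun : test_function test.
Proof.
have st : smooth test by apply: smoothZ; exact: smooth_expV a0 g_lt sg.
split; first by move=> n r; exact: smooth_derivable.
(* [b + 1] rather than [b], since the support bounds must satisfy [r1 < r2] and [a = b] is
   allowed. *)
exists a, (b + 1); split => //; first by rewrite ltr_pwDr.
move=> r nr; rewrite /test vg ?mul0r ?mulr0//.
by apply/negP => /andP[ar rb]; apply: nr; rewrite ar (le_trans rb)// lerDl.
Qed.

Let derive_test r : 0 < r -> derive1 test r = iota * (derive1 g r * r^-1 - g r * r ^- 2).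
Proof.
move=> r0; have := derive_cmul iota (derive_expV_vanish 1 r a0 g_lt sg).
by move=> /is_derive1E ->; rewrite expr1 mulN1r mulrN.
Qed.

Let sub_halfline : `[a, b]%classic `<=` halfline R.
Proof. exact: segment_sub_pos. Qed.

Let to_segment f h : (forall r, a <= r <= b -> f r = h r) ->
  (forall r, 0 < r -> ~~ (a <= r <= b) -> f r = 0) ->
  \int[mu]_(r in halfline R) f r = \int[mu]_(r in `[a, b]) h r.
Proof.
move=> fh f0; rewrite (@Rintegral_zero _ `[a, b]%classic)//; [exact: eq_Rintegral_segment|exact: measurable_itv|].
move=> r; rewrite /halfline/= !in_itv/= andbT => r0 nr; apply: f0 => //; exact/negP.
Qed.

Let pairing (v : R -> R) : \int[mu]_(r in halfline R) (v r * test r * r) =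
  \int[mu]_(r in `[a, b]) (iota * v r * g r).
Proof.
apply: to_segment => r => [/andP[ar _]|r0 nr].
  by rewrite /test expr1; field; rewrite gt_eqF// (lt_le_trans a0).
by rewrite /test vg// mul0r !mulr0 mul0r.
Qed.

Lemma weak_equations t : time_interval Tm +oo%E t ->
  is_derive t 1 (fun s => \int[mu]_(r in `[a, b]) (u s r * g r)) (\int[mu]_(r in `[a, b]) (w t r * g r)) /\
  is_derive t 1 (fun s => \int[mu]_(r in `[a, b]) (w s r * g r))
    (\int[mu]_(r in `[a, b]) (wave_force k (u t) (p t) r * g r) - \int[mu]_(r in `[a, b]) (p t r * derive1 g r)).
Proof.
move=> tI; have [_ _ _ eqn _] := sol; have [e1 e2] := eqn test t test_fun tI; split.
  rewrite -pairing; rewrite (_ : (fun s => _) = fun s : R => \int[mu]_(r in halfline R) ((psi s).1 r * test r * r))//.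
  by apply/funext => s; rewrite pairing.
rewrite (_ : (fun s => \int[mu]_(r in `[a, b]) (w s r * g r)) =
    fun s : R => \int[mu]_(r in halfline R) ((psi s).2 r * test r * r)); last first.
  by apply/funext => s; rewrite pairing.
apply: (is_derive_eq e2).
have [sp _ _] := local_energy tI.
have sP : locally_square_summable (p t).
  exact: (locally_square_summableMr (@continuous_pos_cst R iota) sp).
have cU : continuous_pos (u t).
  by apply: continuous_posM; [exact: continuous_pos_cst|exact: primitive_cont (primitive_psi tI)].
have cg : continuous_pos g := smooth_pos sg.
have cg' : continuous_pos (derive1 g) := smooth_pos (smooth_derive1 sg).
have I1 : locally_summable (fun r => wave_force k (u t) (p t) r * g r).
  apply: locally_summableMl => //; apply: locally_square_summable_summable.
  exact: locally_square_summable_force.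
have I2 : locally_summable (fun r => p t r * derive1 g r).
  by apply: locally_summableMl => //; exact: locally_square_summable_summable.
rewrite -opprB; congr (- _); rewrite -RintegralB//; [|exact: I2|exact: I1].
apply: to_segment => r => [/andP[ar _]|r0 nr].
  have r0 := lt_le_trans a0 ar; rewrite derive_test// /p /u /wave_force /test expr1.
  rewrite (_ : 2 * (iota * (psi t).1 r) = iota * (2 * (psi t).1 r)); last by ring.
  by rewrite iota_sin; field; rewrite gt_eqF.
by rewrite derive_test// /test (vg nr) (vanishes_off_derive vg nr); ring.
Qed.

End Test.

Lemma wave_flow_of_solution T : (Tm < T%:E)%E -> wave_flow k T u p w.
Proof.
move=> TT; have tI t : T < t -> time_interval Tm +oo%E t.
  by move=> tT; split; [apply: lt_trans TT _; rewrite lte_fin|exact: ltry].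
split.
- by move=> t /tI/primitive_psi pv; exact: primitiveZ.
- move=> t /tI/local_energy[sp _ _]; exact: (locally_square_summableMr (@continuous_pos_cst R iota) sp).
- move=> t /tI/local_energy[_ sw _]; exact: (locally_square_summableMr (@continuous_pos_cst R iota) sw).
- move=> t a b /tI/local_energy[_ _ HE] a0 ab; apply: le_trans (HE a b a0 ab).
  rewrite le_eqVlt; apply/orP; left; apply/eqP; apply: eq_Rintegral_segment => r _.
  by rewrite /w /p /u iota_sin !exprMn expr2 iota2 !mul1r.
- by move=> g a b t sg a0 ab vg /tI /(weak_equations sg a0 ab vg)[].
- by move=> g a b t sg a0 ab vg /tI /(weak_equations sg a0 ab vg)[].
Qed.

Lemma bubbles_of_solution T (lambda nu : R -> R) (mu0 : R) : (Tm < T%:E)%E ->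
  (forall t, time_interval Tm +oo%E t -> 0 < lambda t /\ 0 < nu t) ->
  {in time_interval Tm +oo%E, continuous lambda} ->
  H0_norm k (sub_state (psi t) (two_bubble_state k iota (lambda t) (nu t)))
    @[t --> toward +oo%E] --> (0 : \bar R)%E ->
  0 < mu0 -> nu t @[t --> +oo] --> mu0 -> lambda t @[t --> +oo] --> (0 : R) ->
  bubbles k T u p w lambda nu mu0.
Proof.
move=> TT pos cl near mu00 nu_cvg la_cvg.
have tI t : T < t -> time_interval Tm +oo%E t.
  by move=> tT; split; [apply: lt_trans TT _; rewrite lte_fin|exact: ltry].
have [_ H0 _ _ _] := sol.
have iota0 (F : set_system R) (FF : Filter F) (f : R -> R) : f x @[x --> F] --> (0 : R) ->
    iota * f x @[x --> F] --> (0 : R).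
  by move=> f0; rewrite -[X in _ --> X](mulr0 iota); apply: cvgM => //; exact: cvg_cst.
split => //.
- exact: wave_flow_of_solution.
- by move=> t /tI/H0[_ _ _ h _]; exact: iota0.
- by move=> t /tI/H0[_ _ _ _ h]; exact: iota0.
- by move=> t /tI/pos[].
- by move=> t /tI tt; apply: cl; rewrite inE.
move=> e e0.
have [A1 [_ H1]] : \forall t \near +oo, `|0 - lambda t| < e.
  by have /cvgrPdist_lt := la_cvg; apply.
have [A2 [_ H2]] : \forall t \near +oo, `|mu0 - nu t| < mu0 / 2.
  by have /cvgrPdist_lt := nu_cvg; apply; rewrite divr_gt0.
have [A3 _ H3] : toward +oo%E (fun t => H0_norm k (sub_state (psi t) (two_bubble_state k iota (lambda t) (nu t))) < e%:E)%E.
  have : nbhs (0%E : \bar R) [set x | (x < e%:E)%E].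
    by apply: open_nbhs_nbhs; split; [exact: open_ereal_lt_ereal|rewrite /= lte_fin].
  exact: near.
(* The thresholds hold for [t] strictly beyond them; adding 1 makes the half-line closed. *)
pose A := Num.max (Num.max A1 A2) (Num.max A3 T); exists (A + 1).
  by rewrite ltr_pwDr// !le_max lexx !orbT.
move=> t At; have {}At : A < t by apply: lt_le_trans At; rewrite ltr_pwDr.
have [[a1 a2] [a3 a4]] : (A1 < t /\ A2 < t) /\ (A3 < t /\ T < t).
  by move: At; rewrite /A !gt_max => /andP[/andP[? ?] /andP[? ?]].
have ti := tI t a4; have [l0 n0] := pos t ti.
split.
- by have := H1 t a1; rewrite sub0r normrN => h; rewrite (le_trans (ler_norm _))// ltW.
- by have := H2 t a2; rewrite ltr_norml => /andP[h1 h2]; apply/andP; split; lra.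
- have [sp _ _] := local_energy ti.
  apply: (two_bubble_near (ltnW k2) (H0 t ti) sp iota_sign l0 n0 e0).
  by apply: H3; split => //; exact: ltry.
Qed.

End Solution.
End Solution_flow.

(** * From powers of the sixth root back to the scale *)

Section Rates.
Context (R : realType).
Implicit Types (a b c x y t : R) (j k : nat).

Lemma power_rate (k : nat) (mu0 b B : R) : (3 <= k)%N -> 0 < mu0 -> 0 < b -> 0 < B ->
  exists2 C : R, 0 < C & forall t x, 0 < t -> 0 < x -> b <= t * x ^+ (3 * (k - 2)) <= B ->
  C^-1 * mu0 * t `^ (- (2 / (k%:R - 2))) <= x ^+ 6 /\
  x ^+ 6 <= C * mu0 * t `^ (- (2 / (k%:R - 2))).
Proof.
move=> k3 mu00 b0 B0; pose al : R := 2 / (k%:R - 2).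
have kE : k%:R - 2 = (k - 2)%:R :> R by rewrite natrB// ltnW.
have k20 : 0 < (k - 2)%:R :> R by rewrite ltr0n subn_gt0.
have al0 : 0 <= al by rewrite divr_ge0// kE ltW.
have ba := powR_gt0 al b0; have Ba := powR_gt0 al B0.
(* The first summand gives [C^-1 * mu0 <= b]^ al[, the second]B [^ al <= C * mu0]. *)
pose C := mu0 / b `^ al + B `^ al / mu0.
have C0 : 0 < C by rewrite addr_gt0// divr_gt0.
exists C => // t x t0 x0 /andP[h1 h2]; have ta := powR_gt0 (- al) t0.
have xE : x ^+ 6 = (x ^+ (3 * (k - 2))) `^ al.
  rewrite -!powR_mulrn ?(ltW x0)// -powRrM; congr (_ `^ _).
  by rewrite /al kE natrM; field; rewrite gt_eqF.
have tE y : 0 < y -> (y / t) `^ al = y `^ al * t `^ (- al).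
  by move=> y0; rewrite powRM ?invr_ge0 ?(ltW y0) ?(ltW t0)// -powR_inv1 ?(ltW t0)// -powRrM mulN1r.
have xp : 0 <= x ^+ (3 * (k - 2)) by rewrite exprn_ge0// ltW.
rewrite -/al xE; split.
  apply: (@le_trans _ _ ((b / t) `^ al)).
    rewrite tE// ler_pM2r// mulrC ler_pdivrMr// mulrDr.
    by rewrite mulrCA divff ?gt_eqF// mulr1 lerDl mulr_ge0 ?(ltW ba)// ltW// divr_gt0.
  apply: ge0_ler_powR => //; rewrite ?nnegrE ?divr_ge0 ?(ltW b0) ?(ltW t0)//.
  by rewrite ler_pdivrMr// mulrC.
apply: (@le_trans _ _ ((B / t) `^ al)); last first.
  rewrite tE// ler_pM2r// mulrDl divfK ?gt_eqF// lerDr.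
  by rewrite mulr_ge0 ?(ltW mu00)// ltW// divr_gt0.
apply: ge0_ler_powR => //; rewrite ?nnegrE ?divr_ge0 ?(ltW B0) ?(ltW t0)//.
by rewrite ler_pdivlMr// mulrC.
Qed.

Lemma exponential_rate (D q D' q' : R) : 0 < D -> 0 < q -> 0 < D' -> 0 < q' ->
  exists C T : R, 0 < C /\ forall t x, T <= t -> 0 < t -> 0 < x ->
  D' * expR (- (q' * t)) <= x -> x ^+ 12 <= D * expR (- (q * t)) ->
  expR (- (C * t)) <= x ^+ 6 /\ x ^+ 6 <= expR (- (t / C)).
Proof.
move=> D0 q0 D'0 q'0; pose C := 7 * q' + 4 / q.
have C1 : 0 < 7 * q' by rewrite mulr_gt0.
have C2 : 0 < 4 / q by rewrite divr_gt0.
have C0 : 0 < C by rewrite addr_gt0.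
exists C, (Num.max (2 * D / q) (D' ^- 6 / q')); split => // t x.
rewrite ge_max => /andP[t1 t2] t0 x0 h1 h2.
have g1 : D' ^- 6 <= expR (q' * t).
  by apply: le_trans (expR_ge1Dx _); rewrite -[leLHS]add0r lerD// mulrC -ler_pdivrMr.
have g2 : D <= expR (q * t / 2).
  apply: le_trans (expR_ge1Dx _); rewrite -[leLHS]add0r lerD//.
  by rewrite ler_pdivlMr// mulrC [leRHS]mulrC -ler_pdivrMr.
split.
  apply: (@le_trans _ _ (expR (- (7 * (q' * t))))).
    by rewrite ler_expR lerN2 mulrA ler_pM2r// lerDl ltW.
  apply: le_trans (_ : (D' * expR (- (q' * t))) ^+ 6 <= _); last first.
    by rewrite lerXn2r ?nnegrE ?mulr_ge0 ?expR_ge0 ?(ltW D'0) ?(ltW x0).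
  have E : expR (- (7 * (q' * t))) = expR (- (q' * t)) ^+ 7.
    by rewrite -expRM_natl; congr expR; ring.
  rewrite E exprMn exprS ler_pM2r ?exprn_gt0 ?expR_gt0//.
  by rewrite expRN -[leRHS]invrK lef_pV2 ?posrE ?expR_gt0 ?invr_gt0 ?exprn_gt0.
have h3 : (x ^+ 6) ^+ 2 <= expR (- (q * t / 4)) ^+ 2.
  rewrite -exprM; apply: (le_trans h2); apply: (@le_trans _ _ (expR (q * t / 2) * expR (- (q * t)))).
    by rewrite ler_pM2r// expR_gt0.
  rewrite -expRD -expRM_natl ler_expR le_eqVlt; apply/orP; left; apply/eqP.
  by field.
rewrite ler_pXn2r ?nnegrE ?exprn_ge0 ?expR_ge0 ?(ltW x0)// in h3; apply: (le_trans h3).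
rewrite ler_expR lerN2 ler_pdivrMr// /C.
rewrite (_ : q * t / 4 * (7 * q' + 4 / q) = t + q * t / 4 * (7 * q')); last by field; rewrite gt_eqF.
by rewrite lerDl mulr_ge0 ?(ltW C1)// divr_ge0// mulr_ge0// ltW.
Qed.

End Rates.

Theorem mainTheorem2 (R : realType) (k : nat) (Tm Tp : \bar R)
    (psi : R -> state R) (lambda mu : R -> R) (mu0 : R)
    (k_ge2 : (2 <= k)%N)
    (psi_sol : maximal_solution k Tm Tp psi)
    (psi_energy : forall t : R, time_interval Tm Tp t ->
       energy k (psi t) = (2%:E * energy k (vecQ R k))%E)
    (psi_two_bubble : forward_two_bubble k Tm Tp psi lambda mu)
    (Tp_infinite : Tp = +oo%E)
    (mu0_gt0 : 0 < mu0)
    (mu_cvg : mu t @[t --> +oo] --> mu0)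
    (lambda_cvg : lambda t @[t --> +oo] --> (0 : R)) :
  ((3 <= k)%N ->
     exists C : R, 0 < C /\
       \forall t \near +oo,
         C^-1 * mu0 * t `^ (- (2 / (k%:R - 2))) <= lambda t
         /\ lambda t <= C * mu0 * t `^ (- (2 / (k%:R - 2))))
  /\
  (k = 2%N ->
     exists C : R, 0 < C /\
       \forall t \near +oo,
         expR (- (C * t)) <= lambda t /\ lambda t <= expR (- (t / C))).
Proof.
have [sol _] := psi_sol; rewrite Tp_infinite in sol psi_energy psi_two_bubble *.
have [pos la_cont _ [iota [iota_sign near]] _] := psi_two_bubble.
have [[T [TmT _]] _ _ _ _] := sol.
have bu := bubbles_of_solution k_ge2 sol iota_sign psi_energy TmT pos la_cont near mu0_gt0 mu_cvg lambda_cvg.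
(* The sixth root of the scale, the unit of length in all estimates above. *)
pose m t := lambda t `^ 6^-1.
have mE t : T < t -> 0 < m t /\ m t ^+ 6 = lambda t.
  move=> Tt; have l0 := bubbles_scale bu Tt; split; first exact: powR_gt0.
  by rewrite -powR_mulrn ?powR_ge0// -powRrM mulVf// powRr1// ltW.
have [T1 [K [c [g [X [[T10 TT1 K0 c0 g0] H]]]]]] := bubbles_dynamics k_ge2 bu mE.
have mT t : T1 <= t -> T < t := lt_le_trans TT1.
have m0 t : T1 <= t -> 0 < m t by move=> /mT/mE[].
have m6 t : T1 <= t -> m t ^+ 6 = lambda t by move=> /mT/mE[].
have m1 t : T1 <= t -> m t <= 1 by move=> /H[].
have slow t : T1 <= t -> forall x, t <= x <= t + c * (m t ^+ 6 / (m t ^+ k) ^+ 3) -> m t / 2 <= m x <= 2 * m t.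
  by move=> /H[].
have size t : T1 <= t -> `|X t| <= K * ((m t ^+ k) ^+ 3 * m t ^+ 6) by move=> /H[].
have drop t : T1 <= t -> X (t + c * (m t ^+ 6 / (m t ^+ k) ^+ 3)) <= X t - g * ((m t ^+ k) ^+ 3 * m t ^+ 6).
  by move=> /H[].
split=> [k3|kE].
  have [T2 [b [B [b0 B0 T12 bounds]]]] := polynomial_bounds k_ge2 T10 K0 c0 g0 m0 m1 slow size drop k3.
  have [C C0 HC] := power_rate k3 mu0_gt0 b0 B0; exists C; split => //.
  near=> t; have T2t : T2 <= t by near: t; apply: nbhs_pinfty_ge; rewrite num_real.
  have t0 : 0 < t by near: t; apply: nbhs_pinfty_gt; rewrite num_real.
  by rewrite -(m6 t (le_trans T12 T2t)); apply: HC (bounds t T2t); last exact: m0 (le_trans T12 T2t).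
have [D [q [D' [q' [[D0 q0 D'0 q'0] bounds]]]]] := exponential_bounds k_ge2 T10 K0 c0 g0 m0 m1 slow size drop kE.
have [C [T2 [C0 HC]]] := exponential_rate D0 q0 D'0 q'0; exists C; split => //.
near=> t; have T1t : T1 <= t by near: t; apply: nbhs_pinfty_ge; rewrite num_real.
have T2t : T2 <= t by near: t; apply: nbhs_pinfty_ge; rewrite num_real.
have t0 : 0 < t by near: t; apply: nbhs_pinfty_gt; rewrite num_real.
have [h1 h2] := bounds t T1t.
by rewrite -(m6 t T1t); exact: HC T2t t0 (m0 t T1t) h1 h2.
Unshelve. all: by end_near. Qed.
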